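(* Let $g\colon M\to\mathbb{S}^5$ be a nonflat pseudoholomorphic curve, let $n$ be odd with $n\equiv 5\ \mathrm{mod}\ 6$, and let $m=(n+1)/6$. Then the moduli space $\mathcal{M}_n^{\mathrm{e}}(g)$ splits as $\mathcal{M}_n^{\mathrm{e}}(g)=\mathbb{S}^{m-1}_*\times\Gamma_0$, where $\Gamma_0$ is a subset of $\Gamma^m$. If $\Gamma_0$ is a proper subset of $\Gamma^m$, then it is locally a disjoint finite union of $d$-dimensional real analytic subvarieties, where $d=0,\dots,m-1$. Moreover, $\Gamma_0$ has the property that for each point $\boldsymbol{\theta}\in\Gamma_0$, every straight line through $\boldsymbol{\theta}$ that is parallel to a coordinate axis of $\mathbb{R}^m$ intersects $\Gamma_0$ either at finitely many points or in a line segment.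
   Context: Surfaces. $M$ is a connected oriented $2$-dimensional Riemannian manifold (Riemann surface) with complex structure $J$. A minimal surface $f\colon M\to\mathbb{S}^n$ is a minimal isometric immersion into the unit sphere; it is substantial if $f(M)$ is not contained in any proper totally geodesic subsphere. Congruent means differing by an isometry of the ambient sphere. Pseudoholomorphic curves. $\mathbb{S}^6$ is the unit sphere in the imaginary Cayley numbers $\mathbb{R}^7=\mathrm{Im}\,\mathbb{O}$, with the nearly Kähler almost complex structure induced by Cayley multiplication. A pseudoholomorphic curve is a nonconstant smooth map $g\colon M\to\mathbb{S}^6$ from a Riemann surface whose differential is complex linear; $M$ carries the induced metric and $g$ is regarded as an isometric immersion. A pseudoholomorphic curve in $\mathbb{S}^5$ is one with image in a totally geodesic $\mathbb{S}^5\subset\mathbb{S}^6$. Nonflat means that the induced metric is not flat. A surface $f\colon M\to\mathbb{S}^n$ is isometric to $g$ if both induce the same metric on $M$. Exceptional surfaces. Put $\alpha^f_2=\alpha^f$ (second fundamental form) and, for $s\ge3$, $\alpha^f_s(X_1,\dots,X_s)=(\nabla^\perp_{X_s}\cdots\nabla^\perp_{X_3}\alpha^f(X_2,X_1))^\perp$, where $(\cdot)^\perp$ is projection onto the orthogonal complement of $N_1^f\oplus\cdots\oplus N_{s-2}^f$ in the normal bundle and $N^f_k$ is the span of the values of $\alpha^f_{k+1}$. With a local complex coordinate $z=x+iy$ and $\partial=\frac12(\partial_x-i\partial_y)$, the $r$-th Hopf differential is $\Phi_r=\langle\alpha^f_{r+1}(\partial,\dots,\partial),\alpha^f_{r+1}(\partial,\dots,\partial)\rangle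 dz^{2r+2}$ (complex bilinear extensions). A minimal surface in $\mathbb{S}^n$ is exceptional if $\Phi_1,\dots,\Phi_{r+1}$ are holomorphic for $r=[(n-1)/2-1]$, $[\cdot]$ being the integer part. The parameter spaces. $\mathbb{S}_*^{m-1}=\{\mathbf{a}=(a_1,\dots,a_m)\in\mathbb{S}^{m-1}\subset\mathbb{R}^m:\prod_{j=1}^m a_j\ne0\}$ and $\Gamma^m=\{\boldsymbol\theta=(\theta_1,\dots,\theta_m)\in\mathbb{R}^m: 0\le\theta_1<\cdots<\theta_m<\pi\}$. The moduli space. For a simply connected minimal surface $f$, its associated family $f_\theta$ consists of the minimal isometric immersions with $\alpha^{f_\theta}(X,Y)=T_\theta\alpha^f(J_\theta X,Y)$, $J_\theta=\cos\theta I+\sin\theta J$, $T_\theta$ a parallel isometry of normal bundles. $\mathcal{M}_n^{\mathrm e}(g)$ denotes the moduli space (set of congruence classes) of substantial exceptional surfaces $f\colon M\to\mathbb{S}^n$ isometric to $g$. Let $\Pi\colon\tilde M\to M$ be the universal cover with lifted metric and orientation, $\tilde g=g\circ\Pi$, and for $(\mathbf a,\boldsymbol\theta)\in\mathbb{S}_*^{m-1}\times\Gamma^m$ let $\tilde g_{\mathbf a,\boldsymbol\theta}=a_1\tilde g_{\theta_1}\oplus\cdots\oplus a_m\tilde g_{\theta_m}\colon\tilde M\to\mathbb{S}^{6m-1}\subset\mathbb{R}^{6m}$, where $\oplus$ is the orthogonal sum with respect to an orthogonal decomposition $\mathbb{R}^{6m}=\mathbb{R}^6\oplus\cdots\oplus\mathbb{R}^6$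 and $\tilde g_{\theta_j}\colon\tilde M\to\mathbb{S}^5$ are members of the associated family of $\tilde g$. Then $\mathcal{M}_n^{\mathrm e}(g)$ is identified with the set of $(\mathbf a,\boldsymbol\theta)\in\mathbb{S}_*^{m-1}\times\Gamma^m$ such that $\tilde g_{\mathbf a,\boldsymbol\theta}=F\circ\Pi$ for some substantial exceptional surface $F\colon M\to\mathbb{S}^n$. (For odd $n\not\equiv5$ mod $6$ the space $\mathcal{M}_n^{\mathrm e}(g)$ is empty.) ''Locally a disjoint finite union of $d$-dimensional real analytic subvarieties, $d=0,\dots,m-1$'' means: locally $\Gamma_0=\mathcal V^0\cup\cdots\cup\mathcal V^{m-1}$ where each $\mathcal V^d$ is either empty or a disjoint finite union of $d$-dimensional real analytic subvarieties. *)

(* Defs.v *)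
From mathcomp Require Import all_boot all_order all_algebra.
From mathcomp Require Import complex.
From mathcomp Require Import all_classical all_reals all_analysis.
Set Implicit Arguments.
Unset Strict Implicit.
Unset Printing Implicit Defensive.
Import Order.TTheory GRing.Theory Num.Theory.
Import numFieldNormedType.Exports.
Local Open Scope classical_set_scope.
Local Open Scope ring_scope.

(* The coordinate plane, as a normed space over itself: [derivable h z 1] for
   h : Cplx R -> Cplx R is complex differentiability of h at z. *)
Notation Cplx R := ((R[i])^o).

Definition iunit {R : realType} : Cplx R := Complex 0 1.

Definition dot {R : realType} {N : nat} (u v : 'rV[R]_N) : R :=
  (u *m v^T) 0 0.

(* Real directional derivative along the constant real tangent vector
   u = u1 + i u2, standing for u1 d/dx + u2 d/dy; the complex structure J is
   multiplication of u by i. *)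
Definition dird {R : realType} {V : normedModType R} (u : Cplx R)
    (F : Cplx R -> V) : Cplx R -> V :=
  fun z => derive1 (fun t : R => F (z + Complex t 0 * u)) 0.

Fixpoint dirds {R : realType} {V : normedModType R} (us : seq (Cplx R))
    (F : Cplx R -> V) : Cplx R -> V :=
  if us is u :: us' then dird u (dirds us' F) else F.

Definition smooth_on {R : realType} {V : normedModType R} (U : set (Cplx R))
    (F : Cplx R -> V) : Prop :=
  forall (us : seq (Cplx R)) (z : Cplx R), U z ->
    (forall u, derivable (fun t : R => dirds us F (z + Complex t 0 * u)) 0 1)
    /\ {for z, continuous (dirds us F)}.

Record chart (R : realType) (M : Type) := Chart {
  cdom : set M;
  cimg : set (Cplx R);
  cmap : M -> Cplx R;
  cinv : Cplx R -> M }.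

Record riemann_surface (R : realType) (M : topologicalType) := RiemannSurface {
  atlas : set (chart R M);
  surface_hausdorff : hausdorff_space M;
  surface_second_countable : @second_countable M;
  surface_connected : connected [set: M];
  atlas_cover : forall p, exists2 c, atlas c & cdom c p;
  chart_homeo : forall c, atlas c ->
    [/\ open (cdom c) /\ open (cimg c),
        (forall p, cdom c p ->
           cimg c (cmap c p) /\ cinv c (cmap c p) = p),
        (forall z, cimg c z ->
           cdom c (cinv c z) /\ cmap c (cinv c z) = z),
        (forall p, cdom c p -> {for p, continuous (cmap c)}) &
        (forall z, cimg c z -> {for z, continuous (cinv c)})];
  chart_holomorphic : forall c d z, atlas c -> atlas d ->
    cimg c z -> cdom d (cinv c z) ->
    derivable (cmap d \o cinv c : Cplx R -> Cplx R) z 1 }.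

(* [loc f c] is f read in the chart c. *)
Definition loc {R : realType} {M V : Type} (f : M -> V) (c : chart R M)
  : Cplx R -> V := f \o cinv c.

Definition smooth_map {R : realType} {M : topologicalType}
    (X : riemann_surface R M) {V : normedModType R} (f : M -> V) : Prop :=
  forall c, atlas X c -> smooth_on (cimg c) (loc f c).

Definition holomorphic_map {R : realType} {M' M : topologicalType}
    (X' : riemann_surface R M') (X : riemann_surface R M) (P : M' -> M) : Prop :=
  continuous P /\
  forall c d z, atlas X' c -> atlas X d -> cimg c z ->
    cdom d (P (cinv c z)) ->
    derivable (cmap d \o P \o cinv c : Cplx R -> Cplx R) z 1.

(* f and g induce the same (possibly degenerate) first fundamental form. *)
Definition isometric {R : realType} {M : topologicalType}
    (X : riemann_surface R M) {N N' : nat}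
    (f : M -> 'rV[R]_N) (g : M -> 'rV[R]_N') : Prop :=
  forall c z u v, atlas X c -> cimg c z ->
    dot (dird u (loc f c) z) (dird v (loc f c) z) =
    dot (dird u (loc g c) z) (dird v (loc g c) z).

(* Conformal: the induced metric is compatible with the complex structure, in
   other words J is the rotation by pi/2 of the induced metric. *)
Definition conformal_immersion {R : realType} {M : topologicalType}
    (X : riemann_surface R M) {N : nat} (f : M -> 'rV[R]_N) : Prop :=
  smooth_map X f /\
  forall c z, atlas X c -> cimg c z ->
    let fx := dird 1 (loc f c) z in let fy := dird iunit (loc f c) z in
    [/\ 0 < dot fx fx, dot fy fy = dot fx fx & dot fx fy = 0].

(* Component of v orthogonal to the row space of A. *)
Definition perp {R : realType} {k N : nat} (A : 'M[R]_(k, N)) (v : 'rV[R]_N)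
  : 'rV[R]_N :=
  let B := row_base A in v - v *m B^T *m invmx (B *m B^T) *m B.

Section LocalGeometry.
(* F is a map into the unit sphere of R^N read in a conformal chart. *)
Context {R : realType} {N : nat}.
Implicit Types (F : Cplx R -> 'rV[R]_N) (z u : Cplx R).

(* Rows spanning the orthogonal complement of the normal space of F, normal
   being taken inside the sphere. *)
Definition frame F z : 'M[R]_(1 + (1 + 1), N) :=
  col_mx (F z) (col_mx (dird 1 F z) (dird iunit F z)).

Definition normal_vector F z (v : 'rV[R]_N) : Prop := v *m (frame F z)^T = 0.

Definition normal_part F z (v : 'rV[R]_N) : 'rV[R]_N := perp (frame F z) v.

Definition nabla_perp F u (xi : Cplx R -> 'rV[R]_N) z : 'rV[R]_N :=
  normal_part F z (dird u xi z).

(* [nabla_alpha F [:: X_s; ...; X_3; X_2; X_1]] is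
   nabla^perp_{X_s} ... nabla^perp_{X_3} alpha(X_2, X_1) for the fields with
   constant coefficients X_i; the two-entry case is the second fundamental form
   alpha(X_2, X_1), the normal part of X_2 X_1 F. Lists of length < 2 are only
   auxiliary. *)
Fixpoint nabla_alpha F (us : seq (Cplx R)) : Cplx R -> 'rV[R]_N :=
  match us with
  | [::] => F
  | [:: u] => dird u F
  | u :: us' => nabla_perp F u (nabla_alpha F us')
  end.

Definition alpha F u v z : 'rV[R]_N := nabla_alpha F [:: u; v] z.

Definition coord_field (b : bool) : Cplx R := if b then iunit else 1.

(* [osc F k z] has row space N_1 + ... + N_k at z, where N_k is spanned by the
   values of alpha_(k+1) on coordinate fields. *)
Fixpoint osc F (k : nat) z : 'M[R]_N :=
  if k is k'.+1 then
    (osc F k' z +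
     \sum_(t : (k'.+2).-tuple bool)
       <<perp (osc F k' z) (nabla_alpha F (map coord_field t) z)>>)%MS
  else 0.

(* The s-th fundamental form alpha_s, s = size us >= 2; alpha_2 = alpha. *)
Definition higher_alpha F (us : seq (Cplx R)) z : 'rV[R]_N :=
  perp (osc F (size us - 2) z) (nabla_alpha F us z).

(* alpha_s(d, ..., d), d = (d/dx - i d/dy) / 2, expanded by complex
   multilinearity. *)
Definition alpha_del F (s : nat) z : 'rV[R[i]]_N :=
  \sum_(t : s.-tuple bool)
    (\prod_(b <- t) (if b then - iunit / 2 else 1 / 2 : R[i])) *:
    map_mx (real_complex R) (higher_alpha F (map coord_field t) z).

(* Coefficient of dz^(2s+2) in the s-th Hopf differential. *)
Definition hopf F (s : nat) (z : Cplx R) : Cplx R :=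
  \sum_(k < N) alpha_del F s.+1 z 0 k ^+ 2.

(* Near z the spans N_1, ..., N_(s-1) have constant rank, that is they are
   subbundles of the normal bundle and alpha_(s+1) is smooth. *)
Definition regular_upto F (s : nat) z : Prop :=
  \forall w \near z, forall k, (k < s)%N ->
    \rank (osc F k w) = \rank (osc F k z).

End LocalGeometry.

(* Minimal surface in S^n = unit sphere of R^(n+1), for the complex structure
   determined by the induced metric and the orientation. *)
Definition minimal_surface {R : realType} {M : topologicalType}
    (X : riemann_surface R M) {n : nat} (f : M -> 'rV[R]_n.+1) : Prop :=
  [/\ (forall p, dot (f p) (f p) = 1),
      conformal_immersion X f &
      forall c z, atlas X c -> cimg c z ->
        alpha (loc f c) 1 1 z + alpha (loc f c) iunit iunit z = 0].

Definition substantial {R : realType} {M : Type} {n : nat}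
    (f : M -> 'rV[R]_n.+1) : Prop :=
  forall v : 'rV[R]_n.+1, (forall p, dot (f p) v = 0) -> v = 0.

(* Phi_s is required to be holomorphic where the normal spaces N_1, ..., N_(s-1)
   entering it are subbundles: where their rank drops, the pointwise projection
   is discontinuous and says nothing about Phi_s. The range of s is 1, ..., r+1
   with r = [(n-1)/2 - 1], for n >= 3. *)
Definition exceptional {R : realType} {M : topologicalType}
    (X : riemann_surface R M) {n : nat} (f : M -> 'rV[R]_n.+1) : Prop :=
  minimal_surface X f /\
  forall s c z, (1 <= s <= (n.-1)./2.-1.+1)%N -> atlas X c -> cimg c z ->
    regular_upto (loc f c) s z -> derivable (hopf (loc f c) s) z 1.

(* Cross product of Im O = R^7 for the basis with e_k e_(k+1) = e_(k+3),
   indices modulo 7. *)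
Definition cayley_cross {R : realType} (u v : 'rV[R]_7) : 'rV[R]_7 :=
  \row_(k < 7)
    let w (i j : 'I_7) := u 0 i * v 0 j - u 0 j * v 0 i in
    w (k + 1) (k + 3%:R) + w (k + 2%:R) (k + 6%:R) + w (k + 4%:R) (k + 5%:R).

(* At x in S^6 the almost complex structure maps a tangent vector v to the
   Cayley product x v, which is the cross product as v is orthogonal to x. *)
Definition pseudoholomorphic {R : realType} {M : topologicalType}
    (X : riemann_surface R M) (g : M -> 'rV[R]_7) : Prop :=
  [/\ (forall p, dot (g p) (g p) = 1),
      smooth_map X g,
      (exists p q, g p <> g q) &
      forall c z u, atlas X c -> cimg c z ->
        dird (iunit * u) (loc g c) z =
        cayley_cross (loc g c z) (dird u (loc g c) z)].

(* A pseudoholomorphic curve in a totally geodesic S^5 in S^6, the inclusion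
   being x |-> x A. It is an immersion, as M carries the induced metric. *)
Definition pseudoholomorphic_S5 {R : realType} {M : topologicalType}
    (X : riemann_surface R M) (g : M -> 'rV[R]_6) : Prop :=
  conformal_immersion X g /\
  exists2 A : 'M[R]_(6, 7), A *m A^T = 1%:M &
    pseudoholomorphic X (fun p => g p *m A).

(* Gaussian curvature of the conformal metric lambda |dz|^2 induced by F. *)
Definition gauss_curvature {R : realType} {N : nat} (F : Cplx R -> 'rV[R]_N)
    (z : Cplx R) : R :=
  let lambda w := dot (dird 1 F w) (dird 1 F w) in
  let L (w : Cplx R) : R := ln (lambda w) in
  - (dird 1 (dird 1 L) z + dird iunit (dird iunit L) z) / (2 * lambda z).

Definition nonflat {R : realType} {M : topologicalType}
    (X : riemann_surface R M) {N : nat} (g : M -> 'rV[R]_N) : Prop :=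
  ~ (forall c z, atlas X c -> cimg c z -> gauss_curvature (loc g c) z = 0).

(* T p is the matrix (acting on row vectors) of the bundle isometry between the
   normal spaces of f and h at p, in an arbitrary smooth extension to R^(n+1);
   the normal spaces having equal dimension, it is onto. *)
Definition parallel_normal_isometry {R : realType} {M : topologicalType}
    (X : riemann_surface R M) {n : nat} (f h : M -> 'rV[R]_n.+1)
    (T : M -> 'M[R]_n.+1) : Prop :=
  [/\ smooth_map X T,
      (forall c z v w, atlas X c -> cimg c z ->
         normal_vector (loc f c) z v -> normal_vector (loc f c) z w ->
         normal_vector (loc h c) z (v *m loc T c z) /\
         dot (v *m loc T c z) (w *m loc T c z) = dot v w) &
      forall c (U : set (Cplx R)) (xi : Cplx R -> 'rV[R]_n.+1),
        atlas X c -> open U -> U `<=` cimg c -> smooth_on U xi ->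
        (forall z, U z -> normal_vector (loc f c) z (xi z)) ->
        forall z u, U z ->
          nabla_perp (loc h c) u (fun w => xi w *m loc T c w) z =
          nabla_perp (loc f c) u xi z *m loc T c z].

(* h is a member f_theta of the associated family of f. *)
Definition associated {R : realType} {M : topologicalType}
    (X : riemann_surface R M) {n : nat} (f : M -> 'rV[R]_n.+1) (theta : R)
    (h : M -> 'rV[R]_n.+1) : Prop :=
  [/\ minimal_surface X h, isometric X h f &
      exists2 T, parallel_normal_isometry X f h T &
        forall c z u v, atlas X c -> cimg c z ->
          alpha (loc h c) u v z =
          alpha (loc f c) (Complex (cos theta) (sin theta) * u) v z
            *m loc T c z].

Definition simply_connected (R : realType) (M : topologicalType) : Prop :=
  connected [set: M] /\
  forall gamma : R -> M, {within `[0, 1], continuous gamma} ->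
    gamma 0 = gamma 1 ->
    exists H : R * R -> M,
      [/\ {within `[0, 1] `*` `[0, 1], continuous H},
          (forall t, t \in `[0, 1] -> H (0, t) = gamma t),
          (forall t, t \in `[0, 1] -> H (1, t) = gamma 0) &
          (forall s, s \in `[0, 1] -> H (s, 0) = gamma 0 /\ H (s, 1) = gamma 0)].

Definition covering_map {M' M : topologicalType} (P : M' -> M) : Prop :=
  [/\ continuous P, (forall p, exists q, P q = p) &
      forall p, exists U : set M, [/\ open U, U p &
        exists sheets : set (set M'),
          [/\ P @^-1` U = \bigcup_(V in sheets) V,
              trivIset sheets id &
              forall V, sheets V ->
                [/\ open V, set_bij V U P &
                    forall W, open W -> W `<=` V -> open (P @` W)]]]].

(* P is the universal cover, with the complex structure (hence the orientation)
   lifted from M; the metric induced by g \o P is then the lifted one. *)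
Definition universal_cover {R : realType} {M' M : topologicalType}
    (X' : riemann_surface R M') (X : riemann_surface R M) (P : M' -> M) : Prop :=
  [/\ simply_connected R M', covering_map P & holomorphic_map X' X P].

Definition congruence_class {R : realType} {M : Type} {n : nat}
    (f : M -> 'rV[R]_n.+1) : set (M -> 'rV[R]_n.+1) :=
  [set f' | exists2 B : 'M[R]_n.+1, B *m B^T = 1%:M &
                                    forall p, f' p = f p *m B].

(* The set of congruence classes of substantial exceptional surfaces in S^n
   isometric to g. *)
Definition exceptional_classes {R : realType} {M : topologicalType}
    (X : riemann_surface R M) {N : nat} (g : M -> 'rV[R]_N) (n : nat)
  : set (set (M -> 'rV[R]_n.+1)) :=
  [set congruence_class f | f in
     [set f | [/\ substantial f, exceptional X f & isometric X f g]]].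

Arguments exceptional_classes {R M} X {N} g n.

Definition S_star (R : realType) (m : nat) : set 'rV[R]_m :=
  [set a | \sum_(j < m) a 0 j ^+ 2 = 1 /\ \prod_(j < m) a 0 j != 0].

Definition Gamma (R : realType) (m : nat) : set 'rV[R]_m :=
  [set theta | (forall j : 'I_m, 0 <= theta 0 j < pi) /\
               (forall j k : 'I_m, (j < k)%N -> theta 0 j < theta 0 k)].

Arguments S_star R m : clear implicits.
Arguments Gamma R m : clear implicits.

(* The isometric inclusion of R^6 as the j-th block of R^(n+1); for
   n + 1 = 6 m the blocks j < m form an orthogonal decomposition. *)
Definition block_incl (R : realType) (n j : nat) : 'M[R]_(6, n.+1) :=
  \matrix_(k < 6, l < n.+1) (l == (6 * j + k)%N :> nat)%:R.

Definition weighted_sum {R : realType} {M : Type} (n m : nat) (a : 'rV[R]_m)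
    (h : 'I_m -> M -> 'rV[R]_6) : M -> 'rV[R]_n.+1 :=
  fun p => \sum_(j < m) a 0 j *: (h j p *m block_incl R n j).

(* The moduli space, identified with the set of those (a, theta) for which
   g~_(a, theta) factors through P as a representative of one of its classes.
   The members g~_(theta_j) of the associated family are determined up to
   congruence, which does not affect the condition. *)
Definition exceptional_moduli {R : realType} {M' M : topologicalType}
    (X' : riemann_surface R M') (X : riemann_surface R M) (P : M' -> M)
    (g : M -> 'rV[R]_6) (n m : nat) : set ('rV[R]_m * 'rV[R]_m) :=
  [set at_ | [/\ S_star R m at_.1, Gamma R m at_.2 &
     exists h : 'I_m -> M' -> 'rV[R]_6,
       (forall j, associated X' (g \o P) (at_.2 0 j) (h j)) /\
       exists cl F, [/\ exceptional_classes X g n cl, cl F &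
                        weighted_sum n at_.1 h = F \o P]]].

Arguments exceptional_moduli {R M' M} X' X P g n m.

Section AnalyticSets.
Context {R : realType} {m : nat}.
Implicit Types (S W : set 'rV[R]_m) (x y : 'rV[R]_m).

(* Homogeneous part of degree N of the power series with coefficients c. *)
Definition power_term (c : {ffun 'I_m -> nat} -> R) y (N : nat) : R :=
  \sum_(al : {ffun 'I_m -> 'I_N.+1} | (\sum_i al i)%N == N)
    c [ffun i => al i : nat] * \prod_i y 0 i ^+ al i.

Definition real_analytic_at (F : 'rV[R]_m -> R) x : Prop :=
  exists c, exists2 r : R, 0 < r &
    forall y, (forall i, `|y 0 i| < r) ->
      cvgn (series (power_term (fun al => `|c al|) (map_mx Num.norm y))) /\
      series (power_term c y) @ \oo --> F (x + y).

(* Inside the open set W, S is the zero set of the real analytic functions F. *)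
Definition analytic_equations S W (k : nat) (F : 'I_k -> 'rV[R]_m -> R) : Prop :=
  [/\ open W, (forall l x, W x -> real_analytic_at (F l) x) &
      S `&` W = [set x | W x /\ forall l, F l x = 0]].

Definition jacobian (k : nat) (F : 'I_k -> 'rV[R]_m -> R) x : 'M[R]_(k, m) :=
  \matrix_(l, i) derive1 (fun t : R => F l (x + t *: delta_mx 0 i)) 0.

(* Near x, S is a d-dimensional real analytic submanifold of R^m. *)
Definition manifold_point (d : nat) S x : Prop :=
  S x /\ exists k W (F : 'I_k -> 'rV[R]_m -> R),
    [/\ (d + k)%N = m, W x, analytic_equations S W F &
        \rank (jacobian F x) = k].

(* The dimension is the largest dimension at a manifold point. *)
Definition analytic_subvariety (d : nat) S : Prop :=
  [/\ (forall x, S x -> exists W k (F : 'I_k -> 'rV[R]_m -> R),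
         W x /\ analytic_equations S W F),
      (exists x, manifold_point d S x) &
      forall e x, manifold_point e S x -> (e <= d)%N].

Definition disjoint_union_of_subvarieties (d : nat) S : Prop :=
  exists k (T : 'I_k -> set 'rV[R]_m),
    [/\ trivIset setT T, (forall l, analytic_subvariety d (T l)) &
        S = \bigcup_l T l].

(* k = 0 above accounts for the empty V^d. The neighbourhoods range over all
   points of A, not only those of S. *)
Definition locally_union_of_subvarieties (A S : set 'rV[R]_m) : Prop :=
  forall x, A x -> exists U (V : 'I_m -> set 'rV[R]_m),
    [/\ open U /\ U x, (forall d : 'I_m, disjoint_union_of_subvarieties d (V d)) &
        S `&` U = \bigcup_d V d].

Definition coordinate_line x (i : 'I_m) : set 'rV[R]_m :=
  [set x + t *: delta_mx 0 i | t in [set: R]].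

(* A line segment, with or without its endpoints, on the coordinate line. *)
Definition coordinate_segment x (i : 'I_m) S : Prop :=
  exists I : set R,
    [/\ is_interval I, (exists b : R, forall t, I t -> `|t| <= b) &
        S = [set x + t *: delta_mx 0 i | t in I]].

End AnalyticSets.

(* Main.v *)
(* Write gt for the lift of g to the universal cover. A map h belongs to the
   associated family of gt, with angle theta, exactly when h = gt Z for an
   orthogonal matrix valued solution Z of dZ(v) = beta(e v) Z, where beta is the
   second fundamental form seen as a one-form with values in skew matrices and
   e = exp(i theta) - 1.

   Let J be the Cayley product by the unit normal of S^5 and put f_0 = g,
   f_1 = dg/dz, f_2 = conj(f_1) J, f_(k+3) = f_k J. Then d/dz f_k is a combination
   of f_k and f_(k+1), and d/dzbar f_(k+1) one of f_(k+1) and f_k. The vectors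
   X_k = sum_j a_j eps_j^nu(k) f_k Z_j B_j, with eps_j = exp(i theta_j) and B_j the
   inclusion of the j-th block, satisfy the same equations, start with
   F = sum_j a_j g Z_j B_j, and span the osculating spaces of F together with their
   conjugates. Their Gram matrix is constant up to a rescaling, so the Hopf
   differentials of F are zero or constant multiples of powers of the holomorphic
   cubic form C = 2 <d/dz f_1, f_1 J>: F is exceptional. If C is not identically
   zero, F is substantial by a Vandermonde argument in the eps_j^2.

   Hence, for C not identically zero, (a, theta) lies in the moduli space if and
   only if every theta_j lies in the set K of the angles for which some associated
   surface of gt descends to M. If K is finite, so is Gamma_0. If K is infinite, the
   Newton series in theta of the solutions Z at infinitely many nodes of K converges
   to a solution for every theta, because cos and sin are entire, and descending to
   M passes to the limit; thus K is everything and Gamma_0 = Gamma^m. If C = 0 then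
   beta = 0, the associated family is constant, and Gamma_0 is empty or Gamma^m. *)

Require Import Defs.
From HB Require Import structures.
From mathcomp Require Import all_boot all_order all_algebra.
From mathcomp Require Import complex.
From mathcomp Require Import all_classical all_reals all_analysis.
From mathcomp Require Import ring lra zify.
Set Implicit Arguments.
Unset Strict Implicit.
Unset Printing Implicit Defensive.
Import Order.TTheory GRing.Theory Num.Theory.
Import numFieldNormedType.Exports.
Local Open Scope classical_set_scope.
Local Open Scope ring_scope.

(** Transition maps and the covering map are only known to be complex differentiable. Without
    Cauchy's formula, their smoothness is recovered by comparing two smooth conformal immersions,
    one below and one above. The one below is a representative of a point of the moduli space; hence
    the early split between an empty moduli space, for which the empty set serves, and a chosen
    representative.

    The Newton series has to converge at every point of [M]. Angles lie in [0, 4], as pi < 4. Power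
    series weighted with radius 20 make every divided difference of cos and sin gain a factor 8;
    those of the solutions then decay like 5^-n at each point, the Newton weights grow at most like
    4^n, and a geometric series of ratio 4/5 remains.

    A subvariety of dimension 0 may have no manifold point of higher dimension. Even for a one-point
    set this takes an implicit function argument, done by a contraction. A finite [Gamma0] then
    meets lines in finitely many points; the full [Gamma] meets them in segments because it is
    convex. *)

(* Locked copies of the primitives of the statement: unfolding them makes
   unification intractable. *)
HB.lock Definition Dr {R : realType} {V : normedModType R} (u : Cplx R) (F : Cplx R -> V) : Cplx R -> V :=
  dird u F.
HB.lock Definition ii {R : realType} : Cplx R := iunit.

Lemma DrE {R : realType} {V : normedModType R} (u : Cplx R) (F : Cplx R -> V) z : Dr u F z = dird u F z.
Proof. by rewrite Dr.unlock. Qed.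
Lemma DrfE {R : realType} {V : normedModType R} (u : Cplx R) (F : Cplx R -> V) : Dr u F = dird u F.
Proof. by rewrite Dr.unlock. Qed.
Lemma iiE {R : realType} : ii = iunit :> Cplx R.
Proof. by rewrite ii.unlock. Qed.

(** * Real calculus in the coordinate plane *)

Section Plane.
Context {R : realType}.
Local Notation E := (Cplx R).

Definition mkC (a b : R) : E := Complex a b.

Lemma mkCE (z : E) : z = mkC (complex.Re z) (complex.Im z).
Proof. by case: z. Qed.

Lemma normCE (z : E) : `|z| = (Num.sqrt (complex.Re z ^+ 2 + complex.Im z ^+ 2))%:C%C.
Proof. by rewrite -normc_def. Qed.

Lemma sqrt_lt_abs (a b r : R) : 0 < r -> `|a| < r / 2 -> `|b| < r / 2 ->
  Num.sqrt (a ^+ 2 + b ^+ 2) < r.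
Proof.
move=> r0 ha hb; rewrite -(ltr_pXn2r (n := 2)) ?nnegrE ?sqrtr_ge0 ?ltW//.
rewrite sqr_sqrtr ?addr_ge0 ?sqr_ge0//.
rewrite -(real_normK (num_real a)) -(real_normK (num_real b)).
have := normr_ge0 a; have := normr_ge0 b; nra.
Qed.

(** Norms on [Cplx R] take values in [R[i]], where [0 < e] says that [e] is real and positive. This
    trades balls with such radii for real squares, on which the later estimates are done. *)
Lemma nbhsCP (z : E) (A : set E) : nbhs z A <->
  exists2 e : R, 0 < e & forall a b, `|a| < e -> `|b| < e -> A (z + mkC a b).
Proof.
split=> [/nbhs_ballP[e /= e0 zA]|[e e0 zA]].
  have [eI eR] : complex.Im e = 0 /\ 0 < complex.Re e.
    by move: e0; rewrite ltcE/= => /andP[/eqP-> ->].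
  exists (complex.Re e / 2) => [|a b ha hb]; first by rewrite divr_gt0.
  apply: zA; rewrite -ball_normE/= opprD addrA subrr add0r normrN normCE.
  by rewrite ltcE/= eI eqxx/= sqrt_lt_abs.
apply/nbhs_ballP; exists (e%:C%C) => /=; first by rewrite ltcR.
move=> w; rewrite -ball_normE/= normCE ltcR => hw.
have -> : w = z + mkC (complex.Re (w - z)) (complex.Im (w - z)).
  by rewrite -mkCE addrC subrK.
set x := complex.Re (z - w) in hw; set y := complex.Im (z - w) in hw.
have -> : complex.Re (w - z) = - x by rewrite /x; case: (w) (z) => [? ?] [? ?]/=; ring.
have -> : complex.Im (w - z) = - y by rewrite /y; case: (w) (z) => [? ?] [? ?]/=; ring.
apply: zA; rewrite normrN; apply: le_lt_trans hw; rewrite -sqrtr_sqr ler_wsqrtr//.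
  by rewrite lerDl sqr_ge0.
by rewrite lerDr sqr_ge0.
Qed.

Lemma openCP (U : set E) (z : E) : open U -> U z ->
  exists2 e : R, 0 < e & forall a b, `|a| < e -> `|b| < e -> U (z + mkC a b).
Proof. by move=> Uo Uz; apply/nbhsCP; apply: open_nbhs_nbhs. Qed.

Lemma contCP (f : E -> R) (z : E) : {for z, continuous f} <->
  forall e, 0 < e -> exists2 d : R, 0 < d &
    forall a b, `|a| < d -> `|b| < d -> `|f (z + mkC a b) - f z| < e.
Proof.
split=> [fz e e0|h].
  have /nbhsCP[d d0 hd] := fz _ (nbhsx_ballx (f z) e e0); exists d => // a b ha hb.
  by rewrite distrC; have := hd a b ha hb; rewrite /= -ball_normE.
move=> A /nbhs_ballP[e /= e0 eA]; have [d d0 hd] := h e e0.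
apply/nbhsCP; exists d => // a b ha hb; apply: eA.
by rewrite -ball_normE/= distrC; apply: hd.
Qed.

Lemma mkC0 : mkC 0 0 = 0 :> E. Proof. by []. Qed.

Definition line (z u : E) (t : R) : E := z + Complex t 0 * u.

Lemma lineE z u t : line z u t = z + mkC (t * complex.Re u) (t * complex.Im u).
Proof.
by case: u => a b; rewrite /line /mkC; congr (_ + _); simpc.
Qed.

Lemma line0 z u : line z u 0 = z.
Proof. by rewrite lineE !mul0r addr0. Qed.

Lemma line_line z u s t : line (line z u s) u t = line z u (s + t).
Proof. by rewrite !lineE -addrA !mulrDl. Qed.

Lemma near_line (z u : E) (A : set E) : nbhs z A -> \forall t \near (0:R), A (line z u t).
Proof.
move=> /nbhsCP[e e0 zA]; set k := 1 + `|complex.Re u| + `|complex.Im u|.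
have k0 : 0 < k by rewrite /k; have := normr_ge0 (complex.Re u); have := normr_ge0 (complex.Im u); lra.
have ek : 0 < e / k by rewrite divr_gt0.
near=> t; rewrite lineE.
have ht : `|t| * k < e by rewrite -ltr_pdivlMr//; near: t; apply: nbhs0_lt.
have t0 := normr_ge0 t; have a0 := normr_ge0 (complex.Re u); have b0 := normr_ge0 (complex.Im u).
apply: zA; rewrite normrM; apply: le_lt_trans ht; rewrite /k ler_wpM2l//; lra.
Unshelve. all: by end_near. Qed.

End Plane.

(** * Derivatives along lines *)

Section Dird.
Context {R : realType} {V : normedModType R}.
Local Notation E := (Cplx R).
Implicit Types (f g : E -> V) (z u : E).

Definition isd u f z (d : V) := is_derive (0 : R) (1 : R) (f \o line z u) d.
Definition drv u f z := derivable (f \o line z u) (0 : R) 1.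

Lemma isd_dird u f z d : isd u f z d -> Dr u f z = d.
Proof. by case=> _ <-; rewrite !DrE /dird derive1E. Qed.

Lemma isd_drv u f z d : isd u f z d -> drv u f z.
Proof. by case. Qed.

Lemma drv_isd u f z : drv u f z -> isd u f z (Dr u f z).
Proof. by move=> h; rewrite /isd !DrE /dird derive1E; exact: derivableP. Qed.

Lemma isd_near u f g z d : (\forall w \near z, f w = g w) -> isd u f z d -> isd u g z d.
Proof.
move=> fg; apply: near_eq_is_derive.
exact: near_line fg.
Qed.

Lemma drv_near u f g z : (\forall w \near z, f w = g w) -> drv u f z -> drv u g z.
Proof. by move=> fg /drv_isd/(isd_near fg)/isd_drv. Qed.

Lemma dird_near u f g z : (\forall w \near z, f w = g w) -> Dr u f z = Dr u g z.
Proof.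
move=> fg; rewrite !DrE /dird !derive1E; apply: near_eq_derive.
exact: (@near_line R z u [set w | f w = g w]).
Qed.

(** Moving the base point along the line itself turns derivability at every point of a segment into
    derivability of one function of a real variable, as the mean value theorem wants. *)
Lemma isd_at u f z s d : isd u f (line z u s) d <->
  is_derive s (1 : R) (f \o line z u) d.
Proof.
have e : (f \o line (line z u s) u) = (f \o line z u) \o shift s.
  by apply/funext => t /=; rewrite line_line addrC.
have K (F : R -> V) : is_derive (0:R) (1:R) (F \o shift s) d <-> is_derive s (1:R) F d.
  have q : (fun h => h^-1 *: (((F \o shift s) \o shift 0) (h *: (1:R)) - (F \o shift s) 0)) =
           (fun h => h^-1 *: ((F \o shift s) (h *: (1:R)) - F s)) :> (R -> V).
    by apply/funext => h /=; rewrite !addr0 add0r.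
  split; case=> h1 h2; split.
  - by move: h1; rewrite /derivable q.
  - by move: h2; rewrite /derive q.
  - by rewrite /derivable q.
  - by rewrite /derive q.
by rewrite /isd e; exact: K.
Qed.

Lemma isd_cst u (v : V) z : isd u (cst v) z 0.
Proof. exact: is_derive_cst. Qed.

Lemma isdD u f g z a b : isd u f z a -> isd u g z b -> isd u (fun w => f w + g w) z (a + b).
Proof. exact: is_deriveD. Qed.

Lemma isdN u f z a : isd u f z a -> isd u (fun w => - f w) z (- a).
Proof. exact: is_deriveN. Qed.

End Dird.

Section Scalar.
Context {R : realType}.
Local Notation E := (Cplx R).
Implicit Types (f g : E -> R) (z u : E).

Lemma isdM u f g z a b : isd u f z a -> isd u g z b ->
  isd u (fun w => f w * g w) z (a * g z + f z * b).
Proof.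
move=> hf hg; have := is_deriveM hf hg; rewrite /isd /comp/= !line0 => h.
by apply: is_derive_eq h _; rewrite /GRing.scale/=; ring.
Qed.

Lemma isdV u f z a : f z != 0 -> isd u f z a -> isd u (fun w => (f w)^-1) z (- (f z) ^- 2 * a).
Proof.
move=> f0 hf; have := @is_deriveV _ (f \o line z u) 0 a 1; rewrite /comp/= !line0.
exact.
Qed.

(** Fréchet differentiability with differential [a dx + b dy]. Derivatives along lines alone would
    give neither linearity in the direction nor a chain rule. *)
Definition frech f z (a b : R) := forall e, 0 < e -> exists2 d : R, 0 < d &
  forall x y, `|x| < d -> `|y| < d ->
   `|f (z + mkC x y) - f z - (a * x + b * y)| <= e * (`|x| + `|y|).

Lemma mvt_line f z u (t : R) :
  (forall s, `|s| <= `|t| -> drv u f (line z u s)) ->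
  exists2 s, `|s| <= `|t| & f (line z u t) - f z = t * Dr u f (line z u s).
Proof.
move=> h.
have D s : `|s| <= `|t| -> is_derive s (1:R) (f \o line z u) (Dr u f (line z u s)).
  by move=> /h/drv_isd/isd_at.
have C a b : a <= b -> {subset `[a, b] <= [pred s | `|s| <= `|t|]} ->
    exists2 s, s \in `[a, b] & f (line z u b) - f (line z u a) = Dr u f (line z u s) * (b - a).
  move=> ab sub; apply: (@MVT_segment R (f \o line z u) (fun s => Dr u f (line z u s)) a b ab).
    by move=> s; rewrite in_itv/= => /andP[s0 st]; apply: D; apply: sub; rewrite in_itv/= !ltW.
  apply: derivable_within_continuous => s st.
  by apply: ex_derive; apply: D; apply: sub.
have [t0|t0] := leP 0 t.
  have sub : {subset `[0, t] <= [pred s | `|s| <= `|t|]}.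
    by move=> s; rewrite in_itv !inE/= => /andP[s0 st]; rewrite !ger0_norm.
  have [s /sub st e] := C _ _ t0 sub; exists s => //.
  by rewrite line0 subr0 in e; rewrite e mulrC.
have sub : {subset `[t, 0] <= [pred s | `|s| <= `|t|]}.
  by move=> s; rewrite in_itv !inE/= => /andP[s0 st]; rewrite !ler0_norm ?lerN2 ?(ltW t0).
have [s /sub st e] := C _ _ (ltW t0) sub; exists s => //.
by rewrite line0 sub0r in e; rewrite -[LHS]opprB e mulrN opprK mulrC.
Qed.

Lemma iunitM (t : R) : Complex t 0 * ii = mkC 0 t :> E.
Proof. by rewrite iiE /iunit /mkC; simpc. Qed.

Lemma line1 (z : E) t : line z 1 t = z + mkC t 0.
Proof. by rewrite /line mulr1. Qed.

Lemma linei (z : E) t : line z ii t = z + mkC 0 t.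
Proof. by rewrite /line iunitM. Qed.

(** The increment is split into a horizontal and a vertical segment, with the mean value theorem on
    each; continuity of the partial derivatives compares the two values with those at [z]. *)
Lemma C1_frech f z :
  (\forall w \near z, drv 1 f w) -> (\forall w \near z, drv ii f w) ->
  {for z, continuous (Dr 1 f)} -> {for z, continuous (Dr ii f)} ->
  frech f z (Dr 1 f z) (Dr ii f z).
Proof.
move=> /nbhsCP[d1 d10 h1] /nbhsCP[d2 d20 h2] /contCP c1 /contCP c2 e e0.
have [e1 e10 k1] := c1 e e0; have [e2 e20 k2] := c2 e e0.
pose d := Num.min (Num.min d1 d2) (Num.min e1 e2).
have d0 : 0 < d by rewrite !lt_min d10 d20 e10 e20.
exists d => // x y; rewrite !lt_min => /andP[/andP[xd1 xd2] /andP[xe1 xe2]] /andP[/andP[yd1 yd2] /andP[ye1 ye2]].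
have [s sx hs] : exists2 s, `|s| <= `|x| & f (line z 1 x) - f z = x * Dr 1 f (line z 1 s).
  apply: mvt_line => s sx; rewrite line1; apply: h1; last by rewrite normr0.
  exact: le_lt_trans xd1.
have [t ty ht] : exists2 t, `|t| <= `|y| & f (line (line z 1 x) ii y) - f (line z 1 x) = y * Dr ii f (line (line z 1 x) ii t).
  apply: mvt_line => t ty; rewrite line1 linei -addrA -[mkC x 0 + mkC 0 t]/(mkC _ _).
  by rewrite addr0 add0r; apply: h2 => //; exact: le_lt_trans yd2.
have eq : line (line z 1 x) ii y = z + mkC x y.
  by rewrite line1 linei -addrA -[mkC x 0 + mkC 0 y]/(mkC _ _) addr0 add0r.
have A := k1 s 0 (le_lt_trans sx xe1); rewrite normr0 in A; have {}A := A e10.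
have B := k2 x t xe2 (le_lt_trans ty ye2).
rewrite -line1 in A.
have e3 : line (line z 1 x) ii t = z + mkC x t.
  by rewrite line1 linei -addrA -[mkC x 0 + mkC 0 t]/(mkC _ _) addr0 add0r.
rewrite eq e3 in ht.
have -> : f (z + mkC x y) - f z - (Dr 1 f z * x + Dr ii f z * y) =
  x * (Dr 1 f (line z 1 s) - Dr 1 f z) + y * (Dr ii f (z + mkC x t) - Dr ii f z).
  rewrite mulrBr -hs mulrBr -ht; ring.
apply: le_trans (ler_normD _ _) _; rewrite !normrM [e * _]mulrDr.
by apply: lerD; rewrite [leRHS]mulrC ler_wpM2l// ltW.
Qed.

Lemma frech_cont f z a b : frech f z a b -> {for z, continuous f}.
Proof.
move=> h; apply/contCP => e e0; have [d d0 hd] := h 1 ltr01.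
pose k := 2 + `|a| + `|b|.
have a0 := normr_ge0 a; have b0 := normr_ge0 b.
have k0 : 0 < k by rewrite /k; lra.
exists (Num.min d (e / (2 * k))) => [|x y].
  by rewrite lt_min d0/= divr_gt0// mulr_gt0.
rewrite !lt_min => /andP[xd xe] /andP[yd ye].
have {}hd := hd x y xd yd.
have -> : f (z + mkC x y) - f z = (f (z + mkC x y) - f z - (a * x + b * y)) + (a * x + b * y) by ring.
apply: le_lt_trans (ler_normD _ _) _.
have H : `|a * x + b * y| <= `|a| * `|x| + `|b| * `|y| by rewrite -!normrM ler_normD.
apply: le_lt_trans (lerD hd H) _; rewrite mul1r.
rewrite ltr_pdivlMr ?mulr_gt0// in xe; rewrite ltr_pdivlMr ?mulr_gt0// in ye.
have x0 := normr_ge0 x; have y0 := normr_ge0 y.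
rewrite /k in xe ye; nra.
Qed.

(** Chain rule along a curve, made to start at [z] by subtracting [p 0] and [q 0]. Composition with
    a non-linear change of parameter turns lines into such curves. *)
Lemma frech_curve f z a b (p q : R -> R) p' q' :
  frech f z a b -> is_derive (0:R) (1:R) p p' -> is_derive (0:R) (1:R) q q' ->
  is_derive (0:R) (1:R) (fun t => f (z + mkC (p t - p 0) (q t - q 0))) (a * p' + b * q').
Proof.
move=> h [dp <-] [dq <-].
have K (r : R -> R) : derivable r 0 1 -> h^-1 * (r h - r 0) @[h --> 0^'] --> 'D_1 r (0 : R).
  have E0 : (fun h : R => h^-1 *: ((r \o shift 0) (h *: (1:R)) - r 0)) = (fun h => h^-1 * (r h - r 0)).
    by apply/funext => x /=; rewrite addr0 /GRing.scale/= mulr1.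
  by rewrite /derivable /derive E0.
have hp := K p dp; have hq := K q dq.
move: hp hq; set P := 'D_1 p 0; set Q := 'D_1 q 0 => hp hq.
have pc := differentiable_continuous (iffLR (derivable1_diffP p 0) dp).
have qc := differentiable_continuous (iffLR (derivable1_diffP q 0) dq).
set F := (fun t => _).
suff H : h^-1 *: ((F \o shift 0) (h *: (1:R)) - F 0) @[h --> 0^'] --> a * P + b * Q.
  by split; [apply/cvg_ex; exists (a * P + b * Q); exact: H|exact/cvg_lim].
apply/cvgrPdist_le => e e0.
(* Bounds the sum of the difference quotients of [p] and [q] once each is within 1 of its limit;
   [k'] below bounds |a| + |b| and is positive. *)
pose k := 2 + `|P| + `|Q|.
have P0 := normr_ge0 P; have Q0 := normr_ge0 Q.
have k0 : 0 < k by rewrite /k; lra.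
have [d d0 hd] := h (e / (2 * k)) (divr_gt0 e0 (mulr_gt0 (ltr0Sn R 1) k0)).
pose k' := 1 + `|a| + `|b|.
have a0 := normr_ge0 a; have b0 := normr_ge0 b.
have k'0 : 0 < k' by rewrite /k'; lra.
pose e' := Num.min 1 (e / (2 * k')).
have e'0 : 0 < e' by rewrite lt_min ltr01/= divr_gt0// mulr_gt0.
near=> t.
have t0 : t != 0 by near: t; exact: nbhs_dnbhs_neq.
have pt : `|P - t^-1 * (p t - p 0)| <= e' by near: t; move/cvgrPdist_le : hp; exact.
have qt : `|Q - t^-1 * (q t - q 0)| <= e' by near: t; move/cvgrPdist_le : hq; exact.
have pd : `|p t - p 0| < d.
  by rewrite distrC; near: t; apply: nbhs_dnbhs; move/cvgrPdist_lt : pc; exact.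
have qd : `|q t - q 0| < d.
  by rewrite distrC; near: t; apply: nbhs_dnbhs; move/cvgrPdist_lt : qc; exact.
have {}hd := hd _ _ pd qd.
rewrite /F /= addr0 /GRing.scale/= mulr1 !subrr mkC0 addr0.
move: pt qt hd; set x := p t - p 0; set y := q t - q 0 => pt qt hd.
set X := t^-1 * x in pt; set Y := t^-1 * y in qt.
set G := f _ - _ - _ in hd.
have -> : a * P + b * Q - t^-1 * (f (z + mkC x y) - f z) = a * (P - X) + b * (Q - Y) - t^-1 * G.
  by rewrite /G /X /Y; ring.
have tG : `|t^-1 * G| <= e / (2 * k) * (`|X| + `|Y|).
  rewrite /X /Y !normrM -mulrDr mulrCA ler_wpM2l//.
have X1 : `|X| <= `|P| + 1.
  have -> : X = P - (P - X) by ring.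
  apply: le_trans (ler_normB _ _) _; rewrite lerD2l (le_trans pt)//.
  by rewrite ge_min lexx.
have Y1 : `|Y| <= `|Q| + 1.
  have -> : Y = Q - (Q - Y) by ring.
  apply: le_trans (ler_normB _ _) _; rewrite lerD2l (le_trans qt)//.
  by rewrite ge_min lexx.
have e'e : e' <= e / (2 * k') by rewrite ge_min lexx orbT.
apply: le_trans (ler_normB _ _) _.
apply: le_trans (lerD (ler_normD _ _) tG) _; rewrite (normrM a) (normrM b).
have H1 : `|a| * `|P - X| + `|b| * `|Q - Y| <= e / 2.
  have : `|a| * `|P - X| + `|b| * `|Q - Y| <= (`|a| + `|b|) * e' by rewrite mulrDl lerD// ler_wpM2l.
  move=> /le_trans; apply; apply: (@le_trans _ _ (k' * (e / (2 * k')))).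
    by apply: ler_pM; [exact: addr_ge0|exact: ltW|rewrite /k' -addrA lerDr|exact: e'e].
  by rewrite le_eqVlt; apply/orP; left; apply/eqP; field; rewrite gt_eqF.
have H2 : e / (2 * k) * (`|X| + `|Y|) <= e / 2.
  apply: (@le_trans _ _ (e / (2 * k) * k)).
    apply: ler_wpM2l; first by rewrite ltW// divr_gt0// mulr_gt0.
    rewrite /k; lra.
  by rewrite le_eqVlt; apply/orP; left; apply/eqP; field; rewrite gt_eqF.
by rewrite [leRHS]splitr lerD.
Unshelve. all: by end_near. Qed.

Lemma frech_isd f z a b u : frech f z a b -> isd u f z (a * complex.Re u + b * complex.Im u).
Proof.
move=> h.
have L (c : R) : is_derive (0:R) (1:R) (fun t => t * c) c.
  have := @is_deriveM R R id (cst c) (0:R) 1 1 0 (is_derive_id _ _) (is_derive_cst _ _ _).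
  by move=> /is_derive_eq; apply; rewrite /GRing.scale/= mulr0 add0r mulr1.
have := frech_curve h (L (complex.Re u)) (L (complex.Im u)).
rewrite /isd; under eq_fun do rewrite !mul0r !subr0 -lineE.
exact.
Qed.

End Scalar.

(** * Smoothness order by order *)

Section Ck.
Context {R : realType}.
Local Notation E := (Cplx R).
Implicit Types (f g : E -> R) (z u : E) (U : set E).

Definition frech0 f z := frech f z (Dr 1 f z) (Dr ii f z).

(** Smoothness cut off at a finite order, so that it can be proved by induction on the order.
    Quantifying over all directions matches [dirds]. *)
Fixpoint Ck (k : nat) U f : Prop :=
  (forall z, U z -> {for z, continuous f}) /\
  if k is k'.+1 then
    (forall u z, U z -> drv u f z) /\ forall u, Ck k' U (Dr u f)
  else True.

Lemma Ck_cont k U f : Ck k U f -> forall z, U z -> {for z, continuous f}.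
Proof. by case: k => [|k] []. Qed.

Lemma near_open U z (A : set E) : open U -> U z -> U `<=` A -> \forall w \near z, A w.
Proof. by move=> Uo Uz UA; apply: (filterS UA); apply: open_nbhs_nbhs. Qed.

Lemma continuous_near (T : topologicalType) (h1 h2 : E -> T) z :
  (\forall w \near z, h1 w = h2 w) -> {for z, continuous h1} -> {for z, continuous h2}.
Proof.
move=> e c A; rewrite -(nbhs_singleton e) => /c hA.
by apply: filterS2 e hA => w /= ->.
Qed.

Lemma Ck_ext k U f g : open U -> (forall w, U w -> f w = g w) -> Ck k U f -> Ck k U g.
Proof.
move=> Uo; elim: k f g => [|k IH] f g fg /= [fc fk].
  split=> // z Uz; apply: continuous_near (fc z Uz).
  exact: near_open Uz _.
split=> [z Uz|].
  by apply: continuous_near (fc z Uz); exact: near_open Uz _.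
case: fk => fd fk; split=> u.
  by move=> z Uz; apply: drv_near (fd u z Uz); exact: near_open Uz _.
apply: IH (fk u) => w Uw; apply: dird_near; exact: near_open Uw _.
Qed.

Lemma CkS k U f : Ck k.+1 U f -> Ck k U f.
Proof.
elim: k f => [|k IH] f /= [fc [fd fk]]; first by [].
by split=> //; split=> // u; apply: IH; exact: fk.
Qed.

Lemma Ck_sub k U U' f : U' `<=` U -> Ck k U f -> Ck k U' f.
Proof.
move=> s; elim: k f => [|k IH] f /= [fc fk]; split=> //; try by move=> z /s; exact: fc.
case: fk => fd fk; split=> u; first by move=> z /s; exact: fd.
exact: IH.
Qed.

Lemma Ck_cst k U (c : R) : Ck k U (cst c).
Proof.
elim: k c => [|k IH] c /=; split=> //; try by move=> z _; exact: cst_continuous.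
split=> u; first by move=> z _; exact: isd_drv (isd_cst u c z).
suff -> : Dr u (cst c : E -> R) = cst 0 by exact: IH.
by apply/funext => z; exact: isd_dird (isd_cst u c z).
Qed.

Lemma CkD k U f g : open U -> Ck k U f -> Ck k U g -> Ck k U (fun w => f w + g w).
Proof.
move=> Uo; elim: k f g => [|k IH] f g /= [fc fk] [gc gk].
  by split=> // z Uz; apply: continuousD; [exact: fc|exact: gc].
split; first by move=> z Uz; apply: continuousD; [exact: fc|exact: gc].
case: fk gk => fd fk [gd gk]; split=> u.
  by move=> z Uz; apply: isd_drv (isdD (drv_isd (fd u z Uz)) (drv_isd (gd u z Uz))).
apply: (Ck_ext Uo) (IH _ _ (fk u) (gk u)) => w Uw.
by rewrite (isd_dird (isdD (drv_isd (fd u w Uw)) (drv_isd (gd u w Uw)))).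
Qed.

Lemma CkM k U f g : open U -> Ck k U f -> Ck k U g -> Ck k U (fun w => f w * g w).
Proof.
move=> Uo; elim: k f g => [|k IH] f g /= [fc fk] [gc gk].
  by split=> // z Uz; apply: continuousM; [exact: fc|exact: gc].
split; first by move=> z Uz; apply: continuousM; [exact: fc|exact: gc].
case: fk (fk) gk (gk) => fd fk fk' [gd gk] gk'; split=> u.
  by move=> z Uz; apply: isd_drv (isdM (drv_isd (fd u z Uz)) (drv_isd (gd u z Uz))).
have fS : Ck k U f by apply: CkS; split.
have gS : Ck k U g by apply: CkS; split.
apply: (Ck_ext Uo) (CkD Uo (IH _ _ (fk u) gS) (IH _ _ fS (gk u))) => w Uw.
by rewrite (isd_dird (isdM (drv_isd (fd u w Uw)) (drv_isd (gd u w Uw)))).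
Qed.

Lemma CkN k U f : open U -> Ck k U f -> Ck k U (fun w => - f w).
Proof.
move=> Uo hf; apply: (Ck_ext Uo) (CkM Uo (Ck_cst k U (-1)) hf) => w _.
by rewrite /= mulN1r.
Qed.

Lemma CkV k U f : open U -> (forall z, U z -> f z != 0) -> Ck k U f -> Ck k U (fun w => (f w)^-1).
Proof.
move=> Uo f0; elim: k => [|k IH] /= [fc fk].
  by split=> // z Uz; apply: continuousV; [exact: f0|exact: fc].
split; first by move=> z Uz; apply: continuousV; [exact: f0|exact: fc].
case: fk (fk) => fd fk fk'; split=> u.
  by move=> z Uz; apply: isd_drv (isdV (f0 z Uz) (drv_isd (fd u z Uz))).
have fS : Ck k U f by apply: CkS; split.
have I2 := CkM Uo (IH fS) (IH fS).
apply: (Ck_ext Uo) (CkN Uo (CkM Uo I2 (fk u))) => w Uw.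
rewrite (isd_dird (isdV (f0 w Uw) (drv_isd (fd u w Uw)))).
by rewrite mulNr expr2 invfM.
Qed.

Lemma Ck_sum (I : Type) (r : seq I) (P : pred I) k U (F : I -> E -> R) : open U ->
  (forall i, P i -> Ck k U (F i)) -> Ck k U (fun w => \sum_(i <- r | P i) F i w).
Proof.
move=> Uo h; elim: r => [|i r IH].
  by apply: (Ck_ext Uo) (Ck_cst k U 0) => w _; rewrite big_nil.
case Pi : (P i).
  by apply: (Ck_ext Uo) (CkD Uo (h i Pi) IH) => w _; rewrite big_cons Pi.
by apply: (Ck_ext Uo) IH => w _; rewrite big_cons Pi.
Qed.

Definition sm U f := forall k, Ck k U f.

Lemma sm_dird U f u : sm U f -> sm U (Dr u f).
Proof. by move=> h k; have [_ [_ H]] := h k.+1; exact: H. Qed.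

Lemma sm_drv U f u z : sm U f -> U z -> drv u f z.
Proof. by move=> h; have [_ [H _]] := h 1%N; exact: H. Qed.

Lemma Ck_drv k U f u z : Ck k.+1 U f -> U z -> drv u f z.
Proof. by case=> _ [H _]; exact: H. Qed.

Lemma sm_cont U f z : sm U f -> U z -> {for z, continuous f}.
Proof. by move=> h; have [H _] := h 0%N; exact: H. Qed.

Lemma sm_smooth U f : sm U f <-> smooth_on U f.
Proof.
split=> [h us|h].
  suff H vs : sm U (dirds vs f) by move=> z Uz; split=> [u|]; [exact: sm_drv (H us) Uz|exact: sm_cont (H us) Uz].
  by elim: vs => [//|v vs IH] /=; rewrite -DrfE; exact: sm_dird.
suff H k vs : Ck k U (dirds vs f) by move=> k; exact: (H k [::]).
elim: k vs => [|k IH] vs /=.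
  by split=> // z Uz; have [] := h vs z Uz.
split; first by move=> z Uz; have [] := h vs z Uz.
split=> u; last by rewrite DrfE; exact: (IH (u :: vs)).
by move=> z Uz; have [H _] := h vs z Uz; exact: H.
Qed.

Lemma Ck_frech k U f z : open U -> Ck k.+1 U f -> U z -> frech0 f z.
Proof.
move=> Uo [fc [fd fk]] Uz; apply: C1_frech.
- by apply: near_open Uz _ => // w; exact: fd.
- by apply: near_open Uz _ => // w; exact: fd.
- exact: Ck_cont (fk 1) _ Uz.
- exact: Ck_cont (fk ii) _ Uz.
Qed.

Lemma Ck_isd k U f z u : open U -> Ck k.+1 U f -> U z ->
  isd u f z (complex.Re u * Dr 1 f z + complex.Im u * Dr ii f z).
Proof.
by move=> Uo hf Uz; have := frech_isd u (Ck_frech Uo hf Uz); rewrite mulrC [X in _ + X]mulrC.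
Qed.

Lemma Ck_dirdE k U f z u : open U -> Ck k.+1 U f -> U z ->
  Dr u f z = complex.Re u * Dr 1 f z + complex.Im u * Dr ii f z.
Proof. by move=> Uo hf Uz; exact: isd_dird (Ck_isd _ Uo hf Uz). Qed.

Lemma Ck_line_chain k U f (p q : E -> R) z u p' q' : open U -> Ck k.+1 U f ->
  U (mkC (p z) (q z)) -> isd u p z p' -> isd u q z q' ->
  isd u (fun w => f (mkC (p w) (q w))) z (Dr (mkC p' q') f (mkC (p z) (q z))).
Proof.
move=> Uo hf Uz hp hq.
have := frech_curve (Ck_frech Uo hf Uz) hp hq; rewrite /comp !line0 /isd.
have -> : (fun t : R => f (mkC (p z) (q z) + mkC (p (line z u t) - p z) (q (line z u t) - q z))) =
   (fun w => f (mkC (p w) (q w))) \o line z u.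
  by apply/funext => t /=; rewrite -[mkC _ _ + _]/(mkC (_ + _) (_ + _)); congr (f (mkC _ _)); ring.
move=> /is_derive_eq; apply; rewrite (Ck_dirdE (mkC p' q') Uo hf Uz)/=; ring.
Qed.

(** The derivative of the composite is a sum of derivatives of [p] and [q] times composites of the
    first partial derivatives of [f], so the induction lowers the order of all three functions
    together. *)
Lemma Ck_comp k U U' f (p q : E -> R) : open U -> open U' -> Ck k U f ->
  (forall w, U' w -> U (mkC (p w) (q w))) -> Ck k U' p -> Ck k U' q ->
  Ck k U' (fun w => f (mkC (p w) (q w))).
Proof.
move=> Uo U'o; elim: k f => [|k IH] f hf hU hp hq.
  split=> // z U'z; apply/contCP => e e0.
  have /contCP/(_ e e0)[d d0 hd] := Ck_cont hf (hU z U'z).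
  have /contCP/(_ d d0)[d1 d10 hd1] := Ck_cont hp U'z.
  have /contCP/(_ d d0)[d2 d20 hd2] := Ck_cont hq U'z.
  exists (Num.min d1 d2) => [|a b]; first by rewrite lt_min d10.
  rewrite !lt_min => /andP[a1 a2] /andP[b1 b2].
  have := hd _ _ (hd1 a b a1 b1) (hd2 a b a2 b2).
  by rewrite {1}/mkC -[Complex _ _ + _]/(mkC (_ + _) (_ + _)) ![_ + (_ - _)]addrC !subrK.
have hc := IH f (CkS hf) hU (CkS hp) (CkS hq).
split; first exact: Ck_cont hc.
split=> u.
  move=> z U'z.
  have H := Ck_line_chain Uo hf (hU z U'z) (drv_isd (@Ck_drv _ _ _ u _ hp U'z)) (drv_isd (@Ck_drv _ _ _ u _ hq U'z)).
  exact: isd_drv H.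
have [_ [_ hf1]] := hf; have [_ [_ hp1]] := hp; have [_ [_ hq1]] := hq.
apply: (Ck_ext U'o) (CkD U'o (CkM U'o (hp1 u) (IH _ (hf1 1) hU (CkS hp) (CkS hq)))
   (CkM U'o (hq1 u) (IH _ (hf1 ii) hU (CkS hp) (CkS hq)))) => w U'w.
rewrite (isd_dird (Ck_line_chain Uo hf (hU w U'w) (drv_isd (@Ck_drv _ _ _ u _ hp U'w)) (drv_isd (@Ck_drv _ _ _ u _ hq U'w)))).
by rewrite (Ck_dirdE (mkC _ _) Uo hf (hU w U'w)).
Qed.

(** The second difference is the increment along [u] of the function w -> f(w + h v) - f(w): the
    mean value theorem along [u], then along [v]. *)
Lemma mvt2 U f z u v h : (forall s t, `|s| <= `|h| -> `|t| <= `|h| -> U (line (line z u s) v t)) ->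
  Ck 2 U f -> exists s t, [/\ `|s| <= `|h|, `|t| <= `|h| &
  f (line (line z u h) v h) - f (line z u h) - f (line z v h) + f z =
   h * h * Dr v (Dr u f) (line (line z u s) v t)].
Proof.
move=> hU hf; have [fc [fd fk]] := hf.
pose F w := f (line w v h) - f w.
have lc (w a b : E) (s t : R) : line (line w a s) b t = line (line w b t) a s.
  by rewrite !lineE -!addrA [X in w + X]addrC.
have U0 s : `|s| <= `|h| -> U (line z u s).
  by move=> sh; have := hU s 0 sh; rewrite line0 normr0; apply.
have hF s : `|s| <= `|h| -> isd u F (line z u s) (Dr u f (line (line z u s) v h) - Dr u f (line z u s)).
  move=> sh; apply: isdD; last by apply: isdN; apply: drv_isd; apply: fd; exact: U0.
  have := drv_isd (fd u _ (hU s h sh (lexx _))).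
  rewrite /isd; congr is_derive; apply/funext => t /=; by rewrite lc.
have [s sh e1] : exists2 s, `|s| <= `|h| & F (line z u h) - F z = h * Dr u F (line z u s).
  by apply: mvt_line => s sh; exact: isd_drv (hF s sh).
have [t th e2] : exists2 t, `|t| <= `|h| &
    Dr u f (line (line z u s) v h) - Dr u f (line z u s) = h * Dr v (Dr u f) (line (line z u s) v t).
  by apply: mvt_line => t th; exact: (@Ck_drv 0 U _ _ _ (fk u) (hU _ _ sh th)).
exists s, t; split=> //; rewrite -mulrA -e2 -(isd_dird (hF s sh)) -e1 /F; ring.
Qed.

(** The second difference over a parallelogram is symmetric in [u] and [v], so the two mixed
    derivatives take a common value at two nearby points, and both are continuous at [z]. *)
Lemma schwarz U f z u v : open U -> Ck 2 U f -> U z -> Dr u (Dr v f) z = Dr v (Dr u f) z.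
Proof.
move=> Uo hf Uz; have [fc [fd fk]] := hf.
have C a b : {for z, continuous (Dr a (Dr b f))}.
  by have [_ [_ H]] := fk b; exact: (@Ck_cont 0 U _ (H a) _ Uz).
apply/eqP; rewrite -subr_eq0 -normr_le0; apply/ler_addgt0Pr => e e0; rewrite add0r.
have e2 : 0 < e / 2 by rewrite divr_gt0.
have /contCP/(_ _ e2)[d1 d10 h1] := C u v; have /contCP/(_ _ e2)[d2 d20 h2] := C v u.
have [d3 d30 h3] := openCP Uo Uz.
(* With [h = d / (2 * k)] the whole parallelogram stays in the square of half-width [d] around
   [z]. *)
pose k := 1 + `|complex.Re u| + `|complex.Im u| + `|complex.Re v| + `|complex.Im v|.
have k0 : 0 < k by rewrite /k -!addrA ltr_pwDl// !addr_ge0.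
pose d := Num.min (Num.min d1 d2) d3.
have d0 : 0 < d by rewrite !lt_min d10 d20 d30.
pose h := d / (2 * k).
have h0 : 0 < h by rewrite divr_gt0// mulr_gt0.
have B a b s t : (a = u /\ b = v) \/ (a = v /\ b = u) -> `|s| <= `|h| -> `|t| <= `|h| ->
  exists x y, [/\ line (line z a s) b t = z + mkC x y, `|x| < d & `|y| < d].
  move=> ab sh th; rewrite !lineE -addrA.
  exists (s * complex.Re a + t * complex.Re b), (s * complex.Im a + t * complex.Im b).
  have hd : h * k < d.
    have -> : h * k = d / 2 by rewrite /h; field; rewrite gt_eqF.
    by rewrite ltr_pdivrMr// ltr_pMr// ltr1n.
  rewrite (ger0_norm (ltW h0)) in sh th.
  have ru := normr_ge0 (complex.Re u); have iu := normr_ge0 (complex.Im u).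
  have rv := normr_ge0 (complex.Re v); have iv := normr_ge0 (complex.Im v).
  have s0 := normr_ge0 s; have t0 := normr_ge0 t.
  split=> //; apply: le_lt_trans (ler_normD _ _) _; rewrite !normrM;
  apply: le_lt_trans hd; rewrite /k; case: ab => [][-> ->]; nra.
have UU a b : (a = u /\ b = v) \/ (a = v /\ b = u) -> forall s t, `|s| <= `|h| -> `|t| <= `|h| -> U (line (line z a s) b t).
  move=> ab s t sh th; have [x [y [-> xd yd]]] := B a b s t ab sh th.
  by apply: h3; [move: xd|move: yd]; rewrite !lt_min => /andP[_ ->].
have [s [t [sh th e1]]] := mvt2 (UU u v (or_introl (conj erefl erefl))) hf.
have [s' [t' [sh' th' e3]]] := mvt2 (UU v u (or_intror (conj erefl erefl))) hf.
have lc : line (line z u h) v h = line (line z v h) u h by rewrite !lineE -!addrA [X in z + X]addrC.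
have eq : Dr v (Dr u f) (line (line z u s) v t) = Dr u (Dr v f) (line (line z v s') u t').
  apply: (mulfI (_ : h * h != 0)); first by rewrite mulf_neq0 ?gt_eqF.
  move: e1 e3; rewrite lc; move: (Dr v _ _) (Dr u _ _) (f (line (line _ _ _) _ _)) (f (line z u h)) (f (line z v h)) => D1 D2 F1 F2 F3.
  by move=> <- <-; ring.
have [x [y [E1 xd yd]]] := B u v s t (or_introl (conj erefl erefl)) sh th.
have [x' [y' [E2 xd' yd']]] := B v u s' t' (or_intror (conj erefl erefl)) sh' th'.
rewrite E1 E2 in eq.
have A1 : `|Dr v (Dr u f) (z + mkC x y) - Dr v (Dr u f) z| < e / 2.
  by apply: h2; [move: xd|move: yd]; rewrite !lt_min => /andP[/andP[_ ->]].
have A2 : `|Dr u (Dr v f) (z + mkC x' y') - Dr u (Dr v f) z| < e / 2.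
  by apply: h1; [move: xd'|move: yd']; rewrite !lt_min => /andP[/andP[->]].
have -> : Dr u (Dr v f) z - Dr v (Dr u f) z =
  (Dr v (Dr u f) (z + mkC x y) - Dr v (Dr u f) z) - (Dr u (Dr v f) (z + mkC x' y') - Dr u (Dr v f) z).
  by rewrite eq; move: (Dr u (Dr v f) (z + _)) (Dr u (Dr v f) z) (Dr v (Dr u f) z) => X1 X2 X3; ring.
apply: le_trans (ler_normB _ _) _; rewrite [leRHS]splitr; exact: ltW (ltrD A1 A2).
Qed.

End Ck.

(** Makes every derivative a variable, so that [ring] treats it as an atom. *)
Ltac gen_dird := repeat match goal with |- context [Dr ?u ?f ?z] =>
  generalize (Dr u f z); intro end.

Definition fre {R : realType} (f : Cplx R -> R[i]) : Cplx R -> R := fun z => complex.Re (f z).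
Definition fim {R : realType} (f : Cplx R -> R[i]) : Cplx R -> R := fun z => complex.Im (f z).

(** The Wirtinger operators, d/dz here and d/dzbar in [dlb], written out in real and imaginary
    parts. *)
HB.lock Definition dl {R : realType} (f : Cplx R -> R[i]) (z : Cplx R) : R[i] :=
  Complex ((Dr 1 (fre f) z + Dr ii (fim f) z) / 2) ((Dr 1 (fim f) z - Dr ii (fre f) z) / 2).
HB.lock Definition dlb {R : realType} (f : Cplx R -> R[i]) (z : Cplx R) : R[i] :=
  Complex ((Dr 1 (fre f) z - Dr ii (fim f) z) / 2) ((Dr 1 (fim f) z + Dr ii (fre f) z) / 2).

(** * Wirtinger derivatives *)

Section ComplexValued.
Context {R : realType}.
Local Notation E := (Cplx R).
Local Notation C := (R[i]).
Implicit Types (f g : E -> C) (z u : E) (U : set E).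

Definition csm U f := sm U (fre f) /\ sm U (fim f).

Lemma sm_ext U (f g : E -> R) : open U -> (forall w, U w -> f w = g w) -> sm U f -> sm U g.
Proof. by move=> Uo e h k; exact: (Ck_ext Uo e). Qed.

Lemma smD U (f g : E -> R) : open U -> sm U f -> sm U g -> sm U (fun w => f w + g w).
Proof. by move=> Uo hf hg k; exact: CkD. Qed.
Lemma smM U (f g : E -> R) : open U -> sm U f -> sm U g -> sm U (fun w => f w * g w).
Proof. by move=> Uo hf hg k; exact: CkM. Qed.
Lemma smN U (f : E -> R) : open U -> sm U f -> sm U (fun w => - f w).
Proof. by move=> Uo hf k; exact: CkN. Qed.
Lemma smB U (f g : E -> R) : open U -> sm U f -> sm U g -> sm U (fun w => f w - g w).
Proof. by move=> Uo hf hg; apply: smD => //; exact: smN. Qed.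
Lemma smV U (f : E -> R) : open U -> (forall z, U z -> f z != 0) -> sm U f -> sm U (fun w => (f w)^-1).
Proof. by move=> Uo f0 hf k; exact: CkV. Qed.
Lemma sm_cst U (c : R) : sm U (fun _ => c).
Proof. by move=> k; exact: Ck_cst. Qed.
Lemma sm_sum (I : Type) (r : seq I) (P : pred I) U (F : I -> E -> R) : open U ->
  (forall i, P i -> sm U (F i)) -> sm U (fun w => \sum_(i <- r | P i) F i w).
Proof. by move=> Uo h k; apply: Ck_sum => // i Pi; exact: h. Qed.
Lemma sm_sub U U' (f : E -> R) : U' `<=` U -> sm U f -> sm U' f.
Proof. by move=> s h k; exact: Ck_sub s (h k). Qed.

Lemma dird_ext U (f g : E -> R) u z : open U -> (forall w, U w -> f w = g w) -> U z ->
  Dr u f z = Dr u g z.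
Proof. by move=> Uo e Uz; apply: dird_near; apply: near_open Uz _. Qed.

Lemma dirdD U (f g : E -> R) u z : sm U f -> sm U g -> U z ->
  Dr u (fun w => f w + g w) z = Dr u f z + Dr u g z.
Proof. by move=> hf hg Uz; exact: isd_dird (isdD (drv_isd (@sm_drv _ U _ u _ hf Uz)) (drv_isd (@sm_drv _ U _ u _ hg Uz))). Qed.
Lemma dirdN U (f : E -> R) u z : sm U f -> U z -> Dr u (fun w => - f w) z = - Dr u f z.
Proof. by move=> hf Uz; exact: isd_dird (isdN (drv_isd (@sm_drv _ U _ u _ hf Uz))). Qed.
Lemma dirdB U (f g : E -> R) u z : open U -> sm U f -> sm U g -> U z ->
  Dr u (fun w => f w - g w) z = Dr u f z - Dr u g z.
Proof. by move=> Uo hf hg Uz; rewrite (dirdD u hf (smN Uo hg) Uz) (dirdN u hg Uz). Qed.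
Lemma dirdM U (f g : E -> R) u z : sm U f -> sm U g -> U z ->
  Dr u (fun w => f w * g w) z = Dr u f z * g z + f z * Dr u g z.
Proof. by move=> hf hg Uz; exact: isd_dird (isdM (drv_isd (@sm_drv _ U _ u _ hf Uz)) (drv_isd (@sm_drv _ U _ u _ hg Uz))). Qed.
Lemma dird_cst (c : R) u z : Dr u (fun _ => c) z = 0.
Proof. exact: isd_dird (isd_cst u c z). Qed.
Lemma dirdE U (f : E -> R) u z : open U -> sm U f -> U z ->
  Dr u f z = complex.Re u * Dr 1 f z + complex.Im u * Dr ii f z.
Proof. by move=> Uo hf Uz; exact: Ck_dirdE (hf 1%N) Uz. Qed.

Lemma csm_ext U f g : open U -> (forall w, U w -> f w = g w) -> csm U f -> csm U g.
Proof. by move=> Uo e [h1 h2]; split; [apply: sm_ext h1|apply: sm_ext h2] => // w Uw; rewrite /fre /fim e. Qed.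

Lemma csmD U f g : open U -> csm U f -> csm U g -> csm U (fun w => f w + g w).
Proof.
move=> Uo [f1 f2] [g1 g2]; split; [apply: sm_ext (smD Uo f1 g1)|apply: sm_ext (smD Uo f2 g2)] => // w _;
  by rewrite /fre /fim; case: (f w) (g w) => ? ? [].
Qed.
Lemma csmN U f : open U -> csm U f -> csm U (fun w => - f w).
Proof.
move=> Uo [f1 f2]; split; [apply: sm_ext (smN Uo f1)|apply: sm_ext (smN Uo f2)] => // w _;
  by rewrite /fre /fim; case: (f w).
Qed.
Lemma csmM U f g : open U -> csm U f -> csm U g -> csm U (fun w => f w * g w).
Proof.
move=> Uo [f1 f2] [g1 g2].
split; [apply: sm_ext (smB Uo (smM Uo f1 g1) (smM Uo f2 g2))|apply: sm_ext (smD Uo (smM Uo f1 g2) (smM Uo f2 g1))] => // w _;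
  by rewrite /fre /fim; case: (f w) (g w) => ? ? [].
Qed.
Lemma csm_cst U (c : C) : csm U (fun _ => c).
Proof. by split; exact: sm_cst. Qed.
Lemma csm_real U (r : E -> R) : sm U r -> csm U (fun w => (r w)%:C%C).
Proof. by move=> h; split=> //; exact: sm_cst. Qed.
Lemma csm_conj U f : open U -> csm U f -> csm U (fun w => (f w)^*%C).
Proof.
move=> Uo [f1 f2]; split; [apply: sm_ext f1|apply: sm_ext (smN Uo f2)] => // w _;
  by rewrite /fre /fim; case: (f w).
Qed.
Lemma csm_sum (I : Type) (r : seq I) (P : pred I) U (F : I -> E -> C) : open U ->
  (forall i, P i -> csm U (F i)) -> csm U (fun w => \sum_(i <- r | P i) F i w).
Proof.
move=> Uo h; elim: r => [|i r IH].
  by apply: (csm_ext Uo) (csm_cst U 0) => w _; rewrite big_nil.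
case Pi : (P i).
  by apply: (csm_ext Uo) (csmD Uo (h i Pi) IH) => w _; rewrite big_cons Pi.
by apply: (csm_ext Uo) IH => w _; rewrite big_cons Pi.
Qed.

Lemma csm_dl U f : open U -> csm U f -> csm U (dl f).
Proof.
move=> Uo [f1 f2]; rewrite ?dl.unlock ?dlb.unlock; split; apply: smM => //; try exact: sm_cst.
  by apply: smD => //; exact: sm_dird.
by apply: smB => //; exact: sm_dird.
Qed.
Lemma csm_dlb U f : open U -> csm U f -> csm U (dlb f).
Proof.
move=> Uo [f1 f2]; rewrite ?dl.unlock ?dlb.unlock; split; apply: smM => //; try exact: sm_cst.
  by apply: smB => //; exact: sm_dird.
by apply: smD => //; exact: sm_dird.
Qed.

Lemma dl_ext U f g z : open U -> (forall w, U w -> f w = g w) -> U z -> dl f z = dl g z.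
Proof.
move=> Uo e Uz; have e1 u : Dr u (fre f) z = Dr u (fre g) z.
  by apply: dird_ext Uz => // w Uw; rewrite /fre e.
have e2 u : Dr u (fim f) z = Dr u (fim g) z.
  by apply: dird_ext Uz => // w Uw; rewrite /fim e.
by rewrite !dl.unlock !e1 !e2.
Qed.
Lemma dlb_ext U f g z : open U -> (forall w, U w -> f w = g w) -> U z -> dlb f z = dlb g z.
Proof.
move=> Uo e Uz; have e1 u : Dr u (fre f) z = Dr u (fre g) z.
  by apply: dird_ext Uz => // w Uw; rewrite /fre e.
have e2 u : Dr u (fim f) z = Dr u (fim g) z.
  by apply: dird_ext Uz => // w Uw; rewrite /fim e.
by rewrite !dlb.unlock !e1 !e2.
Qed.

Lemma fre_D f g : fre (fun w => f w + g w) = fun w => fre f w + fre g w.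
Proof. by apply/funext => w; rewrite /fre; case: (f w) (g w) => ? ? []. Qed.
Lemma fim_D f g : fim (fun w => f w + g w) = fun w => fim f w + fim g w.
Proof. by apply/funext => w; rewrite /fim; case: (f w) (g w) => ? ? []. Qed.
Lemma fre_M f g : fre (fun w => f w * g w) = fun w => fre f w * fre g w - fim f w * fim g w.
Proof. by apply/funext => w; rewrite /fre /fim; case: (f w) (g w) => ? ? []. Qed.
Lemma fim_M f g : fim (fun w => f w * g w) = fun w => fre f w * fim g w + fim f w * fre g w.
Proof. by apply/funext => w; rewrite /fre /fim; case: (f w) (g w) => ? ? []. Qed.
Lemma fre_J f : fre (fun w => (f w)^*%C) = fre f.
Proof. by apply/funext => w; rewrite /fre; case: (f w). Qed.
Lemma fim_J f : fim (fun w => (f w)^*%C) = fun w => - fim f w.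
Proof. by apply/funext => w; rewrite /fim; case: (f w). Qed.

Lemma Cext (a b c d : R) : a = c -> b = d -> Complex a b = Complex c d :> C.
Proof. by move=> -> ->. Qed.

Lemma dlD U f g z : csm U f -> csm U g -> U z -> dl (fun w => f w + g w) z = dl f z + dl g z.
Proof.
move=> [f1 f2] [g1 g2] Uz; rewrite !dl.unlock fre_D fim_D.
rewrite !(dirdD _ f1 g1 Uz) !(dirdD _ f2 g2 Uz); apply: Cext; ring.
Qed.
Lemma dlbD U f g z : csm U f -> csm U g -> U z -> dlb (fun w => f w + g w) z = dlb f z + dlb g z.
Proof.
move=> [f1 f2] [g1 g2] Uz; rewrite !dlb.unlock fre_D fim_D.
rewrite !(dirdD _ f1 g1 Uz) !(dirdD _ f2 g2 Uz); apply: Cext; ring.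
Qed.
Lemma fE (f : E -> C) z : f z = Complex (fre f z) (fim f z).
Proof. by rewrite /fre /fim; case: (f z). Qed.

Lemma dlM U f g z : open U -> csm U f -> csm U g -> U z ->
  dl (fun w => f w * g w) z = dl f z * g z + f z * dl g z.
Proof.
move=> Uo [f1 f2] [g1 g2] Uz; rewrite !dl.unlock fre_M fim_M.
rewrite !(dirdD _ (smM Uo f1 g2) (smM Uo f2 g1) Uz) !(dirdB _ Uo (smM Uo f1 g1) (smM Uo f2 g2) Uz).
rewrite !(dirdM _ f1 g1 Uz) !(dirdM _ f1 g2 Uz) !(dirdM _ f2 g1 Uz) !(dirdM _ f2 g2 Uz).
rewrite (fE f) (fE g); gen_dird; move: (fre f z) (fim f z) (fre g z) (fim g z) => *; apply: Cext; ring.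
Qed.
Lemma dlbM U f g z : open U -> csm U f -> csm U g -> U z ->
  dlb (fun w => f w * g w) z = dlb f z * g z + f z * dlb g z.
Proof.
move=> Uo [f1 f2] [g1 g2] Uz; rewrite !dlb.unlock fre_M fim_M.
rewrite !(dirdD _ (smM Uo f1 g2) (smM Uo f2 g1) Uz) !(dirdB _ Uo (smM Uo f1 g1) (smM Uo f2 g2) Uz).
rewrite !(dirdM _ f1 g1 Uz) !(dirdM _ f1 g2 Uz) !(dirdM _ f2 g1 Uz) !(dirdM _ f2 g2 Uz).
rewrite (fE f) (fE g); gen_dird; move: (fre f z) (fim f z) (fre g z) (fim g z) => *; apply: Cext; ring.
Qed.
Lemma dl_cst (c : C) z : dl (fun _ => c) z = 0.
Proof. by rewrite !dl.unlock /fre /fim !dird_cst; apply: Cext; ring. Qed.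
Lemma dlb_cst (c : C) z : dlb (fun _ => c) z = 0.
Proof. by rewrite !dlb.unlock /fre /fim !dird_cst; apply: Cext; ring. Qed.
Lemma dl_conj U f z : csm U f -> U z -> dl (fun w => (f w)^*%C) z = (dlb f z)^*%C.
Proof.
move=> [f1 f2] Uz; rewrite !(dl.unlock, dlb.unlock) fre_J fim_J !(dirdN _ f2 Uz) /=; apply: Cext; ring.
Qed.
Lemma dlb_conj U f z : csm U f -> U z -> dlb (fun w => (f w)^*%C) z = (dl f z)^*%C.
Proof.
move=> [f1 f2] Uz; rewrite !(dl.unlock, dlb.unlock) fre_J fim_J !(dirdN _ f2 Uz) /=; apply: Cext; ring.
Qed.
Lemma dl_dlb U f z : open U -> csm U f -> U z -> dl (dlb f) z = dlb (dl f) z.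
Proof.
move=> Uo [f1 f2] Uz; rewrite !(dl.unlock, dlb.unlock).
set A := Dr 1 (fre f); set B := Dr ii (fim f); set A' := Dr 1 (fim f); set B' := Dr ii (fre f).
have sA : sm U A by exact: sm_dird. have sB : sm U B by exact: sm_dird.
have sA' : sm U A' by exact: sm_dird. have sB' : sm U B' by exact: sm_dird.
have c := sm_cst U (2^-1 : R).
rewrite /fre /fim /= !(dirdM _ (smB Uo sA sB) c Uz) !(dirdM _ (smD Uo sA' sB') c Uz)
  !(dirdM _ (smD Uo sA sB) c Uz) !(dirdM _ (smB Uo sA' sB') c Uz).
rewrite !(dirdD _ sA sB Uz) !(dirdD _ sA' sB' Uz) !(dirdB _ Uo sA sB Uz) !(dirdB _ Uo sA' sB' Uz) !dird_cst.
rewrite /A /B /A' /B' (schwarz 1 ii Uo (f1 2) Uz) (schwarz 1 ii Uo (f2 2) Uz).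
gen_dird; apply: Cext; ring.
Qed.

Lemma dl_sum (I : Type) (r : seq I) (P : pred I) U (F : I -> E -> C) z : open U ->
  (forall i, P i -> csm U (F i)) -> U z ->
  dl (fun w => \sum_(i <- r | P i) F i w) z = \sum_(i <- r | P i) dl (F i) z.
Proof.
move=> Uo h Uz; elim: r => [|i r IH].
  by under eq_fun do rewrite big_nil; rewrite dl_cst big_nil.
rewrite big_cons; under eq_fun do rewrite big_cons; case: ifPn => Pi //.
by rewrite (dlD (h i Pi) (csm_sum _ Uo h) Uz) IH.
Qed.
Lemma dlb_sum (I : Type) (r : seq I) (P : pred I) U (F : I -> E -> C) z : open U ->
  (forall i, P i -> csm U (F i)) -> U z ->
  dlb (fun w => \sum_(i <- r | P i) F i w) z = \sum_(i <- r | P i) dlb (F i) z.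
Proof.
move=> Uo h Uz; elim: r => [|i r IH].
  by under eq_fun do rewrite big_nil; rewrite dlb_cst big_nil.
rewrite big_cons; under eq_fun do rewrite big_cons; case: ifPn => Pi //.
by rewrite (dlbD (h i Pi) (csm_sum _ Uo h) Uz) IH.
Qed.

Lemma sub_divr (c h D : C) : h != 0 -> c - h^-1 * D = - (h^-1 * (D - c * h)).
Proof. by move=> h0; rewrite mulrBr (mulrC c) mulKf// opprB. Qed.

(** By the Cauchy-Riemann equations the real differential is multiplication by the complex number
    [Complex a b]; the Fréchet estimates of the two parts then control the complex difference
    quotient. *)
Lemma dlb0_derivable U (f : E -> E) z : open U -> csm U f -> U z -> dlb f z = 0 ->
  derivable f z 1.
Proof.
move=> Uo [f1 f2] Uz e.
have F1 := Ck_frech Uo (f1 1%N) Uz; have F2 := Ck_frech Uo (f2 1%N) Uz.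
move: e; rewrite dlb.unlock => -[e1 e2].
set a := Dr 1 (fre f) z in F1 e1; set b := Dr 1 (fim f) z in F2 e2.
have E1 : Dr ii (fim f) z = a by lra.
have E2 : Dr ii (fre f) z = - b by lra.
rewrite /frech0 E2 in F1; rewrite /frech0 E1 in F2.
apply/cvg_ex; exists (Complex a b : E); apply/cvgrPdist_le => /= e e0.
have [eI eR] : complex.Im e = 0 /\ 0 < complex.Re e.
  by move: e0; rewrite ltcE/= => /andP[/eqP-> ->].
(* Each part contributes at most e/4 times |x| + |y|, and |x| + |y| is at most twice the modulus of
   [h]. *)
have e4 : 0 < complex.Re e / 4 by rewrite divr_gt0.
have [d1 d10 h1] := F1 _ e4; have [d2 d20 h2] := F2 _ e4.
have : \forall h \near (0 : E), `|complex.Re h| < d1 /\ `|complex.Im h| < d1 /\ `|complex.Re h| < d2 /\ `|complex.Im h| < d2.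
  apply/nbhsCP; exists (Num.min d1 d2); first by rewrite lt_min d10.
  by move=> x y; rewrite !lt_min add0r => /andP[? ?] /andP[? ?].
move=> H; near=> h.
have h0 : h != 0 by near: h; exact: withinT.
have [k1 [k2 [k3 k4]]] : `|complex.Re h| < d1 /\ `|complex.Im h| < d1 /\ `|complex.Re h| < d2 /\ `|complex.Im h| < d2.
  by near: h; exact: nbhs_dnbhs H.
rewrite /GRing.scale/= mulr1.
have {h1}A1 := h1 _ _ k1 k2; have {h2}A2 := h2 _ _ k3 k4.
rewrite -mkCE (addrC z) in A1; rewrite -mkCE (addrC z) in A2.
set D := f (h + z) - f z.
set x := complex.Re h in A1 A2; set y := complex.Im h in A1 A2.
have hE : h = Complex x y by rewrite /x /y; case: (h).
pose r : C := (D : C) - (Complex a b : C) * (h : C).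
have rE : r = Complex (fre f (h + z) - fre f z - (a * x + - b * y)) (fim f (h + z) - fim f z - (b * x + a * y)).
  by rewrite /r /D (fE f (h + z)) (fE f z) hE; apply: Cext; ring.
have -> : Complex a b - h^-1 * D = - ((h : C)^-1 * r).
  exact: sub_divr.
rewrite normrN normrM normfV ler_pdivrMl ?normr_gt0//.
have nh : `|h| = (Num.sqrt (x ^+ 2 + y ^+ 2))%:C%C by rewrite normCE.
have nr : `|r| <= (`|complex.Re r| + `|complex.Im r|)%:C%C.
  rewrite normCE lecR -[leRHS]ger0_norm ?addr_ge0// -sqrtr_sqr ler_wsqrtr// sqrrD !real_normK ?num_real//.
  by rewrite [leRHS]addrAC lerDl mulrn_wge0// mulr_ge0.
apply: le_trans nr _; rewrite nh.
have -> : e = (complex.Re e)%:C%C by rewrite [LHS](mkCE (e : E)) eI.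
rewrite -rmorphM lecR rE /=.
have X : `|x| <= Num.sqrt (x ^+ 2 + y ^+ 2) by rewrite -sqrtr_sqr ler_wsqrtr// lerDl sqr_ge0.
have Y : `|y| <= Num.sqrt (x ^+ 2 + y ^+ 2) by rewrite -sqrtr_sqr ler_wsqrtr// lerDr sqr_ge0.
rewrite /fre /fim in A1 A2 *; nra.
Unshelve. all: by end_near. Qed.

End ComplexValued.

HB.lock Definition dt {R : realType} {q} (u v : 'rV[R]_q) : R := dot u v.
Lemma dtE {R : realType} {q} (u v : 'rV[R]_q) : dt u v = (u *m v^T) 0 0.
Proof. by rewrite dt.unlock. Qed.

(** * Matrix-valued functions *)

Section RealMatrixEntries.
Context {R : realType}.
Local Notation E := (Cplx R).
Implicit Types (z u : E) (U : set E).

Definition ent {T : Type} {p q} (G : E -> 'M[T]_(p, q)) i j : E -> T := fun w => G w i j.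

Definition smx {p q} U (G : E -> 'M[R]_(p, q)) := forall i j, sm U (ent G i j).

Lemma mx_cvgP {p q} (G : E -> 'M[R]_(p, q)) z :
  {for z, continuous G} <-> forall i j, {for z, continuous (ent G i j)}.
Proof.
split=> [h i j|h A].
  exact: (continuous_comp h (@coord_continuous _ _ _ i j _)).
case=> P hP sP; rewrite /= in hP *.
have : \forall w \near z, forall i j, P i j (G w i j).
  have Q i j : nbhs z [set w | P i j (G w i j)] := h i j _ (hP i j).
  exact: (filter_forall _ (fun i => filter_forall _ (Q i))).
by apply: filterS => w; exact: sP.
Qed.

Lemma dird_entE {p q} (G : E -> 'M[R]_(p, q)) u z i j : drv u G z ->
  Dr u G z i j = Dr u (ent G i j) z.
Proof. by move=> h; rewrite !DrE /dird !derive1E (derive_mx h) mxE. Qed.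

Lemma drv_mxP {p q} (G : E -> 'M[R]_(p, q)) u z : drv u G z <-> forall i j, drv u (ent G i j) z.
Proof. exact: derivable_mxP. Qed.

End RealMatrixEntries.

Section RealMatrices.
Context {R : realType}.
Local Notation E := (Cplx R).
Implicit Types (z u : E) (U : set E).

Lemma smooth_smx {p q} (G : E -> 'M[R]_(p, q)) U : open U -> smooth_on U G <-> smx U G.
Proof.
move=> Uo; split=> h.
  have K us i j : forall z, U z -> dirds us G z i j = dirds us (ent G i j) z.
    elim: us => [//|u us IH] z Uz /=; rewrite -!DrfE.
    have [/(_ u) H _] := h us z Uz; rewrite (dird_entE _ _ H).
    by apply: dird_near; apply: near_open Uz _ => // w Uw; exact: IH.
  move=> i j; apply/sm_smooth => us z Uz; have [h1 h2] := h us z Uz; split.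
    move=> u; have /drv_mxP/(_ i j) := h1 u.
    by apply: drv_near; apply: near_open Uz _ => // w Uw; rewrite -K.
  by move/mx_cvgP/(_ i j) : h2; apply: continuous_near; apply: near_open Uz _ => // w Uw; rewrite -K.
have K us i j : (forall z, U z -> dirds us G z i j = dirds us (ent G i j) z) /\ (forall z u, U z -> drv u (dirds us G) z).
  elim: us i j => [|u us IH] i j /=; rewrite -?DrfE.
    split=> // z u Uz; apply/drv_mxP => k l; exact: sm_drv (h k l) Uz.
  have S k l vs : sm U (dirds vs (ent G k l)) by elim: vs => [|v vs]; [exact: h|rewrite /= -DrfE; exact: sm_dird].
  have E1 k l : forall z, U z -> Dr u (dirds us G) z k l = Dr u (dirds us (ent G k l)) z.
    move=> z Uz; rewrite dird_entE; last by have [_] := IH k l; exact.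
    by apply: dird_near; apply: near_open Uz _ => // w Uw; have [H _] := IH k l; exact: H.
  split; first exact: E1.
  move=> z v Uz; apply/drv_mxP => k l.
  have := @sm_drv _ _ _ v _ (S k l (u :: us)) Uz.
  by apply: drv_near; apply: near_open Uz _ => // w Uw; rewrite /ent E1 //= -DrfE.
move=> us z Uz; split.
  (* [K] speaks of an entry, so matrices without rows or without columns are treated apart. *)
  move=> u; case: p q G h K => [|p] [|q] G h K; last by have [_] := K us ord0 ord0; apply.
  - by apply/drv_mxP => -[].
  - by apply/drv_mxP => -[].
  - by apply/drv_mxP => ? -[].
apply/mx_cvgP => i j.
have S vs : sm U (dirds vs (ent G i j)) by elim: vs => [|v vs]; [exact: h|rewrite /= -DrfE; exact: sm_dird].
have := sm_cont (S us) Uz; apply: continuous_near; apply: near_open Uz _ => // w Uw.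
by have [H _] := K us i j; rewrite /ent H.
Qed.

Lemma smx_drv {p q} (G : E -> 'M[R]_(p, q)) U u z : smx U G -> U z -> drv u G z.
Proof. by move=> h Uz; apply/drv_mxP => i j; exact: sm_drv (h i j) Uz. Qed.

Lemma dird_mxE {p q} (G : E -> 'M[R]_(p, q)) U u z i j : smx U G -> U z ->
  Dr u G z i j = Dr u (ent G i j) z.
Proof. by move=> h Uz; apply: dird_entE; exact: smx_drv h Uz. Qed.

Lemma smx_ext {p q} (F G : E -> 'M[R]_(p, q)) U : open U -> (forall w, U w -> F w = G w) -> smx U F -> smx U G.
Proof. by move=> Uo e h i j; apply: sm_ext (h i j) => // w Uw; rewrite /ent e. Qed.
Lemma smx_sub {p q} (F : E -> 'M[R]_(p, q)) U U' : U' `<=` U -> smx U F -> smx U' F.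
Proof. by move=> s h i j; exact: sm_sub s _. Qed.
Lemma smx_cst {p q} (A : 'M[R]_(p, q)) U : smx U (fun _ => A).
Proof. by move=> i j; exact: sm_cst. Qed.
Lemma smxD {p q} (F G : E -> 'M[R]_(p, q)) U : open U -> smx U F -> smx U G -> smx U (fun w => F w + G w).
Proof. by move=> Uo f g i j; apply: sm_ext (smD Uo (f i j) (g i j)) => // w _; rewrite /ent mxE. Qed.
Lemma smxN {p q} (F : E -> 'M[R]_(p, q)) U : open U -> smx U F -> smx U (fun w => - F w).
Proof. by move=> Uo f i j; apply: sm_ext (smN Uo (f i j)) => // w _; rewrite /ent mxE. Qed.
Lemma smxB {p q} (F G : E -> 'M[R]_(p, q)) U : open U -> smx U F -> smx U G -> smx U (fun w => F w - G w).
Proof. by move=> Uo f g; apply: smxD => //; exact: smxN. Qed.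
Lemma smxZ {p q} (f : E -> R) (G : E -> 'M[R]_(p, q)) U : open U -> sm U f -> smx U G -> smx U (fun w => f w *: G w).
Proof. by move=> Uo hf g i j; apply: sm_ext (smM Uo hf (g i j)) => // w _; rewrite /ent mxE. Qed.
Lemma smxM {p q r} (F : E -> 'M[R]_(p, q)) (G : E -> 'M[R]_(q, r)) U : open U -> smx U F -> smx U G ->
  smx U (fun w => F w *m G w).
Proof.
move=> Uo f g i j; apply: (@sm_ext _ U (fun w => \sum_k ent F i k w * ent G k j w)) => //.
  by move=> w _; rewrite /ent mxE.
by apply: sm_sum => // k _; exact: smM.
Qed.
Lemma smx_tr {p q} (F : E -> 'M[R]_(p, q)) U : open U -> smx U F -> smx U (fun w => (F w)^T).
Proof. by move=> Uo f i j; apply: sm_ext (f j i) => // w _; rewrite /ent mxE. Qed.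
Lemma smx_dird {p q} (F : E -> 'M[R]_(p, q)) U u : open U -> smx U F -> smx U (Dr u F).
Proof.
move=> Uo f i j; apply: (@sm_ext _ U (Dr u (ent F i j))) => //; last exact: sm_dird (f i j).
by move=> w Uw; rewrite /ent (dird_mxE _ _ _ f Uw).
Qed.
Lemma smx_sum {p q} (I : Type) (r : seq I) (P : pred I) U (F : I -> E -> 'M[R]_(p, q)) : open U ->
  (forall i, P i -> smx U (F i)) -> smx U (fun w => \sum_(i <- r | P i) F i w).
Proof.
move=> Uo h i j; apply: (@sm_ext _ U (fun w => \sum_(k <- r | P k) ent (F k) i j w)) => //.
  by move=> w _; rewrite /ent summxE.
by apply: sm_sum => // k Pk; exact: h.
Qed.
Lemma sm_dot {q} (F G : E -> 'rV[R]_q) U : open U -> smx U F -> smx U G -> sm U (fun w => dt (F w) (G w)).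
Proof. by rewrite dt.unlock => Uo f g; apply: (smxM Uo f (smx_tr Uo g)). Qed.

Lemma dird_mx_ext {p q} (F G : E -> 'M[R]_(p, q)) U u z : open U -> (forall w, U w -> F w = G w) -> U z ->
  Dr u F z = Dr u G z.
Proof. by move=> Uo e Uz; apply: dird_near; apply: near_open Uz _. Qed.
Lemma dird_mx_cst {p q} (A : 'M[R]_(p, q)) u z : Dr u (fun _ => A) z = 0.
Proof. exact: isd_dird (isd_cst u A z). Qed.
Lemma dird_mxD {p q} (F G : E -> 'M[R]_(p, q)) U u z : smx U F -> smx U G -> U z ->
  Dr u (fun w => F w + G w) z = Dr u F z + Dr u G z.
Proof. by move=> hf hg Uz; exact: isd_dird (isdD (drv_isd (@smx_drv _ _ _ U u _ hf Uz)) (drv_isd (@smx_drv _ _ _ U u _ hg Uz))). Qed.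
Lemma dird_mxN {p q} (F : E -> 'M[R]_(p, q)) U u z : smx U F -> U z ->
  Dr u (fun w => - F w) z = - Dr u F z.
Proof. by move=> hf Uz; exact: isd_dird (isdN (drv_isd (@smx_drv _ _ _ U u _ hf Uz))). Qed.
Lemma dird_mxM {p q r} (F : E -> 'M[R]_(p, q)) (G : E -> 'M[R]_(q, r)) U u z : open U -> smx U F -> smx U G -> U z ->
  Dr u (fun w => F w *m G w) z = Dr u F z *m G z + F z *m Dr u G z.
Proof.
move=> Uo f g Uz; apply/matrixP => i j; rewrite (dird_mxE _ _ _ (smxM Uo f g) Uz) !mxE.
have -> : ent (fun w => F w *m G w) i j = fun w => \sum_k ent F i k w * ent G k j w.
  by apply/funext => w; rewrite /ent mxE.
have S k : sm U (fun w => ent F i k w * ent G k j w) by exact: smM.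
have -> : Dr u (fun w => \sum_k ent F i k w * ent G k j w) z =
   \sum_k Dr u (fun w => ent F i k w * ent G k j w) z.
  elim: (index_enum 'I_q) => [|k s IH]; first by under eq_fun do rewrite big_nil; rewrite dird_cst big_nil.
  under eq_fun do rewrite big_cons; rewrite big_cons -IH; apply: (dirdD _ (S k) _ Uz).
  by apply: sm_sum.
rewrite -big_split; apply: eq_bigr => k _ /=.
by rewrite (dirdM _ (f i k) (g k j) Uz) (dird_mxE _ _ _ f Uz) (dird_mxE _ _ _ g Uz).
Qed.
Lemma dird_mxZ {p q} (f : E -> R) (G : E -> 'M[R]_(p, q)) U u z : open U -> sm U f -> smx U G -> U z ->
  Dr u (fun w => f w *: G w) z = Dr u f z *: G z + f z *: Dr u G z.
Proof.
move=> Uo hf g Uz; apply/matrixP => i j; rewrite (dird_mxE _ _ _ (smxZ Uo hf g) Uz) !mxE.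
have -> : ent (fun w => f w *: G w) i j = fun w => f w * ent G i j w.
  by apply/funext => w; rewrite /ent mxE.
by rewrite (dirdM _ hf (g i j) Uz) (dird_mxE _ _ _ g Uz).
Qed.
Lemma dird_mx_tr {p q} (F : E -> 'M[R]_(p, q)) U u z : open U -> smx U F -> U z ->
  Dr u (fun w => (F w)^T) z = (Dr u F z)^T.
Proof.
move=> Uo f Uz; apply/matrixP => i j; rewrite (dird_mxE _ _ _ (smx_tr Uo f) Uz) !mxE (dird_mxE _ _ _ f Uz).
by congr (Dr u _ z); apply/funext => w; rewrite /ent mxE.
Qed.
Lemma dird_mx_lin {p q} (F : E -> 'M[R]_(p, q)) U u z : open U -> smx U F -> U z ->
  Dr u F z = complex.Re u *: Dr 1 F z + complex.Im u *: Dr ii F z.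
Proof.
move=> Uo f Uz; apply/matrixP => i j; rewrite !mxE.
apply: etrans (dird_mxE u i j f Uz) (etrans (dirdE u Uo (f i j) Uz) (esym _)).
by congr (_ * _ + _ * _); exact: dird_mxE.
Qed.
Lemma dird_mx_schwarz {p q} (F : E -> 'M[R]_(p, q)) U u v z : open U -> smx U F -> U z ->
  Dr u (Dr v F) z = Dr v (Dr u F) z.
Proof.
move=> Uo f Uz; apply/matrixP => i j.
have L a b : Dr a (Dr b F) z i j = Dr a (Dr b (ent F i j)) z.
  apply: etrans (dird_mxE a i j (smx_dird b Uo f) Uz) _.
  by apply: (dird_ext _ Uo) => // w Uw; exact: dird_mxE f Uw.
exact: etrans (L u v) (etrans (schwarz u v Uo (f i j 2%N) Uz) (esym (L v u))).
Qed.
Lemma dird_dot {q} (F G : E -> 'rV[R]_q) U u z : open U -> smx U F -> smx U G -> U z ->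
  Dr u (fun w => dt (F w) (G w)) z = dt (Dr u F z) (G z) + dt (F z) (Dr u G z).
Proof.
rewrite dt.unlock => Uo f g Uz; have := dird_mxE u 0 0 (smxM Uo f (smx_tr Uo g)) Uz.
rewrite (dird_mxM u Uo f (smx_tr Uo g) Uz) (dird_mx_tr u Uo g Uz) mxE => <-.
by [].
Qed.

End RealMatrices.

HB.lock Definition cdot {R : realType} {q} (u v : 'rV[R[i]]_q) : R[i] := (u *m v^T) 0 0.
Lemma cdotE {R : realType} {q} (u v : 'rV[R[i]]_q) : cdot u v = (u *m v^T) 0 0.
Proof. by rewrite cdot.unlock. Qed.

Section ComplexMatrices.
Context {R : realType}.
Local Notation E := (Cplx R).
Local Notation C := (R[i]).
Implicit Types (z u : E) (U : set E).

Definition csmx {p q} U (G : E -> 'M[C]_(p, q)) := forall i j, csm U (ent G i j).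
Definition mdl {p q} (G : E -> 'M[C]_(p, q)) z : 'M[C]_(p, q) := \matrix_(i, j) dl (ent G i j) z.
Definition mdlb {p q} (G : E -> 'M[C]_(p, q)) z : 'M[C]_(p, q) := \matrix_(i, j) dlb (ent G i j) z.
Definition mcj {p q} (A : 'M[C]_(p, q)) : 'M[C]_(p, q) := map_mx (@conjc R) A.
Definition rcm {p q} (A : 'M[R]_(p, q)) : 'M[C]_(p, q) := map_mx (real_complex R) A.

Lemma csmx_ext {p q} (F G : E -> 'M[C]_(p, q)) U : open U -> (forall w, U w -> F w = G w) -> csmx U F -> csmx U G.
Proof. by move=> Uo e h i j; apply: csm_ext (h i j) => // w Uw; rewrite /ent e. Qed.
Lemma csmx_cst {p q} (A : 'M[C]_(p, q)) U : csmx U (fun _ => A).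
Proof. by move=> i j; exact: csm_cst. Qed.
Lemma csmxD {p q} (F G : E -> 'M[C]_(p, q)) U : open U -> csmx U F -> csmx U G -> csmx U (fun w => F w + G w).
Proof. by move=> Uo f g i j; apply: csm_ext (csmD Uo (f i j) (g i j)) => // w _; rewrite /ent mxE. Qed.
Lemma csmxZ {p q} (f : E -> C) (G : E -> 'M[C]_(p, q)) U : open U -> csm U f -> csmx U G -> csmx U (fun w => f w *: G w).
Proof. by move=> Uo hf g i j; apply: csm_ext (csmM Uo hf (g i j)) => // w _; rewrite /ent mxE. Qed.
Lemma csmxM {p q r} (F : E -> 'M[C]_(p, q)) (G : E -> 'M[C]_(q, r)) U : open U -> csmx U F -> csmx U G ->
  csmx U (fun w => F w *m G w).
Proof.
move=> Uo f g i j; apply: (@csm_ext _ U (fun w => \sum_k ent F i k w * ent G k j w)) => //.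
  by move=> w _; rewrite /ent mxE.
by apply: csm_sum => // k _; exact: csmM.
Qed.
Lemma csmx_tr {p q} (F : E -> 'M[C]_(p, q)) U : open U -> csmx U F -> csmx U (fun w => (F w)^T).
Proof. by move=> Uo f i j; apply: csm_ext (f j i) => // w _; rewrite /ent mxE. Qed.
Lemma csmx_cj {p q} (F : E -> 'M[C]_(p, q)) U : open U -> csmx U F -> csmx U (fun w => mcj (F w)).
Proof. by move=> Uo f i j; apply: csm_ext (csm_conj Uo (f i j)) => // w _; rewrite /ent mxE. Qed.
Lemma csmx_rcm {p q} (F : E -> 'M[R]_(p, q)) U : open U -> smx U F -> csmx U (fun w => rcm (F w)).
Proof. by move=> Uo f i j; apply: csm_ext (csm_real (f i j)) => // w _; rewrite /ent mxE. Qed.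
Lemma csmx_sum {p q} (I : Type) (r : seq I) (P : pred I) U (F : I -> E -> 'M[C]_(p, q)) : open U ->
  (forall i, P i -> csmx U (F i)) -> csmx U (fun w => \sum_(i <- r | P i) F i w).
Proof.
move=> Uo h i j; apply: (@csm_ext _ U (fun w => \sum_(k <- r | P k) ent (F k) i j w)) => //.
  by move=> w _; rewrite /ent summxE.
by apply: csm_sum => // k Pk; exact: h.
Qed.
Lemma csmx_mdl {p q} (F : E -> 'M[C]_(p, q)) U : open U -> csmx U F -> csmx U (mdl F).
Proof. by move=> Uo f i j; apply: csm_ext (csm_dl Uo (f i j)) => // w _; rewrite /ent mxE. Qed.

Lemma mdl_ext {p q} (F G : E -> 'M[C]_(p, q)) U z : open U -> (forall w, U w -> F w = G w) -> U z ->
  mdl F z = mdl G z.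
Proof. by move=> Uo e Uz; apply/matrixP => i j; rewrite !mxE; apply: (dl_ext Uo) => // w Uw; rewrite /ent e. Qed.
Lemma mdlb_ext {p q} (F G : E -> 'M[C]_(p, q)) U z : open U -> (forall w, U w -> F w = G w) -> U z ->
  mdlb F z = mdlb G z.
Proof. by move=> Uo e Uz; apply/matrixP => i j; rewrite !mxE; apply: (dlb_ext Uo) => // w Uw; rewrite /ent e. Qed.
Lemma mdl_cst {p q} (A : 'M[C]_(p, q)) z : mdl (fun _ => A) z = 0.
Proof. by apply/matrixP => i j; rewrite !mxE dl_cst. Qed.
Lemma mdlb_cst {p q} (A : 'M[C]_(p, q)) z : mdlb (fun _ => A) z = 0.
Proof. by apply/matrixP => i j; rewrite !mxE dlb_cst. Qed.
Lemma mdlD {p q} (F G : E -> 'M[C]_(p, q)) U z : csmx U F -> csmx U G -> U z ->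
  mdl (fun w => F w + G w) z = mdl F z + mdl G z.
Proof.
move=> f g Uz; apply/matrixP => i j; rewrite !mxE -(dlD (f i j) (g i j) Uz).
by congr (dl _ z); apply/funext => w; rewrite /ent mxE.
Qed.
Lemma mdlbD {p q} (F G : E -> 'M[C]_(p, q)) U z : csmx U F -> csmx U G -> U z ->
  mdlb (fun w => F w + G w) z = mdlb F z + mdlb G z.
Proof.
move=> f g Uz; apply/matrixP => i j; rewrite !mxE -(dlbD (f i j) (g i j) Uz).
by congr (dlb _ z); apply/funext => w; rewrite /ent mxE.
Qed.
Lemma mdlZ {p q} (f : E -> C) (G : E -> 'M[C]_(p, q)) U z : open U -> csm U f -> csmx U G -> U z ->
  mdl (fun w => f w *: G w) z = dl f z *: G z + f z *: mdl G z.
Proof.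
move=> Uo hf g Uz; apply/matrixP => i j; rewrite !mxE -(dlM Uo hf (g i j) Uz).
by congr (dl _ z); apply/funext => w; rewrite /ent mxE.
Qed.
Lemma mdlbZ {p q} (f : E -> C) (G : E -> 'M[C]_(p, q)) U z : open U -> csm U f -> csmx U G -> U z ->
  mdlb (fun w => f w *: G w) z = dlb f z *: G z + f z *: mdlb G z.
Proof.
move=> Uo hf g Uz; apply/matrixP => i j; rewrite !mxE -(dlbM Uo hf (g i j) Uz).
by congr (dlb _ z); apply/funext => w; rewrite /ent mxE.
Qed.
Lemma mdlM {p q r} (F : E -> 'M[C]_(p, q)) (G : E -> 'M[C]_(q, r)) U z : open U -> csmx U F -> csmx U G -> U z ->
  mdl (fun w => F w *m G w) z = mdl F z *m G z + F z *m mdl G z.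
Proof.
move=> Uo f g Uz; apply/matrixP => i j; rewrite !mxE.
have -> : ent (fun w => F w *m G w) i j = fun w => \sum_k ent F i k w * ent G k j w.
  by apply/funext => w; rewrite /ent mxE.
rewrite (dl_sum _ Uo _ Uz) => [|k _]; last by exact: csmM.
rewrite -big_split; apply: eq_bigr => k _ /=.
by rewrite (dlM Uo (f i k) (g k j) Uz) !mxE.
Qed.
Lemma mdlbM {p q r} (F : E -> 'M[C]_(p, q)) (G : E -> 'M[C]_(q, r)) U z : open U -> csmx U F -> csmx U G -> U z ->
  mdlb (fun w => F w *m G w) z = mdlb F z *m G z + F z *m mdlb G z.
Proof.
move=> Uo f g Uz; apply/matrixP => i j; rewrite !mxE.
have -> : ent (fun w => F w *m G w) i j = fun w => \sum_k ent F i k w * ent G k j w.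
  by apply/funext => w; rewrite /ent mxE.
rewrite (dlb_sum _ Uo _ Uz) => [|k _]; last by exact: csmM.
rewrite -big_split; apply: eq_bigr => k _ /=.
by rewrite (dlbM Uo (f i k) (g k j) Uz) !mxE.
Qed.
Lemma mdl_tr {p q} (F : E -> 'M[C]_(p, q)) z : mdl (fun w => (F w)^T) z = (mdl F z)^T.
Proof.
by apply/matrixP => i j; rewrite !mxE; congr (dl _ z); apply/funext => w; rewrite /ent mxE.
Qed.
Lemma mdlb_tr {p q} (F : E -> 'M[C]_(p, q)) z : mdlb (fun w => (F w)^T) z = (mdlb F z)^T.
Proof.
by apply/matrixP => i j; rewrite !mxE; congr (dlb _ z); apply/funext => w; rewrite /ent mxE.
Qed.
Lemma mdl_cj {p q} (F : E -> 'M[C]_(p, q)) U z : csmx U F -> U z ->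
  mdl (fun w => mcj (F w)) z = mcj (mdlb F z).
Proof.
move=> f Uz; apply/matrixP => i j; rewrite !mxE -(dl_conj (f i j) Uz).
by congr (dl _ z); apply/funext => w; rewrite /ent mxE.
Qed.
Lemma mdlb_cj {p q} (F : E -> 'M[C]_(p, q)) U z : csmx U F -> U z ->
  mdlb (fun w => mcj (F w)) z = mcj (mdl F z).
Proof.
move=> f Uz; apply/matrixP => i j; rewrite !mxE -(dlb_conj (f i j) Uz).
by congr (dlb _ z); apply/funext => w; rewrite /ent mxE.
Qed.
Lemma mdl_mdlb {p q} (F : E -> 'M[C]_(p, q)) U z : open U -> csmx U F -> U z ->
  mdl (mdlb F) z = mdlb (mdl F) z.
Proof.
move=> Uo f Uz; apply/matrixP => i j; rewrite !mxE.
have -> : ent (mdlb F) i j = dlb (ent F i j) by apply/funext => w; rewrite /ent mxE.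
have -> : ent (mdl F) i j = dl (ent F i j) by apply/funext => w; rewrite /ent mxE.
exact: (dl_dlb Uo (f i j) Uz).
Qed.
Lemma mdl_sum {p q} (I : Type) (r : seq I) (P : pred I) U (F : I -> E -> 'M[C]_(p, q)) z : open U ->
  (forall i, P i -> csmx U (F i)) -> U z ->
  mdl (fun w => \sum_(i <- r | P i) F i w) z = \sum_(i <- r | P i) mdl (F i) z.
Proof.
move=> Uo h Uz; apply/matrixP => i j; rewrite summxE mxE.
have -> : ent (fun w => \sum_(k <- r | P k) F k w) i j = fun w => \sum_(k <- r | P k) ent (F k) i j w.
  by apply/funext => w; rewrite /ent summxE.
rewrite (dl_sum _ Uo _ Uz) => [|k Pk]; last exact: h.
by apply: eq_bigr => k _; rewrite mxE.
Qed.
Lemma mdlb_sum {p q} (I : Type) (r : seq I) (P : pred I) U (F : I -> E -> 'M[C]_(p, q)) z : open U ->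
  (forall i, P i -> csmx U (F i)) -> U z ->
  mdlb (fun w => \sum_(i <- r | P i) F i w) z = \sum_(i <- r | P i) mdlb (F i) z.
Proof.
move=> Uo h Uz; apply/matrixP => i j; rewrite summxE mxE.
have -> : ent (fun w => \sum_(k <- r | P k) F k w) i j = fun w => \sum_(k <- r | P k) ent (F k) i j w.
  by apply/funext => w; rewrite /ent summxE.
rewrite (dlb_sum _ Uo _ Uz) => [|k Pk]; last exact: h.
by apply: eq_bigr => k _; rewrite mxE.
Qed.

Lemma fre_rc (f : E -> R) : fre (fun w => (f w)%:C%C) = f. Proof. by []. Qed.
Lemma fim_rc (f : E -> R) : fim (fun w => (f w)%:C%C) = fun _ => 0. Proof. by []. Qed.

Lemma dl_rc (f : E -> R) z : dl (fun w => (f w)%:C%C) z = Complex (Dr 1 f z / 2) (- Dr ii f z / 2).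
Proof. by rewrite dl.unlock fre_rc fim_rc !dird_cst addr0 sub0r. Qed.
Lemma dlb_rc (f : E -> R) z : dlb (fun w => (f w)%:C%C) z = Complex (Dr 1 f z / 2) (Dr ii f z / 2).
Proof. by rewrite dlb.unlock fre_rc fim_rc !dird_cst subr0 add0r. Qed.

Lemma rcm_dird {p q} (F : E -> 'M[R]_(p, q)) U u z : open U -> smx U F -> U z ->
  rcm (Dr u F z) = (u : C) *: mdl (fun w => rcm (F w)) z + (u : C)^*%C *: mdlb (fun w => rcm (F w)) z.
Proof.
move=> Uo f Uz; apply/matrixP => i j; rewrite !mxE (dird_mxE _ _ _ f Uz).
have -> : ent (fun w => rcm (F w)) i j = fun w => (ent F i j w)%:C%C by apply/funext => w; rewrite /ent mxE.
rewrite dl_rc dlb_rc (dirdE u Uo (f i j) Uz); case: u => a b /=; gen_dird; rewrite /real_complex_def.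
by apply: Cext; field.
Qed.

Lemma mdl_rcm {p q} (F : E -> 'M[R]_(p, q)) U z : smx U F -> U z ->
  mdl (fun w => rcm (F w)) z = 2^-1 *: (rcm (Dr 1 F z) - 'i%C *: rcm (Dr ii F z)).
Proof.
move=> f Uz; apply/matrixP => i j; rewrite !mxE !(dird_mxE _ _ _ f Uz).
have -> : ent (fun w => rcm (F w)) i j = fun w => (ent F i j w)%:C%C by apply/funext => w; rewrite /ent mxE.
rewrite dl_rc; gen_dird => *; rewrite /real_complex_def.
have -> : (2^-1 : C) = (2^-1)%:C%C by rewrite fmorphV rmorph_nat.
by rewrite /real_complex_def; apply: Cext; field.
Qed.

Lemma rcmM {p q r} (A : 'M[R]_(p, q)) (B : 'M[R]_(q, r)) : rcm (A *m B) = rcm A *m rcm B.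
Proof. exact: map_mxM. Qed.
Lemma rcm_inj {p q} : injective (@rcm p q).
Proof. by apply: map_mx_inj; exact: complexI. Qed.
Lemma mcj_rcm {p q} (A : 'M[R]_(p, q)) : mcj (rcm A) = rcm A.
Proof. by apply/matrixP => i j; rewrite !mxE; apply: Cext; rewrite ?oppr0. Qed.
Lemma mcjM {p q r} (A : 'M[C]_(p, q)) (B : 'M[C]_(q, r)) : mcj (A *m B) = mcj A *m mcj B.
Proof. exact: map_mxM. Qed.
Lemma mcjK {p q} : involutive (@mcj p q).
Proof. by move=> A; apply/matrixP => i j; rewrite !mxE conjcK. Qed.

Lemma dl_cdot {q} (F G : E -> 'rV[C]_q) U z : open U -> csmx U F -> csmx U G -> U z ->
  dl (fun w => cdot (F w) (G w)) z = cdot (mdl F z) (G z) + cdot (F z) (mdl G z).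
Proof.
rewrite cdot.unlock => Uo f g Uz; have := mdlM Uo f (csmx_tr Uo g) Uz; rewrite mdl_tr => e.
have -> : dl (fun w => (F w *m (G w)^T) 0 0) z = mdl (fun w => F w *m (G w)^T) z 0 0 by rewrite mxE.
by rewrite e mxE.
Qed.
Lemma dlb_cdot {q} (F G : E -> 'rV[C]_q) U z : open U -> csmx U F -> csmx U G -> U z ->
  dlb (fun w => cdot (F w) (G w)) z = cdot (mdlb F z) (G z) + cdot (F z) (mdlb G z).
Proof.
rewrite cdot.unlock => Uo f g Uz; have := mdlbM Uo f (csmx_tr Uo g) Uz; rewrite mdlb_tr => e.
have -> : dlb (fun w => (F w *m (G w)^T) 0 0) z = mdlb (fun w => F w *m (G w)^T) z 0 0 by rewrite mxE.
by rewrite e mxE.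
Qed.
Lemma csm_cdot {q} (F G : E -> 'rV[C]_q) U : open U -> csmx U F -> csmx U G -> csm U (fun w => cdot (F w) (G w)).
Proof. by rewrite cdot.unlock => Uo f g; exact: (csmxM Uo f (csmx_tr Uo g)). Qed.

End ComplexMatrices.

(** * Euclidean products and orthogonal projections *)

Section Dot.
Context {R : realType}.

Lemma dotE {q} (u v : 'rV[R]_q) : dt u v = \sum_k u 0 k * v 0 k.
Proof. by rewrite dtE mxE; apply: eq_bigr => k _; rewrite mxE. Qed.
Lemma dotC {q} (u v : 'rV[R]_q) : dt u v = dt v u.
Proof. by rewrite !dotE; apply: eq_bigr => k _; rewrite mulrC. Qed.
Lemma dotDl {q} (u v w : 'rV[R]_q) : dt (u + v) w = dt u w + dt v w.
Proof. by rewrite !dtE mulmxDl mxE. Qed.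
Lemma dotDr {q} (u v w : 'rV[R]_q) : dt w (u + v) = dt w u + dt w v.
Proof. by rewrite dotC dotDl !(dotC w). Qed.
Lemma dotZl {q} a (u v : 'rV[R]_q) : dt (a *: u) v = a * dt u v.
Proof. by rewrite !dtE -scalemxAl mxE. Qed.
Lemma dotZr {q} a (u v : 'rV[R]_q) : dt u (a *: v) = a * dt u v.
Proof. by rewrite dotC dotZl dotC. Qed.
Lemma dotNl {q} (u v : 'rV[R]_q) : dt (- u) v = - dt u v.
Proof. by rewrite -scaleN1r dotZl mulN1r. Qed.
Lemma dotNr {q} (u v : 'rV[R]_q) : dt u (- v) = - dt u v.
Proof. by rewrite dotC dotNl dotC. Qed.
Lemma dot0l {q} (v : 'rV[R]_q) : dt 0 v = 0.
Proof. by rewrite !dtE mul0mx mxE. Qed.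
Lemma dot0r {q} (v : 'rV[R]_q) : dt v 0 = 0.
Proof. by rewrite dotC dot0l. Qed.
Lemma dotMl {p q} (u : 'rV[R]_p) (A : 'M[R]_(p, q)) (v : 'rV[R]_q) : dt (u *m A) v = dt u (v *m A^T).
Proof. by rewrite !dtE trmx_mul trmxK mulmxA. Qed.
Lemma dot_sumr {q} (I : Type) (r : seq I) (P : pred I) (F : I -> 'rV[R]_q) v :
  dt v (\sum_(i <- r | P i) F i) = \sum_(i <- r | P i) dt v (F i).
Proof. by apply: (big_morph (dt v)) => [x y|]; [exact: dotDr|exact: dot0r]. Qed.
Lemma dot_suml {q} (I : Type) (r : seq I) (P : pred I) (F : I -> 'rV[R]_q) v :
  dt (\sum_(i <- r | P i) F i) v = \sum_(i <- r | P i) dt (F i) v.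
Proof. by rewrite dotC dot_sumr; apply: eq_bigr => i _; rewrite dotC. Qed.
Lemma dot_ge0 {q} (u : 'rV[R]_q) : 0 <= dt u u.
Proof. by rewrite dotE sumr_ge0// => k _; rewrite -expr2 sqr_ge0. Qed.
Lemma dot_eq0 {q} (u : 'rV[R]_q) : dt u u = 0 -> u = 0.
Proof.
move=> /eqP; rewrite dotE psumr_eq0 => [/allP h|k _]; last by rewrite -expr2 sqr_ge0.
apply/rowP => k; have := h k; rewrite mem_index_enum => /(_ isT)/=.
by rewrite -expr2 sqrf_eq0 mxE => /eqP.
Qed.
Lemma mul_row_tr {q} (u v : 'rV[R]_q) : u *m v^T = (dt u v)%:M.
Proof. by apply/matrixP => i j; rewrite !ord1 [RHS]mxE eqxx mulr1n dtE. Qed.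
Lemma mul_tr_row {p q} (w u : 'rV[R]_p) (v : 'rV[R]_q) : w *m (u^T *m v) = dt w u *: v.
Proof. by rewrite mulmxA mul_row_tr mul_scalar_mx. Qed.

(** A row vector [x] killed by [B *m B^T] satisfies |x B|^2 = 0, and x -> x B is injective. *)
Lemma gram_unit {k q} (B : 'M[R]_(k, q)) : row_free B -> B *m B^T \in unitmx.
Proof.
move=> fB; rewrite -row_free_unit -kermx_eq0; apply/eqP/row_matrixP => i; rewrite row0.
have /sub_kermxP := row_sub i (kermx (B *m B^T)); set x := row i _ => e.
have : dt (x *m B) (x *m B) = 0 by rewrite dotMl -mulmxA mulmxA -[x *m B *m B^T]mulmxA e dot0r.
by move=> /dot_eq0 e2; apply: (row_free_inj fB); rewrite e2 mul0mx.
Qed.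

Definition perp_mx {k q} (A : 'M[R]_(k, q)) : 'M[R]_q :=
  let B := row_base A in 1%:M - B^T *m invmx (B *m B^T) *m B.

Lemma perpE {k q} (A : 'M[R]_(k, q)) v : perp A v = v *m perp_mx A.
Proof. by rewrite /perp /perp_mx mulmxBr mulmx1 !mulmxA. Qed.

(** Characterises the projection without its formula; explicit projections are identified through it
    below. The Gram matrix of a row base is invertible, so the coefficients of [v - w] are recovered
    from [v]. *)
Lemma perp_uniq {k q} (A : 'M[R]_(k, q)) v w : (v - w <= A)%MS -> w *m A^T = 0 -> perp A v = w.
Proof.
move=> vw wA; rewrite /perp; set B := row_base A.
have uB : B *m B^T \in unitmx by apply: gram_unit; exact: row_base_free.
have /submxP[c cE] : (v - w <= B)%MS by rewrite eq_row_base.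
have wB : w *m B^T = 0.
  have /submxP[D ->] : (B <= A)%MS by rewrite eq_row_base.
  by rewrite trmx_mul mulmxA wA mul0mx.
have -> : v *m B^T = c *m (B *m B^T).
  by rewrite -[v](subrK w) mulmxDl wB addr0 cE mulmxA.
by rewrite mulmxK// -cE opprB addrC subrK.
Qed.

Lemma perp_orth {k q} (A : 'M[R]_(k, q)) v : perp A v *m A^T = 0.
Proof.
rewrite /perp; set B := row_base A.
have uB : B *m B^T \in unitmx by apply: gram_unit; exact: row_base_free.
have /submxP[D eA] : (A <= B)%MS by rewrite eq_row_base.
have -> : A^T = B^T *m D^T by rewrite -trmx_mul -eA.
rewrite mulmxA mulmxBl -(mulmxA _ B) -(mulmxA _ (invmx _)) mulVmx// mulmx1 subrr.
by rewrite mul0mx.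
Qed.

Lemma perp_sub {k q} (A : 'M[R]_(k, q)) v : (v - perp A v <= A)%MS.
Proof.
rewrite /perp opprB addrC subrK.
by apply: submx_trans (submxMl _ _) _; rewrite eq_row_base.
Qed.

End Dot.

HB.lock Definition np {R : realType} {N : nat} (F : Cplx R -> 'rV[R]_N) (z : Cplx R) (v : 'rV[R]_N) : 'rV[R]_N :=
  normal_part F z v.
HB.lock Definition al {R : realType} {N : nat} (F : Cplx R -> 'rV[R]_N) (u v z : Cplx R) : 'rV[R]_N :=
  alpha F u v z.

(** * Conformal immersions into spheres *)

Section Conformal.
Context {R : realType} {N : nat}.
Local Notation E := (Cplx R).
Implicit Types (z u v : E) (U : set E) (F : E -> 'rV[R]_N).

Definition conf U F := smx U F /\ forall z, U z ->
  [/\ dt (F z) (F z) = 1, 0 < dt (Dr 1 F z) (Dr 1 F z),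
      dt (Dr ii F z) (Dr ii F z) = dt (Dr 1 F z) (Dr 1 F z) &
      dt (Dr 1 F z) (Dr ii F z) = 0].

Definition lam F z := dt (Dr 1 F z) (Dr 1 F z).

(** Projection onto position and tangent vectors of a conformal [F]: these are orthogonal, of square
    lengths 1, [lam] and [lam]. *)
Definition tang F z (v : 'rV[R]_N) : 'rV[R]_N := dt v (F z) *: F z +
  (lam F z)^-1 *: (dt v (Dr 1 F z) *: Dr 1 F z + dt v (Dr ii F z) *: Dr ii F z).

Lemma normal_vectorP F z (v : 'rV[R]_N) : normal_vector F z v <->
  [/\ dt v (F z) = 0, dt v (Dr 1 F z) = 0 & dt v (Dr ii F z) = 0].
Proof.
rewrite /normal_vector /frame -!DrfE -!iiE !tr_col_mx !mul_mx_row !mul_row_tr; split.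
  move=> /eqP; rewrite row_mx_eq0 row_mx_eq0 => /and3P[a b c].
  by split; [move: a|move: b|move: c] => /eqP/matrixP/(_ 0 0); rewrite !mxE eqxx mulr1n.
by case=> -> -> ->; rewrite !raddf0 !row_mx0.
Qed.

Lemma conf_dot1 U F z u : open U -> conf U F -> U z -> dt (Dr u F z) (F z) = 0.
Proof.
move=> Uo [sF cF] Uz; have : Dr u (fun w => dt (F w) (F w)) z = 0.
  rewrite -[RHS](dird_cst (1:R) u z); apply: (dird_ext _ Uo) => // w Uw.
  by have [] := cF w Uw.
rewrite (dird_dot u Uo sF sF Uz) [X in _ + X]dotC => /eqP.
by rewrite -mulr2n mulrn_eq0/= => /eqP.
Qed.

Lemma tang_frame F z w : (tang F z w <= frame F z)%MS.
Proof.
rewrite /tang /frame -!DrfE -!iiE -addsmxE !(addmx_sub, scalemx_sub)//.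
- exact: addsmxSl.
- by apply: submx_trans (addsmxSr _ _); rewrite -addsmxE; exact: addsmxSl.
- by apply: submx_trans (addsmxSr _ _); rewrite -addsmxE; exact: addsmxSr.
Qed.

Lemma normal_partE U F z (v : 'rV[R]_N) : open U -> conf U F -> U z -> np F z v = v - tang F z v.
Proof.
move=> Uo cF Uz; have [_ h] := cF; have [h1 h2 h3 h4] := h z Uz.
have d1 := conf_dot1 1 Uo cF Uz; have d2 := conf_dot1 ii Uo cF Uz.
rewrite np.unlock; apply: perp_uniq; first by rewrite opprB addrC subrK tang_frame.
have l0 : lam F z != 0 by rewrite gt_eqF.
apply/normal_vectorP; move: (h3) (l0); rewrite /tang /lam; move: h1 h4 d1 d2.
move: (F z) (Dr 1 F z) (Dr ii F z) => f fx fy h1 h4 d1 d2 h3' l0'.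
by split; rewrite dotDl dotNl !(dotDl, dotZl) ?h1 ?h3 ?h4 ?d1 ?d2 ?(dotC f) ?(dotC fy fx) ?h4 ?d1 ?d2 ?h3'; field.
Qed.

Lemma normal_part_normal U F z (v : 'rV[R]_N) : open U -> conf U F -> U z -> normal_vector F z (np F z v).
Proof. by rewrite np.unlock => *; exact: perp_orth. Qed.

Lemma normal_part_id U F z (v : 'rV[R]_N) : open U -> conf U F -> U z -> normal_vector F z v -> np F z v = v.
Proof.
move=> Uo cF Uz /normal_vectorP[a b c].
by rewrite (normal_partE _ Uo cF Uz) /tang a b c !scale0r !add0r scaler0 subr0.
Qed.

Lemma normal_partD F z (v w : 'rV[R]_N) : np F z (v + w) = np F z v + np F z w.
Proof. by rewrite !np.unlock /normal_part !perpE mulmxDl. Qed.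
Lemma normal_partB F z (v w : 'rV[R]_N) : np F z (v - w) = np F z v - np F z w.
Proof. by rewrite !np.unlock /normal_part !perpE mulmxBl. Qed.
Lemma normal_partZ F z a (v : 'rV[R]_N) : np F z (a *: v) = a *: np F z v.
Proof. by rewrite !np.unlock /normal_part !perpE scalemxAl. Qed.

Lemma normal_part_tang U F z (v : 'rV[R]_N) : open U -> conf U F -> U z -> v = np F z v + tang F z v.
Proof. by move=> Uo cF Uz; rewrite (normal_partE _ Uo cF Uz) subrK. Qed.

Lemma alphaE F u v z : al F u v z = np F z (Dr u (Dr v F) z).
Proof. by rewrite al.unlock np.unlock !DrfE. Qed.

Lemma alpha_linl U F u v z : open U -> conf U F -> U z ->
  al F u v z = complex.Re u *: al F 1 v z + complex.Im u *: al F ii v z.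
Proof.
move=> Uo cF Uz; rewrite !alphaE -!normal_partZ -normal_partD.
by rewrite (dird_mx_lin u Uo (smx_dird v Uo cF.1) Uz).
Qed.

Lemma alphaC U F u v z : open U -> conf U F -> U z -> al F u v z = al F v u z.
Proof. by move=> Uo cF Uz; rewrite !alphaE (dird_mx_schwarz u v Uo cF.1 Uz). Qed.

Lemma normal_alpha U F u v z : open U -> conf U F -> U z -> normal_vector F z (al F u v z).
Proof. by move=> Uo cF Uz; rewrite alphaE; exact: normal_part_normal Uo cF Uz. Qed.

(** For [e1], [e2] orthogonal of square length [l], and [a1], [a2] orthogonal to both, this skew
    matrix sends [e1] to [a1] and [e2] to [a2], acting on rows from the right. *)
Definition skew2 (l : R) (e1 a1 e2 a2 : 'rV[R]_N) : 'M[R]_N :=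
  l^-1 *: (e1^T *m a1 - a1^T *m e1 + (e2^T *m a2 - a2^T *m e2)).

Lemma skew2_skew l e1 a1 e2 a2 : (skew2 l e1 a1 e2 a2)^T = - skew2 l e1 a1 e2 a2.
Proof.
apply/matrixP => i j; rewrite !(mxE, big_ord1); ring.
Qed.

Lemma mul_skew2 l e1 a1 e2 a2 w : w *m skew2 l e1 a1 e2 a2 = l^-1 *:
  (dt w e1 *: a1 - dt w a1 *: e1 + (dt w e2 *: a2 - dt w a2 *: e2)).
Proof. by rewrite /skew2 -scalemxAr !mulmxDr !mulmxN !mul_tr_row. Qed.

Lemma skew2_e1 l e1 a1 e2 a2 : l != 0 -> dt e1 e1 = l -> dt e1 e2 = 0 -> dt a1 e1 = 0 -> dt a2 e1 = 0 ->
  e1 *m skew2 l e1 a1 e2 a2 = a1.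
Proof.
move=> l0 h1 h2 h3 h4; rewrite mul_skew2 h1 h2 (dotC e1) h3 (dotC e1) h4.
by rewrite !scale0r !subr0 addr0 scalerA mulVf// scale1r.
Qed.

Lemma skew2_sym l e1 a1 e2 a2 : skew2 l e1 a1 e2 a2 = skew2 l e2 a2 e1 a1.
Proof. by rewrite /skew2 addrC. Qed.

(* The second fundamental form of [F] as a one-form with values in skew matrices. *)
Definition sff F v z : 'M[R]_N := skew2 (lam F z) (Dr 1 F z) (al F v 1 z) (Dr ii F z) (al F v ii z).

Lemma sff_skew F v z : (sff F v z)^T = - sff F v z.
Proof. exact: skew2_skew. Qed.

Lemma mul_sff F v z w : w *m sff F v z = (lam F z)^-1 *:
  (dt w (Dr 1 F z) *: al F v 1 z - dt w (al F v 1 z) *: Dr 1 F z +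
   (dt w (Dr ii F z) *: al F v ii z - dt w (al F v ii z) *: Dr ii F z)).
Proof. exact: mul_skew2. Qed.

Lemma sff_F U F v z : open U -> conf U F -> U z -> F z *m sff F v z = 0.
Proof.
move=> Uo cF Uz; rewrite mul_sff (dotC _ (Dr 1 F z)) (conf_dot1 1 Uo cF Uz) (dotC _ (Dr ii F z)) (conf_dot1 ii Uo cF Uz).
have /normal_vectorP[a1 _ _] := normal_alpha v 1 Uo cF Uz.
have /normal_vectorP[a2 _ _] := normal_alpha v ii Uo cF Uz.
by rewrite (dotC _ (al F v 1 z)) a1 (dotC _ (al F v ii z)) a2 !scale0r !subrr addr0 scaler0.
Qed.

Lemma sff_x U F v z : open U -> conf U F -> U z -> Dr 1 F z *m sff F v z = al F v 1 z.
Proof.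
move=> Uo cF Uz; have [_ h] := cF; have [h1 h2 h3 h4] := h z Uz.
have /normal_vectorP[_ a1 _] := normal_alpha v 1 Uo cF Uz.
have /normal_vectorP[_ a2 _] := normal_alpha v ii Uo cF Uz.
by apply: skew2_e1 => //; rewrite gt_eqF.
Qed.

Lemma sff_y U F v z : open U -> conf U F -> U z -> Dr ii F z *m sff F v z = al F v ii z.
Proof.
move=> Uo cF Uz; have [_ h] := cF; have [h1 h2 h3 h4] := h z Uz.
have /normal_vectorP[_ _ a1] := normal_alpha v 1 Uo cF Uz.
have /normal_vectorP[_ _ a2] := normal_alpha v ii Uo cF Uz.
rewrite /sff skew2_sym; apply: skew2_e1 => //; first by rewrite gt_eqF.
by rewrite dotC.
Qed.

Lemma sff_u U F u v z : open U -> conf U F -> U z -> Dr u F z *m sff F v z = al F v u z.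
Proof.
move=> Uo cF Uz; rewrite (dird_mx_lin u Uo cF.1 Uz) mulmxDl -!scalemxAl (sff_x _ Uo cF Uz) (sff_y _ Uo cF Uz).
by rewrite !(alphaC v _ Uo cF Uz) -(alpha_linl u v Uo cF Uz).
Qed.

(** On normal vectors the form is minus the shape operator, whose values are tangent. *)
Lemma normal_sff U F v z n : open U -> conf U F -> U z -> normal_vector F z n ->
  np F z (n *m sff F v z) = 0.
Proof.
move=> Uo cF Uz /normal_vectorP[n1 n2 n3]; rewrite mul_sff n2 n3 !scale0r !sub0r.
rewrite -opprD normal_partZ -[- _]sub0r normal_partB normal_partD !normal_partZ.
suff K u : np F z (Dr u F z) = 0.
  have n0 : np F z 0 = 0 by rewrite -[in LHS](scale0r (0 : 'rV[R]_N)) normal_partZ scale0r.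
  by rewrite !K n0 !scaler0 addr0 subr0 scaler0.
rewrite np.unlock; apply: perp_uniq; last by rewrite mul0mx.
rewrite subr0 (dird_mx_lin u Uo cF.1 Uz) /frame -!DrfE -!iiE -addsmxE !(addmx_sub, scalemx_sub)//.
- by apply: submx_trans (addsmxSr _ _); rewrite -addsmxE; exact: addsmxSl.
- by apply: submx_trans (addsmxSr _ _); rewrite -addsmxE; exact: addsmxSr.
Qed.

Lemma sff_lin U F v z : open U -> conf U F -> U z ->
  sff F v z = complex.Re v *: sff F 1 z + complex.Im v *: sff F ii z.
Proof.
move=> Uo cF Uz; apply/row_matrixP => i; rewrite !rowE mulmxDr -(scalemxAr (complex.Re v)) -(scalemxAr (complex.Im v)) !mul_sff.
rewrite !(alpha_linl v _ Uo cF Uz); set w := delta_mx _ _.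
set a := al F 1 1 z; set b := al F ii 1 z; set c := al F 1 ii z; set d := al F ii ii z.
apply/rowP => k; rewrite !(mxE, dotDr, dotZr); ring.
Qed.

(** Koszul's formula for commuting fields. The tangential components of second derivatives depend on
    the metric only, so isometric surfaces share them. *)
Lemma christoffel U F u v w z : open U -> smx U F -> U z ->
  dt (Dr u (Dr v F) z) (Dr w F z) = 2^-1 *
   (Dr u (fun p => dt (Dr v F p) (Dr w F p)) z +
    Dr v (fun p => dt (Dr u F p) (Dr w F p)) z -
    Dr w (fun p => dt (Dr u F p) (Dr v F p)) z).
Proof.
move=> Uo f Uz; have s a : smx U (Dr a F) by exact: smx_dird.
rewrite !(dird_dot _ Uo (s _) (s _) Uz) (dird_mx_schwarz v u Uo f Uz) (dird_mx_schwarz w u Uo f Uz) (dird_mx_schwarz w v Uo f Uz).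
rewrite (dotC (Dr v F z)) (dotC (Dr u F z) (Dr v (Dr w F) z)).
by field.
Qed.

Lemma conf_dot2 U F u v z : open U -> conf U F -> U z ->
  dt (Dr u (Dr v F) z) (F z) = - dt (Dr u F z) (Dr v F z).
Proof.
move=> Uo cF Uz; have : Dr u (fun w => dt (Dr v F w) (F w)) z = 0.
  rewrite -[RHS](dird_cst (0:R) u z); apply: (dird_ext _ Uo) => // w Uw.
  exact: conf_dot1 Uo cF Uw.
rewrite (dird_dot u Uo (smx_dird v Uo cF.1) cF.1 Uz) (dotC (Dr v F z)) => /eqP.
by rewrite addr_eq0 => /eqP.
Qed.

End Conformal.

(** * Associated surfaces as rotations of the ambient space *)

Section Rotations.
Context {R : realType} {N : nat}.
Local Notation E := (Cplx R).
Implicit Types (z u v e : E) (U : set E) (F gam h : E -> 'rV[R]_N) (Z T : E -> 'M[R]_N).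

Definition rot U gam e Z := [/\ smx U Z, (forall z, U z -> Z z *m (Z z)^T = 1%:M) &
  forall z v, U z -> Dr v Z z = sff gam (e * v) z *m Z z].

Lemma alphaDl U F u u' v z : open U -> conf U F -> U z -> al F (u + u') v z = al F u v z + al F u' v z.
Proof.
move=> Uo cF Uz; rewrite (alpha_linl (u + u') v Uo cF Uz) (alpha_linl u v Uo cF Uz) (alpha_linl u' v Uo cF Uz).
have -> : complex.Re (u + u') = complex.Re u + complex.Re u' by case: u u' => ? ? [].
have -> : complex.Im (u + u') = complex.Im u + complex.Im u' by case: u u' => ? ? [].
by rewrite !scalerDl addrACA.
Qed.

Lemma dt_isom (A : 'M[R]_N) (a b : 'rV[R]_N) : A *m A^T = 1%:M -> dt (a *m A) (b *m A) = dt a b.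
Proof. by move=> hA; rewrite dotMl -mulmxA hA mulmx1. Qed.

Lemma np_uniq U F z (v w : 'rV[R]_N) : open U -> conf U F -> U z -> normal_vector F z w ->
  (exists a b c, v - w = a *: F z + b *: Dr 1 F z + c *: Dr ii F z) -> np F z v = w.
Proof.
move=> Uo cF Uz nw [a [b [c e]]]; rewrite np.unlock; apply: perp_uniq => //.
rewrite e /frame -!DrfE -!iiE -addsmxE !(addmx_sub, scalemx_sub)//.
- exact: addsmxSl.
- by apply: submx_trans (addsmxSr _ _); rewrite -addsmxE; exact: addsmxSl.
- by apply: submx_trans (addsmxSr _ _); rewrite -addsmxE; exact: addsmxSr.
Qed.

Lemma np_tangE U F z (v : 'rV[R]_N) : open U -> conf U F -> U z ->
  exists a b c, v - np F z v = a *: F z + b *: Dr 1 F z + c *: Dr ii F z.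
Proof.
move=> Uo cF Uz; rewrite (normal_partE v Uo cF Uz) opprB addrC subrK /tang.
exists (dt v (F z)), ((lam F z)^-1 * dt v (Dr 1 F z)), ((lam F z)^-1 * dt v (Dr ii F z)).
by rewrite scalerDr !scalerA addrA.
Qed.

(** * From a rotation to an associated surface *)

Section RotConf.
Variables (U : set E) (gam : E -> 'rV[R]_N) (e : E) (Z : E -> 'M[R]_N).
Hypotheses (Uo : open U) (cg : conf U gam) (rZ : rot U gam e Z).
Let h w := gam w *m Z w.

Lemma rot_smx : smx U h.
Proof. by case: rZ => sZ _ _; exact: smxM Uo cg.1 sZ. Qed.

(** The derivative of [Z] contributes [gam *m sff], which is 0 because the form annihilates the
    position vector. *)
Lemma rot_Dr v z : U z -> Dr v h z = Dr v gam z *m Z z.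
Proof.
case: rZ => sZ oZ dZ Uz; rewrite (dird_mxM v Uo cg.1 sZ Uz) dZ// mulmxA.
by rewrite (sff_F _ Uo cg Uz) mul0mx addr0.
Qed.

Lemma rot_isometric u v z : U z -> dt (Dr u h z) (Dr v h z) = dt (Dr u gam z) (Dr v gam z).
Proof. by case: (rZ) => sZ oZ dZ Uz; rewrite !rot_Dr// dt_isom// oZ. Qed.

Lemma rot_conf : conf U h.
Proof.
split; first exact: rot_smx; move=> z Uz; case: (rZ) => sZ oZ dZ.
by have [_ /(_ z Uz)] := cg; rewrite !rot_isometric// /h dt_isom// oZ.
Qed.

Lemma rot_normal z w : U z -> normal_vector gam z w -> normal_vector h z (w *m Z z).
Proof.
case: (rZ) => sZ oZ dZ Uz /normal_vectorP[a b c]; apply/normal_vectorP.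
by rewrite !rot_Dr// /h !dt_isom ?oZ.
Qed.

Lemma rot_np z w : U z -> np h z (w *m Z z) = np gam z w *m Z z.
Proof.
move=> Uz; apply: (np_uniq Uo rot_conf Uz).
  by apply: rot_normal => //; exact: normal_part_normal Uo cg Uz.
have [a [b [c e']]] := np_tangE w Uo cg Uz; exists a, b, c.
by rewrite -mulmxBl e' !mulmxDl -!scalemxAl !rot_Dr.
Qed.

Lemma rot_Dr2 u v z : U z ->
  Dr u (Dr v h) z = (Dr u (Dr v gam) z + al gam (e * u) v z) *m Z z.
Proof.
move=> Uz; rewrite (dird_mx_ext u Uo (fun w Uw => rot_Dr v Uw) Uz).
case: (rZ) => sZ oZ dZ; rewrite (dird_mxM u Uo (smx_dird v Uo cg.1) sZ Uz) dZ// mulmxA.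
by rewrite (sff_u _ _ Uo cg Uz) mulmxDl.
Qed.

(** Differentiating a rotated tangent vector adds the normal vector [al gam (e * u) v] to the second
    fundamental form. *)
Lemma rot_al u v z : U z -> al h u v z = al gam ((1 + e) * u) v z *m Z z.
Proof.
move=> Uz; rewrite alphaE rot_Dr2// rot_np// normal_partD -alphaE.
rewrite (normal_part_id Uo cg Uz (normal_alpha _ _ Uo cg Uz)).
by rewrite mulrDl mul1r (alphaDl _ _ _ Uo cg Uz).
Qed.

(** The extra term [xi *m sff] is tangent and disappears in the normal projection. *)
Lemma rot_parallel U' (xi : E -> 'rV[R]_N) u z : open U' -> U' `<=` U -> smx U' xi ->
  (forall w, U' w -> normal_vector gam w (xi w)) -> U' z ->
  np h z (Dr u (fun w => xi w *m Z w) z) = np gam z (Dr u xi z) *m Z z.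
Proof.
move=> U'o sU sxi nxi U'z; have Uz := sU z U'z; case: (rZ) => sZ oZ dZ.
rewrite (dird_mxM u U'o sxi (smx_sub sU sZ) U'z) dZ// mulmxA -mulmxDl rot_np// normal_partD.
by rewrite (normal_sff _ Uo cg Uz (nxi z U'z)) addr0.
Qed.

End RotConf.

Definition nproj F z : 'M[R]_N := 1%:M - (F z)^T *m F z -
  (lam F z)^-1 *: ((Dr 1 F z)^T *m Dr 1 F z + (Dr ii F z)^T *m Dr ii F z).

Lemma mul_nproj U F z w : open U -> conf U F -> U z -> w *m nproj F z = np F z w.
Proof.
move=> Uo cF Uz; rewrite (normal_partE w Uo cF Uz) /nproj /tang !mulmxBr mulmx1 -scalemxAr mulmxDr !mul_tr_row.
by rewrite opprD addrA.
Qed.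

(** The rotation that an associated surface must come from: it sends the moving frame of [gam] to
    that of [h] and acts on normal vectors as [T]. *)
Definition Zmap gam h T z : 'M[R]_N := (gam z)^T *m h z +
  (lam gam z)^-1 *: ((Dr 1 gam z)^T *m Dr 1 h z + (Dr ii gam z)^T *m Dr ii h z) + nproj gam z *m T z.

(** * From an associated surface to a rotation *)

Section ZmapRot.
Variables (U : set E) (gam h : E -> 'rV[R]_N) (e : E) (T : E -> 'M[R]_N).
Hypotheses (Uo : open U) (cg : conf U gam) (ch : conf U h) (sT : smx U T).
Hypothesis met : forall z u v, U z -> dt (Dr u h z) (Dr v h z) = dt (Dr u gam z) (Dr v gam z).
Hypothesis isoT : forall z (v w : 'rV[R]_N), U z -> normal_vector gam z v -> normal_vector gam z w ->
  normal_vector h z (v *m T z) /\ dt (v *m T z) (w *m T z) = dt v w.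
Hypothesis parT : forall (xi : E -> 'rV[R]_N) z u, smx U xi ->
  (forall w, U w -> normal_vector gam w (xi w)) -> U z ->
  np h z (Dr u (fun w => xi w *m T w) z) = np gam z (Dr u xi z) *m T z.
Hypothesis alT : forall z u v, U z -> al h u v z = al gam (e * u) v z *m T z.
Let Z := Zmap gam h T.

Lemma lamV_smx F : conf U F -> sm U (fun w => (lam F w)^-1).
Proof.
move=> [sF cF]; apply: smV => //; last exact: sm_dot (smx_dird _ Uo sF) (smx_dird _ Uo sF).
by move=> z Uz; rewrite gt_eqF//; have [] := cF z Uz.
Qed.

Lemma nproj_smx F : conf U F -> smx U (nproj F).
Proof.
move=> cF; have sF := cF.1; apply: smxB => //; first apply: smxB => //.
- exact: smx_cst.
- exact: smxM (smx_tr Uo sF) sF.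
apply: smxZ => //; first exact: lamV_smx.
by apply: smxD => //; apply: smxM (smx_tr Uo _) _ => //; exact: smx_dird.
Qed.

Lemma Zmap_smx : smx U Z.
Proof.
have sg := cg.1; have sh := ch.1.
apply: smxD => //; last by apply: smxM => //; exact: nproj_smx.
apply: smxD => //; first exact: smxM (smx_tr Uo sg) sh.
apply: smxZ => //; first exact: lamV_smx.
by apply: smxD => //; apply: smxM (smx_tr Uo _) _ => //; exact: smx_dird.
Qed.

Lemma mul_Zmap z w : U z -> w *m Z z = dt w (gam z) *: h z +
  (lam gam z)^-1 *: (dt w (Dr 1 gam z) *: Dr 1 h z + dt w (Dr ii gam z) *: Dr ii h z) + np gam z w *m T z.
Proof.
move=> Uz; rewrite /Z /Zmap !mulmxDr -scalemxAr mulmxDr !mul_tr_row mulmxA.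
by rewrite (mul_nproj w Uo cg Uz).
Qed.

Lemma np_tan z u : U z -> np gam z (Dr u gam z) = 0.
Proof.
move=> Uz; apply: (np_uniq Uo cg Uz); first by rewrite /normal_vector mul0mx.
exists 0, (complex.Re u), (complex.Im u).
by rewrite subr0 scale0r add0r (dird_mx_lin u Uo cg.1 Uz).
Qed.

Lemma Zmap_gam z : U z -> gam z *m Z z = h z.
Proof.
move=> Uz; rewrite mul_Zmap//; have [_ /(_ z Uz)[-> _ _ _]] := cg.
rewrite (dotC _ (Dr 1 gam z)) (conf_dot1 1 Uo cg Uz) (dotC _ (Dr ii gam z)) (conf_dot1 ii Uo cg Uz).
have -> : np gam z (gam z) = 0.
  apply: (np_uniq Uo cg Uz); first by rewrite /normal_vector mul0mx.
  by exists 1, 0, 0; rewrite subr0 scale1r !scale0r !addr0.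
by rewrite !scale0r addr0 scaler0 mul0mx !addr0 scale1r.
Qed.

Lemma Zmap_Dr1 z : U z -> Dr 1 gam z *m Z z = Dr 1 h z.
Proof.
move=> Uz; rewrite mul_Zmap//; have [_ /(_ z Uz)[_ l0 _ ->]] := cg.
rewrite (conf_dot1 1 Uo cg Uz) np_tan// -/(lam gam z).
by rewrite !scale0r mul0mx !addr0 add0r scalerA mulVf ?scale1r// gt_eqF.
Qed.

Lemma Zmap_Dri z : U z -> Dr ii gam z *m Z z = Dr ii h z.
Proof.
move=> Uz; rewrite mul_Zmap//; have [_ /(_ z Uz)[_ l0 -> e4]] := cg.
rewrite (conf_dot1 ii Uo cg Uz) np_tan// -/(lam gam z) (dotC (Dr ii gam z)) e4.
by rewrite !scale0r mul0mx !addr0 !add0r scalerA mulVf ?scale1r// gt_eqF.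
Qed.

Lemma Zmap_Dr u z : U z -> Dr u gam z *m Z z = Dr u h z.
Proof.
move=> Uz; rewrite (dird_mx_lin u Uo cg.1 Uz) (dird_mx_lin u Uo ch.1 Uz).
by rewrite mulmxDl -!scalemxAl Zmap_Dr1// Zmap_Dri.
Qed.

Lemma Zmap_normal z n : U z -> normal_vector gam z n -> n *m Z z = n *m T z.
Proof.
move=> Uz nn; have /normal_vectorP[a b c] := nn.
by rewrite mul_Zmap// a b c !scale0r !addr0 scaler0 !add0r (normal_part_id Uo cg Uz nn).
Qed.

Lemma split_frame z w : U z -> w = dt w (gam z) *: gam z +
  (lam gam z)^-1 *: (dt w (Dr 1 gam z) *: Dr 1 gam z + dt w (Dr ii gam z) *: Dr ii gam z) + np gam z w.
Proof. by move=> Uz; rewrite (normal_partE w Uo cg Uz) /tang addrC subrK. Qed.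

(** Both frames have the same Gram matrix and [T] preserves products of normal vectors, so [Z]
    preserves all products. *)
Lemma Zmap_orth z : U z -> Z z *m (Z z)^T = 1%:M.
Proof.
move=> Uz; have K (v w : 'rV[R]_N) : dt (v *m Z z) (w *m Z z) = dt v w.
  rewrite [in RHS](split_frame v Uz) !mul_Zmap// [in RHS](split_frame w Uz).
  have nv := normal_part_normal v Uo cg Uz; have nw := normal_part_normal w Uo cg Uz.
  have [nv' _] := isoT Uz nv nv; have [nw' eT] := isoT Uz nw nw; have [_ {}eT] := isoT Uz nv nw.
  have /normal_vectorP[a1 a2 a3] := nv; have /normal_vectorP[b1 b2 b3] := nw.
  have /normal_vectorP[a1' a2' a3'] := nv'; have /normal_vectorP[b1' b2' b3'] := nw'.
  have [_ /(_ z Uz)[c1 c2 c3 c4]] := cg; have [_ /(_ z Uz)[d1 d2 d3 d4]] := ch.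
  have e1 := conf_dot1 1 Uo cg Uz; have e2 := conf_dot1 ii Uo cg Uz.
  have f1 := conf_dot1 1 Uo ch Uz; have f2 := conf_dot1 ii Uo ch Uz.
  have m1 := met 1 1 Uz.
  move: a1 a2 a3 b1 b2 b3 a1' a2' a3' b1' b2' b3' c1 c2 c3 c4 d1 d2 d3 d4 e1 e2 f1 f2 m1 eT.
  move: (dt v _) (dt v _) (dt v _) (dt w _) (dt w _) (dt w _) (lam gam z)^-1.
  move: (np gam z v) (np gam z w) (np gam z v *m T z) (np gam z w *m T z) (gam z) (h z) (Dr 1 gam z) (Dr 1 h z) (Dr ii gam z) (Dr ii h z).
  move=> nv0 nw0 nv1 nw1 g0 h0 gx hx gy hy x1 x2 x3 y1 y2 y3 l.
  move=> a1 a2 a3 b1 b2 b3 a1' a2' a3' b1' b2' b3' c1 c2 c3 c4 d1 d2 d3 d4 e1 e2 f1 f2 m1 eT.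
  rewrite !(dotDl, dotDr, dotZl, dotZr).
  rewrite (dotC h0 hx) (dotC h0 hy) (dotC hy hx) (dotC h0 nw1) (dotC hx nw1) (dotC hy nw1).
  rewrite (dotC g0 gx) (dotC g0 gy) (dotC gy gx) (dotC g0 nw0) (dotC gx nw0) (dotC gy nw0).
  rewrite a1 a2 a3 b1 b2 b3 a1' a2' a3' b1' b2' b3' c1 c3 c4 d1 d3 d4 e1 e2 f1 f2 m1 eT; ring.
apply/row_matrixP => i; rewrite !rowE mulmx1; set w : 'rV[R]_N := delta_mx _ _.
apply/eqP; rewrite -subr_eq0; apply/eqP/dot_eq0; set d := _ - _.
by rewrite {2}/d dotDr dotNr mulmxA -dotMl K subrr.
Qed.

Lemma dt_mul (a b : 'rV[R]_N) (A B : 'M[R]_N) : dt (a *m A) (b *m B) = (a *m (A *m B^T) *m b^T) 0 0.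
Proof. by rewrite dtE trmx_mul !mulmxA. Qed.

(** Obtained by differentiating [Z *m Z^T = 1]. *)
Lemma Zmap_cross z v (w w' : 'rV[R]_N) : U z ->
  dt (w *m Dr v Z z) (w' *m Z z) = - dt (w *m Z z) (w' *m Dr v Z z).
Proof.
move=> Uz; have : Dr v (fun w => Z w *m (Z w)^T) z = 0.
  rewrite -[RHS](dird_mx_cst (1%:M : 'M[R]_N) v z); apply: (dird_mx_ext _ Uo) => // x Ux.
  exact: Zmap_orth.
have sZ := Zmap_smx.
rewrite (dird_mxM v Uo sZ (smx_tr Uo sZ) Uz) (dird_mx_tr v Uo sZ Uz) => /eqP.
rewrite addr_eq0 => /eqP e0.
by rewrite !dt_mul e0 mulmxN mulNmx mxE.
Qed.

Lemma met_christoffel z u v w : U z ->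
  dt (Dr u (Dr v h) z) (Dr w h z) = dt (Dr u (Dr v gam) z) (Dr w gam z).
Proof.
move=> Uz; rewrite (christoffel u v w Uo ch.1 Uz) (christoffel u v w Uo cg.1 Uz).
have K a b c : Dr a (fun p => dt (Dr b h p) (Dr c h p)) z = Dr a (fun p => dt (Dr b gam p) (Dr c gam p)) z.
  by apply: (dird_ext _ Uo) => // p Up; exact: met.
by rewrite !K.
Qed.

(** Equal metrics have equal Christoffel symbols. *)
Lemma met_tang z u v : U z -> tang h z (Dr u (Dr v h) z) = tang gam z (Dr u (Dr v gam) z) *m Z z.
Proof.
move=> Uz; rewrite /tang !met_christoffel// (conf_dot2 u v Uo ch Uz) (conf_dot2 u v Uo cg Uz) met//.
rewrite /lam met// mulmxDl -!scalemxAl mulmxDl -!scalemxAl.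
by rewrite Zmap_gam// !Zmap_Dr.
Qed.

Lemma Zmap_gamD z v : U z -> gam z *m Dr v Z z = 0.
Proof.
move=> Uz; have : Dr v (fun w => gam w *m Z w) z = Dr v h z.
  by apply: (dird_mx_ext _ Uo) => // x Ux; exact: Zmap_gam.
rewrite (dird_mxM v Uo cg.1 Zmap_smx Uz) Zmap_Dr// => /eqP.
by rewrite addrC -subr_eq0 addrK => /eqP.
Qed.

Lemma alT' z u v : U z -> al h u v z = al gam (e * u) v z *m Z z.
Proof. by move=> Uz; rewrite alT// Zmap_normal//; exact: normal_alpha Uo cg Uz. Qed.

(** Differentiate [Dr u gam *m Z = Dr u h]. Tangential parts cancel by [met_tang]; the normal parts
    are the two second fundamental forms, with factors [e] and 1. *)
Lemma Zmap_DrD z u v : U z -> Dr u gam z *m Dr v Z z = al gam ((e - 1) * v) u z *m Z z.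
Proof.
move=> Uz; have : Dr v (fun w => Dr u gam w *m Z w) z = Dr v (Dr u h) z.
  by apply: (dird_mx_ext _ Uo) => // x Ux; exact: Zmap_Dr.
rewrite (dird_mxM v Uo (smx_dird u Uo cg.1) Zmap_smx Uz).
rewrite [RHS](normal_part_tang _ Uo ch Uz) met_tang// -alphaE alT'//.
rewrite {1}(normal_part_tang (Dr v (Dr u gam) z) Uo cg Uz) -alphaE mulmxDl.
have -> : al gam (e * v) u z = al gam ((e - 1) * v) u z + al gam v u z.
  by rewrite -(alphaDl _ _ _ Uo cg Uz) -{3}[v]mul1r -mulrDl subrK.
rewrite (mulmxDl (al gam _ _ _)); move: (al gam v u z *m Z z) (tang _ _ _ *m Z z) => A B.
by move=> e0; apply: (addrI (A + B)); rewrite e0 -addrA addrC.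
Qed.

(** The components of [n *m Dr v Z] along the frame of [h] are forced by skewness from the values
    already known ([P1]), the normal component by parallelism of [T]. *)
Lemma Zmap_nD z v n : U z -> normal_vector gam z n ->
  n *m Dr v Z z = n *m sff gam ((e - 1) * v) z *m Z z.
Proof.
move=> Uz nn; set S := sff gam _ z; set x := n *m Dr v Z z; set y := n *m S *m Z z.
have oZ := Zmap_orth Uz.
have skewS (a b : 'rV[R]_N) : dt (a *m S) b = - dt a (b *m S).
  by rewrite dotMl /S sff_skew mulmxN dotNr.
have P1 w : w *m Dr v Z z = w *m S *m Z z -> dt (x - y) (w *m Z z) = 0.
  move=> e1; rewrite dotDl dotNl /x Zmap_cross// e1 /y !dt_isom// skewS opprK.
  by rewrite addrC subrr.
have S1 := sff_u _ ((e - 1) * v) Uo cg Uz.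
have Q0 : dt (x - y) (h z) = 0.
  by rewrite -Zmap_gam//; apply: P1; rewrite Zmap_gamD// /S (sff_F _ Uo cg Uz) mul0mx.
have Q1 u : dt (x - y) (Dr u h z) = 0.
  by rewrite -Zmap_Dr//; apply: P1; rewrite Zmap_DrD// /S S1.
have N1 : normal_vector h z (x - y) by apply/normal_vectorP.
suff : np h z (x - y) = 0 by rewrite (normal_part_id Uo ch Uz N1) => /eqP; rewrite subr_eq0 => /eqP.
have npZ (w : 'rV[R]_N) : np h z (w *m Z z) = np gam z w *m Z z.
  apply: (np_uniq Uo ch Uz).
    have nw := normal_part_normal w Uo cg Uz; rewrite (Zmap_normal Uz nw).
    by have [] := isoT Uz nw nw.
  have [a [b [c e']]] := np_tangE w Uo cg Uz; exists a, b, c.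
  by rewrite -mulmxBl e' !mulmxDl -!scalemxAl !Zmap_Dr// Zmap_gam.
rewrite normal_partB /y npZ (normal_sff _ Uo cg Uz nn) mul0mx subr0.
(* A smooth normal field through [n], the projection of a constant vector; parallelism of [T] is
   stated for fields. *)
pose xi w := n *m nproj gam w.
have sxi : smx U xi by apply: smxM => //; [exact: smx_cst|exact: nproj_smx].
have nxi w : U w -> normal_vector gam w (xi w).
  by move=> Uw; rewrite /xi (mul_nproj n Uo cg Uw); exact: normal_part_normal Uo cg Uw.
have xiz : xi z = n by rewrite /xi (mul_nproj n Uo cg Uz) (normal_part_id Uo cg Uz nn).
have e2 : Dr v (fun w => xi w *m T w) z = Dr v xi z *m Z z + x.
  rewrite -(dird_mx_ext (F := fun w => xi w *m Z w) v Uo)// => [|w Uw].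
    by rewrite (dird_mxM v Uo sxi Zmap_smx Uz) xiz.
  by rewrite (Zmap_normal Uw (nxi w Uw)).
have := parT v sxi nxi Uz; rewrite e2 normal_partD npZ -(Zmap_normal Uz (normal_part_normal _ Uo cg Uz)).
by move=> /eqP; rewrite addrC -subr_eq0 addrK => /eqP.
Qed.

Lemma Zmap_rot : rot U gam (e - 1) Z.
Proof.
split; [exact: Zmap_smx|exact: Zmap_orth|move=> z v Uz].
apply/row_matrixP => i; rewrite !rowE mulmxA; move: (delta_mx 0 i) => w.
rewrite (split_frame w Uz); set n := np gam z w.
rewrite !mulmxDl -!scalemxAl !mulmxDl -!scalemxAl Zmap_gamD// !Zmap_DrD//.
rewrite (Zmap_nD v Uz (normal_part_normal w Uo cg Uz)) (sff_F _ Uo cg Uz) mul0mx.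
by rewrite !(sff_u _ _ Uo cg Uz).
Qed.

End ZmapRot.
End Rotations.

(** * Newton interpolation *)

Section NewtonQuotients.
Context {R : realType}.
Implicit Types (p q : {poly R}) (f : R -> R) (t : nat -> R).

(** It bounds the values on [-20, 20]. For a node [c] with |c| <= 4 the quotient [q] by X - c
    satisfies 20 |q| <= |p| + |p(c)| + 4 |q| with |p(c)| <= |p|, hence 16 |q| <= 2 |p|: the radius
    20 is what makes a divided difference gain a factor 8. *)
Definition pnorm p : R := \sum_(i < size p) `|p`_i| * 20 ^+ i.

Lemma pnorm_wide n p : (size p <= n)%N -> pnorm p = \sum_(i < n) `|p`_i| * 20 ^+ i.
Proof.
move=> h; rewrite /pnorm (big_ord_widen n (fun i => `|p`_i| * 20 ^+ i))// big_mkcond.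
apply: eq_bigr => i _; case: ltnP => // hi; by rewrite nth_default// normr0 mul0r.
Qed.

Lemma pnorm_ge0 p : 0 <= pnorm p.
Proof. by rewrite sumr_ge0// => i _; rewrite mulr_ge0// exprn_ge0. Qed.

Lemma pnormD p q : pnorm (p + q) <= pnorm p + pnorm q.
Proof.
pose n := maxn (size p) (size q).
rewrite (@pnorm_wide n p) ?leq_maxl// (@pnorm_wide n q) ?leq_maxr//.
rewrite (@pnorm_wide n (p + q)) ?size_polyD// -big_split/=.
by apply: ler_sum => i _; rewrite coefD -mulrDl ler_wpM2r ?exprn_ge0// ler_normD.
Qed.

Lemma pnormZ c p : pnorm (c *: p) = `|c| * pnorm p.
Proof.
rewrite (@pnorm_wide (size p)) ?size_scale_leq// mulr_sumr.
by apply: eq_bigr => i _; rewrite coefZ normrM mulrA.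
Qed.

Lemma pnormC c : pnorm c%:P = `|c|.
Proof.
by rewrite (@pnorm_wide 1) ?size_polyC_leq1// big_ord1 coefC eqxx expr0 mulr1.
Qed.

Lemma pnormXM p : pnorm (p * 'X) = 20 * pnorm p.
Proof.
rewrite (@pnorm_wide (size p).+1) ?size_polyMX_leq//; last first.
  by apply: leq_trans (size_polyMleq _ _) _; rewrite size_polyX addn2.
rewrite big_ord_recl coefMX/= normr0 mul0r add0r mulr_sumr; apply: eq_bigr => i _.
by rewrite coefMX/= exprS mulrCA.
Qed.

Lemma horner_pnorm p x : `|x| <= 20 -> `|p.[x]| <= pnorm p.
Proof.
move=> hx; rewrite horner_coef; apply: le_trans (ler_norm_sum _ _ _) _.
by apply: ler_sum => i _; rewrite normrM normrX ler_wpM2l// lerXn2r// nnegrE.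
Qed.

(* If [p - p(c) = q (X - c)] then [R |q| <= |p| + |p(c)| + |c| |q|] for the weighted norm. *)
Lemma pnorm_quotient p c : `|c| <= 4 -> exists q,
  p - p.[c]%:P = q * ('X - c%:P) /\ pnorm q <= pnorm p / 8.
Proof.
move=> hc; have : root (p - p.[c]%:P) c by rewrite /root !hornerE subrr.
move=> /factor_theorem[q e]; exists q; split=> //.
have e2 : q * 'X = p - p.[c]%:P + c *: q by rewrite e mulrBr -mul_polyC [_%:P * q]mulrC subrK.
have := pnormXM q; rewrite e2 => H.
have := pnormD (p - p.[c]%:P) (c *: q); rewrite H pnormZ.
have := pnormD p (- p.[c]%:P); rewrite -polyCN pnormC normrN.
have := horner_pnorm p (_ : `|c| <= 20); rewrite (le_trans hc) ?ler_nat// => /(_ isT).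
have := pnorm_ge0 q; have := pnorm_ge0 p; move: (pnorm p) (pnorm q) (pnorm _) => a b d *.
rewrite ler_pdivlMr//; nra.
Qed.

(* Newton quotient of [f] with nodes [t i, ..., t (i + m - 1)]. *)
Fixpoint nq t f (i m : nat) (x : R) : R :=
  if m is m'.+1 then (nq t f i m' x - nq t f i m' (t (i + m')%N)) / (x - t (i + m')%N) else f x.

(** A limit, on [-4, 4], of polynomials of bounded norm. This form passes at once to divided
    differences, polynomial by polynomial. *)
Definition entire_bound f (N : R) := exists p : nat -> {poly R},
  (forall k, pnorm (p k) <= N) /\ forall x, `|x| <= 4 -> (fun k => (p k).[x]) @ \oo --> f x.

(** The approximating polynomials are replaced by their quotients by X - c at the new node [c],
    which divides the bound by 8. *)
Lemma nq_approx t f N i m : injective t -> (forall k, `|t k| <= 4) -> entire_bound f N ->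
  exists p : nat -> {poly R}, (forall k, pnorm (p k) <= N / 8 ^+ m) /\
    forall x, `|x| <= 4 -> (forall j, (j < m)%N -> x != t (i + j)%N) ->
      (fun k => (p k).[x]) @ \oo --> nq t f i m x.
Proof.
move=> tI t4 [p0 [hp0 hp0']]; elim: m => [|m [p [hp hp']]].
  by exists p0; split=> [k|x hx _]; [rewrite expr0 divr1|exact: hp0'].
set c := t (i + m)%N.
have /choice[q hq] : forall k, exists q, p k - (p k).[c]%:P = q * ('X - c%:P) /\ pnorm q <= pnorm (p k) / 8.
  by move=> k; apply: pnorm_quotient; exact: t4.
exists q; split=> [k|x hx hxt].
  have [_ h] := hq k; apply: le_trans h _; rewrite exprSr invfM mulrA ler_wpM2r// invr_ge0//.
have xc : x != c by exact: hxt.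
have qE k : (q k).[x] = ((p k).[x] - (p k).[c]) / (x - c).
  have [/(congr1 (fun r => r.[x])) + _] := hq k; rewrite !hornerE => ->.
  by rewrite mulfK// subr_eq0.
rewrite /= -/c; under eq_fun do rewrite qE.
apply: cvgMl; apply: cvgB; first by apply: hp' => // j jm; apply: hxt; exact: ltnW.
apply: hp'; first exact: t4.
by move=> j jm; rewrite /c; apply/eqP => /tI/addnI e; move: jm; rewrite e ltnn.
Qed.

Lemma nq_bound t f N i m x : injective t -> (forall k, `|t k| <= 4) -> entire_bound f N ->
  `|x| <= 4 -> (forall j, (j < m)%N -> x != t (i + j)%N) -> `|nq t f i m x| <= N / 8 ^+ m.
Proof.
move=> tI t4 fN hx hxt; have [p [hp hp']] := nq_approx i m tI t4 fN.
have hl := hp' x hx hxt.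
have hn : (fun k => `|(p k).[x]|) @ \oo --> `|nq t f i m x| by exact: cvg_norm.
have cv : cvgn (fun k => `|(p k).[x]|) by apply/cvg_ex; eexists; exact: hn.
rewrite -(cvg_lim _ hn)//; apply: limr_le => //; apply: nearW => k.
by apply: le_trans (hp k); apply: horner_pnorm; apply: le_trans hx _; rewrite ler_nat.
Qed.

Lemma entire_boundD f g N N' : entire_bound f N -> entire_bound g N' ->
  entire_bound (fun x => f x + g x) (N + N').
Proof.
move=> [p [hp hp']] [q [hq hq']]; exists (fun k => p k + q k); split.
  by move=> k; apply: le_trans (pnormD _ _) _; exact: lerD.
by move=> x hx; under eq_fun do rewrite hornerD; apply: cvgD; [exact: hp'|exact: hq'].
Qed.

Lemma entire_bound_cst (c : R) : entire_bound (fun=> c) `|c|.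
Proof.
exists (fun=> c%:P); split; first by move=> k; rewrite pnormC.
by move=> x _; under eq_fun do rewrite hornerC; exact: cvg_cst.
Qed.

(** The norms of the truncations are at most the partial sums of the exponential series at 20. *)
Lemma entire_bound_series (c : nat -> R) f :
  (forall k, `|c k| <= k`!%:R^-1) ->
  (forall x, series (fun k => c k * x ^+ k) @ \oo --> f x) -> entire_bound f (expR 20).
Proof.
move=> hc hf; exists (fun n => \poly_(k < n) c k); split.
  move=> n; rewrite (@pnorm_wide n) ?size_poly//.
  apply: (@le_trans _ _ (series (exp_coeff (20 : R)) n)).
    rewrite /series/= big_mkord; apply: ler_sum => k _; rewrite coef_poly ltn_ord mulrC.
    by rewrite ler_wpM2l ?exprn_ge0.
  rewrite /expR; apply: nondecreasing_cvgn_le; last exact: is_cvg_series_exp_coeff.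
  by apply: nondecreasing_series => k _ _; rewrite /exp_coeff/= divr_ge0// exprn_ge0.
move=> x _; under eq_fun do rewrite horner_poly.
by have := hf x; rewrite /series/=; under eq_fun do rewrite big_mkord.
Qed.

Lemma entire_bound_cos : exists N, entire_bound (@cos R) N.
Proof.
exists (expR 20); apply: (@entire_bound_series (fun n => (~~ odd n)%:R * (-1) ^ n./2 / n`!%:R)).
  move=> k; rewrite !normrM normfV normr_nat [in X in _ * X]normr_nat -exprnP normrX normrN1 expr1n mulr1.
  by rewrite ler_piMl ?invr_ge0//; case: odd.
move=> x; have := @is_cvg_series_cos_coeff R x; rewrite cos.unlock /cos_coeff/=.
have -> : (fun n => (~~ odd n)%:R * (-1) ^ n./2 * x ^+ n / n`!%:R) = (fun k => (~~ odd k)%:R * (-1) ^ k./2 / k`!%:R * x ^+ k).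
  by apply/funext => n; rewrite mulrAC.
by [].
Qed.

Lemma entire_bound_sin : exists N, entire_bound (@sin R) N.
Proof.
exists (expR 20); apply: (@entire_bound_series (fun n => (odd n)%:R * (-1) ^+ n.-1./2 / n`!%:R)).
  move=> k; rewrite !normrM normfV normr_nat [in X in _ * X]normr_nat normrX normrN1 expr1n mulr1.
  by rewrite ler_piMl ?invr_ge0//; case: odd.
move=> x; have := @is_cvg_series_sin_coeff R x; rewrite sin.unlock /sin_coeff/=.
have -> : (fun n => (odd n)%:R * (-1) ^+ n.-1./2 * x ^+ n / n`!%:R) = (fun k => (odd k)%:R * (-1) ^+ k.-1./2 / k`!%:R * x ^+ k).
  by apply/funext => n; rewrite mulrAC.
by [].
Qed.

(** The slower geometric sequence dominates the convolution; 5/3 is (1/8) / (1/5 - 1/8), the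
    constant reproduced by the recursion S(n+1) = (S(n) + 5^-n) / 8. *)
Lemma geom_conv n : \sum_(i < n) 8 ^- (n - i)%N * 5 ^- i <= (5 / 3) * 5 ^- n :> R.
Proof.
elim: n => [|n IH]; first by rewrite big_ord0 expr0 invr1; lra.
rewrite big_ord_recr/= subSnn expr1.
have -> : \sum_(i < n) 8 ^- (n.+1 - i)%N * 5 ^- i = 8^-1 * \sum_(i < n) 8 ^- (n - i)%N * 5 ^- i :> R.
  rewrite mulr_sumr; apply: eq_bigr => i _.
  by rewrite subSn ?exprS ?invfM ?mulrA// ltnW.
rewrite exprSr invfM; have : 0 < (5 ^- n : R) by rewrite invr_gt0 exprn_gt0.
move: IH; move: (\sum_(_ < _) _) (5 ^- n) => a b; lra.
Qed.

End NewtonQuotients.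

Section EntryNorm.
Context {R : realType}.

(** Chosen because it is submultiplicative without constants ([nrmM]) and bounds every entry. *)
Definition nrm {p q} (A : 'M[R]_(p, q)) : R := \sum_i \sum_j `|A i j|.

Lemma nrm_ge0 {p q} (A : 'M[R]_(p, q)) : 0 <= nrm A.
Proof. by rewrite sumr_ge0// => i _; rewrite sumr_ge0. Qed.
Lemma nrm0 {p q} : nrm (0 : 'M[R]_(p, q)) = 0.
Proof. by rewrite /nrm big1// => i _; rewrite big1// => j _; rewrite mxE normr0. Qed.
Lemma nrmD {p q} (A B : 'M[R]_(p, q)) : nrm (A + B) <= nrm A + nrm B.
Proof.
rewrite /nrm -big_split/=; apply: ler_sum => i _; rewrite -big_split/=.
by apply: ler_sum => j _; rewrite mxE ler_normD.
Qed.
Lemma nrmZ {p q} a (A : 'M[R]_(p, q)) : nrm (a *: A) = `|a| * nrm A.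
Proof.
rewrite /nrm mulr_sumr; apply: eq_bigr => i _; rewrite mulr_sumr.
by apply: eq_bigr => j _; rewrite mxE normrM.
Qed.
Lemma nrmN {p q} (A : 'M[R]_(p, q)) : nrm (- A) = nrm A.
Proof. by rewrite -scaleN1r nrmZ normrN1 mul1r. Qed.
Lemma nrm_sum {p q} (I : Type) (r : seq I) (P : pred I) (F : I -> 'M[R]_(p, q)) :
  nrm (\sum_(i <- r | P i) F i) <= \sum_(i <- r | P i) nrm (F i).
Proof.
elim/big_rec2: _ => [|i a A _ h]; first by rewrite nrm0.
by apply: le_trans (nrmD _ _) _; rewrite lerD2l.
Qed.
Lemma nrmM {p q r} (A : 'M[R]_(p, q)) (B : 'M[R]_(q, r)) : nrm (A *m B) <= nrm A * nrm B.
Proof.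
rewrite {1 2}/nrm mulr_suml; apply: ler_sum => i _.
apply: (@le_trans _ _ (\sum_j \sum_k `|A i k| * `|B k j|)).
  by apply: ler_sum => j _; rewrite mxE; apply: le_trans (ler_norm_sum _ _ _) _;
    apply: ler_sum => k _; rewrite normrM.
rewrite exchange_big/= mulr_suml; apply: ler_sum => k _; rewrite -mulr_sumr ler_wpM2l//.
rewrite /nrm (bigD1 k)//= lerDl sumr_ge0// => k' _; exact: sumr_ge0.
Qed.
Lemma nrm_entry {p q} (A : 'M[R]_(p, q)) i j : `|A i j| <= nrm A.
Proof.
rewrite /nrm (bigD1 i)//= (bigD1 j)//= -addrA lerDl addr_ge0 ?sumr_ge0// => k _.
exact: sumr_ge0.
Qed.
Lemma nrm_entB {p q} (A B : 'M[R]_(p, q)) i j : `|A i j - B i j| <= nrm (A - B).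
Proof. by have := nrm_entry (A - B) i j; rewrite !mxE. Qed.
Lemma nrm_le {p q} (A : 'M[R]_(p, q)) c : (forall i j, `|A i j| <= c) -> nrm A <= (p * q)%:R * c.
Proof.
move=> h; apply: (@le_trans _ _ (\sum_(i < p) \sum_(j < q) c)).
  by apply: ler_sum => i _; apply: ler_sum => j _.
by rewrite !sumr_const !card_ord -mulrnA mulr_natl mulnC.
Qed.

End EntryNorm.

Section Clopen.

(** The last hypothesis makes membership in [P] locally constant, so [P] is open and closed. *)
Lemma connected_spread (T : topologicalType) (P : set T) (q0 : T) :
  connected [set: T] -> P q0 ->
  (forall p, exists V, [/\ open V, V p & forall q q', V q -> V q' -> P q -> P q']) ->
  forall p, P p.
Proof.
move=> cT Pq h; suff -> : P = [set: T] by [].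
apply: cT; first by exists q0.
  exists P; last by rewrite setTI.
  rewrite openE => p Pp; have [V [Vo Vp hV]] := h p.
  by apply: filterS (open_nbhs_nbhs (conj Vo Vp)) => q Vq; exact: hV Pp.
exists P; last by rewrite setTI.
move=> p clp; have [V [Vo Vp hV]] := h p.
by have [q [Pq' Vq]] := clp V (open_nbhs_nbhs (conj Vo Vp)); exact: hV Pq'.
Qed.

End Clopen.

Section Box.
Context {R : realType}.
Local Notation E := (Cplx R).
Definition box (z0 : E) (r : R) : set E := [set z | `|complex.Re (z - z0)| < r /\ `|complex.Im (z - z0)| < r].

Lemma boxP z0 r z : box z0 r z <-> exists a b, [/\ z = z0 + mkC a b, `|a| < r & `|b| < r].
Proof.
split=> [[h1 h2]|[a [b [-> ha hb]]]].
  by exists (complex.Re (z - z0)), (complex.Im (z - z0)); rewrite -mkCE addrC subrK.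
by rewrite /box/= addrAC subrr add0r.
Qed.

Lemma box_nbhs z0 r : 0 < r -> nbhs z0 (box z0 r).
Proof. by move=> r0; apply/nbhsCP; exists r => // a b ha hb; apply/boxP; exists a, b. Qed.

Lemma box_line z0 r z s : box z0 r z -> `|s| <= 1 -> box z0 r (line z0 (z - z0) s).
Proof.
move=> [h1 h2] s1; rewrite lineE; apply/boxP.
exists (s * complex.Re (z - z0)), (s * complex.Im (z - z0)); split=> //.
  by apply: le_lt_trans h1; rewrite normrM ler_piMl.
by apply: le_lt_trans h2; rewrite normrM ler_piMl.
Qed.

(** [L] bounds the derivative in the direction [z - z0], so it already contains the distance; the
    number of entries comes from applying the mean value theorem to each entry separately. *)
Lemma box_mvt {p q} (F : E -> 'M[R]_(p, q)) z0 r z L : smx (box z0 r) F -> box z0 r z ->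
  (forall w, box z0 r w -> nrm (Dr (z - z0) F w) <= L) ->
  nrm (F z - F z0) <= (p * q)%:R * L.
Proof.
move=> sF bz hL; apply: nrm_le => i j; rewrite !mxE.
have b0 s : `|s| <= `|1 : R| -> box z0 r (line z0 (z - z0) s) by rewrite normr1; exact: box_line.
have [s s1 e] := @mvt_line R (ent F i j) z0 (z - z0) 1 (fun s hs => @sm_drv _ _ _ (z - z0) _ (sF i j) (b0 s hs)).
have l1 : line z0 (z - z0) 1 = z by rewrite /line mul1r addrC subrK.
rewrite l1 mul1r in e; rewrite -[F z i j]/(ent F i j z) -[F z0 i j]/(ent F i j z0) e.
rewrite -(dird_mxE (z - z0) i j sF (b0 s s1)).
by apply: le_trans (nrm_entry _ _ _) (hL _ _); exact: b0.
Qed.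

Lemma sub_box z0 r r' : r' <= r -> box z0 r' `<=` box z0 r.
Proof. by move=> rr z [a b]; split; apply: lt_le_trans rr. Qed.

End Box.

Section UniformLimits.
Context {R : realType}.
Local Notation E := (Cplx R).

Lemma isd_le (f : E -> R) z u l : (forall e, 0 < e -> exists2 d : R, 0 < d & forall h, `|h| < d ->
  `|f (line z u h) - f z - h * l| <= e * `|h|) -> isd u f z l.
Proof.
move=> H; have H2 : h^-1 *: ((f \o line z u \o shift 0) (h *: (1:R)) - (f \o line z u) 0) @[h --> 0^'] --> l.
  apply/cvgrPdist_le => e e0; have [d d0 hd] := H e e0.
  near=> h; have h0 : h != 0 by near: h; exact: nbhs_dnbhs_neq.
  have hh : `|h| < d.
    near: h; apply: nbhs_dnbhs; apply/nbhs_ballP; exists d => // x.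
    by rewrite -ball_normE/= sub0r normrN.
  rewrite /= addr0 /GRing.scale/= mulr1 line0.
  have -> : l - h^-1 * (f (line z u h) - f z) = - (h^-1 * (f (line z u h) - f z - h * l)) by field.
  by rewrite normrN normrM normfV ler_pdivrMl ?normr_gt0// [`|h| * e]mulrC; exact: hd.
by split; [apply/cvg_ex; exists l; exact: H2|exact/cvg_lim].
Unshelve. all: by end_near. Qed.

(** Differentiation of a limit along a single line, from uniform convergence of functions and
    derivatives at the common rate [eps]. *)
Lemma unif_isd (fk : nat -> E -> R) (f g : E -> R) z u (eps : nat -> R) (d : R) : 0 < d ->
  (forall k s, `|s| < d -> drv u (fk k) (line z u s)) ->
  (forall k s, `|s| < d -> `|f (line z u s) - fk k (line z u s)| <= eps k) ->
  (forall k s, `|s| < d -> `|Dr u (fk k) (line z u s) - g (line z u s)| <= eps k) ->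
  (forall e, 0 < e -> exists k, eps k <= e) -> {for z, continuous g} -> isd u f z (g z).
Proof.
move=> d0 dk h1 h2 h3 gc; apply: isd_le => e e0.
have /(near_line u)/nbhs_ballP[d' /= d'0 hd'] : \forall w \near z, `|g w - g z| < e.
  by move/contCP : gc => /(_ e e0)[r r0 hr]; apply/nbhsCP; exists r.
exists (Num.min d d'); first by rewrite lt_min d0.
move=> h; rewrite lt_min => /andP[hd hd2].
apply/ler_addgt0Pr => e' e'0.
(* The error adds up to e |h| + (2 + |h|) eps(k); the slack [e'] absorbs the second term. *)
have [k hk] := h3 (e' / (2 + `|h|)) (divr_gt0 e'0 (ltr_pwDl (ltr0Sn R 1) (normr_ge0 h))).
have [s sh es] := @mvt_line R (fk k) z u h (fun s hs => dk k s (le_lt_trans hs hd)).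
have gs : `|g (line z u s) - g z| <= e.
  by apply/ltW/hd'; rewrite -ball_normE/= sub0r normrN; exact: le_lt_trans hd2.
have a1 := h1 k h hd; have a2 := h1 k 0 (_ : `|0| < d); rewrite normr0 line0 in a2; have {}a2 := a2 d0.
have a3 := h2 k s (le_lt_trans sh hd).
have -> : f (line z u h) - f z - h * g z = (f (line z u h) - fk k (line z u h)) - (f z - fk k z) +
  h * ((Dr u (fk k) (line z u s) - g (line z u s)) + (g (line z u s) - g z)).
  have : fk k (line z u h) = fk k z + h * Dr u (fk k) (line z u s) by rewrite -es; ring.
  by move=> ->; ring.
apply: le_trans (ler_normD _ _) _; rewrite normrM.
have b1 : `|f (line z u h) - fk k (line z u h) - (f z - fk k z)| <= 2 * eps k.
  by apply: le_trans (ler_normB _ _) _; rewrite mulr2n mulrDl mul1r; exact: lerD.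
have b2 : `|h| * `|Dr u (fk k) (line z u s) - g (line z u s) + (g (line z u s) - g z)| <= `|h| * (eps k + e).
  by rewrite ler_wpM2l//; apply: le_trans (ler_normD _ _) (lerD a3 gs).
apply: le_trans (lerD b1 b2) _.
have h20 : 0 < 2 + `|h| by apply: ltr_pwDl.
by rewrite ler_pdivlMr// in hk; move: hk; move: (eps k) `|h| => x y; lra.
Qed.

Lemma unif_cont (fk : nat -> E -> R) (f : E -> R) z (eps : nat -> R) (r : R) : 0 < r ->
  (forall k, {for z, continuous (fk k)}) ->
  (forall k w, box z r w -> `|f w - fk k w| <= eps k) ->
  (forall e, 0 < e -> exists k, eps k <= e) -> {for z, continuous f}.
Proof.
move=> r0 kc h1 h3; apply/contCP => e e0.
have [k hk] := h3 (e / 4) (divr_gt0 e0 (ltr0Sn R 3)).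
have /contCP/(_ _ (divr_gt0 e0 (ltr0Sn R 3)))[d d0 hd] := kc k.
exists (Num.min r d) => [|a b]; first by rewrite lt_min r0.
rewrite !lt_min => /andP[a1 a2] /andP[b1 b2].
have c1 := h1 k (z + mkC a b) (_ : box _ _ _); have {}c1 := c1 (proj2 (boxP _ _ _) (ex_intro _ a (ex_intro _ b (And3 erefl a1 b1)))).
have c2 := h1 k z (_ : box _ _ _); have {}c2 : `|f z - fk k z| <= eps k.
  by apply: c2; apply/boxP; exists 0, 0; rewrite mkC0 addr0 normr0.
have c3 := hd a b a2 b2.
have -> : f (z + mkC a b) - f z = (f (z + mkC a b) - fk k (z + mkC a b)) - (f z - fk k z) + (fk k (z + mkC a b) - fk k z) by ring.
apply: le_lt_trans (ler_normD _ _) _.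
have c4 := le_trans (ler_normB _ _) (lerD c1 c2).
move: hk c3 c4; move: `|_ - _ - _| `|_ - fk k z| => x y; lra.
Qed.

Lemma cvg_fsum (I : Type) (r : seq I) (F : I -> nat -> R) (a : I -> R) :
  (forall l, F l @ \oo --> a l) -> (fun k => \sum_(l <- r) F l k) @ \oo --> \sum_(l <- r) a l.
Proof.
move=> h; elim: r => [|l r IH].
  by rewrite big_nil; under eq_fun do rewrite big_nil; exact: cvg_cst.
by rewrite big_cons; under eq_fun do rewrite big_cons; exact: cvgD.
Qed.

Lemma geom_small (c : R) : forall e, 0 < e -> exists k, c * (4 / 5) ^+ k <= e.
Proof.
move=> e e0; have : (geometric c (4 / 5 : R)) @ \oo --> (0 : R).
  by apply: cvg_geometric; rewrite ger0_norm//; lra.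
move=> /cvgrPdist_le/(_ e e0)[k _ /(_ k (leqnn k))] /=; rewrite sub0r normrN => h.
by exists k; apply: le_trans (ler_norm _) h.
Qed.

End UniformLimits.

(** * Newton series of the solutions of a linear system depending on an angle *)

Section NewtonSeries.
Context {R : realType} {N : nat} {M : topologicalType}.
Local Notation E := (Cplx R).
Variables (X : riemann_surface R M) (B : chart R M -> E -> E -> 'M[R]_N) (q0 : M).
Hypothesis HBs : forall c u, atlas X c -> smx (cimg c) (B c u).
Hypothesis HBl : forall c u z, atlas X c -> cimg c z ->
  B c u z = complex.Re u *: B c 1 z + complex.Im u *: B c ii z.
Variable t : nat -> R.
Hypotheses (tI : injective t) (t4 : forall k, 0 <= t k <= 4).
Variable Zf : nat -> M -> 'M[R]_N.
Hypothesis Zs : forall k c, atlas X c -> smx (cimg c) (Zf k \o cinv c).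
Hypothesis Z1 : forall k p i j, `|Zf k p i j| <= 1.
Hypothesis Z0 : forall k, Zf k q0 = 1%:M.

(** [fcos] and [sin] are the real and imaginary parts of exp(i x) - 1, so [Bth] is the coefficient
    of the equation at angle [x], and [Bq] are its Newton quotients in the angle. *)
Definition fcos (x : R) : R := cos x - 1.
Definition Bq c (u z : E) i m x : 'M[R]_N :=
  nq t fcos i m x *: B c u z + nq t sin i m x *: B c (ii * u) z.
Definition Bth c u z x : 'M[R]_N := fcos x *: B c u z + sin x *: B c (ii * u) z.

Hypothesis Zd : forall k c u z, atlas X c -> cimg c z ->
  Dr u (Zf k \o cinv c) z = Bth c u z (t k) *m Zf k (cinv c z).

(** Divided differences in the angle of solutions known only at the nodes: [fq n k] has nodes t 0,
    ..., t (n - 1) and t k. It is used for n <= k, where the denominators do not vanish; [D n] is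
    the n-th Newton coefficient. *)
Fixpoint fq n k (p : M) : 'M[R]_N :=
  if n is n'.+1 then (t k - t n')^-1 *: (fq n' k p - fq n' n' p) else Zf k p.
Definition D n p := fq n n p.

Lemma imgo c : atlas X c -> open (cimg c).
Proof. by case/chart_homeo => -[]. Qed.

Lemma fq_smx n k c : atlas X c -> smx (cimg c) (fq n k \o cinv c).
Proof.
move=> Xc; have Uo := imgo Xc; elim: n k => [|n IH] k; first exact: Zs.
exact: (smxZ Uo (sm_cst _ _) (smxB Uo (IH k) (IH n))).
Qed.

Lemma fq_bounded n k : exists C, forall p, nrm (fq n k p) <= C.
Proof.
elim: n k => [|n IH] k.
  by exists ((N * N)%:R * 1) => p; apply: nrm_le => i j; exact: Z1.
have [C1 h1] := IH k; have [C2 h2] := IH n.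
exists (`|(t k - t n)^-1| * (C1 + C2)) => p; rewrite /= nrmZ ler_wpM2l//.
by apply: le_trans (nrmD _ _) _; rewrite nrmN lerD.
Qed.

Lemma BqS c u z i m x : x != t (i + m)%N ->
  Bq c u z i m.+1 x = (x - t (i + m)%N)^-1 *: (Bq c u z i m x - Bq c u z i m (t (i + m)%N)).
Proof.
move=> xt; rewrite /Bq/= scalerBr !scalerDr !scalerA.
rewrite opprD addrACA -!scalerBl; congr (_ *: _ + _ *: _); ring.
Qed.

(** Leibniz rule for divided differences of the product [Bth *m Zf]: [D i] is multiplied by the
    quotient of [Bth] with nodes t i, ..., t (n - 1), taken at t k. *)
Lemma fq_Dr n k c u z : atlas X c -> cimg c z -> (n <= k)%N ->
  Dr u (fq n k \o cinv c) z = Bq c u z n 0 (t k) *m fq n k (cinv c z) +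
    \sum_(i < n) Bq c u z i (n - i) (t k) *m D i (cinv c z).
Proof.
move=> Xc cz; have Uo := imgo Xc; elim: n k => [|n IH] k nk.
  by rewrite big_ord0 addr0 Zd.
have kn : t k != t n by apply/eqP => /tI e; move: nk; rewrite e ltnn.
have s1 := fq_smx n k Xc; have s2 := fq_smx n n Xc.
rewrite (dird_mxZ u Uo (sm_cst _ _) (smxB Uo s1 s2) cz) dird_cst scale0r add0r.
rewrite (dird_mxD u s1 (smxN Uo s2) cz) (dird_mxN u s2 cz) (IH k (ltnW nk)) (IH n (leqnn n)).
rewrite big_ord_recr/= subSnn -/(D n _) BqS ?addn0//.
have -> : \sum_(i < n) Bq c u z i (n.+1 - i) (t k) *m D i (cinv c z) = (t k - t n)^-1 *:
   (\sum_(i < n) Bq c u z i (n - i) (t k) *m D i (cinv c z) - \sum_(i < n) Bq c u z i (n - i) (t n) *m D i (cinv c z)).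
  rewrite -sumrB scaler_sumr; apply: eq_bigr => i _; rewrite subSn 1?ltnW// BqS subnKC ?(ltnW (ltn_ord _))//.
  by rewrite -scalemxAl mulmxBl.
rewrite -scalemxAr -scalemxAl -!scalerDr; congr (_ *: _).
have E0 i x : Bq c u z i 0 x = Bth c u z x by [].
rewrite !E0 mulmxBr mulmxBl.
move: (\sum_(i < n) _) (\sum_(i < n) _) (_ *m fq n k _) (_ *m D n _) (_ *m D n _) => a b d e f.
by apply/matrixP => i j; rewrite !mxE; ring.
Qed.

Lemma t4n k : `|t k| <= 4.
Proof. by have /andP[a b] := t4 k; rewrite ger0_norm. Qed.

Lemma nq_bounds : exists2 Nb, 0 <= Nb & forall i m x, `|x| <= 4 -> (forall j, (j < m)%N -> x != t (i + j)%N) ->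
  `|nq t fcos i m x| <= Nb / 8 ^+ m /\ `|nq t sin i m x| <= Nb / 8 ^+ m.
Proof.
have [N1 h1] := @entire_bound_cos R; have [N2 h2] := @entire_bound_sin R.
have h3 : entire_bound fcos (N1 + `|-1|) := entire_boundD h1 (entire_bound_cst (-1)).
have b0 f N0 : entire_bound f N0 -> 0 <= N0.
  by case=> p [hp _]; apply: le_trans (hp 0%N); exact: pnorm_ge0.
exists (N1 + `|-1| + N2); first by apply: addr_ge0; [exact: b0 h3|exact: b0 h2].
move=> i m x hx hxt; split.
  apply: le_trans (nq_bound tI t4n h3 hx hxt) _; rewrite ler_wpM2r ?invr_ge0 ?exprn_ge0// lerDl.
  exact: b0 h2.
apply: le_trans (nq_bound tI t4n h2 hx hxt) _; rewrite ler_wpM2r ?invr_ge0 ?exprn_ge0// lerDr.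
exact: b0 h3.
Qed.

Lemma smx_locbnd {p q} (F : E -> 'M[R]_(p, q)) U z0 : open U -> U z0 -> smx U F ->
  exists2 K, 0 <= K & exists2 r, 0 < r & forall w, box z0 r w -> U w /\ nrm (F w) <= K.
Proof.
move=> Uo Uz sF.
have h i j : \forall w \near z0, `|ent F i j w - ent F i j z0| < 1.
  have /contCP/(_ 1 ltr01)[d d0 hd] := sm_cont (sF i j) Uz.
  by apply/nbhsCP; exists d.
have hh : \forall w \near z0, forall i j, `|ent F i j w - ent F i j z0| < 1.
  exact: (filter_forall _ (fun i => filter_forall _ (h i))).
have /nbhsCP[r r0 hr] : \forall w \near z0, U w /\ forall i j, `|ent F i j w - ent F i j z0| < 1.
  by apply: filterS2 hh (open_nbhs_nbhs (conj Uo Uz)) => w a b.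
exists (nrm (F z0) + (p * q)%:R * 1); first by rewrite addr_ge0 ?nrm_ge0// mulr1.
exists r => // w /boxP[a [b [-> ha hb]]]; have [Uw hw] := hr a b ha hb; split=> //.
rewrite -[F (z0 + _)](subrK (F z0)) addrC; apply: le_trans (nrmD _ _) _; rewrite lerD2l.
by apply: nrm_le => i j; rewrite !mxE; exact: ltW (hw i j).
Qed.

Lemma nrm_B c u z K rho : atlas X c -> cimg c z -> nrm (B c 1 z) <= K -> nrm (B c ii z) <= K ->
  `|complex.Re u| <= rho -> `|complex.Im u| <= rho -> nrm (B c u z) <= 2 * rho * K.
Proof.
move=> Xc cz h1 h2 ru iu; rewrite HBl//; apply: le_trans (nrmD _ _) _; rewrite !nrmZ.
have := nrm_ge0 (B c 1 z); have := nrm_ge0 (B c ii z); have := normr_ge0 (complex.Re u); have := normr_ge0 (complex.Im u).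
have : `|complex.Re u| * nrm (B c 1 z) <= rho * K by apply: ler_pM => //; exact: nrm_ge0.
have : `|complex.Im u| * nrm (B c ii z) <= rho * K by apply: ler_pM => //; exact: nrm_ge0.
move: (_ * nrm _) (_ * nrm _) (rho * K) (rho) => *; lra.
Qed.

Lemma nrm_Bq c u z K rho b1 i m x : atlas X c -> cimg c z -> nrm (B c 1 z) <= K -> nrm (B c ii z) <= K ->
  `|complex.Re u| <= rho -> `|complex.Im u| <= rho ->
  `|nq t fcos i m x| <= b1 -> `|nq t sin i m x| <= b1 ->
  nrm (Bq c u z i m x) <= b1 * (4 * rho * K).
Proof.
move=> Xc cz h1 h2 ru iu n1 n2; apply: le_trans (nrmD _ _) _; rewrite !nrmZ.
have a1 := nrm_B Xc cz h1 h2 ru iu.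
have a2 : nrm (B c (ii * u) z) <= 2 * rho * K.
  by apply: nrm_B => //; rewrite iiE /iunit; case: (u) ru iu => a b /= ru iu; simpc => /=; rewrite ?normrN.
have : `|nq t fcos i m x| * nrm (B c u z) <= b1 * (2 * rho * K) by apply: ler_pM => //; exact: nrm_ge0.
have : `|nq t sin i m x| * nrm (B c (ii * u) z) <= b1 * (2 * rho * K) by apply: ler_pM => //; exact: nrm_ge0.
move: (_ * nrm _) (_ * nrm _) => *; lra.
Qed.

Lemma B_locbnd c z0 : atlas X c -> cimg c z0 -> exists2 K, 0 <= K & exists2 r, 0 < r &
  forall w, box z0 r w -> [/\ cimg c w, nrm (B c 1 w) <= K & nrm (B c ii w) <= K].
Proof.
move=> Xc cz; have Uo := imgo Xc.
have [K1 K10 [r1 r10 h1]] := smx_locbnd Uo cz (HBs 1 Xc).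
have [K2 K20 [r2 r20 h2]] := smx_locbnd Uo cz (HBs ii Xc).
exists (K1 + K2); first by rewrite addr_ge0.
exists (Num.min r1 r2); first by rewrite lt_min r10.
move=> w bw; have [cw a] : cimg c w /\ nrm (B c 1 w) <= K1.
  by apply: h1; apply: sub_box bw; rewrite ge_min lexx.
have [_ b] : cimg c w /\ nrm (B c ii w) <= K2.
  by apply: h2; apply: sub_box bw; rewrite ge_min lexx orbT.
by split=> //; [apply: le_trans a _; rewrite lerDl|apply: le_trans b _; rewrite lerDr].
Qed.

Lemma t_neq k j i : (i + j < k)%N -> t k != t (i + j)%N.
Proof. by move=> h; apply/eqP => /tI e; move: h; rewrite e ltnn. Qed.

(* Each divided difference solves a linear equation driven by the earlier ones, with coefficients decaying like 8^-n; on a small box this turns decay 5^-n at one point into decay 5^-n at all points. *)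
Lemma good_local c z0 : atlas X c -> cimg c z0 -> exists2 r, 0 < r & forall z1 z2 S, box z0 r z1 -> box z0 r z2 ->
  0 <= S -> (forall n, nrm (D n (cinv c z1)) <= S * 5 ^- n) ->
  cimg c z2 /\ forall n, nrm (D n (cinv c z2)) <= (2 * S) * 5 ^- n.
Proof.
move=> Xc cz; have [K K0 [r1 r10 h1]] := B_locbnd Xc cz; have [Nb Nb0 hN] := nq_bounds.
(* Makes [r] so small that the number of entries times the coefficient of the equation over the box
   is at most 1/20, see [kap]. *)
pose k0 := 1 + 8 * (N * N)%:R * K * Nb.
have k00 : 0 < k0 by rewrite ltr_pwDl// !mulr_ge0.
pose r := Num.min r1 (10 * k0)^-1.
have r0 : 0 < r by rewrite lt_min r10 invr_gt0 mulr_gt0.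
exists r => // z1 z2 S b1 b2 S0 hS.
have hr w : box z0 r w -> [/\ cimg c w, nrm (B c 1 w) <= K & nrm (B c ii w) <= K].
  by move=> bw; apply: h1; apply: sub_box bw; rewrite ge_min lexx.
split; first by have [] := hr _ b2.
suff H n : forall z, box z0 r z -> nrm (D n (cinv c z)) <= (2 * S) * 5 ^- n by move=> n; exact: H.
elim/ltn_ind: n => n IH.
have [C hC] := fq_bounded n n.
(* The supremum [d] is finite by [fq_bounded]. It will be bounded by S 5^-n + (d + (10/3) S 5^-n) /
   10; solving for [d] gives (40/27) S 5^-n, below 2 S 5^-n. *)
pose A : set R := [set nrm (D n (cinv c z)) | z in box z0 r].
have A0 : has_sup A.
  by split; [exists (nrm (D n (cinv c z1))); exists z1|exists C => _ [z _ <-]; exact: hC].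
have subA z : box z0 r z -> nrm (D n (cinv c z)) <= sup A.
  by move=> bz; apply: ub_le_sup; [exact: A0.2|exists z].
set d := sup A in subA.
have d0 : 0 <= d by apply: le_trans (subA _ b1); exact: nrm_ge0.
have p5 : 0 < (5 : R) ^- n by rewrite invr_gt0 exprn_gt0.
(* 10/3 is twice 5/3: the induction hypothesis gives 2 S 5^-i, and the convolution with 8^-(n - i)
   costs 5/3. *)
pose L := Nb * (4 * r * K) * (d + (10 / 3) * S * 5 ^- n).
have sD : smx (box z0 r) (D n \o cinv c).
  by apply: smx_sub (fq_smx n n Xc) => w /hr[].
have hL z w : box z0 r z -> box z0 r w -> nrm (Dr (z - z0) (D n \o cinv c) w) <= L.
  move=> [/ltW ru /ltW iu] bw; have [cw B1 B2] := hr _ bw.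
  rewrite (fq_Dr (z - z0) Xc cw (leqnn n)); apply: le_trans (nrmD _ _) _.
  rewrite /L mulrDr; apply: lerD.
    apply: le_trans (nrmM _ _) _; apply: ler_pM; rewrite ?nrm_ge0//; last exact: subA.
    have [|n1 n2] := hN n 0%N (t n) (t4n n); first by [].
    by apply: (nrm_Bq Xc cw B1 B2 ru iu); [rewrite expr0 divr1 in n1|rewrite expr0 divr1 in n2].
  apply: le_trans (nrm_sum _ _ _) _.
  apply: (@le_trans _ _ (\sum_(i < n) Nb * (4 * r * K) * (2 * S) * (8 ^- (n - i) * 5 ^- i))).
    apply: ler_sum => i _; apply: le_trans (nrmM _ _) _.
    have [|n1 n2] := hN i (n - i)%N (t n) (t4n n).
      by move=> j; rewrite ltn_subRL; exact: t_neq.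
    have q1 := nrm_Bq Xc cw B1 B2 ru iu n1 n2; have q2 := IH i (ltn_ord i) w bw.
    apply: le_trans (ler_pM (nrm_ge0 _) (nrm_ge0 _) q1 q2) _.
    by rewrite le_eqVlt; apply/orP; left; apply/eqP; ring.
  rewrite -mulr_sumr; apply: (@le_trans _ _ (Nb * (4 * r * K) * (2 * S) * ((5 / 3) * 5 ^- n))).
    by rewrite ler_wpM2l ?geom_conv// !mulr_ge0// ltW.
  by rewrite le_eqVlt; apply/orP; left; apply/eqP; field; rewrite expf_neq0.
have kap : (N * N)%:R * (Nb * (4 * r * K)) <= 1 / 20.
  have e1 : (N * N)%:R * (Nb * (4 * r * K)) = (8 * (N * N)%:R * K * Nb) * r / 2 by field.
  rewrite e1; have : r * k0 <= 1 / 10.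
    apply: (@le_trans _ _ ((10 * k0)^-1 * k0)); last by rewrite le_eqVlt; apply/orP; left; apply/eqP; field; rewrite gt_eqF.
    by apply: ler_wpM2r; [exact: ltW|rewrite ge_min lexx orbT].
  rewrite /k0 mulrDr mulr1; move: r0; move: (8 * _ * K * Nb) => y; nra.
(* Two points of the box are compared through its centre, which costs 1/20 twice. *)
have Q z : box z0 r z -> nrm (D n (cinv c z)) <= S * 5 ^- n + 1 / 10 * (d + (10 / 3) * S * 5 ^- n).
  move=> bz; have m1 := box_mvt sD b1 (fun w bw => hL z1 w b1 bw).
  have m2 := box_mvt sD bz (fun w bw => hL z w bz bw).
  have e1 : D n (cinv c z) = D n (cinv c z1) + ((D n (cinv c z) - D n (cinv c z0)) - (D n (cinv c z1) - D n (cinv c z0))).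
    by apply/matrixP => i j; rewrite !mxE; ring.
  rewrite e1; apply: le_trans (nrmD _ _) _; apply: lerD; first exact: hS.
  apply: le_trans (nrmD _ _) _; rewrite nrmN; apply: le_trans (lerD m2 m1) _.
  rewrite /L mulrA; set y := d + _.
  have y0 : 0 <= y by rewrite addr_ge0// !mulr_ge0// ltW.
  by move: kap; move: (_ * (Nb * _)) => x; nra.
have : d <= S * 5 ^- n + 1 / 10 * (d + (10 / 3) * S * 5 ^- n).
  by apply: ge_sup; [exact: A0.1|move=> _ [z bz <-]; exact: Q].
move=> hd z bz; apply: le_trans (subA z bz) _.
have : 0 <= S * 5 ^- n by rewrite mulr_ge0// ltW.
move: hd; rewrite -!mulrA; move: (S * 5 ^- n) => y; lra.
Qed.

(** At [q0] all solutions are 1, so every coefficient after the first vanishes; the estimate spreads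
    by connectedness. The constant depends on the point, the rate does not. *)
Lemma good p : exists2 S, 0 <= S & forall n, nrm (D n p) <= S * 5 ^- n.
Proof.
apply: (@connected_spread M (fun p => exists2 S, 0 <= S & forall n, nrm (D n p) <= S * 5 ^- n) q0).
- exact: surface_connected X.
- have Dq n k : (n <= k)%N -> fq n k q0 = if n == 0%N then 1%:M else 0.
    elim: n k => [|n IH] k nk; first exact: Z0.
    by rewrite /= !IH// ?subrr ?scaler0// ltnW.
  exists (nrm (1%:M : 'M[R]_N)); first exact: nrm_ge0.
  move=> n; rewrite /D Dq//; case: n => [|n] /=; first by rewrite expr0 invr1 mulr1.
  by rewrite nrm0 mulr_ge0 ?nrm_ge0// invr_ge0 exprn_ge0.
move=> {}p; have [c Xc cp] := atlas_cover X p.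
have [[od oi] h1 h2 h3 h4] := chart_homeo Xc.
have [cz e] := h1 p cp.
have [r r0 hr] := good_local Xc cz.
have : nbhs p (cdom c `&` [set q | box (cmap c p) r (cmap c q)]).
  apply: filterI; first exact: open_nbhs_nbhs.
  by apply: (h3 p cp); exact: box_nbhs.
rewrite nbhsE => -[V [Vo Vp] sV].
exists V; split=> // q q' /sV[cq bq] /sV[cq' bq'] [S S0 hS].
exists (2 * S); first by rewrite mulr_ge0.
have [_ e1] := h1 q cq; have [_ e2] := h1 q' cq'.
have [|_ H] := hr _ _ S bq bq' S0; first by rewrite e1.
by rewrite e2 in H.
Qed.

Variable th : R.
Hypotheses (th4 : 0 <= th <= 4) (tht : forall k, th != t k).

(** Basis polynomials of Newton's interpolation series, taken at the angle [th] of the solution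
    sought. *)
Definition wt n : R := \prod_(i < n) (th - t i).
Definition Sp k p : 'M[R]_N := \sum_(n < k) wt n *: D n p.
Definition Zl p : 'M[R]_N := \matrix_(i, j) limn (fun k => Sp k p i j).

Lemma wt_bound n : `|wt n| <= 4 ^+ n.
Proof.
rewrite /wt; elim: n => [|n IH]; first by rewrite big_ord0 normr1 expr0.
rewrite big_ord_recr/= normrM exprSr; apply: ler_pM => //.
have /andP[a b] := th4; have /andP[a' b'] := t4 n; rewrite ler_norml; lra.
Qed.

(** Weights of size 4^n, since [th] and the nodes lie in [0, 4], meet coefficients of size 5^-n. *)
Lemma wt_term S p n : 0 <= S -> nrm (D n p) <= S * 5 ^- n -> nrm (wt n *: D n p) <= S * (4 / 5) ^+ n.
Proof.
move=> S0 h; rewrite nrmZ expr_div_n mulrCA; apply: ler_pM => //; first exact: nrm_ge0.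
exact: wt_bound.
Qed.

(** Telescoping: (4/5)^l is 5 times the difference of (4/5)^l and (4/5)^(l+1). *)
Lemma Sp_tail S p : 0 <= S -> (forall n, nrm (D n p) <= S * 5 ^- n) ->
  forall k l, (k <= l)%N -> nrm (Sp l p - Sp k p) <= 5 * S * ((4 / 5) ^+ k - (4 / 5) ^+ l).
Proof.
move=> S0 h k l /subnK <-; elim: (l - k)%N => [|d IH].
  by rewrite !subrr nrm0 mulr0.
rewrite addSn /Sp big_ord_recr/= -/(Sp _ p) addrAC; apply: le_trans (nrmD _ _) _.
apply: le_trans (lerD IH (wt_term S0 (h _))) _; rewrite [in leRHS]exprS.
move: (_ ^+ k) (_ ^+ (d + k)) => x y; lra.
Qed.

Lemma Sp_cvg p i j : (fun k => Sp k p i j) @ \oo --> Zl p i j.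
Proof.
have [S S0 hS] := good p; rewrite mxE.
have e0 : (fun k => Sp k p i j) = series (fun n => (wt n *: D n p) i j).
  by apply/funext => k; rewrite /Sp summxE /series/= big_mkord.
suff : cvgn (series (fun n => (wt n *: D n p) i j)) by rewrite -e0.
apply: normed_cvg; apply: (@series_le_cvg _ _ (geometric S (4 / 5))).
- by move=> n; exact: normr_ge0.
- by move=> n; rewrite /geometric/= mulr_ge0// exprn_ge0.
- by move=> n; rewrite /geometric/=; apply: le_trans (nrm_entry _ i j) (wt_term S0 (hS n)).
- by apply: is_cvg_geometric_series; rewrite ger0_norm//; lra.
Qed.

Lemma Zl_tail S p i j k : 0 <= S -> (forall n, nrm (D n p) <= S * 5 ^- n) ->
  `|Zl p i j - Sp k p i j| <= 5 * S * (4 / 5) ^+ k.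
Proof.
move=> S0 h.
have cv : (fun l => `|Sp l p i j - Sp k p i j|) @ \oo --> `|Zl p i j - Sp k p i j|.
  by apply: cvg_norm; apply: cvgB; [exact: Sp_cvg|exact: cvg_cst].
have cv' : cvgn (fun l => `|Sp l p i j - Sp k p i j|) by apply/cvg_ex; eexists; exact: cv.
rewrite -(cvg_lim _ cv)//; apply: limr_le => //.
exists k => // l /= kl; have := nrm_entry (Sp l p - Sp k p) i j; rewrite !mxE => /le_trans; apply.
apply: le_trans (Sp_tail S0 h kl) _; rewrite ler_wpM2l ?mulr_ge0// gerBl exprn_ge0//.
Qed.

Lemma Sp_smx k c : atlas X c -> smx (cimg c) (Sp k \o cinv c).
Proof.
move=> Xc; have Uo := imgo Xc.
apply: (@smx_sum _ _ _ 'I_k (index_enum _) predT (cimg c) (fun i w => wt i *: D i (cinv c w)) Uo) => i _.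
exact: smxZ Uo (sm_cst _ _) (fq_smx i i Xc).
Qed.

(** The partial sum solves the equation at [th] up to the Newton remainder of the product
    [Bth *m Zf], again by the Leibniz rule; from [k] to [k.+1] every quotient gains one node. *)
Lemma Sp_Dr k c u z : atlas X c -> cimg c z ->
  Dr u (Sp k \o cinv c) z = Bth c u z th *m Sp k (cinv c z) -
    wt k *: \sum_(i < k) Bq c u z i (k - i) th *m D i (cinv c z).
Proof.
move=> Xc cz; have Uo := imgo Xc; elim: k => [|k IH].
  rewrite /Sp !big_ord0 mulmx0 scaler0 subr0 -[RHS](dird_mx_cst (0 : 'M[R]_N) u z).
  by apply: (dird_mx_ext _ Uo) => // w _; rewrite /comp/= big_ord0.
have s1 := Sp_smx k Xc; have s2 := fq_smx k k Xc.
have -> : Dr u (Sp k.+1 \o cinv c) z = Dr u (fun w => (Sp k \o cinv c) w + wt k *: (D k \o cinv c) w) z.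
  by apply: (dird_mx_ext _ Uo) => // w _; rewrite /comp/= {1}/Sp big_ord_recr.
rewrite (dird_mxD u s1 (smxZ Uo (sm_cst _ (wt k)) s2) cz) (dird_mxZ u Uo (sm_cst _ (wt k)) s2 cz).
rewrite dird_cst scale0r add0r IH (fq_Dr u Xc cz (leqnn k)).
have -> : Sp k.+1 (cinv c z) = Sp k (cinv c z) + wt k *: D k (cinv c z) by rewrite {1}/Sp big_ord_recr.
have tk : th - t k != 0 by rewrite subr_eq0.
have wS : wt k.+1 = wt k * (th - t k) by rewrite /wt big_ord_recr.
have H : (th - t k) *: (Bq c u z k 1 th *m D k (cinv c z)) = (Bq c u z k 0 th - Bq c u z k 0 (t k)) *m D k (cinv c z).
  by rewrite BqS ?addn0// -scalemxAl scalerA mulfV// scale1r.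
rewrite big_ord_recr/= subSnn wS -scalerA (scalerDr (th - t k)) H.
have -> : (th - t k) *: \sum_(i < k) Bq c u z i (k.+1 - i) th *m D i (cinv c z) =
   \sum_(i < k) Bq c u z i (k - i) th *m D i (cinv c z) - \sum_(i < k) Bq c u z i (k - i) (t k) *m D i (cinv c z).
  rewrite -sumrB scaler_sumr; apply: eq_bigr => i _; rewrite subSn 1?ltnW// BqS subnKC ?(ltnW (ltn_ord _))//.
  by rewrite -scalemxAl scalerA mulfV// scale1r mulmxBl.
have E0 i x : Bq c u z i 0 x = Bth c u z x by [].
rewrite !E0 mulmxDr mulmxBl -scalemxAr -/(D k (cinv c z)).
move: (\sum_(i < k) _) (\sum_(i < k) _) (_ *m Sp k _) (_ *m D k _) (Bth c u z (t k) *m _) => a b d e f.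
by apply/matrixP => i j; rewrite !mxE; ring.
Qed.

Lemma Sp_err c u z K rho S k : atlas X c -> cimg c z -> nrm (B c 1 z) <= K -> nrm (B c ii z) <= K ->
  0 <= rho -> 0 <= K -> `|complex.Re u| <= rho -> `|complex.Im u| <= rho -> 0 <= S ->
  (forall n, nrm (D n (cinv c z)) <= S * 5 ^- n) ->
  forall Nb, 0 <= Nb -> (forall i m x, `|x| <= 4 -> (forall j, (j < m)%N -> x != t (i + j)%N) ->
  `|nq t fcos i m x| <= Nb / 8 ^+ m /\ `|nq t sin i m x| <= Nb / 8 ^+ m) ->
  nrm (Dr u (Sp k \o cinv c) z - Bth c u z th *m Sp k (cinv c z)) <= Nb * (4 * rho * K) * S * 2 * (4 / 5) ^+ k.
Proof.
move=> Xc cz B1 B2 rho0 K0 ru iu S0 hS Nb Nb0 hN.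
rewrite Sp_Dr// addrAC subrr sub0r nrmN nrmZ.
have h : nrm (\sum_(i < k) Bq c u z i (k - i) th *m D i (cinv c z)) <= Nb * (4 * rho * K) * S * ((5 / 3) * 5 ^- k).
  apply: le_trans (nrm_sum _ _ _) _.
  apply: (@le_trans _ _ (\sum_(i < k) Nb * (4 * rho * K) * S * (8 ^- (k - i) * 5 ^- i))).
    apply: ler_sum => i _; apply: le_trans (nrmM _ _) _.
    have [||n1 n2] := hN i (k - i)%N th; first by have /andP[a b] := th4; rewrite ger0_norm.
      by move=> j _; exact: tht.
    have q1 := nrm_Bq Xc cz B1 B2 ru iu n1 n2.
    apply: le_trans (ler_pM (nrm_ge0 _) (nrm_ge0 _) q1 (hS i)) _.
    by rewrite le_eqVlt; apply/orP; left; apply/eqP; ring.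
  by rewrite -mulr_sumr ler_wpM2l ?geom_conv// !mulr_ge0.
apply: le_trans (ler_pM (normr_ge0 _) (nrm_ge0 _) (wt_bound k) h) _.
have p5 : 0 < (5 : R) ^- k by rewrite invr_gt0 exprn_gt0.
have p4 : 0 < (4 : R) ^+ k by rewrite exprn_gt0.
rewrite expr_div_n; have : 0 <= Nb * (4 * rho * K) * S by rewrite !mulr_ge0.
have : 0 < 4 ^+ k * (5 : R) ^- k by rewrite mulr_gt0.
move: (Nb * _ * S) => x hy hx.
have -> : 4 ^+ k * (x * (5 / 3 * 5 ^- k)) = x * (5 / 3) * (4 ^+ k * 5 ^- k) by ring.
by rewrite ler_wpM2r ?(ltW hy)// ler_wpM2l//; lra.
Qed.

(** [good] bounds the coefficients at the centre; [good_local] carries the bound over the box with a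
    factor 2, which makes the convergence of the partial sums and of their derivatives uniform
    there. *)
Lemma Zl_local c z0 : atlas X c -> cimg c z0 -> exists2 r, 0 < r &
  (forall w, box z0 r w -> cimg c w) /\ exists2 C, 0 <= C &
  forall k w, box z0 r w -> nrm (Zl (cinv c w) - Sp k (cinv c w)) <= C * (4 / 5) ^+ k /\
   forall u, nrm (Dr u (Sp k \o cinv c) w - Bth c u w th *m Zl (cinv c w)) <=
     C * (`|complex.Re u| + `|complex.Im u|) * (4 / 5) ^+ k.
Proof.
move=> Xc cz; have [K K0 [r1 r10 h1]] := B_locbnd Xc cz; have [Nb Nb0 hN] := nq_bounds.
have [r2 r20 h2] := good_local Xc cz; have [S0 S00 hS0] := good (cinv c z0).
pose r := Num.min r1 r2; have r0 : 0 < r by rewrite lt_min r10.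
have b0 : box z0 r2 z0 by apply/boxP; exists 0, 0; rewrite mkC0 addr0 normr0.
exists r => //; split.
  by move=> w bw; have [] := h1 w; first by apply: sub_box bw; rewrite ge_min lexx.
pose S := 2 * S0; have S20 : 0 <= S by rewrite mulr_ge0.
pose c1 := (N * N)%:R * (5 * S).
have c10 : 0 <= c1 by rewrite !mulr_ge0.
pose c2 := 8 * Nb * K * S + 4 * Nb * K * c1.
have c20 : 0 <= c2 by rewrite addr_ge0// !mulr_ge0.
exists (c1 + c2); first by rewrite addr_ge0.
move=> k w bw; have [|cw B1 B2] := h1 w; first by apply: sub_box bw; rewrite ge_min lexx.
have [|_ hS] := h2 z0 w S0 b0 _ S00 hS0; first by apply: sub_box bw; rewrite ge_min lexx orbT.
have g0 : 0 <= (4 / 5 : R) ^+ k by rewrite exprn_ge0.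
have T : nrm (Zl (cinv c w) - Sp k (cinv c w)) <= c1 * (4 / 5) ^+ k.
  rewrite /c1 -mulrA; apply: nrm_le => i j; rewrite !mxE -/(Zl (cinv c w)).
  by have := Zl_tail i j k S20 hS; rewrite !mxE.
split; first by apply: le_trans T _; rewrite ler_wpM2r// lerDl.
move=> u; set rho := `|complex.Re u| + `|complex.Im u|.
have rho0 : 0 <= rho by rewrite addr_ge0.
have ru : `|complex.Re u| <= rho by rewrite lerDl.
have iu : `|complex.Im u| <= rho by rewrite lerDr.
have E1 := Sp_err k Xc cw B1 B2 rho0 K0 ru iu S20 hS Nb0 hN.
have -> : Dr u (Sp k \o cinv c) w - Bth c u w th *m Zl (cinv c w) =
  (Dr u (Sp k \o cinv c) w - Bth c u w th *m Sp k (cinv c w)) - Bth c u w th *m (Zl (cinv c w) - Sp k (cinv c w)).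
  by rewrite mulmxBr opprB addrA subrK.
apply: le_trans (nrmD _ _) _; rewrite nrmN.
have n1 : nrm (Bth c u w th) <= Nb * (4 * rho * K).
  have [||n1 n2] := hN 0%N 0%N th; first by have /andP[a b] := th4; rewrite ger0_norm.
    by [].
  by apply: (@nrm_Bq c u w K rho Nb 0%N 0%N th Xc cw B1 B2 ru iu); [rewrite expr0 divr1 in n1|rewrite expr0 divr1 in n2].
have n2 := le_trans (nrmM (Bth c u w th) (Zl (cinv c w) - Sp k (cinv c w))) (ler_pM (nrm_ge0 _) (nrm_ge0 _) n1 T).
apply: le_trans (lerD E1 n2) _.
apply: (@le_trans _ _ (c2 * rho * (4 / 5) ^+ k)).
  by rewrite le_eqVlt; apply/orP; left; apply/eqP; rewrite /c2; ring.
by rewrite ler_wpM2r// ler_wpM2r// lerDr.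
Qed.

Lemma Zl_cont c z0 i j : atlas X c -> cimg c z0 -> {for z0, continuous (ent (Zl \o cinv c) i j)}.
Proof.
move=> Xc cz; have [r r0 [sb [C C0 hC]]] := Zl_local Xc cz.
apply: (@unif_cont R (fun k => ent (Sp k \o cinv c) i j) _ z0 (fun k => C * (4 / 5) ^+ k) r r0).
- by move=> k; exact: sm_cont (Sp_smx k Xc i j) cz.
- move=> k w bw; have [h _] := hC k w bw; exact: le_trans (nrm_entB _ _ _ _) h.
- exact: geom_small.
Qed.

Lemma Bth_smx c u : atlas X c -> smx (cimg c) (fun w => Bth c u w th).
Proof.
move=> Xc; have Uo := imgo Xc; apply: smxD => //; apply: (smxZ Uo (sm_cst _ _)); exact: HBs.
Qed.

Lemma Zl_isd c z0 u i j : atlas X c -> cimg c z0 ->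
  isd u (ent (Zl \o cinv c) i j) z0 (ent (fun w => Bth c u w th *m Zl (cinv c w)) i j z0).
Proof.
move=> Xc cz; have [r r0 [sb [C C0 hC]]] := Zl_local Xc cz; have Uo := imgo Xc.
have : nbhs z0 (box z0 r) by exact: box_nbhs.
move=> /(near_line u)/nbhs_ballP[d /= d0 hd].
have hd' s : `|s| < d -> box z0 r (line z0 u s).
  by move=> sd; apply: hd; rewrite -ball_normE/= sub0r normrN.
set rho := `|complex.Re u| + `|complex.Im u|.
have rho0 : 0 <= rho by rewrite addr_ge0.
apply: (@unif_isd R (fun k => ent (Sp k \o cinv c) i j) _ _ z0 u (fun k => C * (1 + rho) * (4 / 5) ^+ k) d d0).
- by move=> k s sd; exact: sm_drv (Sp_smx k Xc i j) (sb _ (hd' s sd)).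
- move=> k s sd; have [h _] := hC k _ (hd' s sd).
  apply: le_trans (_ : C * (4 / 5) ^+ k <= _); last by rewrite ler_wpM2r ?exprn_ge0// ler_peMr// lerDl.
  exact: le_trans (nrm_entB _ _ _ _) h.
- move=> k s sd; have [_ /(_ u) h] := hC k _ (hd' s sd); set w := line z0 u s in h *.
  apply: le_trans (_ : C * rho * (4 / 5) ^+ k <= _); last by rewrite ler_wpM2r ?exprn_ge0// ler_wpM2l// lerDr.
  apply: le_trans h; rewrite -(dird_mxE u i j (Sp_smx k Xc) (sb _ (hd' s sd))).
  exact: nrm_entB.
- exact: geom_small.
have -> : ent (fun w => Bth c u w th *m Zl (cinv c w)) i j =
  fun w => \sum_k ent (fun w => Bth c u w th) i k w * ent (Zl \o cinv c) k j w.
  by apply/funext => w; rewrite /ent mxE.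
have -> : (fun w => \sum_k ent (fun w => Bth c u w th) i k w * ent (Zl \o cinv c) k j w) =
  \sum_k (fun w => ent (fun w => Bth c u w th) i k w * ent (Zl \o cinv c) k j w).
  by apply/funext => w; rewrite fct_sumE.
elim/big_ind: _ => [|f1 f2 c1 c2|k _]; first exact: cst_continuous.
  exact: continuousD.
by apply: continuousM; [exact: sm_cont (Bth_smx u Xc i k) cz|exact: Zl_cont].
Qed.

(** A derivative of [Zl] is a smooth coefficient times [Zl], so each order of smoothness gives the
    next. *)
Lemma Zl_smx c : atlas X c -> smx (cimg c) (Zl \o cinv c).
Proof.
move=> Xc i j k; have Uo := imgo Xc; elim: k i j => [|k IH] i j.
  by split=> // z cz; exact: Zl_cont.
split; first by move=> z cz; exact: Zl_cont.
split=> u; first by move=> z cz; exact: isd_drv (Zl_isd u i j Xc cz).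
apply: (Ck_ext (f := fun w => \sum_l ent (fun w => Bth c u w th) i l w * ent (Zl \o cinv c) l j w) Uo).
  by move=> w cw; rewrite (isd_dird (Zl_isd u i j Xc cw)) /ent mxE.
by apply: Ck_sum => // l _; apply: CkM => //; exact: Bth_smx.
Qed.

Lemma Zl_Dr c u z : atlas X c -> cimg c z ->
  Dr u (Zl \o cinv c) z = Bth c u z th *m Zl (cinv c z).
Proof.
move=> Xc cz; apply/matrixP => i j; rewrite (dird_mxE u i j (Zl_smx Xc) cz).
exact: isd_dird (Zl_isd u i j Xc cz).
Qed.

Lemma Zl_q0 : Zl q0 = 1%:M.
Proof.
have Dq n k : (n <= k)%N -> fq n k q0 = if n == 0%N then 1%:M else 0.
  elim: n k => [|n IH] k nk; first exact: Z0.
  by rewrite /= !IH// ?subrr ?scaler0// ltnW.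
have Sq k : Sp k.+1 q0 = 1%:M.
  rewrite /Sp big_ord_recl big1 => [|i _]; last by rewrite /D Dq// scaler0.
  by rewrite /D Dq// /wt big_ord0 scale1r addr0.
apply/matrixP => i j; have := @Sp_cvg q0 i j; rewrite -(cvg_shiftn 1).
under eq_fun do rewrite /= addn1 Sq.
by move=> h; have := cvg_lim (@Rhausdorff R) h; rewrite lim_cst// => ->.
Qed.

(** The condition is linear in the solution, so it passes to divided differences, partial sums and
    the limit. Descent to the base surface has this form. *)
Lemma Zl_factor (G : M -> 'rV[R]_N) q q' : (forall k, G q *m Zf k q = G q' *m Zf k q') ->
  G q *m Zl q = G q' *m Zl q'.
Proof.
move=> h; have Df n k : G q *m fq n k q = G q' *m fq n k q'.
  by elim: n k => [//|n IH] k /=; rewrite -!scalemxAr !mulmxBr !IH.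
have Sf k : G q *m Sp k q = G q' *m Sp k q'.
  by rewrite /Sp !mulmx_sumr; apply: eq_bigr => i _; rewrite -!scalemxAr /D Df.
have L p i : (fun k => (G p *m Sp k p) 0 i) @ \oo --> (G p *m Zl p) 0 i.
  rewrite mxE; under eq_fun do rewrite mxE.
  by apply: cvg_fsum => l; apply: cvgMr; exact: Sp_cvg.
apply/rowP => i; have h1 := cvg_lim (@Rhausdorff R) (L q i).
by rewrite -h1 -(cvg_lim (@Rhausdorff R) (L q' i)); congr (limn _); apply/funext => k; rewrite Sf.
Qed.

End NewtonSeries.

(** * Holomorphic changes of parameter *)

Section ComplexDerivative.
Context {R : realType}.
Local Notation E := (Cplx R).
Local Notation C := (R[i]).
Implicit Types (z u k : E) (U : set E) (phi psi : E -> E).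

(** The modulus as a real number; the norm of [R[i]] is complex valued. *)
Definition nc (z : C) : R := Num.sqrt (complex.Re z ^+ 2 + complex.Im z ^+ 2).
Lemma ncE (z : C) : (nc z)%:C%C = `|z|.
Proof. by rewrite normc_def. Qed.
Lemma ncM (x y : C) : nc (x * y) = nc x * nc y.
Proof. by apply: complexI; rewrite rmorphM/= !ncE normrM. Qed.
Lemma ncD (x y : C) : nc (x + y) <= nc x + nc y.
Proof. by rewrite -lecR rmorphD/= !ncE ler_normD. Qed.
Lemma ncN (x : C) : nc (- x) = nc x.
Proof. by apply: complexI; rewrite !ncE normrN. Qed.
Lemma ncV (x : C) : nc x^-1 = (nc x)^-1.
Proof. by apply: complexI; rewrite fmorphV/= !ncE normfV. Qed.
Lemma nc_ge0 (x : C) : 0 <= nc x. Proof. exact: sqrtr_ge0. Qed.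
Lemma nc_gt0 (x : C) : (0 < nc x) = (x != 0).
Proof. by rewrite -normr_gt0 -ncE ltcR. Qed.
Lemma nc_Re (x : C) : `|complex.Re x| <= nc x.
Proof. by rewrite /nc -sqrtr_sqr ler_wsqrtr// lerDl sqr_ge0. Qed.
Lemma nc_Im (x : C) : `|complex.Im x| <= nc x.
Proof. by rewrite /nc -sqrtr_sqr ler_wsqrtr// lerDr sqr_ge0. Qed.
Lemma nc_sum (x : C) : nc x <= `|complex.Re x| + `|complex.Im x|.
Proof.
rewrite /nc -[leRHS]ger0_norm ?addr_ge0// -sqrtr_sqr ler_wsqrtr// sqrrD !real_normK ?num_real//.
by rewrite [leRHS]addrAC lerDl mulrn_wge0// mulr_ge0.
Qed.

Definition cfr phi z k := forall e, 0 < e -> exists2 d : R, 0 < d &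
  forall h : E, nc h < d -> nc (phi (z + h) - phi z - (k : C) * h) <= e * nc h.

Lemma diff_quot_mul (k h D : C) : h != 0 -> (k - h^-1 * D) * h = - (D - k * h).
Proof. by move=> h0; rewrite mulrBl mulrAC mulVf// mul1r opprB. Qed.

Lemma derivable_cfr phi z : derivable phi z 1 -> exists k, cfr phi z k.
Proof.
move=> /cvg_ex[k hk]; exists k => e e0.
have e0' : 0 < e%:C%C by rewrite ltcR.
have /cvgrPdist_le/(_ _ e0') := hk => hn.
have /nbhsCP[d d0 hd] : \forall h \near (0 : E), h != 0 -> `|k - h^-1 *: ((phi \o shift z) (h *: (1 : E)) - phi z)| <= e%:C%C by exact: hn.
exists d => // h hh; have [->|h0] := eqVneq h 0.
  by rewrite mulr0 addr0 subrr subr0 /nc /= !expr0n/= addr0 sqrtr0 mulr0.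
have := hd (complex.Re h) (complex.Im h) (le_lt_trans (nc_Re h) hh) (le_lt_trans (nc_Im h) hh).
rewrite -mkCE add0r => /(_ h0); rewrite -ncE lecR /= /GRing.scale/= mulr1 (addrC h).
set D := phi (z + h) - phi z => a1.
have := ler_wpM2r (nc_ge0 h) a1; rewrite -ncM.
by rewrite -[X in _ -> X <= _]ncN -(diff_quot_mul k D h0).
Qed.

Lemma cfr_frech phi z k : cfr phi z k ->
  frech (fre phi) z (complex.Re k) (- complex.Im k) /\ frech (fim phi) z (complex.Im k) (complex.Re k).
Proof.
move=> h; have K e : 0 < e -> exists2 d : R, 0 < d & forall x y, `|x| < d -> `|y| < d ->
    nc (phi (z + mkC x y) - phi z - (k : C) * mkC x y) <= e * (`|x| + `|y|).
  move=> e0; have [d d0 hd] := h e e0; exists (d / 2) => [|x y hx hy]; first by rewrite divr_gt0.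
  apply: le_trans (hd _ _) _; last by apply: ler_wpM2l; [exact: ltW|exact: nc_sum].
  by apply: le_lt_trans (nc_sum _) _; rewrite [ltRHS]splitr ltrD.
split=> e e0; have [d d0 hd] := K e e0; exists d => // x y hx hy; apply: le_trans (hd x y hx hy).
  apply: le_trans (nc_Re _); rewrite /fre.
  by case: (phi (z + _)) (phi z) (k) => a b [a' b'] [k1 k2] /=; rewrite mulNr.
apply: le_trans (nc_Im _); rewrite /fim.
by case: (phi (z + _)) (phi z) (k) => a b [a' b'] [k1 k2] /=; rewrite addrC [_ * y + _]addrC addrC.
Qed.

Lemma cfr_isd phi z k u : cfr phi z k ->
  isd u (fre phi) z (complex.Re ((u : C) * k)) /\ isd u (fim phi) z (complex.Im ((u : C) * k)).
Proof.
move=> /cfr_frech[/(frech_isd u) h1 /(frech_isd u) h2].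
move: h1 h2; case: u k => a b [k1 k2] /= h1 h2; split.
  by move: h1; congr (isd _ _ _ _); ring.
by move: h2; congr (isd _ _ _ _); ring.
Qed.

(** Continuity of [psi] places psi(y + h) where the expansion of [phi] is valid; the expansion is
    then solved for the increment of [psi]. *)
Lemma cfr_inverse phi psi y k : cfr phi (psi y) k -> k != 0 ->
  (\forall w \near y, phi (psi w) = w) -> {for y, continuous psi} -> cfr psi y (k : C)^-1.
Proof.
move=> hk k0 inv pc e e0.
have nk : 0 < nc k by rewrite nc_gt0.
(* The first bound absorbs half of |x| and yields |x| <= 2 |h| / |k|; with it the second gives the
   error e |h|. *)
pose e1 := Num.min (nc k / 2) (e * nc k ^+ 2 / 2).
have e10 : 0 < e1 by rewrite lt_min !divr_gt0// mulr_gt0// exprn_gt0.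
have [d d0 hd] := hk e1 e10.
have d2 : 0 < d / 2 by rewrite divr_gt0.
have B1 : nbhs (psi y) (box (psi y) (d / 2)) by exact: box_nbhs.
have /nbhsCP[r r0 hr] : \forall w \near y, phi (psi w) = w /\ box (psi y) (d / 2) (psi w).
  by apply: filterS2 inv (pc _ B1) => w a b.
exists r => // h hh.
have := hr (complex.Re h) (complex.Im h) (le_lt_trans (nc_Re h) hh) (le_lt_trans (nc_Im h) hh).
rewrite -mkCE => -[e2 [b1 b2]].
set x := psi (y + h) - psi y in b1 b2 *.
have := hr 0 0; rewrite normr0 => /(_ r0 r0)[]; rewrite mkC0 addr0 => e3 _.
have xd : nc x < d by apply: le_lt_trans (nc_sum _) _; rewrite [ltRHS]splitr ltrD.
have := hd x xd; have -> : psi y + x = psi (y + h) by rewrite /x addrC subrK.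
rewrite e2 e3 (addrC y) addrK => H.
have e4 : x - (k : C)^-1 * h = - ((k : C)^-1 * ((h : C) - (k : C) * x)).
  by rewrite mulrBr mulKf// opprB.
have m1 : nc (x - (k : C)^-1 * h) <= (nc k)^-1 * (e1 * nc x).
  by rewrite e4 ncN ncM ncV ler_wpM2l// invr_ge0 nc_ge0.
have m2 : nc x <= 2 * (nc k)^-1 * nc h.
  have : nc x <= (nc k)^-1 * (e1 * nc x) + (nc k)^-1 * nc h.
    rewrite -[x in leLHS](subrK ((k : C)^-1 * h)); apply: le_trans (ncD _ _) _.
    by rewrite lerD// ncM ncV.
  have : (nc k)^-1 * (e1 * nc x) <= nc x / 2.
    rewrite mulrA [leRHS]mulrC ler_wpM2r ?nc_ge0// ler_pdivrMl// ge_min.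
    by rewrite (_ : nc k * 2^-1 = nc k / 2)// lexx.
  rewrite -(mulrA 2); move: ((nc k)^-1 * nc h) => t; lra.
apply: le_trans m1 _.
apply: (@le_trans _ _ ((nc k)^-1 * (e * nc k ^+ 2 / 2 * (2 * (nc k)^-1 * nc h)))).
  rewrite ler_wpM2l ?invr_ge0 ?nc_ge0//; apply: ler_pM => //; [exact: ltW|exact: nc_ge0|].
  by rewrite ge_min lexx orbT.
by rewrite le_eqVlt; apply/orP; left; apply/eqP; field; rewrite gt_eqF.
Qed.

(** [k] is the complex derivative. Smoothness is put into the definition, being established by a
    separate argument in [hol_bootstrap] and [hol_inverse]. *)
Definition hol U phi (k : E -> C) := csm U phi /\ forall z, U z -> k z != 0 /\
  forall u, Dr u (fre phi) z = complex.Re ((u : C) * k z) /\ Dr u (fim phi) z = complex.Im ((u : C) * k z).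

Lemma phiE phi z : phi z = mkC (fre phi z) (fim phi z).
Proof. by rewrite /fre /fim /mkC; case: (phi z). Qed.

Lemma Dr_comp1 {p q} (F : E -> 'M[R]_(p, q)) U phi z k u : open U -> smx U F -> U (phi z) ->
  cfr phi z k -> isd u (F \o phi) z (Dr ((u : C) * k) F (phi z)).
Proof.
move=> Uo sF Uz hk; have [h1 h2] := cfr_isd u hk.
have D i j : isd u (ent (F \o phi) i j) z (Dr ((u : C) * k) (ent F i j) (phi z)).
  have := Ck_line_chain Uo (sF i j 1%N) (p := fre phi) (q := fim phi) _ h1 h2.
  rewrite -phiE => /(_ Uz); rewrite (_ : mkC _ _ = (u : C) * k); last by rewrite /mkC; case: (_ * _).
  have -> // : (fun w => ent F i j (mkC (fre phi w) (fim phi w))) = ent (F \o phi) i j.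
  by apply/funext => w; rewrite -phiE.
have dm : drv u (F \o phi) z by apply/drv_mxP => i j; exact: isd_drv (D i j).
have -> : Dr ((u : C) * k) F (phi z) = Dr u (F \o phi) z; last exact: drv_isd.
apply/matrixP => i j; rewrite (dird_mxE _ _ _ sF Uz) (dird_entE _ _ dm).
by rewrite (isd_dird (D i j)).
Qed.

Section HolComp.
Variables (U U' : set E) (phi : E -> E) (k : E -> C).
Hypotheses (Uo : open U) (U'o : open U') (hphi : hol U' phi k) (phiU : forall w, U' w -> U (phi w)).

Lemma smx_hol {p q} (F : E -> 'M[R]_(p, q)) : smx U F -> smx U' (F \o phi).
Proof.
move=> sF i j n; have [[s1 s2] _] := hphi.
apply: (Ck_ext U'o) (Ck_comp Uo U'o (sF i j n) _ (s1 n) (s2 n)) => w U'w; rewrite -?phiE//.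
exact: phiU.
Qed.

Lemma Dr_hol {p q} (F : E -> 'M[R]_(p, q)) u z : smx U F -> U' z ->
  Dr u (F \o phi) z = Dr ((u : C) * k z) F (phi z).
Proof.
move=> sF U'z; have Uz := phiU U'z; have [[s1 s2] /(_ z U'z)[_ /(_ u)[d1 d2]]] := hphi.
apply/matrixP => i j; rewrite (dird_mxE _ _ _ (smx_hol sF) U'z) (dird_mxE _ _ _ sF Uz).
have := Ck_line_chain Uo (sF i j 1%N) (p := fre phi) (q := fim phi) _ (drv_isd (@sm_drv _ _ _ u _ s1 U'z)) (drv_isd (@sm_drv _ _ _ u _ s2 U'z)).
rewrite -phiE => /(_ Uz)/isd_dird; rewrite d1 d2.
rewrite (_ : mkC _ _ = (u : C) * k z); last by rewrite /mkC; case: (_ * _).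
by move=> <-; congr (Dr u _ z); apply/funext => w; rewrite -phiE.
Qed.

Lemma csm_k : csm U' k.
Proof.
have [[s1 s2] h] := hphi; split.
  apply: (fun e => sm_ext U'o e (@sm_dird R U' _ 1 s1)) => w U'w.
  by have [_ /(_ 1)[-> _]] := h w U'w; rewrite mul1r.
apply: (fun e => sm_ext U'o e (@sm_dird R U' _ 1 s2)) => w U'w.
by have [_ /(_ 1)[_ ->]] := h w U'w; rewrite mul1r.
Qed.

Variables (N : nat) (F : E -> 'rV[R]_N).
Hypothesis cF : conf U F.

Lemma dt_Dr u v z : U z -> dt (Dr u F z) (Dr v F z) =
  (complex.Re u * complex.Re v + complex.Im u * complex.Im v) * lam F z.
Proof.
move=> Uz; have [_ /(_ z Uz)[_ _ e1 e2]] := cF.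
rewrite (dird_mx_lin u Uo cF.1 Uz) (dird_mx_lin v Uo cF.1 Uz) !(dotDl, dotDr, dotZl, dotZr).
by rewrite (dotC (Dr ii F z) (Dr 1 F z)) e1 e2 /lam; ring.
Qed.

Lemma lam_hol z : U' z -> lam (F \o phi) z = nc (k z) ^+ 2 * lam F (phi z).
Proof.
move=> U'z; rewrite {1}/lam (Dr_hol 1 cF.1 U'z) dt_Dr; last exact: phiU.
by rewrite mul1r /nc sqr_sqrtr ?addr_ge0 ?sqr_ge0// !expr2.
Qed.

Lemma conf_hol : conf U' (F \o phi).
Proof.
split; first exact: smx_hol cF.1.
move=> z U'z; have [_ /(_ z U'z)[k0 _]] := hphi; have Uz := phiU U'z.
rewrite !(Dr_hol _ cF.1 U'z) !dt_Dr// !mul1r; have [_ /(_ _ Uz)[e1 l0 _ _]] := cF.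
have ek : 0 < complex.Re (k z) ^+ 2 + complex.Im (k z) ^+ 2.
  have : 0 < nc (k z) by rewrite nc_gt0.
  by rewrite /nc sqrtr_gt0.
rewrite iiE /iunit; case: (k z) ek => a b /= ek.
by split=> //; [rewrite -!expr2 mulr_gt0|ring|ring].
Qed.

(** As [k] does not vanish, both maps have the same tangent plane. *)
Lemma np_hol z (w : 'rV[R]_N) : U' z -> np (F \o phi) z w = np F (phi z) w.
Proof.
move=> U'z; have Uz := phiU U'z; have [_ /(_ z U'z)[k0 _]] := hphi.
have nn := normal_part_normal w Uo cF Uz.
have Kl u : exists b c, Dr u F (phi z) = b *: Dr 1 (F \o phi) z + c *: Dr ii (F \o phi) z.
  have := dird_mx_lin ((u : C) / k z) U'o (smx_hol cF.1) U'z.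
  rewrite (Dr_hol _ cF.1 U'z) divfK// => ->.
  by exists (complex.Re ((u : C) / k z)), (complex.Im ((u : C) / k z)).
apply: (np_uniq U'o conf_hol U'z).
  have /normal_vectorP[n1 n2 n3] := nn.
  have nu u : dt (np F (phi z) w) (Dr u F (phi z)) = 0.
    by rewrite (dird_mx_lin u Uo cF.1 Uz) dotDr !dotZr n2 n3 !mulr0 addr0.
  by apply/normal_vectorP; split=> //; rewrite (Dr_hol _ cF.1 U'z) nu.
have [a [b [c e]]] := np_tangE w Uo cF Uz.
have [b1 [c1 e1]] := Kl 1; have [b2 [c2 e2]] := Kl ii.
exists a, (b * b1 + c * b2), (b * c1 + c * c2).
rewrite e e1 e2 !scalerDr !scalerA !scalerDl -!addrA; congr (_ + _).
by congr (_ + _); exact: addrCA.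
Qed.

(** The derivative of [k] multiplies tangent vectors only and is removed by the normal projection,
    so the form changes as a tensor. *)
Lemma al_hol u v z : U' z -> al (F \o phi) u v z = al F ((u : C) * k z) ((v : C) * k z) (phi z).
Proof.
move=> U'z; have Uz := phiU U'z.
rewrite !alphaE np_hol//.
pose K1 w := complex.Re ((v : C) * k w); pose K2 w := complex.Im ((v : C) * k w).
have [sk1 sk2] : csm U' (fun w => (v : C) * k w) by apply: csmM => //; [exact: csm_cst|exact: csm_k].
have s1 : smx U' (Dr 1 F \o phi) by apply: smx_hol; exact: smx_dird cF.1.
have s2 : smx U' (Dr ii F \o phi) by apply: smx_hol; exact: smx_dird cF.1.
have e0 w : U' w -> K1 w *: (Dr 1 F \o phi) w + K2 w *: (Dr ii F \o phi) w = Dr v (F \o phi) w.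
  by move=> U'w; rewrite (Dr_hol _ cF.1 U'w) (dird_mx_lin _ Uo cF.1 (phiU U'w)).
rewrite -(dird_mx_ext u U'o e0 U'z).
rewrite (dird_mxD u (smxZ U'o sk1 s1) (smxZ U'o sk2 s2) U'z).
rewrite (dird_mxZ u U'o sk1 s1 U'z) (dird_mxZ u U'o sk2 s2 U'z).
rewrite !normal_partD !normal_partZ /comp/= (np_tan Uo cF 1 Uz) (np_tan Uo cF ii Uz) !scaler0 !add0r.
rewrite !(Dr_hol u (smx_dird _ Uo cF.1) U'z) -!alphaE.
rewrite [RHS](alphaC _ _ Uo cF Uz) [RHS](alpha_linl _ _ Uo cF Uz).
by rewrite (alphaC 1 ((u : C) * k z) Uo cF Uz) (alphaC ii ((u : C) * k z) Uo cF Uz).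
Qed.

(** Turning the tangent frame by the argument of [k] does not change the skew matrix, and scaling it
    by |k| is cancelled by the factor |k|^2 in [lam]. *)
Lemma sff_hol v z : U' z -> sff (F \o phi) v z = sff F ((v : C) * k z) (phi z).
Proof.
move=> U'z; have Uz := phiU U'z; have [_ /(_ z U'z)[k0 _]] := hphi.
apply/row_matrixP => i; rewrite !rowE !mul_sff lam_hol// !al_hol// !(Dr_hol _ cF.1 U'z).
set w := delta_mx _ _; set V := (v : C) * k z.
have aR u : al F V ((u : C) * k z) (phi z) = complex.Re ((u : C) * k z) *: al F V 1 (phi z) + complex.Im ((u : C) * k z) *: al F V ii (phi z).
  by rewrite (alphaC _ _ Uo cF Uz) (alpha_linl _ _ Uo cF Uz) !(alphaC _ V Uo cF Uz).
rewrite !aR !(dird_mx_lin (_ * k z) Uo cF.1 Uz) !mul1r.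
have -> : complex.Re ((ii : C) * k z) = - complex.Im (k z) by rewrite iiE /iunit; case: (k z) => a b /=; ring.
have -> : complex.Im ((ii : C) * k z) = complex.Re (k z) by rewrite iiE /iunit; case: (k z) => a b /=; ring.
have nk : nc (k z) ^+ 2 = complex.Re (k z) ^+ 2 + complex.Im (k z) ^+ 2.
  by rewrite /nc sqr_sqrtr// addr_ge0 ?sqr_ge0.
have nk0 : complex.Re (k z) ^+ 2 + complex.Im (k z) ^+ 2 != 0.
  by rewrite -nk expf_neq0// gt_eqF// nc_gt0.
have l0 : lam F (phi z) != 0 by have [_ /(_ _ Uz)[_ l0 _ _]] := cF; rewrite gt_eqF.
rewrite nk; move: (complex.Re (k z)) (complex.Im (k z)) (lam F (phi z)) nk0 l0 => a b l nk0 l0.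
move: (al F V 1 _) (al F V ii _) (Dr 1 F _) (Dr ii F _) => A1 A2 G1 G2.
rewrite !(dotDr, dotZr); apply/rowP => j; rewrite !mxE; field.
by rewrite nk0 l0.
Qed.

Lemma rot_hol e (Z : E -> 'M[R]_N) : rot U F e Z -> rot U' (F \o phi) e (Z \o phi).
Proof.
move=> [sZ oZ dZ]; split; first exact: smx_hol.
  by move=> z U'z; apply: oZ; exact: phiU.
move=> z v U'z; rewrite (Dr_hol v sZ U'z) dZ; last exact: phiU.
by rewrite sff_hol// mulrA.
Qed.

End HolComp.

(* A complex differentiable change of parameter between two smooth conformal immersions is smooth, since its derivative is read off the first derivatives of the immersions. *)
Lemma hol_bootstrap N (F : E -> 'rV[R]_N) U U' phi (k : E -> C) : open U -> open U' -> conf U F ->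
  (forall w, U' w -> U (phi w)) -> (forall w, U' w -> cfr phi w (k w)) ->
  smx U' (F \o phi) -> (forall w, U' w -> Dr 1 (F \o phi) w != 0) -> hol U' phi k.
Proof.
move=> Uo U'o cF phiU hk sH H0.
have dH w : U' w -> Dr 1 (F \o phi) w = Dr (k w) F (phi w).
  by move=> U'w; rewrite (isd_dird (Dr_comp1 1 Uo cF.1 (phiU w U'w) (hk w U'w))) mul1r.
have kE w : U' w -> complex.Re (k w) = dt (Dr 1 (F \o phi) w) (Dr 1 F (phi w)) * (lam F (phi w))^-1 /\
   complex.Im (k w) = dt (Dr 1 (F \o phi) w) (Dr ii F (phi w)) * (lam F (phi w))^-1.
  move=> U'w; have Uw := phiU w U'w.
  have l0 : lam F (phi w) != 0 by have [_ /(_ _ Uw)[_ l0 _ _]] := cF; rewrite gt_eqF.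
  rewrite dH// !(dt_Dr Uo cF)// iiE /iunit /=; split; by field.
have dphi u w : U' w -> Dr u (fre phi) w = complex.Re ((u : C) * k w) /\ Dr u (fim phi) w = complex.Im ((u : C) * k w).
  by move=> U'w; have [h1 h2] := cfr_isd u (hk w U'w); split; exact: isd_dird.
(* Order [n] of [phi] gives order [n] of [k] by [kE], and [k] is the derivative of [phi]. *)
have S n : Ck n U' (fre phi) /\ Ck n U' (fim phi).
  elim: n => [|n [I1 I2]].
    split; split=> // w U'w; have [f1 f2] := cfr_frech (hk w U'w); [exact: frech_cont f1|exact: frech_cont f2].
  have CF (f : E -> R) : sm U f -> Ck n U' (f \o phi).
    move=> sf; apply: (Ck_ext U'o) (Ck_comp Uo U'o (sf n) _ I1 I2) => w U'w; rewrite -?phiE//.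
    exact: phiU.
  have CD v : Ck n U' (fun w => dt (Dr 1 (F \o phi) w) (Dr v F (phi w)) * (lam F (phi w))^-1).
    apply: CkM => //; last by apply: (CF (fun w => (lam F w)^-1)); exact: lamV_smx.
    apply: (Ck_ext (f := fun w => \sum_i ent (Dr 1 (F \o phi)) 0 i w * (ent (Dr v F) 0 i \o phi) w) U'o).
      by move=> w _; rewrite dotE.
    apply: Ck_sum => // i _; apply: CkM => //; last by apply: CF; exact: (smx_dird v Uo cF.1 0 i).
    exact: (smx_dird 1 U'o sH 0 i n).
  have Ckk u : Ck n U' (fun w => complex.Re ((u : C) * k w)) /\ Ck n U' (fun w => complex.Im ((u : C) * k w)).
    split.
      apply: (Ck_ext U'o) (CkD U'o (CkM U'o (Ck_cst n U' (complex.Re u)) (CD 1)) (CkM U'o (Ck_cst n U' (- complex.Im u)) (CD ii))).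
      move=> w U'w; have [<- <-] := kE w U'w; case: (u) (k w) => a b [c d] /=; ring.
    apply: (Ck_ext U'o) (CkD U'o (CkM U'o (Ck_cst n U' (complex.Re u)) (CD ii)) (CkM U'o (Ck_cst n U' (complex.Im u)) (CD 1))).
    by move=> w U'w; have [<- <-] := kE w U'w; case: (u) (k w) => a b [c d] /=; ring.
  split; (split; [exact: Ck_cont I1 || exact: Ck_cont I2|split=> u]).
  - by move=> w U'w; have [h1 _] := cfr_isd u (hk w U'w); exact: isd_drv h1.
  - apply: (Ck_ext U'o) (Ckk u).1 => w U'w; by have [-> _] := dphi u w U'w.
  - by move=> w U'w; have [_ h1] := cfr_isd u (hk w U'w); exact: isd_drv h1.
  - apply: (Ck_ext U'o) (Ckk u).2 => w U'w; by have [_ ->] := dphi u w U'w.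
split; first by split=> n; have [] := S n.
move=> w U'w; split=> [|u]; last exact: dphi.
apply: contraNneq (H0 w U'w) => k0; rewrite dH// k0 (dird_mx_lin _ Uo cF.1 (phiU w U'w)) /=.
by rewrite !scale0r addr0.
Qed.

Lemma hol_cfr U phi (k : E -> C) z : open U -> hol U phi k -> U z -> cfr phi z (k z).
Proof.
move=> Uo [[s1 s2] h] Uz; have [_ {}h] := h z Uz.
have F1 := Ck_frech Uo (s1 1%N) Uz; have F2 := Ck_frech Uo (s2 1%N) Uz.
have [a1 a2] := h 1; have [b1 b2] := h ii; rewrite mul1r in a1 a2.
rewrite /frech0 a1 b1 in F1; rewrite /frech0 a2 b2 in F2.
move=> e e0; have e4 : 0 < e / 4 by rewrite divr_gt0.
have [d1 d10 h1] := F1 _ e4; have [d2 d20 h2] := F2 _ e4.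
exists (Num.min d1 d2) => [|w]; first by rewrite lt_min d10.
rewrite lt_min => /andP[w1 w2].
have {h1}h1 := h1 _ _ (le_lt_trans (nc_Re w) w1) (le_lt_trans (nc_Im w) w1).
have {h2}h2 := h2 _ _ (le_lt_trans (nc_Re w) w2) (le_lt_trans (nc_Im w) w2).
rewrite -mkCE in h1 h2.
apply: le_trans (nc_sum _) _.
have c1 := nc_Re w; have c2 := nc_Im w.
have -> : complex.Re (phi (z + w) - phi z - k z * w) = fre phi (z + w) - fre phi z - (complex.Re (k z) * complex.Re w + complex.Re ((ii : C) * k z) * complex.Im w).
  by rewrite iiE /iunit /fre; move: (phi (z + w)); case: (phi z) (k z) (w) => [? ?] [? ?] [? ?] [? ?] /=; ring.
have -> : complex.Im (phi (z + w) - phi z - k z * w) = fim phi (z + w) - fim phi z - (complex.Im (k z) * complex.Re w + complex.Im ((ii : C) * k z) * complex.Im w).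
  by rewrite iiE /iunit /fim; move: (phi (z + w)); case: (phi z) (k z) (w) => [? ?] [? ?] [? ?] [? ?] /=; ring.
apply: le_trans (lerD h1 h2) _.
have : e / 4 * (`|complex.Re w| + `|complex.Im w|) <= e / 4 * (nc w + nc w).
  by apply: ler_wpM2l; [exact: ltW|exact: lerD].
move: (e / 4 * (`|_| + `|_|)) (nc w) => x y; lra.
Qed.

(** The derivative of [psi] is 1/k composed with [psi], so each order of smoothness of [psi] gives
    the next. *)
Lemma hol_inverse U' W phi psi (k : E -> C) : open U' -> open W -> hol U' phi k ->
  (forall y, W y -> U' (psi y)) -> (forall y, W y -> phi (psi y) = y) ->
  (forall y, W y -> {for y, continuous psi}) -> hol W psi (fun y => (k (psi y))^-1).
Proof.
move=> U'o Wo hphi WU inv pc.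
have k0 y : W y -> k (psi y) != 0 by move=> Wy; have [_ /(_ _ (WU y Wy))[]] := hphi.
have hk y : W y -> cfr psi y (k (psi y))^-1.
  move=> Wy; apply: (@cfr_inverse phi psi y (k (psi y))).
  - exact: hol_cfr hphi (WU y Wy).
  - exact: k0.
  - by apply: near_open Wy _.
  - exact: pc.
have dpsi u w : W w -> Dr u (fre psi) w = complex.Re ((u : C) * (k (psi w))^-1) /\ Dr u (fim psi) w = complex.Im ((u : C) * (k (psi w))^-1).
  by move=> Ww; have [h1 h2] := cfr_isd u (hk w Ww); split; exact: isd_dird.
have [sk1 sk2] := csm_k U'o hphi.
have S n : Ck n W (fre psi) /\ Ck n W (fim psi).
  elim: n => [|n [I1 I2]].
    split; split=> // w Ww; have [f1 f2] := cfr_frech (hk w Ww); [exact: frech_cont f1|exact: frech_cont f2].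
  have CF (f : E -> R) : sm U' f -> Ck n W (f \o psi).
    move=> sf; apply: (Ck_ext Wo) (Ck_comp U'o Wo (sf n) _ I1 I2) => w Ww; rewrite -?phiE//.
    exact: WU.
  have r1 := CF _ sk1; have r2 := CF _ sk2.
  have n0 w : W w -> (fre k \o psi) w * (fre k \o psi) w + (fim k \o psi) w * (fim k \o psi) w != 0.
    move=> Ww; have := k0 w Ww; rewrite /fre /fim /= -nc_gt0 /nc sqrtr_gt0 !expr2 => ?.
    by rewrite gt_eqF.
  have rn := CkV Wo n0 (CkD Wo (CkM Wo r1 r1) (CkM Wo r2 r2)).
  have inE w : W w -> (k (psi w))^-1 = Complex ((fre k \o psi) w * ((fre k \o psi) w * (fre k \o psi) w + (fim k \o psi) w * (fim k \o psi) w)^-1)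
       (- (fim k \o psi) w * ((fre k \o psi) w * (fre k \o psi) w + (fim k \o psi) w * (fim k \o psi) w)^-1).
    by move=> Ww; rewrite /fre /fim /=; case: (k (psi w)) => a b /=; rewrite {1}/GRing.inv/= !expr2 mulNr.
  have Ckk u : Ck n W (fun w => complex.Re ((u : C) * (k (psi w))^-1)) /\ Ck n W (fun w => complex.Im ((u : C) * (k (psi w))^-1)).
    have q1 := CkM Wo r1 rn; have q2 := CkM Wo (CkN Wo r2) rn.
    split.
      apply: (Ck_ext Wo) (CkD Wo (CkM Wo (Ck_cst n W (complex.Re u)) q1) (CkM Wo (Ck_cst n W (- complex.Im u)) q2)).
      by move=> w Ww; rewrite inE//; case: (u) => a b /=; rewrite mulNr.
    apply: (Ck_ext Wo) (CkD Wo (CkM Wo (Ck_cst n W (complex.Re u)) q2) (CkM Wo (Ck_cst n W (complex.Im u)) q1)).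
    by move=> w Ww; rewrite inE//; case: (u) => a b /=.
  split; (split; [exact: Ck_cont I1 || exact: Ck_cont I2|split=> u]).
  - by move=> w Ww; have [h1 _] := cfr_isd u (hk w Ww); exact: isd_drv h1.
  - apply: (Ck_ext Wo) (Ckk u).1 => w Ww; by have [-> _] := dpsi u w Ww.
  - by move=> w Ww; have [_ h1] := cfr_isd u (hk w Ww); exact: isd_drv h1.
  - apply: (Ck_ext Wo) (Ckk u).2 => w Ww; by have [_ ->] := dpsi u w Ww.
split; first by split=> n; have [] := S n.
by move=> w Ww; split=> [|u]; [rewrite invr_eq0 k0|exact: dpsi].
Qed.

End ComplexDerivative.

(** * Charts of the universal cover *)

Section CoverCharts.
Context {R : realType} {M Mt : topologicalType}.
Local Notation E := (Cplx R).
Local Notation C := (R[i]).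
Variables (X : riemann_surface R M) (Xt : riemann_surface R Mt) (P : Mt -> M).
Hypotheses (hP : universal_cover Xt X P).
Variables (N : nat) (F0 : M -> 'rV[R]_N).
Hypothesis F0c : forall c, atlas X c -> conf (cimg c) (loc F0 c).
Hypothesis F0P : forall c, atlas Xt c -> smx (cimg c) (loc (F0 \o P) c).
Hypothesis F0n : forall c z, atlas Xt c -> cimg c z -> Dr 1 (loc (F0 \o P) c) z != 0.

Lemma proj_chart c' c z0 : atlas Xt c' -> atlas X c -> cimg c' z0 -> cdom c (P (cinv c' z0)) ->
  exists W phi (k : E -> C), [/\ open W, W z0, W `<=` cimg c', hol W phi k &
    (phi = cmap c \o P \o cinv c') /\
    forall w, W w -> [/\ cdom c (P (cinv c' w)), cimg c (phi w) & cinv c (phi w) = P (cinv c' w)]].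
Proof.
move=> Xc' Xc cz cd; have [_ [Pc _ _] [_ hol_]] := hP.
have [[_ o2] n1 n2 n3 ic] := chart_homeo Xc'.
have [[do_ io_] m1 m2 m3 m4] := chart_homeo Xc.
pose W : set E := [set w | cimg c' w /\ cdom c (P (cinv c' w))].
pose phi : E -> E := cmap c \o P \o cinv c'.
have Wo : open W.
  rewrite openE => w [w1 w2]; apply: filterI; first exact: open_nbhs_nbhs.
  have nP : nbhs (P (cinv c' w)) (cdom c) by exact: open_nbhs_nbhs.
  exact: (ic w w1 _ (Pc (cinv c' w) _ nP)).
have hk w : exists k, W w -> cfr phi w k.
  have [Ww|nW] := pselect (W w); last by exists 0.
  by have [k hk] := derivable_cfr (hol_ c' c w Xc' Xc Ww.1 Ww.2); exists k.
have /choice[k {}hk] := hk.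
have PE w : W w -> cimg c (phi w) /\ cinv c (phi w) = P (cinv c' w) by move=> [w1 w2]; exact: m1.
have FE w : W w -> loc (F0 \o P) c' w = (loc F0 c \o phi) w.
  by move=> Ww; rewrite /loc /= (PE w Ww).2.
exists W, phi, k; split=> //; first by move=> w [].
  apply: (@hol_bootstrap _ _ (loc F0 c) (cimg c)) => //; first exact: F0c.
  - by move=> w Ww; have [] := PE w Ww.
  - by apply: (smx_ext Wo FE); apply: smx_sub (F0P Xc') => w [].
  - by move=> w Ww; rewrite -(dird_mx_ext 1 Wo FE Ww); apply: F0n => //; have [] := Ww.
by split=> // w Ww; have [] := PE w Ww; split=> //; have [] := Ww.
Qed.

(** A local section of the covering over one sheet, read in charts. It inverts the map of
    [proj_chart], so [hol_inverse] applies. *)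
Lemma lift_chart c z0 : atlas X c -> cimg c z0 ->
  exists c' W psi (k : E -> C), [/\ atlas Xt c', [/\ open W, W z0 & W `<=` cimg c], hol W psi k &
    forall w, W w -> cimg c' (psi w) /\ P (cinv c' (psi w)) = cinv c w].
Proof.
move=> Xc cz; have [_ [Pc Ps Pcov] _] := hP.
have [[_ co] m1 m2 _ ic] := chart_homeo Xc.
have [U [Uo Up [sh [Ush _ shP]]]] := Pcov (cinv c z0).
have [q Pq] := Ps (cinv c z0).
have [V shV Vq] : (\bigcup_(V in sh) V) q by rewrite -Ush /= Pq.
have [Vo [_ Vi _] Vop] := shP V shV.
have [c' Xc' c'q] := atlas_cover Xt q.
have [[do' _] n1 n2 mc' ic'] := chart_homeo Xc'.
have [i1 i2] := n1 q c'q; have [d1 d2] := m2 z0 cz.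
have [|W' [phi [k [W'o W'q W's hphi [phE hW']]]]] := proj_chart Xc' Xc i1 _.
  by rewrite i2 Pq.
have PI x y : V x -> V y -> P x = P y -> x = y.
  by move=> Vx Vy e; apply: Vi => //; rewrite inE.
(* The part of the sheet [V] that the chart sends into [A]. Its image under [P] is open for open
   [A], whence openness of [W] and continuity of the section. *)
pose Om (A : set E) : set Mt := V `&` [set x | cdom c' x /\ A (cmap c' x)].
have Omo A : open A -> open (Om A).
  move=> Ao; apply: openI => //; rewrite openE => x [x1 x2]; apply: filterI.
    exact: open_nbhs_nbhs.
  by apply: (mc' x x1); exact: open_nbhs_nbhs.
have OV A : Om A `<=` V by move=> x [].
pose W : set E := [set w | cimg c w /\ (P @` Om W') (cinv c w)].
have Wo : open W.
  rewrite openE => w [w1 w2]; apply: filterI; first exact: open_nbhs_nbhs.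
  apply: (ic w w1); apply: open_nbhs_nbhs; split=> //; exact: Vop (Omo _ W'o) (OV _).
(* Outside [W] the section takes the arbitrary value [q], so that choice applies to a total
   statement. *)
have sg w : exists x, W w -> Om W' x /\ P x = cinv c w.
  have [[_ [x ox e]]|nW] := pselect (W w); last by exists q.
  by exists x.
have /choice[sig {}sg] := sg.
exists c', W, (cmap c' \o sig), (fun y => (k (cmap c' (sig y)))^-1).
have cW w : W w -> W' (cmap c' (sig w)) by move=> /sg[[_ []]].
have cE w : W w -> cinv c' (cmap c' (sig w)) = sig w by move=> /sg[[_ [/n1[]]]].
split=> //.
- split=> //; last by move=> w [].
  by split=> //; exists q => //; split=> //=; split.
- apply: (@hol_inverse _ W' W phi (cmap c' \o sig) k) => //.
    by move=> y Wy; rewrite phE /= cE//; have [_ ->] := sg y Wy; have [y1 _] := Wy; have [] := m2 y y1.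
  move=> y Wy A /= A0; have [B [Bo By] BA] : exists2 B, open B /\ B (cmap c' (sig y)) & B `<=` A.
    by move: A0; rewrite nbhsE => -[B [? ?] ?]; exists B.
  have [[Vy [dy _]] ey] := sg y Wy; have [y1 _] := Wy.
  have : nbhs (cinv c y) (P @` Om B).
    apply: open_nbhs_nbhs; split; first exact: Vop (Omo _ Bo) (OV _).
    by exists (sig y) => //; split=> //=; split.
  move=> /(ic y y1) nB; rewrite /nbhs/=.
  apply: filterS2 (open_nbhs_nbhs (conj Wo Wy)) nB => w Ww [x [Vx [dx Bx]] ex].
  have [[Vw _] ew] := sg w Ww; apply: BA.
  by rewrite /= -(PI x (sig w))// ex ew.
move=> w Ww; rewrite /= cE//; have [_ ->] := sg w Ww; split=> //.
exact: W's (cW w Ww).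
Qed.

End CoverCharts.

(** * The associated family *)

Section GlobalRotations.
Context {R : realType} {M : topologicalType}.
Local Notation E := (Cplx R).
Local Notation C := (R[i]).
Variable X : riemann_surface R M.

Lemma dtdot {q} (u v : 'rV[R]_q) : dt u v = dot u v.
Proof. exact: dtE. Qed.

Lemma chart_spread (Q : set M) (q0 : M) : Q q0 ->
  (forall c z0, atlas X c -> cimg c z0 -> exists2 r, 0 < r &
    forall z1 z2, cimg c z1 -> cimg c z2 -> box z0 r z1 -> box z0 r z2 -> Q (cinv c z1) -> Q (cinv c z2)) ->
  forall p, Q p.
Proof.
move=> Qq0 h; apply: connected_spread Qq0 _; first exact: surface_connected X.
move=> p; have [c Xc cp] := atlas_cover X p; have [[od oi] h1 h2 h3 h4] := chart_homeo Xc.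
have [cz e] := h1 p cp; have [r r0 hr] := h c _ Xc cz.
have : nbhs p (cdom c `&` [set q | box (cmap c p) r (cmap c q)]).
  apply: filterI; first exact: open_nbhs_nbhs.
  by apply: (h3 p cp); exact: box_nbhs.
rewrite nbhsE => -[V [Vo Vp] sV].
exists V; split=> // q q' /sV[cq bq] /sV[cq' bq'].
have [i1 <-] := h1 q cq; have [i2 <-] := h1 q' cq'; exact: hr.
Qed.

Lemma const_box {p q} U (F : E -> 'M[R]_(p, q)) z0 : open U -> smx U F -> U z0 ->
  (\forall z \near z0, Dr 1 F z = 0 /\ Dr ii F z = 0) ->
  exists2 r, 0 < r & forall z, box z0 r z -> U z /\ F z = F z0.
Proof.
move=> Uo sF Uz h; have /nbhsCP[r r0 hr] : nbhs z0 (U `&` [set z | Dr 1 F z = 0 /\ Dr ii F z = 0]).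
  by apply: filterI h; exact: open_nbhs_nbhs.
have br z : box z0 r z -> U z /\ (Dr 1 F z = 0 /\ Dr ii F z = 0).
  by move=> /boxP[a [b [-> ha hb]]]; exact: hr.
exists r => // z bz; split; first by have [] := br z bz.
have sF' : smx (box z0 r) F by apply: smx_sub sF => w /br[].
have : nrm (F z - F z0) <= (p * q)%:R * 0.
  apply: box_mvt sF' bz _ => w bw; have [Uw [e1 e2]] := br w bw.
  by rewrite (dird_mx_lin _ Uo sF Uw) e1 e2 !scaler0 addr0 nrm0.
rewrite mulr0 => n0; apply/matrixP => i j; apply/eqP; rewrite -subr_eq0 -normr_le0.
exact: le_trans (nrm_entB _ _ _ _) n0.
Qed.

Lemma const_connected {p q} (G : M -> 'M[R]_(p, q)) :
  (forall c, atlas X c -> smx (cimg c) (loc G c)) ->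
  (forall c z u, atlas X c -> cimg c z -> Dr u (loc G c) z = 0) -> forall x y, G x = G y.
Proof.
move=> sG dG x y; apply/esym; move: y; apply: chart_spread => // c z0 Xc cz.
have [|r r0 hr] := const_box (imgo Xc) (sG c Xc) cz.
  by apply: near_open (imgo Xc) cz _ => z cz'; rewrite !dG.
exists r => // z1 z2 _ _ /hr[_ e1] /hr[_ e2] <-.
by have : loc G c z2 = loc G c z1 by rewrite e1 e2.
Qed.

Lemma chart_cover (Q : set M) : (forall c z, atlas X c -> cimg c z -> Q (cinv c z)) -> forall p, Q p.
Proof.
move=> h p; have [c Xc cp] := atlas_cover X p; have [_ h1 _ _ _] := chart_homeo Xc.
by have [i1 <-] := h1 p cp; exact: h.
Qed.

Lemma conformal_conf {N} (f : M -> 'rV[R]_N) : (forall p, dot (f p) (f p) = 1) ->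
  conformal_immersion X f <-> forall c, atlas X c -> conf (cimg c) (loc f c).
Proof.
move=> f1; split=> [[sf cf] c Xc|h].
  split; first by apply/(smooth_smx _ (imgo Xc)); exact: sf.
  move=> z cz; have [a b d] := cf c z Xc cz; rewrite -!DrE -iiE -!dtdot in a b d *.
  by split; [rewrite dtdot; exact: f1|exact: a|exact: b|exact: d].
split=> [c Xc|c z Xc cz]; first by apply/(smooth_smx _ (imgo Xc)); have [] := h c Xc.
by have [_ /(_ z cz)[_ a b d]] := h c Xc; rewrite /= -!DrE -iiE -!dtdot; split.
Qed.

Lemma minimalP {n} (f : M -> 'rV[R]_n.+1) : minimal_surface X f <->
  (forall c, atlas X c -> conf (cimg c) (loc f c)) /\
  (forall c z, atlas X c -> cimg c z -> al (loc f c) 1 1 z + al (loc f c) ii ii z = 0).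
Proof.
split=> [[f1 cf mf]|[cf mf]].
  split; first exact/(conformal_conf f1).
  by move=> c z Xc cz; rewrite !al.unlock iiE; exact: mf.
have f1 p : dot (f p) (f p) = 1.
  by move: p; apply: chart_cover => c z Xc cz; have [_ /(_ z cz)[]] := cf c Xc; rewrite dtdot.
split; [exact: f1|by apply/(conformal_conf f1)|].
by move=> c z Xc cz; have := mf c z Xc cz; rewrite !al.unlock iiE.
Qed.

(** For a = x + i y the sum is x times the trace plus y times al(i, 1) - al(1, i), and the form is
    symmetric. *)
Lemma al_trace U N (F : E -> 'rV[R]_N) (a : E) z : open U -> conf U F -> U z ->
  al F 1 1 z + al F ii ii z = 0 -> al F (a * 1) 1 z + al F (a * ii) ii z = 0.
Proof.
move=> Uo cF Uz h; rewrite mulr1 (alpha_linl a _ Uo cF Uz) (alpha_linl (a * ii) _ Uo cF Uz).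
have -> : complex.Re (a * ii) = - complex.Im a by rewrite iiE /iunit; case: a => x y /=; ring.
have -> : complex.Im (a * ii) = complex.Re a by rewrite iiE /iunit; case: a => x y /=; ring.
rewrite (alphaC 1 ii Uo cF Uz) -[RHS](scaler0 _ (complex.Re a)) -h scalerDr.
by apply/rowP => j; rewrite !mxE; ring.
Qed.

(* [Z] carries [gam] to a surface whose second fundamental form is that of [gam] rotated by [1 + e]. *)
Definition grot {N} (gam : M -> 'rV[R]_N) e (Z : M -> 'M[R]_N) :=
  forall c, atlas X c -> rot (cimg c) (loc gam c) e (loc Z c).

Definition expi (t : R) : E := Complex (cos t) (sin t).

Section Associated.
Variables (n : nat) (gam : M -> 'rV[R]_n.+1).
Hypothesis cg : forall c, atlas X c -> conf (cimg c) (loc gam c).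

(** [Zmap] is formed in each chart. Its values on position, tangent and normal vectors are given by
    [h] and [T], which do not depend on the chart, so the local rotations glue. *)
Lemma associated_grot t (h : M -> 'rV[R]_n.+1) : associated X gam t h ->
  exists2 Z, grot gam (expi t - 1) Z & forall p, h p = gam p *m Z p.
Proof.
move=> [/minimalP[ch _] met [T [sT iT pT] aT]].
have hch c : atlas X c -> smx (cimg c) (loc T c) by move=> Xc; apply/(smooth_smx _ (imgo Xc)); exact: sT.
pose Zc c := Zmap (loc gam c) (loc h c) (loc T c).
have Zrot c : atlas X c -> rot (cimg c) (loc gam c) (expi t - 1) (Zc c).
  move=> Xc; apply: (Zmap_rot (imgo Xc) (cg Xc) (ch c Xc) (hch c Xc)).
  - by move=> z u v cz; rewrite !dtdot !DrE; exact: met.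
  - by move=> z v w cz; rewrite !dtdot; exact: iT.
  - move=> xi z u sx nx cz; rewrite !np.unlock !DrE.
    have sx' : smooth_on (cimg c) xi by apply/(smooth_smx _ (imgo Xc)).
    exact: (pT c (cimg c) xi Xc (imgo Xc) (fun w h => h) sx' nx z u cz).
  - by move=> z u v cz; rewrite !al.unlock; exact: aT.
have Zg c z : atlas X c -> cimg c z -> loc gam c z *m Zc c z = loc h c z.
  by move=> Xc cz; exact: (Zmap_gam _ _ (imgo Xc) (cg Xc)).
have ZD c z u : atlas X c -> cimg c z -> Dr u (loc gam c) z *m Zc c z = Dr u (loc h c) z.
  by move=> Xc cz; exact: (Zmap_Dr _ (imgo Xc) (cg Xc) (ch c Xc)).
have ZN c z w : atlas X c -> cimg c z -> normal_vector (loc gam c) z w -> w *m Zc c z = w *m loc T c z.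
  by move=> Xc cz; exact: (Zmap_normal _ _ (imgo Xc) (cg Xc)).
have indep c d p : atlas X c -> atlas X d -> cdom c p -> cdom d p -> Zc c (cmap c p) = Zc d (cmap d p).
  move=> Xc Xd cp dp.
  have [[_ _] m1 m2 m3 m4] := chart_homeo Xc; have [i1 i2] := m1 p cp.
  have [[_ _] n1 n2 n3 n4] := chart_homeo Xd; have [j1 j2] := n1 p dp.
  set z := cmap c p in i1 i2 *; set w := cmap d p in j1 j2 *.
  (* Only the derivative of the transition map at the single point [z] enters the comparison. *)
  have [|k hk] := @derivable_cfr R (cmap d \o cinv c) z.
    by apply: (chart_holomorphic Xc Xd i1); rewrite i2.
  have ez : (cmap d \o cinv c) z = w by rewrite /= i2.
  have nd : \forall x \near z, cdom d (cinv c x).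
    by apply: (m4 z i1); rewrite i2; apply: open_nbhs_nbhs; split=> //; have [[]] := chart_homeo Xd.
  have tr q (f : M -> 'rV[R]_q) u : smx (cimg d) (loc f d) -> Dr u (loc f c) z = Dr ((u : C) * k) (loc f d) w.
    move=> sf; have := @Dr_comp1 R _ _ (loc f d) (cimg d) (cmap d \o cinv c) z k u (imgo Xd) sf.
    rewrite ez => /(_ j1 hk)/isd_dird <-; apply: dird_near; apply: filterS nd => x /n1[_ ex].
    by rewrite /loc /= ex.
  have Lk u : Dr u (loc gam c) z = Dr ((u : C) * k) (loc gam d) w by apply: tr; have [] := cg Xd.
  have Lh u : Dr u (loc h c) z = Dr ((u : C) * k) (loc h d) w by apply: tr; have [] := ch d Xd.
  have lE q (f : M -> 'rV[R]_q) : loc f c z = loc f d w by rewrite /loc /= i2 j2.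
  have LT : loc T c z = loc T d w by rewrite /loc /= i2 j2.
  have k0 : k != 0.
    have [_ /(_ z i1)[_ l0 _ _]] := cg Xc; apply: contraTneq l0 => k0.
    by rewrite Lk k0 mulr0 (dird_mx_lin 0 (imgo Xd) (cg Xd).1 j1) /= !scale0r addr0 dot0l ltxx.
  have Lk' u : Dr u (loc gam d) w = Dr ((u : C) / k) (loc gam c) z by rewrite Lk divfK.
  have Lh' u : Dr u (loc h d) w = Dr ((u : C) / k) (loc h c) z by rewrite Lh divfK.
  have nn x : normal_vector (loc gam d) w x -> normal_vector (loc gam c) z x.
    move=> /normal_vectorP[a b e]; apply/normal_vectorP; rewrite !lE.
    have nu u : dt x (Dr u (loc gam d) w) = 0.
      by rewrite (dird_mx_lin u (imgo Xd) (cg Xd).1 j1) dotDr !dotZr b e !mulr0 addr0.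
    by rewrite !Lk !nu.
  have e0 : loc gam d w *m Zc c z = loc gam d w *m Zc d w by rewrite (Zg d w Xd j1) -(lE _ gam) (Zg c z Xc i1) lE.
  have eu u : Dr u (loc gam d) w *m Zc c z = Dr u (loc gam d) w *m Zc d w.
    by rewrite (ZD d w u Xd j1) Lk' (ZD c z _ Xc i1) Lh'.
  have en x : normal_vector (loc gam d) w x -> x *m Zc c z = x *m Zc d w.
    by move=> nx; rewrite (ZN d w x Xd j1 nx) (ZN c z x Xc i1 (nn x nx)) LT.
  apply/row_matrixP => i; rewrite !rowE; move: (delta_mx 0 i) => x.
  rewrite (split_frame (imgo Xd) (cg Xd) x j1).
  have {}en := en _ (normal_part_normal x (imgo Xd) (cg Xd) j1).
  have e1 := eu 1; have e2 := eu ii.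
  move: (Zc c z) (Zc d w) e0 e1 e2 en => A B e0 e1 e2 en.
  by rewrite !mulmxDl -!scalemxAl !mulmxDl -!scalemxAl e0 e1 e2 en.
have /choice[ch_ hch_] : forall p, exists c, atlas X c /\ cdom c p.
  by move=> p; have [c] := atlas_cover X p; exists c.
pose Z p := Zc (ch_ p) (cmap (ch_ p) p).
have ZE c z : atlas X c -> cimg c z -> loc Z c z = Zc c z.
  move=> Xc cz; have [_ _ /(_ z cz)[m1 m2] _ _] := chart_homeo Xc.
  have [a b] := hch_ (cinv c z).
  by rewrite /loc /= /Z (indep _ c _ a Xc b m1) m2.
exists Z; last by apply: chart_cover => c z Xc cz; have := Zg c z Xc cz; rewrite -ZE.
move=> c Xc; have [s1 s2 s3] := Zrot c Xc; have Uo := imgo Xc; split.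
- by apply: smx_ext s1 => // w cw; rewrite ZE.
- by move=> z cz; rewrite ZE// s2.
- move=> z v cz; rewrite (dird_mx_ext v Uo (fun w cw => ZE c w Xc cw) cz) ZE//; exact: s3.
Qed.

Hypothesis mg : forall c z, atlas X c -> cimg c z -> al (loc gam c) 1 1 z + al (loc gam c) ii ii z = 0.

Lemma grot_minimal e Z : grot gam e Z -> minimal_surface X (fun p => gam p *m Z p).
Proof.
move=> hZ; apply/minimalP; split=> [c Xc|c z Xc cz].
  exact: rot_conf (imgo Xc) (cg Xc) (hZ c Xc).
have aE u v := rot_al (imgo Xc) (cg Xc) (hZ c Xc) u v cz.
rewrite [al _ 1 1 z]aE [al _ ii ii z]aE -mulmxDl.
by rewrite (al_trace (1 + e) (imgo Xc) (cg Xc) cz) ?mul0mx//; exact: mg.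
Qed.

Lemma grot_isometric e Z : grot gam e Z -> isometric X (fun p => gam p *m Z p) gam.
Proof.
by move=> hZ c z u v Xc cz; rewrite -!dtdot -!DrE; exact: (rot_isometric (imgo Xc) (cg Xc) (hZ c Xc)).
Qed.

(** [Z] itself serves as the isometry of normal bundles. *)
Lemma grot_associated t Z : grot gam (expi t - 1) Z -> associated X gam t (fun p => gam p *m Z p).
Proof.
move=> hZ; split; [exact: grot_minimal hZ|exact: grot_isometric hZ|].
exists Z.
  split.
  - by move=> c Xc; apply/(smooth_smx _ (imgo Xc)); have [] := hZ c Xc.
  - move=> c z v w Xc cz nv nw; split; first exact: (rot_normal (imgo Xc) (cg Xc) (hZ c Xc)).
    by rewrite -!dtdot dt_isom//; have [_ o_ _] := hZ c Xc; exact: o_.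
  - move=> c U xi Xc Uo sU sx nx z u Uz; rewrite /nabla_perp -!DrE.
    have := @rot_parallel R _ (cimg c) (loc gam c) (expi t - 1) (loc Z c) (imgo Xc) (cg Xc) (hZ c Xc) U xi u z Uo sU.
    by rewrite !np.unlock; apply => //; apply/(smooth_smx _ Uo).
move=> c z u v Xc cz; have := rot_al (imgo Xc) (cg Xc) (hZ c Xc) u v cz.
by rewrite addrC subrK !al.unlock.
Qed.

(** A constant rotation on the right is a congruence of the ambient sphere; it allows a solution to
    be normalised at a chosen point. *)
Lemma grot_mulr e Z (B : 'M[R]_n.+1) : B *m B^T = 1%:M -> grot gam e Z -> grot gam e (fun p => Z p *m B).
Proof.
move=> hB hZ c Xc; have [s1 s2 s3] := hZ c Xc; have Uo := imgo Xc; split.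
- exact: smxM Uo s1 (smx_cst _ _).
- by move=> z cz; rewrite /loc /= trmx_mul mulmxA -(mulmxA _ B) hB mulmx1; exact: s2.
- move=> z v cz; rewrite (dird_mxM v Uo s1 (smx_cst _ _) cz) dird_mx_cst mulmx0 addr0 s3//.
  by rewrite mulmxA.
Qed.

End Associated.
End GlobalRotations.

(** * Pseudoholomorphic curves in the five-sphere *)

Section CrossProduct.
Context {R : realType}.
Local Notation E := (Cplx R).
Local Notation cr := (@cayley_cross R).

(** Numerals as indices: identities of the cross product become polynomial identities in seven named
    coordinates, within reach of [ring]. *)
Definition i7 (k : nat) : 'I_7 := inord k.

Lemma i7E (k : 'I_7) : k = i7 k.
Proof. by rewrite /i7 inord_val. Qed.

Lemma crE (u v : 'rV[R]_7) (k : nat) : (k < 7)%N -> cr u v 0 (i7 k) =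
  (u 0 (i7 ((k + 1) %% 7)) * v 0 (i7 ((k + 3) %% 7)) - u 0 (i7 ((k + 3) %% 7)) * v 0 (i7 ((k + 1) %% 7))) +
  (u 0 (i7 ((k + 2) %% 7)) * v 0 (i7 ((k + 6) %% 7)) - u 0 (i7 ((k + 6) %% 7)) * v 0 (i7 ((k + 2) %% 7))) +
  (u 0 (i7 ((k + 4) %% 7)) * v 0 (i7 ((k + 5) %% 7)) - u 0 (i7 ((k + 5) %% 7)) * v 0 (i7 ((k + 4) %% 7))).
Proof.
move=> k7; rewrite mxE; cbv zeta beta.
congr (_ - _ + (_ - _) + (_ - _)); congr (u 0 _ * v 0 _); apply: val_inj.
all: by rewrite /= /i7 !inordK ?ltn_mod.
Qed.

Lemma sum7 (f : 'I_7 -> R) : \sum_i f i = f (i7 0) + f (i7 1) + f (i7 2) + f (i7 3) + f (i7 4) + f (i7 5) + f (i7 6).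
Proof.
rewrite !big_ord_recl big_ord0 addr0 !addrA; do !congr (_ + _); congr (f _).
all: by apply: val_inj; rewrite /i7 /= inordK.
Qed.

Lemma row7P (u v : 'rV[R]_7) : (forall k, (k < 7)%N -> u 0 (i7 k) = v 0 (i7 k)) -> u = v.
Proof. by move=> h; apply/rowP => k; rewrite (i7E k) h. Qed.

Lemma cr_triple (u v w : 'rV[R]_7) : dt (cr u v) w = dt u (cr v w).
Proof. by rewrite !dotE !sum7 !crE//=; ring. Qed.

Lemma crC (u v : 'rV[R]_7) : cr u v = - cr v u.
Proof. by apply: row7P => k k7; rewrite [RHS]mxE !crE//; ring. Qed.

Lemma cr_cr (u v : 'rV[R]_7) : cr u (cr v u) = dt u u *: v - dt u v *: u.
Proof.
apply: row7P => k k7; rewrite [RHS]mxE [X in _ = X + _]mxE [X in _ = _ + X]mxE [X in _ = _ - X]mxE [LHS]crE// !dotE !sum7.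
by do 7!(case: k k7 => [_|k k7]; first by rewrite !crE//=; ring).
Qed.

Lemma crDl (u v w : 'rV[R]_7) : cr (u + v) w = cr u w + cr v w.
Proof. by apply: row7P => k k7; rewrite [RHS]mxE ?[X in _ = X + _]crE ?crE// !mxE; ring. Qed.
Lemma crZl a (u v : 'rV[R]_7) : cr (a *: u) v = a *: cr u v.
Proof. by apply: row7P => k k7; rewrite [RHS]mxE ?[X in _ = X + _]crE ?crE// !mxE; ring. Qed.

Lemma crNr (u v : 'rV[R]_7) : cr u (- v) = - cr u v.
Proof. by rewrite crC -[- v]scaleN1r crZl scaleN1r opprK crC. Qed.

Lemma smx_cr U (G H : E -> 'rV[R]_7) : open U -> smx U G -> smx U H -> smx U (fun w => cr (G w) (H w)).
Proof.
move=> Uo sG sH i b; rewrite ord1 (i7E b); have b7 : (b < 7)%N := ltn_ord b.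
have S c d : sm U (fun w => G w 0 c * H w 0 d) by apply: smM => //; [exact: sG|exact: sH].
have S2 c d : sm U (fun w => G w 0 c * H w 0 d - G w 0 d * H w 0 c) := smB Uo (S c d) (S d c).
have := fun c d c' d' c'' d'' => smD Uo (smD Uo (S2 c d) (S2 c' d')) (S2 c'' d'').
by move=> S3; apply: (fun e => sm_ext Uo e (S3 _ _ _ _ _ _)) => w Uw; rewrite /ent crE.
Qed.

Lemma dird_cr U (G H : E -> 'rV[R]_7) (u z : E) : open U -> smx U G -> smx U H -> U z ->
  Dr u (fun w => cr (G w) (H w)) z = cr (Dr u G z) (H z) + cr (G z) (Dr u H z).
Proof.
move=> Uo sG sH Uz; apply/rowP => j; rewrite (i7E j); set k := (j : nat); have k7 : (k < 7)%N := ltn_ord j.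
have P a b : isd u (fun w => ent G 0 a w * ent H 0 b w - ent G 0 b w * ent H 0 a w) z
    (Dr u G z 0 a * H z 0 b + G z 0 a * Dr u H z 0 b - (Dr u G z 0 b * H z 0 a + G z 0 b * Dr u H z 0 a)).
  have dG c : isd u (ent G 0 c) z (Dr u G z 0 c) by rewrite (dird_mxE u 0 c sG Uz); apply: drv_isd; exact: sm_drv (sG 0 c) Uz.
  have dH c : isd u (ent H 0 c) z (Dr u H z 0 c) by rewrite (dird_mxE u 0 c sH Uz); apply: drv_isd; exact: sm_drv (sH 0 c) Uz.
  have M c d := isdM (dG c) (dH d).
  exact: isdD (M a b) (isdN (M b a)).
have D0 := isdD (isdD (P (i7 ((k + 1) %% 7)) (i7 ((k + 3) %% 7))) (P (i7 ((k + 2) %% 7)) (i7 ((k + 6) %% 7)))) (P (i7 ((k + 4) %% 7)) (i7 ((k + 5) %% 7))).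
rewrite [RHS]mxE [X in _ = X + _]crE// [X in _ = _ + X]crE//.
rewrite (@dird_mxE R 1 7 (fun w => cr (G w) (H w)) U u z 0 (i7 k) (smx_cr Uo sG sH) Uz).
apply: (etrans _ (etrans (isd_dird D0) _)); last by ring.
by congr (Dr u _ z); apply/funext => w; rewrite [LHS]/ent crE.
Qed.

Lemma cr_mx (e : 'rV[R]_7) : exists K, forall x, x *m K = cr e x.
Proof.
exists (\matrix_(i < 7) cr e (delta_mx 0 i)) => x.
have cD y w : cr e (y + w) = cr e y + cr e w by rewrite crC crDl opprD -!crC.
have cZ a y : cr e (a *: y) = a *: cr e y by rewrite crC crZl -scalerN -crC.
have c0 : cr e 0 = 0 by have := cZ 0 0; rewrite !scale0r.
rewrite mulmx_sum_row [in RHS](row_sum_delta x) (big_morph (cr e) cD c0).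
by apply: eq_bigr => i _; rewrite rowK cZ.
Qed.

End CrossProduct.

Section JStructure.
Context {R : realType}.
Local Notation E := (Cplx R).
Local Notation C := (R[i]).

(* The structure that a pseudoholomorphic curve inherits from S^5 in S^6, where
   [J] is the Cayley product by the unit normal of S^5. *)
Definition jcurve {N} (U : set E) (gam : E -> 'rV[R]_N) (J : 'M[R]_N) :=
  [/\ conf U gam, J^T = - J, J *m J = - 1%:M &
   forall z, U z -> [/\ dt (Dr 1 gam z) (gam z *m J) = 0, dt (Dr ii gam z) (gam z *m J) = 0,
     dt (Dr 1 gam z) (Dr ii gam z *m J) = 0 &
     Dr 1 (Dr 1 gam) z + Dr ii (Dr ii gam) z = - (2 * lam gam z) *: gam z]].

(** [e] is the unit normal of the hyperplane. Stacking [A] and [e] gives an orthogonal 7 by 7 matrix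
    [Q], and the last identity is Q^T Q = 1. *)
Lemma unit_kernel (A : 'M[R]_(6, 7)) : A *m A^T = 1%:M ->
  exists2 e : 'rV[R]_7, dt e e = 1 & e *m A^T = 0 /\ A^T *m A = 1%:M - e^T *m e.
Proof.
move=> hA; pose K := kermx A^T; have rA : \rank A^T = 6.
  have := mxrankM_maxl A A^T; rewrite hA mxrank1 mxrank_tr => h.
  by apply/eqP; rewrite eqn_leq h andbT rank_leq_row.
have rK : \rank K = 1%N by rewrite mxrank_ker rA.
have K0 : row_base K != 0 by rewrite -mxrank_eq0 eq_row_base rK.
have [e0 e00 he0] : exists2 e0 : 'rV[R]_7, e0 != 0 & e0 *m A^T = 0.
  have /rowV0Pn[v vK v0] : K != 0 by rewrite -mxrank_eq0 rK.
  by exists v => //; apply/sub_kermxP.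
have n0 : 0 < dt e0 e0.
  by rewrite lt_neqAle dot_ge0 andbT eq_sym; apply: contraNneq e00 => /dot_eq0->.
have s0 : 0 < Num.sqrt (dt e0 e0) by rewrite sqrtr_gt0.
exists ((Num.sqrt (dt e0 e0))^-1 *: e0).
  rewrite dotZl dotZr mulrA -expr2 exprVn sqr_sqrtr ?ltW// mulVf// gt_eqF//.
set e := _ *: e0; have he : e *m A^T = 0 by rewrite -scalemxAl he0 scaler0.
have ee : e *m e^T = 1%:M.
  rewrite mul_row_tr dotZl dotZr mulrA -expr2 exprVn sqr_sqrtr ?ltW// mulVf// gt_eqF//.
split=> //; pose Q := col_mx A e.
have QQ : Q *m Q^T = 1%:M.
  rewrite tr_col_mx mul_col_row hA ee he -[A *m e^T]trmxK trmx_mul trmxK he trmx0.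
  by rewrite -scalar_mx_block.
have := mulmx1C QQ; rewrite tr_col_mx mul_row_col => <-.
by rewrite addrK.
Qed.

(** Let # be the cross product and F the curve in S^6. Holomorphy says F_y = F # F_x and F_x = - F #
    F_y, hence F_x # F_y = lam F; all of these are orthogonal to [e]. Differentiating the two
    relations and adding cancels F # F_xy and leaves F_xx + F_yy = - 2 lam F. *)
Lemma pholo_jcurve U (gam : E -> 'rV[R]_6) (A : 'M[R]_(6, 7)) (e : 'rV[R]_7) K : open U -> conf U gam ->
  A *m A^T = 1%:M -> dt e e = 1 -> e *m A^T = 0 -> A^T *m A = 1%:M - e^T *m e ->
  (forall x, x *m K = cayley_cross e x) ->
  (forall z u, U z -> Dr (ii * u) gam z *m A = cayley_cross (gam z *m A) (Dr u gam z *m A)) ->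
  jcurve U gam (A *m K *m A^T).
Proof.
move=> Uo cg hA ee eA AA hK ph; have [sg _] := cg.
have trA (x y : 'rV[R]_6) : dt (x *m A) (y *m A) = dt x y by rewrite dotMl -mulmxA hA mulmx1.
have inA (x y : 'rV[R]_6) : x *m A = y *m A -> x = y.
  by move=> h; rewrite -[x]mulmx1 -[y]mulmx1 -hA !mulmxA h.
have dJ (x y : 'rV[R]_6) : dt x (y *m (A *m K *m A^T)) = dt e (cayley_cross (y *m A) (x *m A)).
  by rewrite dotC !mulmxA dotMl trmxK hK cr_triple.
have dt_eA (x : 'rV[R]_6) : dt e (x *m A) = 0 by rewrite dotC dotMl eA dot0r.
have phx z : U z -> Dr 1 gam z *m A = - cayley_cross (gam z *m A) (Dr ii gam z *m A).
  move=> Uz; rewrite -(ph z ii Uz) -mulNmx; congr (_ *m A).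
  rewrite (dird_mx_lin (ii * ii) Uo sg Uz) iiE /iunit /= !mul0r !mulr0 mulr1 addr0 sub0r.
  by rewrite scale0r addr0 scaleN1r opprK.
have phy z : U z -> Dr ii gam z *m A = cayley_cross (gam z *m A) (Dr 1 gam z *m A).
  by move=> Uz; rewrite -(ph z 1 Uz) mulr1.
have XY z : U z -> cayley_cross (Dr 1 gam z *m A) (Dr ii gam z *m A) = lam gam z *: (gam z *m A).
  by move=> Uz; rewrite phy// cr_cr !trA (conf_dot1 1 Uo cg Uz) scale0r subr0.
have sK : K^T = - K.
  have skew x y : dt (x *m K) y = - dt (y *m K) x by rewrite !hK !cr_triple (crC y) dotNr opprK.
  apply/matrixP => i j; rewrite !mxE.
  have dE i' j' : dt (delta_mx 0 i' *m K) (delta_mx 0 j' : 'rV[R]_7) = K i' j'.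
    rewrite dtE -rowE trmx_delta mxE (bigD1 j')//= big1 ?addr0; first by rewrite !mxE !eqxx mulr1.
    by move=> l /negPf lj; rewrite !mxE lj mulr0.
  by rewrite -!dE skew.
have KK : K *m K = e^T *m e - 1%:M.
  apply/row_matrixP => i; rewrite !rowE mulmxA !hK mulmxBr mulmx1 mul_tr_row.
  by rewrite (crC e (delta_mx 0 i)) crNr cr_cr ee scale1r opprB (dotC e).
split=> //.
- by rewrite !trmx_mul trmxK sK mulNmx mulmxN mulmxA.
- have eK : e *m K = 0 by rewrite hK; apply/eqP; rewrite -[X in X == 0]addr0; have := crC e e; move: (cayley_cross e e) => x; move=> h; rewrite addr0; apply/eqP/rowP => j; have := congr1 (fun y : 'rV_7 => y 0 j) h; rewrite !mxE; lra.
  rewrite -!mulmxA (mulmxA A^T A) AA mulmxBl mul1mx -(mulmxA e^T) (mulmxA e K) eK mul0mx mulmx0 subr0.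
  by rewrite (mulmxA K K) KK mulmxBl mul1mx -(mulmxA e^T) eA mulmx0 sub0r mulmxN hA.
move=> z Uz; split.
- by rewrite dJ -phy// dt_eA.
- by rewrite dJ -[X in dt e X]opprK -phx// -mulNmx dt_eA.
- by rewrite dJ crC dotNr XY// dotZr dt_eA mulr0 oppr0.
have sX u : smx U (fun w => Dr u gam w *m A) := smxM Uo (smx_dird u Uo sg) (smx_cst A U).
have sG : smx U (fun w => gam w *m A) := smxM Uo sg (smx_cst A U).
have dA u v : Dr u (Dr v gam) z *m A = Dr u (fun w => Dr v gam w *m A) z.
  by rewrite (dird_mxM u Uo (smx_dird v Uo sg) (smx_cst A U) Uz) dird_mx_cst mulmx0 addr0.
have dG u : Dr u (fun w => gam w *m A) z = Dr u gam z *m A.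
  by rewrite (dird_mxM u Uo sg (smx_cst A U) Uz) dird_mx_cst mulmx0 addr0.
apply: inA; rewrite mulmxDl !dA (dird_mx_ext 1 Uo phx Uz) (dird_mx_ext ii Uo phy Uz).
have scr u : smx U (fun w => cayley_cross (gam w *m A) (Dr u gam w *m A)).
  by apply: smx_cr.
rewrite (dird_mxN 1 (scr ii) Uz) (dird_cr 1 Uo sG (sX ii) Uz) (dird_cr ii Uo sG (sX 1) Uz) !dG -!dA.
rewrite (dird_mx_schwarz 1 ii Uo sg Uz) opprD -addrA [X in _ + X]addrCA addNr addr0.
rewrite (crC (Dr ii gam z *m A)) XY//.
by apply/rowP => j; rewrite -scalemxAl !mxE; ring.
Qed.

End JStructure.

(** * The complex frame *)

Section ComplexDot.
Context {R : realType}.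
Local Notation C := (R[i]).

Lemma cdotDl {q} (u v w : 'rV[C]_q) : cdot (u + v) w = cdot u w + cdot v w.
Proof. by rewrite !cdotE mulmxDl mxE. Qed.
Lemma cdotZl {q} a (u v : 'rV[C]_q) : cdot (a *: u) v = a * cdot u v.
Proof. by rewrite !cdotE -scalemxAl mxE. Qed.
Lemma cdotC {q} (u v : 'rV[C]_q) : cdot u v = cdot v u.
Proof. by rewrite !cdotE -[u *m v^T]trmxK trmx_mul trmxK mxE. Qed.
Lemma cdotDr {q} (u v w : 'rV[C]_q) : cdot w (u + v) = cdot w u + cdot w v.
Proof. by rewrite !(cdotC w) cdotDl. Qed.
Lemma cdotZr {q} a (u v : 'rV[C]_q) : cdot u (a *: v) = a * cdot u v.
Proof. by rewrite cdotC cdotZl cdotC. Qed.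
Lemma cdotNl {q} (u v : 'rV[C]_q) : cdot (- u) v = - cdot u v.
Proof. by rewrite -scaleN1r cdotZl mulN1r. Qed.
Lemma cdotNr {q} (u v : 'rV[C]_q) : cdot u (- v) = - cdot u v.
Proof. by rewrite cdotC cdotNl cdotC. Qed.
Lemma cdot0l {q} (v : 'rV[C]_q) : cdot 0 v = 0.
Proof. by rewrite cdotE mul0mx mxE. Qed.
Lemma cdot0r {q} (v : 'rV[C]_q) : cdot v 0 = 0.
Proof. by rewrite cdotC cdot0l. Qed.
Lemma cdotMl {p q} (u : 'rV[C]_p) (A : 'M[C]_(p, q)) v : cdot (u *m A) v = cdot u (v *m A^T).
Proof. by rewrite !cdotE trmx_mul trmxK mulmxA. Qed.
Lemma cdot_suml {q} (I : Type) (r : seq I) (P : pred I) (F : I -> 'rV[C]_q) v :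
  cdot (\sum_(i <- r | P i) F i) v = \sum_(i <- r | P i) cdot (F i) v.
Proof. by apply: (big_morph (fun x => cdot x v)) => [x y|]; [exact: cdotDl|exact: cdot0l]. Qed.
Lemma cdot_sumr {q} (I : Type) (r : seq I) (P : pred I) (F : I -> 'rV[C]_q) v :
  cdot v (\sum_(i <- r | P i) F i) = \sum_(i <- r | P i) cdot v (F i).
Proof. by rewrite cdotC cdot_suml; apply: eq_bigr => i _; rewrite cdotC. Qed.
Lemma cdot_rcm {q} (u v : 'rV[R]_q) : cdot (rcm u) (rcm v) = (dt u v)%:C%C.
Proof. by rewrite cdotE dtE /rcm map_trmx -map_mxM mxE. Qed.
Lemma rcm_tr {p q} (A : 'M[R]_(p, q)) : (rcm A)^T = rcm A^T.
Proof. by rewrite /rcm map_trmx. Qed.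
Lemma cdot_cj {q} (u v : 'rV[C]_q) : cdot (mcj u) (mcj v) = (cdot u v)^*%C.
Proof. by rewrite !cdotE /mcj map_trmx -map_mxM mxE. Qed.
Lemma mul_row_trC {q} (u v : 'rV[C]_q) : u *m v^T = (cdot u v)%:M.
Proof. by apply/matrixP => i j; rewrite !ord1 [RHS]mxE eqxx mulr1n cdotE. Qed.
Lemma mcjD {p q} (A B : 'M[C]_(p, q)) : mcj (A + B) = mcj A + mcj B.
Proof. by apply/matrixP => i j; rewrite !mxE rmorphD. Qed.
Lemma mcjN {p q} (A : 'M[C]_(p, q)) : mcj (- A) = - mcj A.
Proof. by apply/matrixP => i j; rewrite !mxE rmorphN. Qed.
Lemma mcjZ {p q} a (A : 'M[C]_(p, q)) : mcj (a *: A) = a^*%C *: mcj A.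
Proof. by apply/matrixP => i j; rewrite !mxE rmorphM. Qed.
Lemma mcj0 {p q} : mcj (0 : 'M[C]_(p, q)) = 0.
Proof. by apply/matrixP => i j; rewrite !mxE rmorph0. Qed.
Lemma mcj_sum {p q} (I : Type) (r : seq I) (P : pred I) (F : I -> 'M[C]_(p, q)) :
  mcj (\sum_(i <- r | P i) F i) = \sum_(i <- r | P i) mcj (F i).
Proof. by apply: (big_morph (@mcj R p q)) => [x y|]; [exact: mcjD|exact: mcj0]. Qed.
Lemma rcmD {p q} (A B : 'M[R]_(p, q)) : rcm (A + B) = rcm A + rcm B.
Proof. exact: map_mxD. Qed.
Lemma rcmN {p q} (A : 'M[R]_(p, q)) : rcm (- A) = - rcm A.
Proof. exact: map_mxN. Qed.
Lemma rcmZ {p q} a (A : 'M[R]_(p, q)) : rcm (a *: A) = a%:C%C *: rcm A.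
Proof. exact: map_mxZ. Qed.
Lemma rcm0 {p q} : rcm (0 : 'M[R]_(p, q)) = 0.
Proof. exact: map_mx0. Qed.
Lemma rcm1 {p} : rcm (1%:M : 'M[R]_p) = 1%:M.
Proof. exact: map_mx1. Qed.
Lemma ci2 : 'i%C * 'i%C = -1 :> C.
Proof. by rewrite -expr2 sqr_i. Qed.
Lemma two_C : (2 : C) != 0. Proof. by rewrite pnatr_eq0. Qed.

End ComplexDot.

Section ComplexFrame.
Context {R : realType}.
Local Notation E := (Cplx R).
Local Notation C := (R[i]).
Variables (U : set E) (gam : E -> 'rV[R]_6) (J : 'M[R]_6).
Hypotheses (Uo : open U) (jg : jcurve U gam J).

Let cg : conf U gam. Proof. by case: jg. Qed.
Let sg : smx U gam. Proof. exact: cg.1. Qed.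
Let JT : J^T = - J. Proof. by case: jg. Qed.
Let JJ : J *m J = - 1%:M. Proof. by case: jg. Qed.

Definition JC : 'M[C]_6 := rcm J.
Definition g0 z : 'rV[C]_6 := rcm (gam z).
Definition g1 : E -> 'rV[C]_6 := mdl g0.
Definition g1b z : 'rV[C]_6 := mcj (g1 z).
Definition Lc z : C := (lam gam z)%:C%C.
Definition Cq z : C := 2 * cdot (mdl g1 z) (g1 z *m JC).

Lemma JCT : JC^T = - JC. Proof. by rewrite /JC rcm_tr JT rcmN. Qed.
Lemma JCJ : JC *m JC = - 1%:M. Proof. by rewrite /JC -rcmM JJ rcmN rcm1. Qed.
Lemma JCcj : mcj JC = JC. Proof. exact: mcj_rcm. Qed.
Lemma mulJJ {p} (v : 'M[C]_(p, 6)) : v *m JC *m JC = - v.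
Proof. by rewrite -mulmxA JCJ mulmxN mulmx1. Qed.
Lemma cdotJ (u v : 'rV[C]_6) : cdot (u *m JC) v = - cdot u (v *m JC).
Proof. by rewrite cdotMl JCT mulmxN cdotNr. Qed.
Lemma cdotJJ (u v : 'rV[C]_6) : cdot (u *m JC) (v *m JC) = cdot u v.
Proof. by rewrite cdotJ mulJJ cdotNr opprK. Qed.
Lemma cdot_vJ (v : 'rV[C]_6) : cdot v (v *m JC) = 0.
Proof.
have h := cdotJ v v; rewrite cdotC in h.
have : 2 * cdot v (v *m JC) = 0 by rewrite mulr_natl mulr2n {1}h addNr.
by move=> /eqP; rewrite mulf_eq0 (negPf two_C) /= => /eqP.
Qed.

Lemma csm_g0 : csmx U g0. Proof. exact: csmx_rcm. Qed.
Lemma csm_g1 : csmx U g1. Proof. exact: csmx_mdl Uo csm_g0. Qed.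
Lemma csm_g1b : csmx U g1b. Proof. exact: csmx_cj Uo csm_g1. Qed.
Lemma csm_J {p} (F : E -> 'M[C]_(p, 6)) : csmx U F -> csmx U (fun w => F w *m JC).
Proof. by move=> sF; exact: csmxM Uo sF (csmx_cst JC U). Qed.
Lemma csm_Lc : csm U Lc.
Proof. by apply: csm_real; exact: sm_dot (smx_dird _ Uo sg) (smx_dird _ Uo sg). Qed.
Lemma csm_Cq : csm U Cq.
Proof.
apply: csmM => //; first exact: csm_cst.
exact: csm_cdot Uo (csmx_mdl Uo csm_g1) (csm_J csm_g1).
Qed.
Lemma mdlJ {p} (F : E -> 'M[C]_(p, 6)) z : csmx U F -> U z -> mdl (fun w => F w *m JC) z = mdl F z *m JC.
Proof. by move=> sF Uz; rewrite (mdlM Uo sF (csmx_cst JC U) Uz) mdl_cst mulmx0 addr0. Qed.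
Lemma mdlbJ {p} (F : E -> 'M[C]_(p, 6)) z : csmx U F -> U z -> mdlb (fun w => F w *m JC) z = mdlb F z *m JC.
Proof. by move=> sF Uz; rewrite (mdlbM Uo sF (csmx_cst JC U) Uz) mdlb_cst mulmx0 addr0. Qed.

Lemma g1E z : U z -> g1 z = 2^-1 *: (rcm (Dr 1 gam z) - 'i%C *: rcm (Dr ii gam z)).
Proof. by move=> Uz; exact: mdl_rcm sg Uz. Qed.
Lemma conj2V : ((2^-1 : C)^*)%C = 2^-1.
Proof. by rewrite fmorphV rmorph_nat. Qed.
Lemma conji : (('i%C : C)^*)%C = - 'i%C.
Proof. by apply: Cext; rewrite ?oppr0. Qed.
Lemma g1bE z : U z -> g1b z = 2^-1 *: (rcm (Dr 1 gam z) + 'i%C *: rcm (Dr ii gam z)).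
Proof.
by move=> Uz; rewrite /g1b g1E// mcjZ conj2V mcjD mcjN mcjZ !mcj_rcm conji scaleNr opprK.
Qed.
Lemma mdlb_g0 z : U z -> mdlb g0 z = g1b z.
Proof.
move=> Uz; rewrite /g1b /g1 -(mdlb_cj csm_g0 Uz).
by apply: (mdlb_ext Uo _ Uz) => w _; rewrite mcj_rcm.
Qed.

Lemma Lc0 z : U z -> Lc z != 0.
Proof. by move=> Uz; have [_ /(_ z Uz)[_ l0 _ _]] := cg; rewrite /Lc fmorph_eq0 gt_eqF. Qed.
Lemma Lcj z : (Lc z)^*%C = Lc z. Proof. exact: conjc_real. Qed.

Lemma frame_table z : U z ->
  [/\ cdot (g0 z) (g0 z) = 1, cdot (g0 z) (g1 z) = 0, cdot (g1 z) (g1 z) = 0 & cdot (g1 z) (g1b z) = Lc z / 2] /\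
  [/\ cdot (g1 z) (g0 z *m JC) = 0 & cdot (g1 z) (g1b z *m JC) = 0].
Proof.
move=> Uz; have [_ /(_ z Uz)[e1 e2 e3 e4]] := cg; have [_ _ _ /(_ z Uz)[f1 f2 f3 _]] := jg.
have d1 := conf_dot1 1 Uo cg Uz; have d2 := conf_dot1 ii Uo cg Uz.
have f4 : dt (Dr ii gam z) (Dr 1 gam z *m J) = 0.
  by rewrite dotC dotMl JT mulmxN dotNr f3 oppr0.
have sk (v : 'rV[R]_6) : dt v (v *m J) = 0.
  by have := dotMl v J v; rewrite JT mulmxN dotNr dotC; lra.
have rJ (v : 'rV[R]_6) : rcm v *m JC = rcm (v *m J) by rewrite rcmM.
have e3' : dt (Dr ii gam z) (Dr ii gam z) = lam gam z by rewrite e3.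
have e4' : dt (Dr ii gam z) (Dr 1 gam z) = 0 by rewrite dotC.
rewrite /g0 g1bE// g1E//; split; split; rewrite -?scalemxAl ?mulmxDl ?mulNmx -?scalemxAl ?rJ !(cdotZl, cdotZr, cdotDl, cdotDr, cdotNl, cdotNr, cdot_rcm).
- by rewrite e1.
- by rewrite !(dotC (gam z)) d1 d2; ring.
- rewrite e4 e4' e3' -/(lam gam z) -/(Lc z); move: (ci2 : 'i%C * 'i%C = -1 :> C); move: ('i%C : C) (Lc z) => x l h.
  by ring: h.
- rewrite e4 e4' e3' -/(lam gam z) -/(Lc z); move: (ci2 : 'i%C * 'i%C = -1 :> C); move: ('i%C : C) (Lc z) => x l h.
  by field: h.
- by rewrite f1 f2; ring.
- rewrite f3 f4 !sk; ring.
Qed.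

Lemma rcm_x z : U z -> rcm (Dr 1 gam z) = g1 z + g1b z.
Proof.
move=> Uz; rewrite g1bE// g1E//; apply/matrixP => i j; rewrite !mxE; by field.
Qed.
Lemma rcm_y z : U z -> rcm (Dr ii gam z) = 'i%C *: (g1 z - g1b z).
Proof.
move=> Uz; rewrite g1bE// g1E//; move: (rcm (Dr 1 gam z)) (rcm (Dr ii gam z)) (ci2 (R := R)) => a b.
move: ('i%C : C) => t h; rewrite -scalerBr scalerA opprD addrACA subrr add0r -opprD -scalerDl -scalerN scalerA.
by rewrite -[LHS]scale1r scalerN -scaleNr; congr (_ *: _); field: h.
Qed.

(** The position vector, the two coordinate tangent vectors and their images by [J] have a block
    diagonal Gram matrix with invertible blocks, so they span R^6; the six complex vectors have the
    same complex span. *)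
Lemma six_basis (v : 'rV[C]_6) z : U z -> cdot v (g0 z) = 0 -> cdot v (g1 z) = 0 -> cdot v (g1b z) = 0 ->
  cdot v (g0 z *m JC) = 0 -> cdot v (g1 z *m JC) = 0 -> cdot v (g1b z *m JC) = 0 -> v = 0.
Proof.
move=> Uz v1 v2 v3 v4 v5 v6; have [_ /(_ z Uz)[e1 e2 e3 e4]] := cg; have [_ _ _ /(_ z Uz)[f1 f2 f3 _]] := jg.
have s0 : 0%:M = 0 :> 'M[R]_1 by exact: raddf0.
move: (conf_dot1 1 Uo cg Uz) (conf_dot1 ii Uo cg Uz) (rcm_x Uz) (rcm_y Uz) e2 e3 e4 f1 f2 f3.
move: (Dr 1 gam z) (Dr ii gam z) => x y d1 d2 rcx rcy e2 e3 e4 f1 f2 f3.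
pose G := col_mx (gam z) (col_mx x y).
have l0 : dt x x \is a GRing.unit by rewrite unitfE gt_eqF.
have GG : G *m G^T = block_mx 1%:M 0 0 (block_mx (dt x x)%:M 0 0 (dt x x)%:M).
  rewrite /G !tr_col_mx mul_col_row mul_mx_row mul_col_mx mul_col_row !mul_row_tr e1 e3 e4.
  by rewrite !(dotC (gam z)) d1 d2 (dotC y) e4 !s0 row_mx0 col_mx0.
have GU : G *m G^T \in unitmx.
  by rewrite GG unitmxE det_ublock det1 mul1r det_ublock !det_scalar1 unitrM l0.
have JG : G *m J *m G^T = 0.
  have sk (w : 'rV[R]_6) : dt (w *m J) w = 0.
    by have := dotMl w J w; rewrite JT mulmxN dotNr dotC; lra.
  have rev (u w : 'rV[R]_6) : dt (u *m J) w = - dt u (w *m J).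
    by rewrite dotMl JT mulmxN dotNr.
  rewrite /G !tr_col_mx mul_col_mx (mul_col_mx x y J) mul_col_row mul_mx_row mul_col_mx mul_col_row !mul_row_tr !sk.
  rewrite (rev x (gam z)) (rev y (gam z)) (rev x y) f1 f2 f3 (dotC _ x) f1 (dotC _ y) f2 (dotC _ x) f3 !oppr0.
  by rewrite !s0 row_mx0 col_mx0 !block_mx0.
have JJT : J *m J^T = 1%:M by rewrite JT mulmxN JJ opprK.
pose K := col_mx G (G *m J).
have KU : K *m K^T \in unitmx.
  rewrite /K tr_col_mx mul_col_row trmx_mul !mulmxA JG -(mulmxA G J) JJT mulmx1.
  have -> : G *m J^T *m G^T = 0 by rewrite JT mulmxN mulNmx JG oppr0.
  by rewrite unitmxE det_ublock unitrM -!unitmxE GU.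
have KF : row_full K.
  have : row_free K.
    by rewrite -row_leq_rank; apply: leq_trans (mxrankM_maxl K K^T); rewrite mxrank_unit.
  by rewrite /row_free /row_full.
have vK : v *m (rcm K)^T = 0.
  have vx : cdot v (rcm x) = 0 by rewrite rcx cdotDr v2 v3 addr0.
  have vy : cdot v (rcm y) = 0 by rewrite rcy cdotZr cdotDr cdotNr v2 v3 subr0 mulr0.
  have vxJ : cdot v (rcm (x *m J)) = 0 by rewrite rcmM rcx mulmxDl cdotDr v5 v6 addr0.
  have vyJ : cdot v (rcm (y *m J)) = 0.
    by rewrite rcmM rcy -scalemxAl mulmxBl cdotZr cdotDr cdotNr v5 v6 subr0 mulr0.
  have v4' : cdot v (rcm (gam z *m J)) = 0 by rewrite rcmM.
  have s0C : 0%:M = 0 :> 'M[C]_1 by exact: raddf0.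
  have v1' : cdot v (rcm (gam z)) = 0 by [].
  rewrite /K /G !mul_col_mx /rcm !map_col_mx !tr_col_mx !mul_mx_row !mul_row_trC -!/(rcm _).
  by rewrite v1' vx vy v4' vxJ vyJ !s0C !row_mx0.
have [B hB] := row_fullP KF.
have : v *m (rcm K)^T *m (rcm B)^T = v by rewrite -mulmxA -trmx_mul -rcmM hB rcm1 trmx1 mulmx1.
by rewrite vK mul0mx.
Qed.

(** d/dzbar d/dz is a quarter of the Laplacian, which minimality makes a multiple of the position
    vector. *)
Lemma mdlb_g1 z : U z -> mdlb g1 z = - (Lc z / 2) *: g0 z.
Proof.
move=> Uz; have [_ _ _ /(_ z Uz)[_ _ _ h]] := jg.
have e1 : mdlb g1 z = mdl g1b z.
  by rewrite /g1 -(mdl_mdlb Uo csm_g0 Uz); apply: (mdl_ext Uo _ Uz) => w Uw; rewrite mdlb_g0.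
rewrite e1.
have -> : mdl g1b z = 2^-1 *: (mdl (fun w => rcm (Dr 1 gam w)) z + 'i%C *: mdl (fun w => rcm (Dr ii gam w)) z).
  rewrite (mdl_ext Uo (fun w Uw => g1bE Uw) Uz).
  have s1 := csmx_rcm Uo (smx_dird 1 Uo sg); have s2 := csmx_rcm Uo (smx_dird ii Uo sg).
  have s3 := csmxZ Uo (csm_cst U 'i%C) s2.
  rewrite (mdlZ Uo (csm_cst _ _) (csmxD Uo s1 s3) Uz) (mdlD s1 s3 Uz) (mdlZ Uo (csm_cst _ _) s2 Uz).
  by rewrite !dl_cst !scale0r !add0r.
rewrite !(mdl_rcm (smx_dird _ Uo sg) Uz) (dird_mx_schwarz ii 1 Uo sg Uz).
move: (congr1 (@rcm R _ _) h); rewrite rcmD rcmZ rmorphN rmorphM rmorph_nat -/(Lc z) -/(g0 z) => h'.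
have -> : - (Lc z / 2) *: g0 z = 4^-1 *: (- (2 * Lc z) *: g0 z).
  by rewrite scalerA; congr (_ *: _); field.
rewrite -h'; move: (rcm _) (rcm (Dr 1 (Dr ii gam) z)) (rcm (Dr ii (Dr ii gam) z)) => a b c.
by apply/matrixP => i j; rewrite !mxE; have e := ci2 (R := R); field: e.
Qed.

Lemma mdlb_g1b z : U z -> mdl g1b z = - (Lc z / 2) *: g0 z.
Proof.
move=> Uz; rewrite /g1b (mdl_cj csm_g1 Uz) mdlb_g1// mcjZ mcj_rcm; congr (_ *: _).
by rewrite rmorphN rmorphM; congr (- (_ * _)); [exact: Lcj|exact: conj2V].
Qed.

(** Both sides are tested against the basis of [six_basis]; the products of [mdl g1] with it come
    from differentiating entries of [frame_table], except the one that defines [Cq]. *)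
Lemma mdl_g1 z : U z -> mdl g1 z = (dl Lc z / Lc z) *: g1 z + (Cq z / Lc z) *: (g1b z *m JC).
Proof.
move=> Uz; have l0 := Lc0 Uz.
have [[t1 t2 t3 t4] [t5 t6]] := frame_table Uz.
have D0 (G H : E -> 'rV[C]_6) : csmx U G -> csmx U H -> (forall w, U w -> cdot (G w) (H w) = 0) ->
    cdot (mdl G z) (H z) = - cdot (G z) (mdl H z).
  move=> sG sH h0; have := dl_cdot Uo sG sH Uz; rewrite (dl_ext Uo h0 Uz) dl_cst => /eqP.
  by rewrite eq_sym addr_eq0 => /eqP.
have c1 : cdot (mdl g1 z) (g0 z) = 0.
  rewrite (D0 _ _ csm_g1 csm_g0) => [|w Uw]; last by rewrite cdotC; have [[]] := frame_table Uw.
  by rewrite t3 oppr0.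
have c2 : cdot (mdl g1 z) (g1 z) = 0.
  have h := D0 _ _ csm_g1 csm_g1 (fun w Uw => let: conj (And4 _ _ h _) _ := frame_table Uw in h).
  rewrite [in RHS]cdotC in h; have : 2 * cdot (mdl g1 z) (g1 z) = 0 by rewrite mulr_natl mulr2n {1}h addNr.
  by move=> /eqP; rewrite mulf_eq0 (negPf (two_C (R := R))) /= => /eqP.
have c3 : cdot (mdl g1 z) (g1b z) = dl Lc z / 2.
  have := dl_cdot Uo csm_g1 csm_g1b Uz.
  have hw w : U w -> cdot (g1 w) (g1b w) = Lc w * 2^-1 by move=> /frame_table[[]].
  rewrite (dl_ext Uo hw Uz).
  rewrite (dlM Uo csm_Lc (csm_cst _ _) Uz) dl_cst mulr0 addr0 mdlb_g1b// cdotZr (cdotC (g1 z)) t2 mulr0 addr0.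
  by move=> <-.
have c4 : cdot (mdl g1 z) (g0 z *m JC) = 0.
  rewrite (D0 _ _ csm_g1 (csm_J csm_g0)) => [|w Uw]; last by have [_ []] := frame_table Uw.
  by rewrite (mdlJ csm_g0 Uz) cdot_vJ oppr0.
have c5 : cdot (mdl g1 z) (g1 z *m JC) = Cq z / 2 by rewrite /Cq mulrAC divff ?mul1r// two_C.
have c6 : cdot (mdl g1 z) (g1b z *m JC) = 0.
  rewrite (D0 _ _ csm_g1 (csm_J csm_g1b)) => [|w Uw]; last by have [_ []] := frame_table Uw.
  by rewrite (mdlJ csm_g1b Uz) mdlb_g1b// -scalemxAl cdotZr t5 mulr0 oppr0.
have t4' : cdot (g1b z) (g1 z) = Lc z / 2 by rewrite cdotC.
have t7 : cdot (g1b z) (g1b z) = 0 by rewrite cdot_cj t3 rmorph0.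
have t8 : cdot (g1b z) (g0 z) = 0.
  by rewrite -[g0 z]mcj_rcm cdot_cj -/(g0 z) cdotC t2 rmorph0.
have t10 : cdot (g1b z) (g0 z *m JC) = 0.
  by rewrite -[g0 z *m JC]mcjK mcjM JCcj [mcj (g0 z)]mcj_rcm cdot_cj t5 rmorph0.
have t9 : cdot (g1b z) (g1 z *m JC) = 0 by rewrite cdotC cdotJ t6 oppr0.
apply/eqP; rewrite -subr_eq0; apply/eqP; apply: (six_basis Uz);
  rewrite cdotDl cdotNl cdotDl !cdotZl ?cdotJJ ?cdotJ ?(c1, c2, c3, c4, c5, c6) ?mulJJ ?cdotNr ?(t1, t2, t3, t4, t4', t5, t6, t7, t8, t9).
all: rewrite ?(cdotC (g1 z) (g0 z)) ?t2 ?t8 ?(cdotC (g1b z) (g0 z)) ?t5 ?t6 ?t10 ?cdot_vJ.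
all: by field; rewrite ?l0.
Qed.

End ComplexFrame.

Definition cnp {R : realType} {N : nat} (F : Cplx R -> 'rV[R]_N) z (v : 'rV[R[i]]_N) : 'rV[R[i]]_N :=
  v *m rcm (perp_mx (frame F z)).

Lemma cnp_rcm {R : realType} {N : nat} (F : Cplx R -> 'rV[R]_N) z (v : 'rV[R]_N) :
  cnp F z (rcm v) = rcm (np F z v).
Proof. by rewrite /cnp -rcmM np.unlock /normal_part perpE. Qed.

Section StructureEquations.
Context {R : realType}.
Local Notation E := (Cplx R).
Local Notation C := (R[i]).
Variables (U : set E) (gam : E -> 'rV[R]_6) (J : 'M[R]_6).
Hypotheses (Uo : open U) (jg : jcurve U gam J).

Let cg : conf U gam. Proof. by case: jg. Qed.
Let sg : smx U gam. Proof. exact: cg.1. Qed.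
Let JT : J^T = - J. Proof. by case: jg. Qed.
Let JJ : J *m J = - 1%:M. Proof. by case: jg. Qed.
Local Notation JC := (JC J).
Local Notation g0 := (g0 gam).
Local Notation g1 := (g1 gam).
Local Notation g1b := (g1b gam).
Local Notation Lc := (Lc gam).
Local Notation Cq := (Cq gam J).

Definition cc z : C := Cq z / Lc z.
(** The d/dz component of the one-form [sff]. *)
Definition Sd z : 'M[C]_6 := 2^-1 *: (rcm (sff gam 1 z) - 'i%C *: rcm (sff gam ii z)).

Lemma np_F z : U z -> np gam z (gam z) = 0.
Proof.
move=> Uz; apply: (np_uniq Uo cg Uz); first by rewrite /normal_vector mul0mx.
by exists 1, 0, 0; rewrite subr0 scale1r !scale0r !addr0.
Qed.

Lemma minimal_alpha z : U z -> al gam ii ii z = - al gam 1 1 z.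
Proof.
move=> Uz; have [_ _ _ /(_ z Uz)[_ _ _ h]] := jg.
have : np gam z (Dr 1 (Dr 1 gam) z + Dr ii (Dr ii gam) z) = 0.
  by rewrite h normal_partZ np_F// scaler0.
by rewrite normal_partD -!alphaE => /eqP; rewrite addrC addr_eq0 => /eqP.
Qed.

(** As [al gam ii ii] is minus [al gam 1 1], the left side is twice alpha(d/dz, d/dz), the normal
    part of d/dz f_1, which [mdl_g1] gives as [cc] times f_2. *)
Lemma alpha_zz z : U z -> rcm (al gam 1 1 z) - 'i%C *: rcm (al gam 1 ii z) = 2 *: (cc z *: (g1b z *m JC)).
Proof.
move=> Uz; have [_ _ _ /(_ z Uz)[f1 f2 f3 h]] := jg.
have s1 := csmx_rcm Uo (smx_dird 1 Uo sg); have s2 := csmx_rcm Uo (smx_dird ii Uo sg).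
have s3 := csmxZ Uo (csm_cst U (- 'i%C)) s2.
have e1 : rcm (Dr 1 (Dr 1 gam) z) - 'i%C *: rcm (Dr 1 (Dr ii gam) z) = 2 *: mdl g1 z - Lc z *: g0 z.
  have -> : mdl g1 z = 2^-1 *: (mdl (fun w => rcm (Dr 1 gam w)) z - 'i%C *: mdl (fun w => rcm (Dr ii gam w)) z).
    have e0 w : U w -> g1 w = 2^-1 *: (rcm (Dr 1 gam w) + - 'i%C *: rcm (Dr ii gam w)).
      by move=> Uw; rewrite (g1E jg Uw) scaleNr.
    rewrite (mdl_ext Uo e0 Uz) (mdlZ Uo (csm_cst _ _) (csmxD Uo s1 s3) Uz).
    rewrite (mdlD s1 s3 Uz) (mdlZ Uo (csm_cst _ _) s2 Uz) !dl_cst !scale0r !add0r.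
    by rewrite scaleNr.
  rewrite !(mdl_rcm (smx_dird _ Uo sg) Uz) (dird_mx_schwarz ii 1 Uo sg Uz).
  move: (congr1 (@rcm R _ _) h); rewrite rcmD rcmZ (_ : (- (2 * lam gam z))%:C%C = - (2 * Lc z)); last by rewrite /Lc rmorphN rmorphM rmorph_nat.
  rewrite -/(g0 z).
  move: (rcm (Dr 1 (Dr 1 gam) z)) (rcm (Dr 1 (Dr ii gam) z)) (rcm (Dr ii (Dr ii gam) z)) (g0 z) (Lc z) => a b c d l h'.
  have -> : c = - (2 * l) *: d - a by rewrite -h' addrC addKr.
  move: (ci2 (R := R)); move: ('i%C : C) => t et.
  by apply/matrixP => i j; rewrite !mxE; field: et.
have cZ a v : cnp gam z (a *: v) = a *: cnp gam z v by rewrite /cnp scalemxAl.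
have cD v w : cnp gam z (v + w) = cnp gam z v + cnp gam z w by rewrite /cnp mulmxDl.
have cN v : cnp gam z (- v) = - cnp gam z v by rewrite /cnp mulNmx.
have c0 : cnp gam z (g0 z) = 0.
  by rewrite [LHS](cnp_rcm gam z (gam z)) (np_F Uz); exact: rcm0.
have c1 : cnp gam z (g1 z) = 0.
  by rewrite (g1E jg Uz) cZ cD cN cZ !cnp_rcm !(np_tan Uo cg _ Uz) !rcm0 scaler0 subr0 scaler0.
have c2 : cnp gam z (g1b z *m JC) = g1b z *m JC.
  have nJ v : dt (v *m J) (gam z) = 0 -> dt (v *m J) (Dr 1 gam z) = 0 -> dt (v *m J) (Dr ii gam z) = 0 ->
      np gam z (v *m J) = v *m J.
    move=> n1 n2 n3; apply: (normal_part_id Uo cg Uz).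
    by apply/normal_vectorP; split; [exact: n1|exact: n2|exact: n3].
  have rev (u w : 'rV[R]_6) : dt (u *m J) w = - dt (w *m J) u.
    by rewrite dotMl JT mulmxN dotNr dotC.
  have sk (w : 'rV[R]_6) : dt (w *m J) w = 0 by have := rev w w; lra.
  have nx : np gam z (Dr 1 gam z *m J) = Dr 1 gam z *m J.
    apply: nJ; [rewrite rev dotC f1; exact: oppr0|exact: sk|rewrite rev dotC f3; exact: oppr0].
  have ny : np gam z (Dr ii gam z *m J) = Dr ii gam z *m J.
    apply: nJ; [rewrite rev dotC f2; exact: oppr0|rewrite dotC; exact: f3|exact: sk].
  by rewrite (g1bE jg Uz) -scalemxAl mulmxDl -scalemxAl cZ cD cZ /JC -!rcmM !cnp_rcm nx ny.
rewrite !alphaE -!cnp_rcm -cZ -cN -cD e1 (mdl_g1 Uo jg Uz) cD cN !cZ cD !cZ c0 c1 c2.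
by rewrite !scaler0 add0r subr0.
Qed.

(** Since alpha(d/dz, d/dzbar) = 0, the skew matrix built from two real directions reduces to the
    one built from conj(f_1) and conj(f_1) J alone. *)
Lemma mul_Sd z (w : 'rV[C]_6) : U z -> w *m Sd z =
  (2 * cc z / Lc z) *: (cdot w (g1b z) *: (g1b z *m JC) - cdot w (g1b z *m JC) *: g1b z).
Proof.
move=> Uz; have l0 := Lc0 jg Uz.
(* By linearity it is enough to treat real vectors, to which [mul_sff] applies. *)
suff H (i : 'I_6) : rcm (delta_mx 0 i) *m Sd z = (2 * cc z / Lc z) *:
    (cdot (rcm (delta_mx 0 i)) (g1b z) *: (g1b z *m JC) - cdot (rcm (delta_mx 0 i)) (g1b z *m JC) *: g1b z).
  have wE : w = \sum_i w 0 i *: rcm (delta_mx 0 i).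
    by rewrite {1}(row_sum_delta w); apply: eq_bigr => i _; rewrite /rcm map_delta_mx.
  rewrite [in LHS]wE mulmx_suml.
  have -> : cdot w (g1b z) = \sum_i w 0 i * cdot (rcm (delta_mx 0 i)) (g1b z).
    by rewrite {1}wE cdot_suml; apply: eq_bigr => i _; rewrite cdotZl.
  have -> : cdot w (g1b z *m JC) = \sum_i w 0 i * cdot (rcm (delta_mx 0 i)) (g1b z *m JC).
    by rewrite {1}wE cdot_suml; apply: eq_bigr => i _; rewrite cdotZl.
  rewrite !scaler_suml -sumrB scaler_sumr; apply: eq_bigr => i _; rewrite -scalemxAl H.
  by rewrite -!(scalerA (w 0 i)) -scalerBr !scalerA mulrC.
move: (delta_mx 0 i) => v; rewrite /Sd -scalemxAr mulmxBr -scalemxAr.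
have mS k : rcm v *m rcm (sff gam k z) = (Lc z)^-1 *: (cdot (rcm v) (rcm (Dr 1 gam z)) *: rcm (al gam k 1 z) -
    cdot (rcm v) (rcm (al gam k 1 z)) *: rcm (Dr 1 gam z) + (cdot (rcm v) (rcm (Dr ii gam z)) *: rcm (al gam k ii z) -
    cdot (rcm v) (rcm (al gam k ii z)) *: rcm (Dr ii gam z))).
  by rewrite -rcmM mul_sff !(rcmZ, rcmD, rcmN) !cdot_rcm /Lc -fmorphV.
rewrite !mS (alphaC ii 1 Uo cg Uz) (minimal_alpha Uz) rcmN.
have aE : rcm (al gam 1 1 z) = 2 *: (cc z *: (g1b z *m JC)) + 'i%C *: rcm (al gam 1 ii z).
  by rewrite -(alpha_zz Uz) subrK.
have x_ := rcm_x jg Uz; have y_ := rcm_y jg Uz.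
rewrite x_ y_ aE.
move: (g1b z *m JC) (rcm (al gam 1 ii z)) (cc z) => f2 b c.
rewrite !(cdotDr, cdotNr, cdotZr).
move: (cdot _ f2) (cdot _ b) (cdot _ (g1 z)) (cdot _ (g1b z)) => d1 d2 d3 d4.
move: (Lc z) l0 (g1 z) (g1b z) (ci2 (R := R)) => l l0 a1 a2; move: ('i%C : C) => t et.
by apply/matrixP => p q; rewrite !mxE; field: et; rewrite l0.
Qed.

Lemma Sd_J z : U z -> Sd z *m JC = JC *m Sd z.
Proof.
move=> Uz; apply/row_matrixP => i; rewrite !rowE !mulmxA; move: (delta_mx 0 i) => w.
rewrite !(mul_Sd _ Uz) -scalemxAl mulmxBl -!scalemxAl (mulJJ jg) !(cdotJ jg) (mulJJ jg) cdotNr opprK.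
by rewrite scalerN scaleNr addrC.
Qed.

(* The frame f_0 = g, f_1 = dg/dz, f_2 = conj(f_1) J, f_(k+3) = f_k J: d/dz moves f_k towards f_(k+1), d/dzbar towards f_(k-1). *)
Fixpoint fr k z : 'rV[C]_6 :=
  match k with 0 => g0 z | 1 => g1 z | 2 => g1b z *m JC | k'.+3 => fr k' z *m JC end.

Lemma nat3_ind (Q : nat -> Prop) : Q 0%N -> Q 1%N -> Q 2%N -> (forall k, Q k -> Q k.+3) -> forall k, Q k.
Proof.
move=> q0 q1 q2 q3 k; suff : [/\ Q k, Q k.+1 & Q k.+2] by case.
by elim: k => [//|k [a b c]]; split=> //; exact: q3.
Qed.

Lemma mod3S k : (k.+3 %% 3 = k %% 3)%N.
Proof. by rewrite -addn3 modnDr. Qed.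

Lemma csm_fr k : csmx U (fr k).
Proof.
elim/nat3_ind: k => [|||k IH]; [exact: csm_g0 Uo jg|exact: csm_g1 Uo jg| |].
  exact: (csm_J J Uo (csm_g1b Uo jg)).
exact: (csm_J J Uo IH).
Qed.

(** Coefficients of the ladder, [pk], [qk] for d/dz and [pbk], [qbk] for d/dzbar. They have period 3
    in [k] because f_(k+3) = f_k J with [J] constant. *)
Definition pk k z : C := if (k %% 3 == 1)%N then dl Lc z / Lc z else 0.
Definition qk k z : C := if (k %% 3 == 0)%N then 1 else if (k %% 3 == 1)%N then cc z else - (Lc z / 2).
Definition pbk k z : C := if (k %% 3 == 2)%N then (dl Lc z / Lc z)^*%C else 0.
Definition qbk k z : C := if (k %% 3 == 0)%N then 1 else if (k %% 3 == 1)%N then - (Lc z / 2) else - (cc z)^*%C.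

Lemma mdl_fr k z : U z -> mdl (fr k) z = pk k z *: fr k z + qk k z *: fr k.+1 z.
Proof.
move=> Uz; elim/nat3_ind: k => [|||k IH].
- by rewrite /pk /qk /= scale0r add0r scale1r.
- by rewrite /pk /qk /= (mdl_g1 Uo jg Uz).
- rewrite /pk /qk /= scale0r add0r; have -> : mdl (fr 2) z = mdl g1b z *m JC := mdlJ J Uo (csm_g1b Uo jg) Uz.
  by rewrite (mdlb_g1b Uo jg Uz) -scalemxAl.
have -> : mdl (fr k.+3) z = mdl (fr k) z *m JC := mdlJ J Uo (csm_fr k) Uz; rewrite IH mulmxDl -!scalemxAl.
by rewrite /pk /qk mod3S.
Qed.

Lemma mdlb_fr0 z : U z -> mdlb (fr 0) z = mcj (fr 1 z).
Proof. by move=> Uz; rewrite [LHS](mdlb_g0 Uo jg Uz). Qed.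

Lemma mcj_J p (v : 'M[C]_(p, 6)) : mcj (v *m JC) = mcj v *m JC.
Proof. by rewrite mcjM JCcj. Qed.

Lemma mdlb_g1b_ z : U z -> mdlb g1b z = (pk 1 z)^*%C *: g1b z + (cc z)^*%C *: (g1 z *m JC).
Proof.
move=> Uz; rewrite /g1b (mdlb_cj (csm_g1 Uo jg) Uz) (mdl_g1 Uo jg Uz) mcjD !mcjZ mcj_J.
by rewrite /g1b mcjK.
Qed.

Lemma mdlb_fr k z : U z -> mdlb (fr k.+1) z = pbk k.+1 z *: fr k.+1 z + qbk k.+1 z *: fr k z.
Proof.
move=> Uz; elim/nat3_ind: k => [|||k IH].
- by rewrite /pbk /qbk /= scale0r add0r (mdlb_g1 Uo jg Uz).
- have -> : mdlb (fr 2) z = mdlb g1b z *m JC := mdlbJ J Uo (csm_g1b Uo jg) Uz; rewrite mdlb_g1b_//.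
  by rewrite mulmxDl -!scalemxAl (mulJJ jg) /pbk /qbk /= scalerN scaleNr.
- have -> : mdlb (fr 3) z = mdlb g0 z *m JC := mdlbJ J Uo (csm_g0 Uo jg) Uz; rewrite (mdlb_g0 Uo jg Uz).
  by rewrite /pbk /qbk /= scale0r add0r scale1r.
have -> : mdlb (fr k.+4) z = mdlb (fr k.+1) z *m JC := mdlbJ J Uo (csm_fr k.+1) Uz; rewrite IH mulmxDl -!scalemxAl.
by rewrite /pbk /qbk !mod3S.
Qed.

Lemma fr_Sd k z : U z -> fr k z *m Sd z = (if (k %% 3 == 1)%N then cc z else 0) *: fr k.+1 z.
Proof.
move=> Uz; have l0 := Lc0 jg Uz; have [[t1 t2 t3 t4] [t5 t6]] := frame_table Uo jg Uz.
have t7 : cdot (g1b z) (g1b z) = 0 by rewrite cdot_cj t3 rmorph0.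
have t8 : cdot (g0 z) (g1b z) = 0.
  by rewrite -[g0 z]mcj_rcm cdot_cj t2 rmorph0.
have t9 : cdot (g0 z) (g1b z *m JC) = 0.
  by rewrite -[g0 z]mcj_rcm -mcj_J cdot_cj cdotC (cdotJ jg) t5 oppr0 rmorph0.
elim/nat3_ind: k => [|||k IH].
- by rewrite /= (mul_Sd _ Uz) t8 t9 !scale0r subr0 scaler0.
- rewrite /= (mul_Sd _ Uz) t4 t6 !scale0r subr0 scalerA; congr (_ *: _).
  by field.
- by rewrite /= (mul_Sd _ Uz) (cdotJJ jg) (cdotJ jg) (cdot_vJ jg) t7 oppr0 !scale0r subr0 scaler0.
by rewrite [fr k.+3 z]/= -mulmxA -(Sd_J Uz) mulmxA IH -scalemxAl mod3S.
Qed.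

(** The frame is stable under conjugation up to sign: conj(f_0) = f_0, conj(f_1) = - f_5, conj(f_2)
    = f_4, and so on by shifts of 3. [sgn3] and [cj3] record sign and index. *)
Definition sgn3 k : C := if (k %% 3 == 1)%N then -1 else 1.
Definition cj3 k : nat := if (k %% 3 == 0)%N then k else if (k %% 3 == 1)%N then k + 4 else k + 2.

Lemma cj3S k : cj3 k.+3 = (cj3 k).+3.
Proof. by rewrite /cj3 mod3S; case: ifP => // _; case: ifP. Qed.

Lemma mcj_fr k z : mcj (fr k z) = sgn3 k *: fr (cj3 k) z.
Proof.
elim/nat3_ind: k => [|||k IH].
- by rewrite /sgn3 /= scale1r mcj_rcm.
- by rewrite /sgn3 /= (mulJJ jg) scaleN1r opprK.
- by rewrite /sgn3 /= scale1r mcj_J mcjK.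
by rewrite cj3S /= mcj_J IH -scalemxAl /sgn3 mod3S.
Qed.

Lemma fr_Sdb k z : U z -> fr k.+1 z *m mcj (Sd z) = (if (k.+1 %% 3 == 2)%N then - (cc z)^*%C else 0) *: fr k z.
Proof.
move=> Uz; have K j : fr j z *m mcj (Sd z) = mcj (mcj (fr j z) *m Sd z) by rewrite mcjM mcjK.
have SJ : JC *m mcj (Sd z) = mcj (Sd z) *m JC by rewrite -{1}(JCcj J) -mcjM -(Sd_J Uz) mcj_J.
elim/nat3_ind: k => [|||k IH].
- by rewrite K mcj_fr -scalemxAl (fr_Sd _ Uz) /= !scale0r scaler0 mcj0.
- rewrite K mcj_fr -scalemxAl (fr_Sd _ Uz) /= /sgn3 /= scale1r mcjZ mcj_J scaleNr -scalerN; congr (_ *: _).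
  by rewrite mcj_J mcjK (mulJJ jg).
- by rewrite K mcj_fr -scalemxAl (fr_Sd _ Uz) /= !scale0r scaler0 mcj0.
by rewrite [fr k.+4 z]/= -/(fr k.+1 z) -mulmxA SJ mulmxA IH -scalemxAl !mod3S.
Qed.

Lemma fr0_Sdb z : U z -> fr 0 z *m mcj (Sd z) = 0.
Proof.
by move=> Uz; rewrite -[fr 0 z]mcjK -mcjM mcj_fr -scalemxAl (fr_Sd _ Uz) /= scale0r scaler0 mcj0.
Qed.

End StructureEquations.

(** * Weighted sums of associated surfaces *)

Section WeightedSum.
Context {R : realType}.
Local Notation E := (Cplx R).
Local Notation C := (R[i]).
Variables (U : set E) (gam : E -> 'rV[R]_6) (J : 'M[R]_6).
Hypotheses (Uo : open U) (jg : jcurve U gam J).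
Variables (m N : nat) (a : 'I_m -> R) (eps : 'I_m -> E) (Z : 'I_m -> E -> 'M[R]_6) (B : 'I_m -> 'M[R]_(6, N)).
Hypothesis rZ : forall j, rot U gam (eps j - 1) (Z j).
Hypothesis eps1 : forall j, (eps j : C) * (eps j : C)^*%C = 1.
Hypothesis BB : forall i j, B i *m (B j)^T = if i == j then 1%:M else 0.

Let cg : conf U gam. Proof. by case: jg. Qed.
Local Notation Lc := (Lc gam).
Local Notation Sd := (Sd gam).
Local Notation fr := (fr gam J).
Local Notation cc := (cc gam J).
Local Notation pk := (pk gam).
Local Notation qk := (qk gam J).
Local Notation pbk := (pbk gam).
Local Notation qbk := (qbk gam J).

Definition Wj j z : 'M[C]_(6, N) := rcm (Z j z *m B j).

Lemma csm_W j : csmx U (Wj j).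
Proof. by have [sZ _ _] := rZ j; exact: csmx_rcm Uo (smxM Uo sZ (smx_cst (B j) U)). Qed.

Lemma mdl_W j z : U z -> mdl (Wj j) z = ((eps j : C) - 1) *: (Sd z *m Wj j z).
Proof.
move=> Uz; have [sZ _ dZ] := rZ j.
have dW u : Dr u (fun w => Z j w *m B j) z = sff gam ((eps j - 1) * u) z *m (Z j z *m B j).
  by rewrite (dird_mxM u Uo sZ (smx_cst (B j) U) Uz) dird_mx_cst mulmx0 addr0 dZ// mulmxA.
rewrite (mdl_rcm (smxM Uo sZ (smx_cst (B j) U)) Uz) !dW !rcmM -/(Wj j z) /Sd.
rewrite !(sff_lin (_ * _) Uo cg Uz) mulr1; set e := eps j - 1.
have -> : complex.Re (e * ii) = - complex.Im e by rewrite iiE /iunit; case: e => p q /=; ring.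
have -> : complex.Im (e * ii) = complex.Re e by rewrite iiE /iunit; case: e => p q /=; ring.
have eE : (e : C) = (complex.Re e)%:C%C + 'i%C * (complex.Im e)%:C%C by exact: complexE.
have eN : (- complex.Im e)%:C%C = - (complex.Im e)%:C%C :> C by rewrite rmorphN.
rewrite -rcmM -/(Wj j z); move: (sff gam 1 z) (sff gam ii z) (Wj j z) => S1 S2 W.
rewrite !(rcmD, rcmZ) eN -!scalemxAl mulmxBl -!scalemxAl !mulmxDl -!scalemxAl [in RHS]eE.
move: (rcm S1 *m W) (rcm S2 *m W) (ci2 (R := R)) => {}S1 {}S2; move: ('i%C : C) => t et.
by apply/matrixP => p q; rewrite !mxE; move: (S1 p q) (S2 p q) => s1 s2; field: et.
Qed.

Lemma mcj_W j z : mcj (Wj j z) = Wj j z. Proof. exact: mcj_rcm. Qed.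

Lemma mdlb_W j z : U z -> mdlb (Wj j) z = ((eps j : C) - 1)^*%C *: (mcj (Sd z) *m Wj j z).
Proof.
move=> Uz; have -> : mdlb (Wj j) z = mcj (mdl (Wj j) z).
  rewrite -(mdlb_cj (csm_W j) Uz); apply: (mdlb_ext Uo _ Uz) => w _; exact/esym/mcj_W.
by rewrite mdl_W// mcjZ mcjM mcj_W.
Qed.

Lemma csm_G j k : csmx U (fun z => fr k z *m Wj j z).
Proof. exact: csmxM Uo (csm_fr Uo jg k) (csm_W j). Qed.

(** The number of i < k with i = 1 mod 3, the steps of the ladder that pass through the second
    fundamental form. *)
Definition nu k := (k.+1 %/ 3)%N.

Lemma nuS k : nu k.+1 = (nu k + (k %% 3 == 1))%N.
Proof. rewrite /nu; lia. Qed.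

(** At k = 1 mod 3 the coefficient [cc] of the frame and (eps - 1) [cc] from the derivative of the
    rotation add up to eps [cc]; elsewhere the rotation contributes nothing. *)
Lemma mdl_G j k z : U z -> mdl (fun w => fr k w *m Wj j w) z =
  pk k z *: (fr k z *m Wj j z) + (qk k z * (eps j : C) ^+ (k %% 3 == 1)%N) *: (fr k.+1 z *m Wj j z).
Proof.
move=> Uz; rewrite (mdlM Uo (csm_fr Uo jg k) (csm_W j) Uz) mdl_W// (mdl_fr Uo jg k Uz) -scalemxAr.
rewrite mulmxA (fr_Sd Uo jg k Uz) mulmxDl -!scalemxAl scalerA -addrA -scalerDl.
congr (_ + _ *: _); rewrite /qk; case: (k %% 3)%N (ltn_pmod k (isT : 0 < 3)%N) => [|[|[|//]]] _ /=; ring.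
Qed.

Lemma mdlb_G j k z : U z -> mdlb (fun w => fr k.+1 w *m Wj j w) z =
  pbk k.+1 z *: (fr k.+1 z *m Wj j z) + (qbk k.+1 z * (eps j : C)^*%C ^+ (k %% 3 == 1)%N) *: (fr k z *m Wj j z).
Proof.
move=> Uz; rewrite (mdlbM Uo (csm_fr Uo jg k.+1) (csm_W j) Uz) mdlb_W// (mdlb_fr Uo jg k Uz) -scalemxAr.
rewrite mulmxA (fr_Sdb Uo jg k Uz) mulmxDl -!scalemxAl scalerA -addrA -scalerDl rmorphB rmorph1.
congr (_ + _ *: _); rewrite /qbk.
have -> : (k.+1 %% 3 == 0)%N = (k %% 3 == 2)%N by lia.
have -> : (k.+1 %% 3 == 1)%N = (k %% 3 == 0)%N by lia.
have -> : (k.+1 %% 3 == 2)%N = (k %% 3 == 1)%N by lia.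
case: (k %% 3)%N (ltn_pmod k (isT : 0 < 3)%N) => [|[|[|//]]] _ /=; ring.
Qed.

Lemma mdlb_G0 j z : U z -> mdlb (fun w => fr 0 w *m Wj j w) z = mcj (fr 1 z *m Wj j z).
Proof.
move=> Uz; rewrite (mdlbM Uo (csm_fr Uo jg 0) (csm_W j) Uz) mdlb_W// (mdlb_fr0 Uo jg Uz) -scalemxAr.
by rewrite mulmxA (fr0_Sdb Uo jg Uz) mul0mx scaler0 addr0 mcjM mcj_W.
Qed.

Definition cf j k : C := (a j)%:C%C * (eps j : C) ^+ nu k.
Definition XX k z : 'rV[C]_N := \sum_j cf j k *: (fr k z *m Wj j z).

Lemma csm_XX k : csmx U (XX k).
Proof. by apply: csmx_sum => // j _; apply: csmxZ => //; [exact: csm_cst|exact: csm_G]. Qed.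

Lemma mdl_cZ (c : C) (G : E -> 'rV[C]_N) z : csmx U G -> U z -> mdl (fun w => c *: G w) z = c *: mdl G z.
Proof. by move=> sG Uz; rewrite (mdlZ Uo (csm_cst _ _) sG Uz) dl_cst scale0r add0r. Qed.
Lemma mdlb_cZ (c : C) (G : E -> 'rV[C]_N) z : csmx U G -> U z -> mdlb (fun w => c *: G w) z = c *: mdlb G z.
Proof. by move=> sG Uz; rewrite (mdlbZ Uo (csm_cst _ _) sG Uz) dlb_cst scale0r add0r. Qed.

(** The powers of eps in [cf] absorb the factors of [mdl_G], which leaves coefficients independent
    of [j], those of the frame itself. *)
Lemma mdl_XX k z : U z -> mdl (XX k) z = pk k z *: XX k z + qk k z *: XX k.+1 z.
Proof.
move=> Uz; rewrite (mdl_sum _ Uo _ Uz) => [|j _]; last by apply: csmxZ => //; [exact: csm_cst|exact: csm_G].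
rewrite /XX !scaler_sumr -big_split; apply: eq_bigr => j _ /=.
rewrite (mdl_cZ _ (csm_G j k) Uz) mdl_G// scalerDr !scalerA; congr (_ *: _ + _ *: _); first by rewrite mulrC.
by rewrite /cf nuS exprD; ring.
Qed.

Lemma epsV j n : (eps j : C) ^+ n.+1 * (eps j : C)^*%C = (eps j : C) ^+ n.
Proof. by rewrite exprSr -mulrA eps1 mulr1. Qed.

(** Here conj(eps) lowers the power of eps by one, because |eps| = 1. *)
Lemma mdlb_XX k z : U z -> mdlb (XX k.+1) z = pbk k.+1 z *: XX k.+1 z + qbk k.+1 z *: XX k z.
Proof.
move=> Uz; rewrite (mdlb_sum _ Uo _ Uz) => [|j _]; last by apply: csmxZ => //; [exact: csm_cst|exact: csm_G].
rewrite /XX !scaler_sumr -big_split; apply: eq_bigr => j _ /=.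
rewrite (mdlb_cZ _ (csm_G j k.+1) Uz) mdlb_G// scalerDr !scalerA; congr (_ *: _ + _ *: _); first by rewrite mulrC.
rewrite /cf nuS; case: (k %% 3 == 1)%N; last by rewrite addn0 expr0; ring.
by rewrite addn1 expr1 -(epsV j (nu k)); ring.
Qed.

Lemma mdlb_XX0 z : U z -> mdlb (XX 0) z = mcj (XX 1 z).
Proof.
move=> Uz; rewrite (mdlb_sum _ Uo _ Uz) => [|j _]; last by apply: csmxZ => //; [exact: csm_cst|exact: csm_G].
rewrite /XX mcj_sum; apply: eq_bigr => j _; rewrite (mdlb_cZ _ (csm_G j 0) Uz) mdlb_G0// mcjZ; congr (_ *: _).
by rewrite /cf !expr0 !mulr1 [RHS]conjc_real.
Qed.

Lemma WW i j z : U z -> Wj i z *m (Wj j z)^T = if i == j then 1%:M else 0.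
Proof.
move=> Uz; rewrite /Wj rcm_tr trmx_mul -rcmM -mulmxA (mulmxA (B i)) BB; case: eqP => [<-|_].
  by rewrite mul1mx; have [_ oZ _] := rZ i; rewrite oZ// rcm1.
by rewrite mul0mx mulmx0 rcm0.
Qed.

Lemma cdot_sumW (c d : 'I_m -> C) (u v : 'rV[C]_6) z : U z ->
  cdot (\sum_j c j *: (u *m Wj j z)) (\sum_j d j *: (v *m Wj j z)) = (\sum_j c j * d j) * cdot u v.
Proof.
move=> Uz; rewrite cdot_suml mulr_suml; apply: eq_bigr => i _; rewrite cdot_sumr (bigD1 i)//= big1 ?addr0 => [|j ji].
  by rewrite cdotZl cdotZr cdotMl -mulmxA WW// eqxx mulmx1 mulrA.
by rewrite cdotZl cdotZr cdotMl -mulmxA WW// (negPf ji) mulmx0 cdot0r !mulr0.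
Qed.

(* Dividing the frame vectors by [sg] makes their Gram matrix constant. *)
Definition sg k z : C := if (k %% 3 == 0)%N then 1 else (Num.sqrt (lam gam z / 2))%:C%C.

Lemma sg_gt0 k z : U z -> exists2 r : R, 0 < r & sg k z = r%:C%C.
Proof.
move=> Uz; rewrite /sg; case: ifP => _; first by exists 1.
exists (Num.sqrt (lam gam z / 2)) => //; rewrite sqrtr_gt0 divr_gt0//.
by have [_ /(_ z Uz)[]] := cg.
Qed.

Lemma sg2 z : U z -> (Num.sqrt (lam gam z / 2))%:C%C * (Num.sqrt (lam gam z / 2))%:C%C = Lc z / 2 :> C.
Proof.
move=> Uz; have l0 : 0 <= lam gam z / 2 by have [_ /(_ z Uz)[_ /ltW l0 _ _]] := cg; rewrite divr_ge0.
by rewrite -rmorphM -expr2 sqr_sqrtr// rmorphM fmorphV rmorph_nat.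
Qed.

Lemma sgS k z : sg k.+3 z = sg k z.
Proof. by rewrite /sg mod3S. Qed.

(** The classes modulo 3 between which bilinear products of frame vectors can be non-zero. *)
Definition pairing k l := (k %% 3 == 0)%N && (l %% 3 == 0)%N || (k %% 3 == 1)%N && (l %% 3 == 2)%N ||
  (k %% 3 == 2)%N && (l %% 3 == 1)%N.

(** [kap] does not depend on the point. The cases k < 3, l < 6 are read off the frame table; raising
    [l] by 6 changes the sign as J^2 = -1, and a [J] on the left moves to the right by skewness. *)
Lemma gram_fr k l : exists2 kap : C, (pairing k l || (kap == 0)) &
  forall z, U z -> cdot (fr k z) (fr l z) = kap * sg k z * sg l z.
Proof.
have S6 p q (kap : C) : (forall z, U z -> cdot (fr p z) (fr q z) = kap * sg p z * sg q z) ->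
    forall z, U z -> cdot (fr p z) (fr (q.+3.+3) z) = - kap * sg p z * sg q.+3.+3 z.
  by move=> h z Uz; rewrite /= (mulJJ jg) cdotNr h// !sgS !mulNr.
have base k0 l0 : (k0 < 3)%N -> (l0 < 6)%N -> exists2 kap : C, (pairing k0 l0 || (kap == 0)) &
    forall z, U z -> cdot (fr k0 z) (fr l0 z) = kap * sg k0 z * sg l0 z.
  have H0 : (forall z, U z -> cdot (fr k0 z) (fr l0 z) = 0) -> exists2 kap : C, (pairing k0 l0 || (kap == 0)) &
    forall z, U z -> cdot (fr k0 z) (fr l0 z) = kap * sg k0 z * sg l0 z.
    by move=> h; exists 0 => [|z Uz]; [rewrite eqxx orbT|rewrite h// !mul0r].
  have T z (Uz : U z) := frame_table Uo jg Uz.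
  have t7 z : U z -> cdot (g1b gam z) (g1b gam z) = 0.
    by move=> /T[[_ _ t3 _] _]; rewrite cdot_cj t3 rmorph0.
  have t8 z : U z -> cdot (g0 gam z) (g1b gam z) = 0.
    by move=> /T[[_ t2 _ _] _]; rewrite -[g0 gam z]mcj_rcm cdot_cj t2 rmorph0.
  have t9 z : U z -> cdot (g0 gam z) (g1b gam z *m JC J) = 0.
    move=> /T[_ [t5 _]]; rewrite -[g0 gam z]mcj_rcm -mcj_J cdot_cj cdotC (cdotJ jg) t5.
    by rewrite oppr0 rmorph0.
  have t10 z : U z -> cdot (g0 gam z) (g1 gam z *m JC J) = 0.
    by move=> /T[_ [t5 _]]; rewrite cdotC (cdotJ jg) t5 oppr0.
  have sq z : U z -> sg 1 z * sg 1 z = Lc z / 2 by exact: sg2.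
  move: H0; case: k0 => [|[|[|//]]]; case: l0 => [|[|[|[|[|[|//]]]]]] H0 _ _.
  - by exists 1 => // z /T[[-> _ _ _] _]; rewrite !mul1r.
  - by apply: H0 => z /T[[_ -> _ _] _].
  - by apply: H0 => z /t9.
  - by apply: H0 => z Uz; exact: (cdot_vJ jg).
  - by apply: H0 => z /t10.
  - by apply: H0 => z Uz /=; rewrite (mulJJ jg) cdotNr t8// oppr0.
  - by apply: H0 => z /T[[_ h _ _] _] /=; rewrite cdotC.
  - by apply: H0 => z /T[[_ _ h _] _].
  - by apply: H0 => z /T[_ [_ h]].
  - by apply: H0 => z /T[_ [h _]].
  - by apply: H0 => z Uz; exact: (cdot_vJ jg).
  - exists (-1) => // z Uz /=; rewrite (mulJJ jg) cdotNr; have [[_ _ _ ->] _] := T z Uz.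
    by rewrite -(sq z Uz) !mulNr mul1r.
  - by apply: H0 => z Uz /=; rewrite cdotC t9.
  - by apply: H0 => z Uz /=; have [_ [_ h]] := T z Uz; rewrite cdotC.
  - by apply: H0 => z Uz /=; rewrite (cdotJJ jg) t7.
  - by apply: H0 => z Uz /=; rewrite (cdotJJ jg) cdotC t8.
  - exists 1 => // z Uz /=; rewrite (cdotJJ jg) cdotC; have [[_ _ _ ->] _] := T z Uz.
    by rewrite -(sq z Uz) mul1r.
  - by apply: H0 => z Uz /=; rewrite (cdotJJ jg) (cdot_vJ jg).
have step l0 k0 : (k0 < 3)%N ->
    exists2 kap : C, (pairing k0 l0 || (kap == 0)) &
    forall z, U z -> cdot (fr k0 z) (fr l0 z) = kap * sg k0 z * sg l0 z.
  move=> k3; elim/ltn_ind: l0 => l0 IH; have [l6|] := ltnP l0 6; first exact: base.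
  case: l0 IH => [|[|[|[|[|[|l0]]]]]]// IH _.
  have [|kap h1 h2] := IH l0; first by lia.
  exists (- kap); last exact: S6.
  by move: h1; rewrite oppr_eq0 /pairing !mod3S.
elim/nat3_ind: k l => [l|l|l|k IH l]; try exact: step.
have [kap h1 h2] := IH l.+3; exists (- kap).
  by move: h1; rewrite oppr_eq0 /pairing !mod3S.
move=> z Uz; rewrite [fr k.+3 z]/= (cdotJ jg) -[fr l z *m _]/(fr l.+3 z) h2//.
by rewrite !sgS !mulNr.
Qed.

Lemma sg_cj3 k z : sg (cj3 k) z = sg k z.
Proof.
elim/nat3_ind: k => [|||k IH]//; by rewrite cj3S !sgS.
Qed.

Lemma cj3_mod k : (cj3 k %% 3 = if k %% 3 == 0 then 0 else if k %% 3 == 1 then 2 else 1)%N.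
Proof. by elim/nat3_ind: k => [|||k IH]//; rewrite cj3S !mod3S. Qed.

Lemma gram_XX k l : exists2 kap : C, (pairing k l || (kap == 0)) &
  forall z, U z -> cdot (XX k z) (XX l z) = kap * sg k z * sg l z.
Proof.
have [kap h1 h2] := gram_fr k l; exists ((\sum_j cf j k * cf j l) * kap).
  by case/orP: h1 => [->//|/eqP->]; rewrite mulr0 eqxx orbT.
by move=> z Uz; rewrite cdot_sumW// h2//; ring.
Qed.

(** conj(f_l) is up to sign another frame vector, so hermitian products reduce to bilinear ones. *)
Lemma gram_XXb k l : exists2 kap : C, ((k %% 3 == l %% 3)%N || (kap == 0)) &
  forall z, U z -> cdot (XX k z) (mcj (XX l z)) = kap * sg k z * sg l z.
Proof.
have [kap h1 h2] := gram_fr k (cj3 l); exists ((\sum_j cf j k * (cf j l)^*%C) * sgn3 l * kap).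
  case/orP: h1 => [h|/eqP->]; last by rewrite mulr0 eqxx orbT.
  apply/orP; left; move: h; rewrite /pairing cj3_mod.
  by case: (k %% 3)%N (ltn_pmod k (isT : 0 < 3)%N) => [|[|[|//]]] _; case: (l %% 3)%N (ltn_pmod l (isT : 0 < 3)%N) => [|[|[|//]]] _.
move=> z Uz; rewrite {2}/XX mcj_sum; under eq_bigr do rewrite mcjZ mcjM mcj_W (mcj_fr jg) -scalemxAl scalerA.
rewrite cdot_sumW// h2// sg_cj3.
have -> : \sum_j cf j k * ((cf j l)^*%C * sgn3 l) = (\sum_j cf j k * (cf j l)^*%C) * sgn3 l.
  by rewrite mulr_suml; apply: eq_bigr => j _; rewrite mulrA.
by rewrite !mulrA.
Qed.

End WeightedSum.

(** * Residuals and osculating spaces *)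

Section ComplexSpan.
Context {R : realType} {N : nat}.
Local Notation C := (R[i]).
Implicit Types (v w : 'rV[C]_N) (A : 'M[R]_N).

Definition rre {p q} (v : 'M[C]_(p, q)) : 'M[R]_(p, q) := map_mx (@complex.Re R) v.
Definition rim {p q} (v : 'M[C]_(p, q)) : 'M[R]_(p, q) := map_mx (@complex.Im R) v.

Lemma rreimE {p q} (v : 'M[C]_(p, q)) : v = rcm (rre v) + 'i%C *: rcm (rim v).
Proof. by apply/matrixP => i j; rewrite !mxE; exact: complexE. Qed.
Lemma rreD {p q} (v w : 'M[C]_(p, q)) : rre (v + w) = rre v + rre w.
Proof. by apply/matrixP => i j; rewrite !mxE; case: (v i j) (w i j) => ? ? [? ?]. Qed.
Lemma rimD {p q} (v w : 'M[C]_(p, q)) : rim (v + w) = rim v + rim w.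
Proof. by apply/matrixP => i j; rewrite !mxE; case: (v i j) (w i j) => ? ? [? ?]. Qed.
Lemma rreZ {p q} c (v : 'M[C]_(p, q)) : rre (c *: v) = complex.Re c *: rre v - complex.Im c *: rim v.
Proof. by apply/matrixP => i j; rewrite !mxE; case: c (v i j) => ? ? [? ?]. Qed.
Lemma rimZ {p q} c (v : 'M[C]_(p, q)) : rim (c *: v) = complex.Re c *: rim v + complex.Im c *: rre v.
Proof. by apply/matrixP => i j; rewrite !mxE; case: c (v i j) => ? ? [? ?]. Qed.
Lemma rre_cj {p q} (v : 'M[C]_(p, q)) : rre (mcj v) = rre v.
Proof. by apply/matrixP => i j; rewrite !mxE; case: (v i j). Qed.
Lemma rim_cj {p q} (v : 'M[C]_(p, q)) : rim (mcj v) = - rim v.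
Proof. by apply/matrixP => i j; rewrite !mxE; case: (v i j). Qed.
Lemma rre_rcm {p q} (v : 'M[R]_(p, q)) : rre (rcm v) = v.
Proof. by apply/matrixP => i j; rewrite !mxE. Qed.
Lemma rim_rcm {p q} (v : 'M[R]_(p, q)) : rim (rcm v) = 0.
Proof. by apply/matrixP => i j; rewrite !mxE. Qed.
Lemma mulr_rcm {p q r} (v : 'M[C]_(p, q)) (A : 'M[R]_(q, r)) :
  rre (v *m rcm A) = rre v *m A /\ rim (v *m rcm A) = rim v *m A.
Proof.
have e : v *m rcm A = rcm (rre v *m A) + 'i%C *: rcm (rim v *m A).
  by rewrite {1}(rreimE v) mulmxDl -scalemxAl !rcmM.
rewrite e rreD rimD rreZ rimZ !rre_rcm !rim_rcm /= !scale0r !scale1r ?scaler0 ?subr0.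
by rewrite ?add0r ?addr0 ?subr0 ?add0r ?addr0.
Qed.
Lemma rreim0 {p q} (v : 'M[C]_(p, q)) : rre v = 0 -> rim v = 0 -> v = 0.
Proof. by move=> h1 h2; rewrite (rreimE v) h1 h2 rcm0 scaler0 addr0. Qed.

(** Membership in the complexification of the row space of [A]. *)
Definition cmem A v := (rre v <= A)%MS /\ (rim v <= A)%MS.

Lemma cmemD A v w : cmem A v -> cmem A w -> cmem A (v + w).
Proof. by move=> [a b] [c d]; rewrite /cmem rreD rimD !addmx_sub. Qed.
Lemma cmemZ A c v : cmem A v -> cmem A (c *: v).
Proof. by move=> [a b]; rewrite /cmem rreZ rimZ !addmx_sub// ?eqmx_opp scalemx_sub. Qed.
Lemma cmem_cj A v : cmem A v -> cmem A (mcj v).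
Proof. by move=> [a b]; rewrite /cmem rre_cj rim_cj eqmx_opp. Qed.
Lemma cmem0 A : cmem A 0.
Proof.
have -> : 0 = rcm 0 :> 'rV[C]_N by rewrite rcm0.
by rewrite /cmem rre_rcm rim_rcm !sub0mx.
Qed.
Lemma cmem_sum A (I : Type) (r : seq I) (P : pred I) (F : I -> 'rV[C]_N) :
  (forall i, P i -> cmem A (F i)) -> cmem A (\sum_(i <- r | P i) F i).
Proof. by move=> h; apply: big_ind => //; [exact: cmem0|exact: cmemD]. Qed.
Lemma cmem_rcm A (v : 'rV[R]_N) : (v <= A)%MS <-> cmem A (rcm v).
Proof. by rewrite /cmem rre_rcm rim_rcm sub0mx; split=> [->|[]]. Qed.
Lemma cmem_sub A B v : (A <= B)%MS -> cmem A v -> cmem B v.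
Proof. by move=> s [a b]; split; exact: submx_trans s. Qed.

Definition cperp A v : 'rV[C]_N := v *m rcm (perp_mx A).

Lemma cperp_rcm A (v : 'rV[R]_N) : cperp A (rcm v) = rcm (perp A v).
Proof. by rewrite /cperp -rcmM perpE. Qed.
Lemma cperpD A v w : cperp A (v + w) = cperp A v + cperp A w.
Proof. exact: mulmxDl. Qed.
Lemma cperpZ A c v : cperp A (c *: v) = c *: cperp A v.
Proof. by rewrite /cperp scalemxAl. Qed.
Lemma cperp_cj A v : cperp A (mcj v) = mcj (cperp A v).
Proof. by rewrite /cperp mcjM mcj_rcm. Qed.
Lemma perp0 A (v : 'rV[R]_N) : (v <= A)%MS -> perp A v = 0.
Proof. by move=> h; apply: perp_uniq; rewrite ?subr0// mul0mx. Qed.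
Lemma cperp0 A v : cmem A v -> cperp A v = 0.
Proof.
move=> [a b]; have [h1 h2] := mulr_rcm v (perp_mx A).
by apply: rreim0; rewrite ?h1 ?h2 -perpE perp0.
Qed.
Lemma cperp_sub A v : cmem A (v - cperp A v).
Proof.
have [h1 h2] := mulr_rcm v (perp_mx A).
have eN w : - w = (-1 : C) *: w by rewrite scaleN1r.
have r1 (w : 'rV[R]_N) : complex.Re (-1 : C) *: w = - w by rewrite /= scaleN1r.
have r2 (w : 'rV[R]_N) : complex.Im (-1 : C) *: w = 0 by rewrite /= oppr0 scale0r.
rewrite /cmem eN rreD rimD rreZ rimZ !r1 !r2 subr0 addr0 h1 h2 -!perpE.
by split; exact: perp_sub.
Qed.
Lemma cdot_mem A v w : v *m rcm A^T = 0 -> cmem A w -> cdot v w = 0.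
Proof.
move=> vA [a b]; have K (t : 'rV[R]_N) : (t <= A)%MS -> cdot v (rcm t) = 0.
  by move=> /submxP[D ->]; rewrite rcmM cdotC cdotMl rcm_tr vA cdot0r.
by rewrite (rreimE w) cdotDr cdotZr !K// mulr0 addr0.
Qed.
Lemma cperp_orth A v : cperp A v *m rcm A^T = 0.
Proof.
rewrite /cperp -mulmxA -rcmM; have [h1 h2] := mulr_rcm v (perp_mx A *m A^T).
by apply: rreim0; rewrite ?h1 ?h2 mulmxA -perpE perp_orth.
Qed.
Lemma cperp_uniq A v w : cmem A (v - w) -> w *m rcm A^T = 0 -> cperp A v = w.
Proof.
move=> vw wA; rewrite -[v](subrK w) cperpD cperp0// add0r.
have [h1 h2] := mulr_rcm w A^T; rewrite wA in h1 h2.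
have rw : rre w *m A^T = 0 by rewrite -h1 -(rcm0 (p := 1)) rre_rcm.
have iw : rim w *m A^T = 0 by rewrite -h2 -(rcm0 (p := 1)) rim_rcm.
have [k1 k2] := mulr_rcm w (perp_mx A).
rewrite [LHS]rreimE /cperp k1 k2 -!perpE (perp_uniq (w := rre w)) ?subrr ?sub0mx//.
by rewrite (perp_uniq (w := rim w)) ?subrr ?sub0mx// -rreimE.
Qed.

(** A real space whose complexification is spanned by the [x i], i < s, and their conjugates;
    through it complex vectors describe the real osculating spaces. *)
Definition TT s (x : nat -> 'rV[C]_N) : 'M[R]_N := (\sum_(i < s) (<<rre (x i)>> + <<rim (x i)>>))%MS.

Lemma TT_x s x i : (i < s)%N -> cmem (TT s x) (x i).
Proof.
move=> h; split; apply: (sumsmx_sup (Ordinal h)) => //=.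
  by apply: submx_trans (addsmxSl _ _); rewrite genmxE.
by apply: submx_trans (addsmxSr _ _); rewrite genmxE.
Qed.

Lemma TT_sub s x (A : 'M[R]_N) : (forall i, (i < s)%N -> cmem A (x i)) -> (TT s x <= A)%MS.
Proof.
move=> h; apply/sumsmx_subP => i _; have [a b] := h i (ltn_ord i).
by rewrite addsmx_sub !genmxE a.
Qed.

Lemma TT_le s t x : (s <= t)%N -> (TT s x <= TT t x)%MS.
Proof. by move=> st; apply: TT_sub => i h; apply: TT_x; exact: leq_trans h st. Qed.

Lemma TT_scale s x y (c : nat -> C) : (forall i, c i != 0) -> (forall i, y i = c i *: x i) -> (TT s x :=: TT s y)%MS.
Proof.
move=> c0 yE; apply/eqmxP/andP; split; apply: TT_sub => i h.
  have -> : x i = (c i)^-1 *: y i by rewrite yE scalerA mulVf// scale1r.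
  by apply: cmemZ; exact: TT_x.
by rewrite yE; apply: cmemZ; exact: TT_x.
Qed.

Lemma TT_memP s x (v : 'rV[R]_N) : (v <= TT s x)%MS ->
  exists b b' : 'I_s -> C, rcm v = \sum_i (b i *: x i + b' i *: mcj (x i)).
Proof.
move=> /sub_sumsmxP[u ->].
suff H (i : 'I_s) : exists bb : C * C, rcm (u i *m (<<rre (x i)>> + <<rim (x i)>>)%MS) = bb.1 *: x i + bb.2 *: mcj (x i).
  have [f hf] := choice H; exists (fun i => (f i).1), (fun i => (f i).2).
  by rewrite /rcm raddf_sum; apply: eq_bigr => i _; exact: hf.
have : (u i *m (<<rre (x i)>> + <<rim (x i)>>)%MS <= rre (x i) + rim (x i))%MS.
  by apply: submx_trans (submxMl _ _) _; rewrite addsmxS// genmxE.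
move=> /sub_addsmxP[[p q] /= ->].
have e1 : rcm (rre (x i)) = 2^-1 *: (x i + mcj (x i)).
  by apply/matrixP => k l; rewrite !mxE; case: (x i k l) => y1 y2; rewrite -[2^-1]conj2V /=; apply: Cext; simpl; field.
have e2 : rcm (rim (x i)) = (- 'i%C) *: (x i - rcm (rre (x i))).
  rewrite {2}(rreimE (x i)) [in RHS]addrC addKr scalerA mulNr ci2 opprK scale1r //.
rewrite e1 in e2.
have [c1 ->] : exists c, p = c%:M by exists (p 0 0); exact: mx11_scalar.
have [c2 ->] : exists c, q = c%:M by exists (q 0 0); exact: mx11_scalar.
exists (c1%:C%C / 2 + c2%:C%C * (- 'i%C / 2), c1%:C%C / 2 - c2%:C%C * (- 'i%C / 2)) => /=.
rewrite !mul_scalar_mx rcmD !rcmZ e1 e2; move: (x i) (mcj (x i)) (c1%:C%C) (c2%:C%C) ('i%C : C) => y1 y2 d1 d2 t.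
by apply/rowP => j; rewrite !mxE; move: (y1 0 j) (y2 0 j) => r1 r2; field.
Qed.

Lemma cmem_TTP s x v : cmem (TT s x) v ->
  exists b b' : 'I_s -> C, v = \sum_i (b i *: x i + b' i *: mcj (x i)).
Proof.
move=> [/TT_memP[b [b' e1]] /TT_memP[d [d' e2]]].
exists (fun i => b i + 'i%C * d i), (fun i => b' i + 'i%C * d' i).
rewrite (rreimE v) e1 e2 scaler_sumr -big_split; apply: eq_bigr => i _ /=.
by rewrite scalerDr !scalerA addrACA -!scalerDl.
Qed.

Lemma orth_TT s x v : (forall i, (i < s)%N -> cdot v (x i) = 0 /\ cdot v (mcj (x i)) = 0) ->
  v *m rcm (TT s x)^T = 0.
Proof.
move=> h; rewrite -[v *m _]trmxK trmx_mul rcm_tr trmxK; apply/eqP; rewrite trmx_eq0; apply/eqP.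
apply/row_matrixP => i; rewrite row0 row_mul.
have [b [b' e]] : exists b b' : 'I_s -> C, row i (rcm (TT s x)) = \sum_i (b i *: x i + b' i *: mcj (x i)).
  by rewrite /rcm -map_row; apply: TT_memP; exact: row_sub.
rewrite mul_row_trC e cdot_suml big1 ?raddf0// => k _.
by have [a1 a2] := h k (ltn_ord k); rewrite cdotDl !cdotZl !(cdotC _ v) a1 a2 !mulr0 addr0.
Qed.

(* The residual is [x s] minus a combination of the earlier vectors; the same combination of the [y i] is again orthogonal to them, as the Gram matrices agree. *)
Lemma gram_residual s (x y : nat -> 'rV[C]_N) :
  (forall i k, (i <= s)%N -> (k <= s)%N -> cdot (x i) (x k) = cdot (y i) (y k)) ->
  (forall i k, (i <= s)%N -> (k <= s)%N -> cdot (x i) (mcj (x k)) = cdot (y i) (mcj (y k))) ->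
  cdot (cperp (TT s x) (x s)) (cperp (TT s x) (x s)) = cdot (cperp (TT s y) (y s)) (cperp (TT s y) (y s)).
Proof.
move=> h1 h2; set Y := cperp (TT s x) _; have [b [b' e]] := cmem_TTP (cperp_sub (TT s x) (x s)).
(* The combination is an abstract function of the family, as it will be applied to both [x] and
   [y]. *)
have [L L_] : exists L : (nat -> 'rV[C]_N) -> 'rV[C]_N, forall z, L z = \sum_(i < s) (b i *: z i + b' i *: mcj (z i)).
  by eexists.
have YE : Y = x s - L x by rewrite L_ -e opprB addrC subrK.
have lt_ (i : 'I_s) : (i <= s)%N := ltnW (ltn_ord i).
have h3 i k : (i <= s)%N -> (k <= s)%N -> cdot (mcj (x i)) (x k) = cdot (mcj (y i)) (y k).
  by move=> i1 k1; rewrite cdotC h2// cdotC.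
have h4 i k : (i <= s)%N -> (k <= s)%N -> cdot (mcj (x i)) (mcj (x k)) = cdot (mcj (y i)) (mcj (y k)).
  by move=> i1 k1; rewrite !cdot_cj h1.
have LE z v : cdot (L z) v = \sum_i (b i * cdot (z i) v + b' i * cdot (mcj (z i)) v).
  by rewrite L_ cdot_suml; apply: eq_bigr => i _; rewrite cdotDl !cdotZl.
have G1 k : (k <= s)%N -> cdot (x s - L x) (x k) = cdot (y s - L y) (y k).
  move=> k1; rewrite [LHS]cdotDl [RHS]cdotDl cdotNl [in RHS]cdotNl (h1 s k (leqnn s) k1) !LE.
  have -> // : \sum_i (b i * cdot (x i) (x k) + b' i * cdot (mcj (x i)) (x k)) =
    \sum_i (b i * cdot (y i) (y k) + b' i * cdot (mcj (y i)) (y k)).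
  by apply: eq_bigr => i _; rewrite (h1 i k (lt_ i) k1) (h3 i k (lt_ i) k1).
have G2 k : (k <= s)%N -> cdot (x s - L x) (mcj (x k)) = cdot (y s - L y) (mcj (y k)).
  move=> k1; rewrite [LHS]cdotDl [RHS]cdotDl cdotNl [in RHS]cdotNl (h2 s k (leqnn s) k1) !LE.
  have -> // : \sum_i (b i * cdot (x i) (mcj (x k)) + b' i * cdot (mcj (x i)) (mcj (x k))) =
    \sum_i (b i * cdot (y i) (mcj (y k)) + b' i * cdot (mcj (y i)) (mcj (y k))).
  by apply: eq_bigr => i _; rewrite (h2 i k (lt_ i) k1) (h4 i k (lt_ i) k1).
have Yx k : (k < s)%N -> cdot Y (x k) = 0 by move=> k1; apply: cdot_mem (cperp_orth _ _) (TT_x _ k1).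
have Yxb k : (k < s)%N -> cdot Y (mcj (x k)) = 0.
  by move=> k1; apply: cdot_mem (cperp_orth _ _) (cmem_cj (TT_x _ k1)).
have LM z : cmem (TT s z) (L z).
  by rewrite L_; apply: cmem_sum => i _; apply: cmemD; apply: cmemZ; [|apply: cmem_cj]; exact: TT_x.
have -> : cperp (TT s y) (y s) = y s - L y.
  apply: cperp_uniq; first by rewrite opprB addrC subrK.
  apply: orth_TT => i i1; rewrite -(G1 i (ltnW i1)) -(G2 i (ltnW i1)) -YE; split; [exact: Yx|exact: Yxb].
have D z : cdot (z s - L z) (z s - L z) = cdot (z s - L z) (z s) -
    \sum_(i < s) (b i * cdot (z s - L z) (z i) + b' i * cdot (z s - L z) (mcj (z i))).
  rewrite cdotDr cdotNr; congr (_ - _); rewrite {2}L_ cdot_sumr; apply: eq_bigr => i _.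
  by rewrite cdotDr !cdotZr.
rewrite YE !D (G1 s (leqnn s)); congr (_ - _); apply: eq_bigr => i _.
by rewrite (G1 i (lt_ i)) (G2 i (lt_ i)).
Qed.

End ComplexSpan.

(** Evaluates the sums over tuples of coordinate directions in [alpha_del]. *)
Lemma sum_tuple_prod {K : comNzRingType} (f : bool -> K) s :
  \sum_(t : s.-tuple bool) \prod_(b <- t) f b = (f true + f false) ^+ s.
Proof.
elim: s => [|s IH].
  rewrite expr0 (big_pred1 [tuple])/= ?big_nil// => t.
  by apply/esym/eqP; exact: tuple0.
rewrite exprS -IH mulr_sumr; pose h (p : bool * s.-tuple bool) := [tuple of p.1 :: p.2].
rewrite (reindex h) /=; last first.
  exists (fun t => (thead t, [tuple of behead t])) => [[b t] _|t _] /=.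
    by congr (_, _); apply: val_inj.
  by rewrite /h /= -tuple_eta.
rewrite -(pair_big xpredT xpredT (fun b (t : s.-tuple bool) => \prod_(b' <- h (b, t)) f b')) /=.
rewrite exchange_big /=; apply: eq_bigr => t _.
by rewrite big_bool /h /= !big_cons mulrDl.
Qed.

(** * Osculating spaces and Hopf differentials of an abstract ladder *)

Section Ladder.
Context {R : realType} {N : nat}.
Local Notation E := (Cplx R).
Local Notation C := (R[i]).
Variables (U : set E) (F : E -> 'rV[R]_N) (X : nat -> E -> 'rV[C]_N) (p q p' q' : nat -> E -> C).
Hypotheses (Uo : open U) (cF : conf U F) (FX : forall z, U z -> rcm (F z) = X 0 z).
Hypotheses (sX : forall k, csmx U (X k)).
Hypotheses (sp : forall k, csm U (p k)) (sq : forall k, csm U (q k)) (sp' : forall k, csm U (p' k)) (sq' : forall k, csm U (q' k)).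
Hypothesis dX0 : forall z, U z -> mdl (X 0) z = X 1 z.
Hypothesis dX : forall k z, U z -> mdl (X k) z = p k z *: X k z + q k z *: X k.+1 z.
Hypothesis dbX0 : forall z, U z -> mdlb (X 0) z = mcj (X 1 z).
Hypothesis dbX : forall k z, U z -> mdlb (X k.+1) z = p' k.+1 z *: X k.+1 z + q' k.+1 z *: X k z.

(** Combinations, with smooth coefficients, of the [X i] with i < s and their conjugates. In
    inductive form, closure under differentiation is an induction; [SPext] admits fields that agree
    only on [U]. *)
Inductive SP (s : nat) : (E -> 'rV[C]_N) -> Prop :=
| SP0 : SP s (fun _ => 0)
| SPX i f : (i < s)%N -> csm U f -> SP s (fun z => f z *: X i z)
| SPXb i f : (i < s)%N -> csm U f -> SP s (fun z => f z *: mcj (X i z))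
| SPD G H : SP s G -> SP s H -> SP s (fun z => G z + H z)
| SPext G H : (forall z, U z -> G z = H z) -> SP s G -> SP s H.

Lemma SP_csm s G : SP s G -> csmx U G.
Proof.
elim=> {G} [|i f _ sf|i f _ sf|G H _ h1 _ h2|G H e _ h].
- exact: csmx_cst.
- exact: csmxZ.
- by apply: csmxZ => //; exact: csmx_cj.
- exact: csmxD.
- exact: csmx_ext e h.
Qed.

Lemma SP_le s t G : (s <= t)%N -> SP s G -> SP t G.
Proof.
move=> st; elim=> {G} [|i f h sf|i f h sf|G H _ h1 _ h2|G H e _ h].
- exact: SP0.
- by apply: SPX => //; exact: leq_trans h st.
- by apply: SPXb => //; exact: leq_trans h st.
- exact: SPD.
- exact: SPext e h.
Qed.

Lemma SP_cj s G : SP s G -> SP s (fun z => mcj (G z)).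
Proof.
elim=> {G} [|i f h sf|i f h sf|G H _ h1 _ h2|G H e _ h].
- by apply: SPext (SP0 s) => z _; rewrite mcj0.
- by apply: SPext (SPXb h (csm_conj Uo sf)) => z _; rewrite mcjZ.
- by apply: SPext (SPX h (csm_conj Uo sf)) => z _; rewrite mcjZ mcjK.
- by apply: SPext (SPD h1 h2) => z _; rewrite mcjD.
- by apply: SPext h => z Uz; rewrite e.
Qed.

Lemma SP_Z s f G : csm U f -> SP s G -> SP s (fun z => f z *: G z).
Proof.
move=> sf; elim=> {G} [|i g h sg|i g h sg|G H _ h1 _ h2|G H e _ h].
- by apply: SPext (SP0 s) => z _; rewrite scaler0.
- by apply: SPext (SPX h (csmM Uo sf sg)) => z _; rewrite scalerA.
- by apply: SPext (SPXb h (csmM Uo sf sg)) => z _; rewrite scalerA.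
- by apply: SPext (SPD h1 h2) => z _; rewrite scalerDr.
- by apply: SPext h => z Uz; rewrite e.
Qed.

Lemma SP_c s (c : C) G : SP s G -> SP s (fun z => c *: G z).
Proof. exact: SP_Z (csm_cst U c). Qed.

Lemma SP_dX i : SP i.+2 (mdl (X i)) /\ SP i.+2 (mdlb (X i)).
Proof.
split.
  apply: SPext (SPD (SPX (leqnSn i.+1 : i < i.+2)%N (sp i)) (SPX (leqnn i.+2) (sq i))) => z Uz.
  by rewrite dX.
case: i => [|i].
  by apply: SPext (SPXb (leqnn 2) (csm_cst U 1)) => z Uz; rewrite dbX0// scale1r.
apply: SPext (SPD (SPX (leqnSn i.+2 : i.+1 < i.+3)%N (sp' i.+1)) (SPX (ltnW (leqnSn i.+2) : i < i.+3)%N (sq' i.+1))) => z Uz.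
by rewrite dbX.
Qed.

Lemma SP_d s G : SP s G -> SP s.+1 (mdl G) /\ SP s.+1 (mdlb G).
Proof.
have K i f (h : (i < s)%N) (sf : csm U f) : SP s.+1 (fun z => dl f z *: X i z + f z *: mdl (X i) z) /\
    SP s.+1 (fun z => dlb f z *: X i z + f z *: mdlb (X i) z).
  have h1 : (i < s.+1)%N := ltnW h; have [d1 d2] := SP_dX i.
  have e1 : SP s.+1 (mdl (X i)) by exact: SP_le d1.
  have e2 : SP s.+1 (mdlb (X i)) by exact: SP_le d2.
  split; [exact: SPD (SPX h1 (csm_dl Uo sf)) (SP_Z sf e1)|exact: SPD (SPX h1 (csm_dlb Uo sf)) (SP_Z sf e2)].
elim=> {G} [|i f h sf|i f h sf|G H G1 [h1 h1'] H1 [h2 h2']|G H e G1 [h1 h2]].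
- split; apply: SPext (SP0 _) => z Uz; [by rewrite mdl_cst|by rewrite mdlb_cst].
- have [k1 k2] := K i f h sf; split.
    by apply: SPext k1 => z Uz; rewrite (mdlZ Uo sf (sX i) Uz).
  by apply: SPext k2 => z Uz; rewrite (mdlbZ Uo sf (sX i) Uz).
- have sc := csm_conj Uo sf; have [k1 k2] := K i _ h sc; have sXb := csmx_cj Uo (sX i); split.
    apply: SPext (SP_cj k2) => z Uz; rewrite (mdlZ Uo sf sXb Uz) mcjD !mcjZ conjcK (mdl_cj (sX i) Uz).
    by rewrite (dlb_conj sf Uz) conjcK.
  apply: SPext (SP_cj k1) => z Uz; rewrite (mdlbZ Uo sf sXb Uz) mcjD !mcjZ conjcK (mdlb_cj (sX i) Uz).
  by rewrite (dl_conj sf Uz) conjcK.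
- split; [apply: SPext (SPD h1 h2)|apply: SPext (SPD h1' h2')] => z Uz.
    by rewrite (mdlD (SP_csm G1) (SP_csm H1) Uz).
  by rewrite (mdlbD (SP_csm G1) (SP_csm H1) Uz).
- split; [apply: SPext h1|apply: SPext h2] => z Uz.
    by rewrite (mdl_ext Uo e Uz).
  by rewrite (mdlb_ext Uo e Uz).
Qed.

Lemma SP_mem s G z : SP s G -> U z -> cmem (TT s (X^~ z)) (G z).
Proof.
move=> h Uz; elim: h => {G} [|i f h sf|i f h sf|G H _ h1 _ h2|G H e _ h].
- exact: cmem0.
- by apply: cmemZ; exact: (TT_x (X^~ z) h).
- by apply: cmemZ; apply: cmem_cj; exact: (TT_x (X^~ z) h).
- exact: cmemD.
- by rewrite -e.
Qed.

Lemma rcm_DF u z : U z -> rcm (Dr u F z) = (u : C) *: X 1 z + (u : C)^*%C *: mcj (X 1 z).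
Proof.
move=> Uz; rewrite (rcm_dird u Uo cF.1 Uz) (mdl_ext Uo FX Uz) (mdlb_ext Uo FX Uz).
by rewrite (dX0 Uz) (dbX0 Uz).
Qed.

Lemma SP_DF u : SP 2 (fun z => rcm (Dr u F z)).
Proof.
apply: SPext (SPD (SPX (leqnn 2) (csm_cst U (u : C))) (SPXb (leqnn 2) (csm_cst U (u : C)^*%C))) => z Uz.
by rewrite rcm_DF.
Qed.

Lemma SP_F : SP 2 (fun z => rcm (F z)).
Proof. by apply: SPext (SPX (isT : 0 < 2)%N (csm_cst U 1)) => z Uz; rewrite FX// scale1r. Qed.

Lemma SP_rZ s f G : sm U f -> SP s (fun z => rcm (G z)) -> SP s (fun z => rcm (f z *: G z)).
Proof. by move=> sf h; apply: SPext (SP_Z (csm_real sf) h) => z _; rewrite rcmZ. Qed.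

Lemma SP_rD s G H : SP s (fun z => rcm (G z)) -> SP s (fun z => rcm (H z)) -> SP s (fun z => rcm (G z + H z)).
Proof. by move=> h1 h2; apply: SPext (SPD h1 h2) => z _; rewrite rcmD. Qed.

Lemma SP_tang v : smx U v -> SP 2 (fun z => rcm (tang F z (v z))).
Proof.
move=> sv; have sD u := smx_dird u Uo cF.1.
apply: SP_rD; first by apply: SP_rZ; [exact: sm_dot Uo sv cF.1|exact: SP_F].
apply: SP_rZ; first exact: lamV_smx.
by apply: SP_rD; apply: SP_rZ; [exact: sm_dot Uo sv (sD 1)|exact: SP_DF|exact: sm_dot Uo sv (sD ii)|exact: SP_DF].
Qed.

Lemma nabla_smx us : smx U (nabla_alpha F us).
Proof.
elim: us => [|u us IH]; first exact: cF.1.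
case: us IH => [_|v us IH]; first by rewrite /= -DrfE; exact: smx_dird Uo cF.1.
have sG := smx_dird u Uo IH; apply: (smx_ext Uo) (smxM Uo sG (nproj_smx Uo cF)) => w Uw.
by rewrite (mul_nproj _ Uo cF Uw) np.unlock DrfE.
Qed.

Lemma nablaS u v us z : nabla_alpha F [:: u, v & us] z = np F z (Dr u (nabla_alpha F (v :: us)) z).
Proof. by rewrite np.unlock DrE. Qed.

(** The factor gathered when s - 1 derivatives lift [X 1] to [X s]. *)
Definition Qs s z : C := \prod_(1 <= i < s) q i z.
Definition Pu (us : seq E) : C := \prod_(u <- us) (u : C).

Lemma csm_Qs s : csm U (Qs s).
Proof.
rewrite /Qs; elim: s => [|s IH].
  by apply: (csm_ext Uo _ (csm_cst U 1)) => w _; rewrite big_geq.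
case: s IH => [|s] IH; first by apply: (csm_ext Uo _ (csm_cst U 1)) => w _; rewrite big_geq.
by apply: (csm_ext Uo _ (csmM Uo IH (sq s.+1))) => w _; rewrite [RHS]big_nat_recr.
Qed.

(** Each derivative along [u] lifts the leading term with the factor u q_s. All other terms, and the
    tangential part removed by the normal connection, stay among the earlier vectors and their
    conjugates. *)
Lemma nabla_ladder us : us != [::] -> exists2 L, SP (size us) L & forall z, U z ->
  let T := (Pu us * Qs (size us) z) *: X (size us) z in rcm (nabla_alpha F us z) = T + mcj T + L z.
Proof.
elim: us => // u us IH _; case: us IH => [_|v us IH].
  exists (fun _ => 0); [exact: SP0|move=> z Uz].
  rewrite /Qs /Pu big_geq//= big_seq1 mulr1 addr0 mcjZ -rcm_DF//.
  by rewrite DrE.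
have {IH} [//|L sL hL] := IH; set s := size (v :: us) in sL hL *.
rewrite [size _]/=; pose t z := Pu (v :: us) * Qs s z.
have st : csm U t by apply: csmM => //; [exact: csm_cst|exact: csm_Qs].
pose T z := t z *: X s z; have sT : csmx U T by exact: csmxZ.
pose G := nabla_alpha F (v :: us); have sG : smx U G := nabla_smx _.
have GE z : U z -> rcm (G z) = T z + mcj (T z) + L z by exact: hL.
have sTb := csmx_cj Uo sT; have sL' := SP_csm sL; have sTT := csmxD Uo sT sTb.
have [d1 d2] := SP_d sL; have [x1 x2] := SP_dX s.
have dT z : U z -> mdl T z = dl t z *: X s z + t z *: (p s z *: X s z + q s z *: X s.+1 z).
  by move=> Uz; rewrite (mdlZ Uo st (sX s) Uz) dX.
have B2 : SP s.+1 (mdlb T).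
  have B1 : SP s.+1 (fun z => dlb t z *: X s z) by apply: SPX => //; exact: csm_dlb.
  have B3 : SP s.+1 (mdlb (X s)).
    (* At index 0 the operator d/dzbar would produce conj(X 1) and climb the ladder; from index 1 on
       it does not climb. *)
    have [s' es] : exists s', s = s'.+1 by exists (size us).
    rewrite es; apply: SPext (SPD (SPX (leqnn s'.+2) (sp' s'.+1)) (SPX (leqnSn s'.+1 : s' < s'.+2)%N (sq' s'.+1))) => z Uz.
    by rewrite dbX.
  by apply: SPext (SPD B1 (SP_Z st B3)) => z Uz; rewrite (mdlbZ Uo st (sX s) Uz).
pose S z := (u : C) *: (t z * q s z *: X s.+1 z).
have A1 : SP s.+1 (fun z => mdl T z - t z * q s z *: X s.+1 z).
  have B1 : SP s.+1 (fun z => (dl t z + t z * p s z) *: X s z).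
    by apply: SPX => //; apply: csmD => //; [exact: csm_dl|exact: csmM].
  by apply: SPext B1 => z Uz; rewrite dT// scalerDl scalerDr !scalerA addrA addrK.
have st' : SP s.+1 (fun z => rcm (tang F z (Dr u G z))).
  by apply: SP_le (SP_tang (smx_dird u Uo sG)); rewrite ltnS.
pose A z := mdl T z - t z * q s z *: X s.+1 z; rewrite -/A in A1.
exists (fun z => (u : C) *: A z + (u : C) *: mcj (mdlb T z) + (u : C) *: mdl L z +
   ((u : C)^*%C *: mdlb T z + (u : C)^*%C *: mcj (A z) + (u : C)^*%C *: mdlb L z) +
   (-1 : C) *: rcm (tang F z (Dr u G z))).
  apply: SPD; last exact: SP_c.
  apply: SPD; (apply: SPD; last exact: SP_c).
    by apply: SPD; [exact: SP_c|apply: SP_c; exact: SP_cj].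
  by apply: SPD; [exact: SP_c|apply: SP_c; exact: SP_cj].
move=> z Uz; rewrite nablaS -/G (normal_partE _ Uo cF Uz) rcmD rcmN (rcm_dird u Uo sG Uz).
rewrite (mdl_ext Uo GE Uz) (mdlb_ext Uo GE Uz) (mdlD sTT sL' Uz) (mdlbD sTT sL' Uz) (mdlD sT sTb Uz) (mdlbD sT sTb Uz).
rewrite (mdl_cj sT Uz) (mdlb_cj sT Uz).
have -> : Pu [:: u, v & us] * Qs s.+1 z = (u : C) * (t z * q s z).
  by rewrite /Pu big_cons -/(Pu (v :: us)) /Qs big_nat_recr// -/(Qs s z) /t /=; ring.
have -> : mdl T z = A z + t z * q s z *: X s.+1 z by rewrite subrK.
rewrite -scalerA scaleN1r; move: (A z) (mdlb T z) (mdl L z) (mdlb L z) ((t z * q s z) *: X s.+1 z).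
move: (rcm (tang F z _)) => v1 v2 v3 v4 v5 v6; rewrite /= mcjD mcjZ.
by apply/rowP => j; rewrite !mxE; ring.
Qed.

Section AtPoint.
Variable z : E.
Hypothesis Uz : U z.
Local Notation T := (fun s => TT s (X^~ z)).

Lemma frame_sub k (A : 'M[R]_(k, N)) : (frame F z <= A)%MS <->
  [/\ (F z <= A)%MS, (Dr 1 F z <= A)%MS & (Dr ii F z <= A)%MS].
Proof.
rewrite /frame -!DrfE -!iiE !col_mx_sub; split; first by move=> /and3P[].
by case=> -> -> ->.
Qed.

Lemma frame_T : (frame F z :=: T 2)%MS.
Proof.
have eF : X 0 z = rcm (F z) by rewrite FX.
have two : (2 : C) *: X 1 z = rcm (Dr 1 F z) - 'i%C *: rcm (Dr ii F z).
  rewrite !rcm_DF// iiE -[(iunit : C)]/('i%C : C) conji rmorph1 !scale1r.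
  have := ci2 (R := R); move: ('i%C : C) (X 1 z) (mcj (X 1 z)) => t a b et.
  by apply/rowP => j; rewrite !mxE; move: (a 0 j) (b 0 j) => c d; ring: et.
apply/eqmxP/andP; split.
  apply/frame_sub; split; apply/cmem_rcm; first by rewrite -eF; exact: (TT_x (X^~ z)).
    exact: (SP_mem (SP_DF 1) Uz).
  exact: (SP_mem (SP_DF ii) Uz).
suff K (A : 'M[R]_N) : (frame F z <= A)%MS -> (T 2 <= A)%MS.
  by rewrite -(genmxE (frame F z)); apply: K; rewrite genmxE.
move=> /frame_sub[h1 h2 h3]; apply: TT_sub => -[|[|//]] _.
  by rewrite eF; apply/cmem_rcm.
have -> : X 1 z = 2^-1 *: (2 *: X 1 z) by rewrite scalerA mulVf ?two_C// scale1r.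
rewrite two -scaleNr; apply: cmemZ; apply: cmemD; first exact/cmem_rcm.
by apply: cmemZ; apply/cmem_rcm.
Qed.

Lemma nabla_normal u v us : nabla_alpha F [:: u, v & us] z *m (frame F z)^T = 0.
Proof. by rewrite nablaS; exact: normal_part_normal Uo cF Uz. Qed.

Lemma osc_normal k : osc F k z *m (frame F z)^T = 0.
Proof.
suff K : (osc F k z <= kermx (frame F z)^T)%MS by apply/sub_kermxP.
elim: k => [|k IH] /=; first exact: sub0mx.
rewrite addsmx_sub IH; apply/sumsmx_subP => t _; rewrite genmxE; set w := nabla_alpha F _ z.
have hw : (w <= kermx (frame F z)^T)%MS.
  by apply/sub_kermxP; rewrite /w; case: (t) => -[|a [|b t']]//= _; exact: nabla_normal.
rewrite -[perp _ w](subKr w) addmx_sub//.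
by rewrite eqmx_opp; apply: submx_trans (perp_sub _ _) IH.
Qed.

Lemma nabla_mem us : us != [::] -> (nabla_alpha F us z <= T (size us).+1)%MS.
Proof.
move=> us0; apply/cmem_rcm; have [L sL hL] := nabla_ladder us0; rewrite hL//.
have Xs : cmem (T (size us).+1) (X (size us) z) by exact: (TT_x (X^~ z)).
apply: cmemD; last exact: SP_mem (SP_le (leqnSn _) sL) Uz.
by apply: cmemD; [|apply: cmem_cj]; exact: cmemZ.
Qed.

Definition qnz k := forall i, (0 < i <= k)%N -> q i z != 0.

Lemma qnz_le k l : (k <= l)%N -> qnz l -> qnz k.
Proof. by move=> kl h i /andP[i0 ik]; apply: h; rewrite i0 (leq_trans ik). Qed.

Lemma Qs0 k : qnz k -> Qs k.+1 z != 0.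
Proof.
move=> h; rewrite /Qs prodf_seq_neq0; apply/allP => i.
by rewrite mem_index_iota ltnS => hi; rewrite h.
Qed.

(** Where the q_i do not vanish, the leading coefficient of [nabla_ladder] is invertible, so each
    normal space adds exactly the next vector and its conjugate. *)
Lemma osc_T k : qnz k -> ((frame F z + osc F k z)%MS :=: T k.+2)%MS.
Proof.
elim: k => [_|k IH hq]; first by rewrite /=; apply: eqmx_trans (addsmx0 _ _) frame_T.
have {}IH := IH (qnz_le (leqnSn k) hq).
have sT : (T k.+2 <= T k.+3)%MS by exact: TT_le.
apply/eqmxP/andP; split.
  rewrite addsmx_sub /= addsmx_sub; apply/and3P; split.
  - by rewrite frame_T; apply: TT_le.
  - by apply: submx_trans (addsmxSr (frame F z) _) _; rewrite IH.
  apply/sumsmx_subP => t _; rewrite genmxE; set w := nabla_alpha F _ z.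
  rewrite -[perp _ w](subKr w) addmx_sub//.
    by have := @nabla_mem (map coord_field t); rewrite size_map size_tuple; apply; case: (t) => -[].
  rewrite eqmx_opp; apply: submx_trans (perp_sub _ _) _.
  by apply: submx_trans (addsmxSr (frame F z) _) _; rewrite IH.
pose V := (frame F z + osc F k.+1 z)%MS.
have V2 : (T k.+2 <= V)%MS by rewrite -IH /V addsmxS//= addsmxSl.
have Vn (t : (k.+2).-tuple bool) : (nabla_alpha F (map coord_field t) z <= V)%MS.
  set w := nabla_alpha F _ z; rewrite -[w](subrK (perp (osc F k z) w)) addmx_sub//.
    apply: submx_trans (perp_sub _ _) _; apply: submx_trans _ (addsmxSr (frame F z) _).
    exact: addsmxSl.
  apply: submx_trans _ (addsmxSr (frame F z) _) => /=; apply: submx_trans _ (addsmxSr _ _).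
  by apply: (sumsmx_sup t) => //; rewrite genmxE.
have Vw (t : (k.+2).-tuple bool) : cmem V ((Pu (map coord_field t) * Qs k.+2 z) *: X k.+2 z +
     mcj ((Pu (map coord_field t) * Qs k.+2 z) *: X k.+2 z)).
  have t0 : map (@coord_field R) t != [::] by case: (t) => -[].
  have [L sL hL] := nabla_ladder t0; move: sL hL; rewrite size_map size_tuple => sL hL.
  have -> : forall a b : 'rV[C]_N, a + b = a + b + L z - L z by move=> a b; rewrite addrK.
  rewrite -hL// -scaleN1r; apply: cmemD; first by apply/cmem_rcm.
  by apply: cmemZ; apply: cmem_sub V2 (SP_mem sL Uz).
pose w := Qs k.+2 z *: X k.+2 z.
have Pn l : \prod_(b <- nseq l false) (coord_field b : C) = 1.
  by elim: l => [|l IHl]; rewrite ?big_nil//= big_cons IHl mulr1.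
have P1 : Pu (map (@coord_field R) [tuple of nseq k.+2 false]) = 1 by rewrite /Pu big_map; exact: Pn k.+2.
have P2 : Pu (map (@coord_field R) [tuple of true :: nseq k.+1 false]) = 'i%C.
  by rewrite /Pu big_map /= big_cons (Pn k.+1) mulr1.
(* The direction 1 throughout gives w + conj(w), twice the real part; one direction i in front gives
   i w + conj(i w), minus twice the imaginary part. *)
have W1 := Vw [tuple of nseq k.+2 false]; have W2 := Vw [tuple of true :: nseq k.+1 false].
rewrite P1 mul1r -/w in W1; rewrite P2 -scalerA -/w in W2.
have half (y : 'rV[R]_N) : ((y + y)%R <= V)%MS -> (y <= V)%MS.
  by move=> h; have -> : y = 2^-1 *: (y + y); [apply/rowP => j; rewrite !mxE; lra|exact: scalemx_sub].
have Vww : cmem V w.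
  split; apply: half; first by have [h _] := W1; move: h; rewrite rreD rre_cj.
  have [h _] := W2; move: h; rewrite rreD rre_cj rreZ /= scale0r scale1r sub0r -opprD eqmx_opp.
  by [].
apply: TT_sub => i; rewrite ltnS leq_eqVlt => /orP[/eqP->|h].
  have -> : X k.+2 z = (Qs k.+2 z)^-1 *: w by rewrite scalerA mulVf ?(Qs0 hq)// scale1r.
  exact: cmemZ.
by apply: cmem_sub V2 _; exact: (TT_x (X^~ z)).
Qed.

(** Both [v] and [osc] are normal to the frame, so adding the frame to the space projected off
    changes nothing. *)
Lemma perp_osc_T k (v : 'rV[R]_N) : qnz k -> v *m (frame F z)^T = 0 -> perp (osc F k z) v = perp (T k.+2) v.
Proof.
move=> hq vF; apply/esym/perp_uniq.
  by rewrite -(osc_T hq); apply: submx_trans (perp_sub _ _) (addsmxSr _ _).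
set w := perp _ v; have wF : w *m (frame F z)^T = 0.
  rewrite -[w](subKr v) mulmxBl vF; have /submxP[D ->] := perp_sub (osc F k z) v.
  by rewrite -mulmxA osc_normal mulmx0 subr0.
have : (T k.+2 <= kermx w^T)%MS.
  rewrite -(osc_T hq) addsmx_sub; apply/andP; split; apply/sub_kermxP.
    by rewrite -[LHS]trmxK trmx_mul trmxK wF trmx0.
  by rewrite -[LHS]trmxK trmx_mul trmxK /w perp_orth trmx0.
by move=> /sub_kermxP h; rewrite -[LHS]trmxK trmx_mul trmxK h trmx0.
Qed.

Definition resid s : 'rV[C]_N := cperp (T s) (X s z).

Lemma rcm_higher_alpha us : (1 < size us)%N -> qnz (size us - 2) -> rcm (higher_alpha F us z) =
  (Pu us * Qs (size us) z) *: resid (size us) + mcj ((Pu us * Qs (size us) z) *: resid (size us)).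
Proof.
move=> s2 hq; have us0 : us != [::] by case: us s2 {hq}.
have nz : nabla_alpha F us z *m (frame F z)^T = 0.
  by case: us s2 {us0 hq} => [|u [|v us]]// _; exact: nabla_normal.
rewrite /higher_alpha (perp_osc_T hq nz).
have -> : (size us - 2).+2 = size us by rewrite -addn2 subnK.
have [L sL hL] := nabla_ladder us0; rewrite -cperp_rcm hL// 2!cperpD (cperp0 (SP_mem sL Uz)) addr0.
by rewrite cperp_cj !cperpZ.
Qed.

(** Over all tuples the weights sum to (1/2 - i i/2)^s = 1 on the leading term and to (1/2 + i
    i/2)^s = 0 on its conjugate. *)
Lemma alpha_delE s : (1 < s)%N -> qnz (s - 2) -> alpha_del F s z = Qs s z *: resid s.
Proof.
move=> s2 hq; rewrite /alpha_del; pose f (b : bool) : C := if b then - iunit / 2 else 1 / 2.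
pose g (b : bool) : C := coord_field b.
have Pg (t : s.-tuple bool) : Pu (map coord_field t) = \prod_(b <- t) g b by rewrite /Pu big_map.
have H (t : s.-tuple bool) : (\prod_(b <- t) f b) *: rcm (higher_alpha F (map coord_field t) z) =
    (\prod_(b <- t) (f b * g b) * Qs s z) *: resid s + (\prod_(b <- t) (f b * (g b)^*%C) * (Qs s z)^*%C) *: mcj (resid s).
  rewrite rcm_higher_alpha size_map size_tuple // mcjZ Pg rmorphM rmorph_prod !big_split /=.
  by rewrite scalerDr !scalerA !mulrA.
rewrite (eq_bigr _ (fun t _ => H t)).
rewrite big_split /= -!scaler_suml.
have -> : \sum_(t : s.-tuple bool) \prod_(b <- t) (f b * g b) = 1.
  rewrite (sum_tuple_prod (fun b => f b * g b)) /f /g /coord_field /=.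
  rewrite (_ : _ + _ = 1) ?expr1n//.
  by have h := ci2 (R := R); rewrite -[iunit]/('i%C : C); field: h.
have -> : \sum_(t : s.-tuple bool) \prod_(b <- t) (f b * (g b)^*%C) = 0.
  rewrite (sum_tuple_prod (fun b => f b * (g b)^*%C)) /f /g /coord_field; cbv beta iota.
  rewrite (_ : _ + _ = 0) ?expr0n; first by case: s s2 {Pg H hq}.
  have h := ci2 (R := R); rewrite -[iunit]/('i%C : C) conji rmorph1.
  by field: h.
by rewrite !scale0r addr0 scale1r.
Qed.

Lemma hopfE s : (0 < s)%N -> qnz s.-1 -> hopf F s z = Qs s.+1 z ^+ 2 * cdot (resid s.+1) (resid s.+1).
Proof.
move=> s0 hq; have hq' : qnz (s.+1 - 2) by rewrite subSS subn1.
rewrite /hopf (alpha_delE _ hq')// cdotE mxE mulr_sumr; apply: eq_bigr => k _.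
by rewrite !mxE; ring.
Qed.

End AtPoint.
End Ladder.

(** Tested with the polynomial that vanishes at all [y k] except [y j]. *)
Lemma vandermonde {K : fieldType} m (x y : 'I_m -> K) : injective y ->
  (forall i : nat, \sum_j x j * y j ^+ i = 0) -> forall j, x j = 0.
Proof.
move=> yI h; have hp (P : {poly K}) : \sum_j x j * P.[y j] = 0.
  under eq_bigr do rewrite horner_coef mulr_sumr.
  rewrite exchange_big big1// => i _; transitivity (P`_i * \sum_j x j * y j ^+ i); last by rewrite h mulr0.
  by rewrite mulr_sumr; apply: eq_bigr => j _; rewrite mulrCA.
move=> j; have := hp (\prod_(k | k != j) ('X - (y k)%:P)).
rewrite (bigD1 j)//= [X in _ + X]big1 ?addr0 => [/eqP|k kj].
  rewrite mulf_eq0 => /orP[/eqP//|]; rewrite horner_prod => /prodf_eq0[k kj].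
  by rewrite hornerXsubC subr_eq0 => /eqP/yI e; rewrite e eqxx in kj.
by rewrite horner_prod (bigD1 k)//= hornerXsubC subrr mul0r mulr0.
Qed.

Lemma cperp_eqmx {R : realType} {N} (A B : 'M[R]_N) (v : 'rV[R[i]]_N) : (A :=: B)%MS -> cperp A v = cperp B v.
Proof.
move=> AB; apply: cperp_uniq; first by apply: cmem_sub (cperp_sub B v); rewrite AB.
have /submxP[D ->] : (A <= B)%MS by rewrite AB.
by rewrite trmx_mul rcmM mulmxA cperp_orth mul0mx.
Qed.

Lemma near_open_ex {T : topologicalType} (z : T) (P : T -> Prop) : (\forall w \near z, P w) ->
  exists2 W : set T, open W /\ W z & forall w, W w -> P w.
Proof. by rewrite /prop_near1 nbhsE => -[W Wz hW]; exists W. Qed.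

(** * Hopf differentials *)

Section GramResidual.
Context {R : realType} {N : nat}.
Local Notation C := (R[i]).
Variables (s : nat) (x y : nat -> 'rV[C]_N) (c d : nat -> C).
Local Notation sq s x := (cdot (cperp (TT s x) (x s)) (cperp (TT s x) (x s))).
Hypotheses (c0 : forall i, c i != 0).

Lemma residual_scale : sq s (fun i => c i *: x i) = c s ^+ 2 * sq s x.
Proof.
rewrite -(@cperp_eqmx _ _ (TT s x)); last exact: (@TT_scale _ _ s _ _ c).
by rewrite cperpZ cdotZl cdotZr mulrA expr2.
Qed.

(** Rescaling by [c] preserves the Gram data, hence the square of the residual, and also multiplies
    that square by [c s ^+ 2]. *)
Lemma gram_twist :
  (forall i k, cdot (c i *: x i) (c k *: x k) = cdot (x i) (x k)) ->
  (forall i k, cdot (c i *: x i) (mcj (c k *: x k)) = cdot (x i) (mcj (x k))) ->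
  sq s x = c s ^+ 2 * sq s x.
Proof.
by move=> h1 h2; rewrite -residual_scale; apply: (@gram_residual _ _ s x (fun i => c i *: x i)) => i k _ _.
Qed.

End GramResidual.

(** Divided by [c] and [d], the two families have the same Gram entries [kap]; real scalars make
    hermitian and bilinear products rescale alike. *)
Lemma gram_scale {R : realType} {N} s (x y : nat -> 'rV[R[i]]_N) (c d : nat -> R[i]) :
  (forall i, c i != 0) -> (forall i, d i != 0) -> (forall i, (c i)^*%C = c i) -> (forall i, (d i)^*%C = d i) ->
  (forall i k, exists kap, cdot (x i) (x k) = kap * c i * c k /\ cdot (y i) (y k) = kap * d i * d k) ->
  (forall i k, exists kap, cdot (x i) (mcj (x k)) = kap * c i * c k /\ cdot (y i) (mcj (y k)) = kap * d i * d k) ->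
  cdot (cperp (TT s x) (x s)) (cperp (TT s x) (x s)) =
  c s ^+ 2 / d s ^+ 2 * cdot (cperp (TT s y) (y s)) (cperp (TT s y) (y s)).
Proof.
move=> c0 d0 cc dc h1 h2.
have cV i : (c i)^-1 != 0 by rewrite invr_eq0.
have dV i : (d i)^-1 != 0 by rewrite invr_eq0.
have e1 := @residual_scale _ _ s x _ cV; have e2 := @residual_scale _ _ s y _ dV.
have alg (p q u v t t' : R[i]) : t != 0 -> t' != 0 -> u = t^-1 ^+ 2 * p -> v = t'^-1 ^+ 2 * q -> u = v ->
    p = t ^+ 2 / t' ^+ 2 * q.
  move=> t0 t'0 -> -> e; have -> : p = t ^+ 2 * (t^-1 ^+ 2 * p) by field.
  by rewrite e; field.
apply: (alg _ _ _ _ _ _ (c0 s) (d0 s) e1 e2).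
apply: (@gram_residual _ _ s (fun i => (c i)^-1 *: x i) (fun i => (d i)^-1 *: y i)) => i k _ _.
  have [kap [-> ->]] : exists kap, cdot ((c i)^-1 *: x i) ((c k)^-1 *: x k) = kap /\ cdot ((d i)^-1 *: y i) ((d k)^-1 *: y k) = kap.
    have [kap [k1 k2]] := h1 i k; exists kap; rewrite !cdotZl !cdotZr k1 k2.
    by split; [move: (c0 i) (c0 k)|move: (d0 i) (d0 k)] => u0 v0; field; rewrite u0 v0.
  by [].
have [kap [-> ->]] : exists kap, cdot ((c i)^-1 *: x i) (mcj ((c k)^-1 *: x k)) = kap /\ cdot ((d i)^-1 *: y i) (mcj ((d k)^-1 *: y k)) = kap.
  have [kap [k1 k2]] := h2 i k; exists kap; rewrite !mcjZ !cdotZl !cdotZr k1 k2.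
  have -> : ((c k)^-1)^*%C = (c k)^-1 by rewrite fmorphV; congr (_^-1); exact: cc.
  have -> : ((d k)^-1)^*%C = (d k)^-1 by rewrite fmorphV; congr (_^-1); exact: dc.
  by split; [move: (c0 i) (c0 k)|move: (d0 i) (d0 k)] => u0 v0; field; rewrite u0 v0.
by [].
Qed.

Section Exceptional.
Context {R : realType}.
Local Notation E := (Cplx R).
Local Notation C := (R[i]).
Variables (U : set E) (gam : E -> 'rV[R]_6) (J : 'M[R]_6).
Hypotheses (Uo : open U) (jg : jcurve U gam J).
Variables (m N : nat) (a : 'I_m -> R) (eps : 'I_m -> E) (Z : 'I_m -> E -> 'M[R]_6) (B : 'I_m -> 'M[R]_(6, N)).
Hypothesis rZ : forall j, rot U gam (eps j - 1) (Z j).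
Hypothesis eps1 : forall j, (eps j : C) * (eps j : C)^*%C = 1.
Hypothesis BB : forall i j, B i *m (B j)^T = if i == j then 1%:M else 0.
Hypothesis a1 : \sum_j a j ^+ 2 = 1.
Variable F : E -> 'rV[R]_N.
Hypothesis FE : forall z, U z -> F z = \sum_j a j *: (gam z *m Z j z *m B j).

Let cg : conf U gam. Proof. by case: jg. Qed.
Local Notation X := (XX gam J a eps Z B).
Local Notation Lc := (Lc gam).
Local Notation Cq := (Cq gam J).
Local Notation g0 := (g0 gam).
Local Notation g1 := (g1 gam).
Local Notation g1b := (g1b gam).
Local Notation JC := (JC J).

Local Notation pk := (pk gam).
Local Notation qk := (qk gam J).
Local Notation pbk := (pbk gam).
Local Notation qbk := (qbk gam J).
Local Notation sg := (sg gam).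

Let sXk k : csmx U (X k). Proof. exact: csm_XX. Qed.
Let dXk k z : U z -> mdl (X k) z = pk k z *: X k z + qk k z *: X k.+1 z. Proof. exact: mdl_XX. Qed.
Let dbXk k z : U z -> mdlb (X k.+1) z = pbk k.+1 z *: X k.+1 z + qbk k.+1 z *: X k z. Proof. exact: mdlb_XX. Qed.
Let dbX0 z : U z -> mdlb (X 0) z = mcj (X 1 z). Proof. exact: mdlb_XX0. Qed.
Let dX0 z : U z -> mdl (X 0) z = X 1 z.
Proof. by move=> Uz; rewrite dXk// /pk /qk /= scale0r add0r scale1r. Qed.

Lemma csm_LV : csm U (fun w => (Lc w)^-1).
Proof.
have s1 : sm U (fun w => (lam gam w)^-1) by exact: lamV_smx.
by apply: (csm_ext Uo _ (csm_real s1)) => w _; rewrite fmorphV.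
Qed.
Lemma csm_cc : csm U (cc gam J).
Proof. exact: csmM Uo (csm_Cq Uo jg) csm_LV. Qed.
Lemma csm_dL : csm U (fun w => dl Lc w / Lc w).
Proof. exact: csmM Uo (csm_dl Uo (csm_Lc Uo jg)) csm_LV. Qed.
Let spk k : csm U (pk k).
Proof. case E: (k %% 3 == 1)%N; [apply: (csm_ext Uo _ csm_dL)|apply: (csm_ext Uo _ (csm_cst U 0))] => w _; by rewrite /pk E. Qed.
Let spbk k : csm U (pbk k).
Proof. case E: (k %% 3 == 2)%N; [apply: (csm_ext Uo _ (csm_conj Uo csm_dL))|apply: (csm_ext Uo _ (csm_cst U 0))] => w _; by rewrite /pbk E. Qed.
Lemma csm_L2 : csm U (fun w => - (Lc w / 2)).
Proof. exact: csmN Uo (csmM Uo (csm_Lc Uo jg) (csm_cst U 2^-1)). Qed.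
Let sqk k : csm U (qk k).
Proof.
case E: (k %% 3 == 0)%N; first by apply: (csm_ext Uo _ (csm_cst U 1)) => w _; rewrite /qk E.
by case E': (k %% 3 == 1)%N; [apply: (csm_ext Uo _ csm_cc)|apply: (csm_ext Uo _ csm_L2)] => w _; rewrite /qk E E'.
Qed.
Let sqbk k : csm U (qbk k).
Proof.
case E: (k %% 3 == 0)%N; first by apply: (csm_ext Uo _ (csm_cst U 1)) => w _; rewrite /qbk E.
by case E': (k %% 3 == 1)%N; [apply: (csm_ext Uo _ csm_L2)|apply: (csm_ext Uo _ (csmN Uo (csm_conj Uo csm_cc)))] => w _; rewrite /qbk E E'.
Qed.

Lemma FX z : U z -> rcm (F z) = X 0 z.
Proof.
move=> Uz; rewrite FE// /XX /rcm raddf_sum; apply: eq_bigr => j _ /=; rewrite -/(rcm _) rcmZ /cf expr0 mulr1.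
by rewrite /Wj -mulmxA rcmM.
Qed.

Lemma F_smx : smx U F.
Proof.
move=> i j; have [s1 _] := sXk 0 i j.
by apply: (sm_ext Uo _ s1) => w Uw; rewrite /fre /ent -FX// mxE.
Qed.

Lemma rcm_DF_ u z : U z -> rcm (Dr u F z) = (u : C) *: X 1 z + (u : C)^*%C *: mcj (X 1 z).
Proof.
move=> Uz; rewrite (rcm_dird u Uo F_smx Uz) (mdl_ext Uo FX Uz) (mdlb_ext Uo FX Uz).
by rewrite (dX0 Uz) (dbX0 Uz).
Qed.

Lemma rcm_Dgam u z : U z -> rcm (Dr u gam z) = (u : C) *: g1 z + (u : C)^*%C *: g1b z.
Proof. by move=> Uz; rewrite (rcm_dird u Uo cg.1 Uz) [mdlb _ z](mdlb_g0 Uo jg Uz). Qed.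

Lemma cdot_XkW k l z : U z -> nu k = 0%N -> nu l = 0%N -> cdot (X k z) (X l z) = cdot (fr gam J k z) (fr gam J l z).
Proof.
move=> Uz k0 l0; rewrite (cdot_sumW rZ BB _ _ _ _ Uz) -[RHS]mul1r; congr (_ * _).
rewrite -[RHS](rmorph1 (real_complex R)) -a1 rmorph_sum; apply: eq_bigr => j _.
by rewrite /cf k0 l0 !expr0 !mulr1 expr2 rmorphM.
Qed.

Lemma cdot_X1b z : U z -> cdot (X 1 z) (mcj (X 1 z)) = Lc z / 2.
Proof.
move=> Uz; have -> : mcj (X 1 z) = \sum_j cf a eps j 1 *: (g1b z *m Wj Z B j z).
  rewrite /XX mcj_sum; apply: eq_bigr => j _; rewrite mcjZ mcjM mcj_W; congr (_ *: _).
  by rewrite /cf expr0 mulr1 [LHS]conjc_real.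
rewrite (cdot_sumW rZ BB _ _ _ _ Uz); have [[_ _ _ <-] _] := frame_table Uo jg Uz.
rewrite -[RHS]mul1r; congr (_ * _); rewrite -[RHS](rmorph1 (real_complex R)) -a1 rmorph_sum; apply: eq_bigr => j _.
by rewrite /cf !expr0 !mulr1 expr2 rmorphM.
Qed.

(** Only X_1 and its conjugate enter, and [nu 1 = 0]; so the weights are the a_j^2, whose sum is
    1. *)
Lemma F_met u v z : U z -> dt (Dr u F z) (Dr v F z) = dt (Dr u gam z) (Dr v gam z).
Proof.
move=> Uz; apply: complexI; rewrite -!cdot_rcm !rcm_DF_// !rcm_Dgam//.
rewrite !(cdotDl, cdotDr, cdotZl, cdotZr) !cdot_cj !(cdotC (mcj _)) cdot_X1b// (cdot_XkW Uz (erefl : nu 1 = 0)%N (erefl : nu 1 = 0)%N).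
have [[_ _ t3 t4] _] := frame_table Uo jg Uz.
rewrite -[fr _ _ 1 z]/(g1 z) -[mcj (g1 z)]/(g1b z) t3 t4; reflexivity.
Qed.

Lemma F_conf : conf U F.
Proof.
split; first exact: F_smx.
move=> z Uz; rewrite !F_met//; have [_ /(_ z Uz)[e1 e2 e3 e4]] := cg; split; [|exact: e2|exact: e3|exact: e4].
apply: complexI; rewrite -cdot_rcm FX// cdot_XkW//=.
by have [[-> _ _ _] _] := frame_table Uo jg Uz.
Qed.

(** The ladder gives d/dzbar X_1 = - (L/2) X_0, so the Laplacian of [F] is a multiple of [F]. *)
Lemma F_minimal z : U z -> al F 1 1 z + al F ii ii z = 0.
Proof.
move=> Uz; rewrite !alphaE -normal_partD.
have nF : np F z (F z) = 0.
  apply: (np_uniq Uo F_conf Uz); first by rewrite /normal_vector mul0mx.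
  by exists 1, 0, 0; rewrite subr0 scale1r !scale0r !addr0.
suff -> : Dr 1 (Dr 1 F) z + Dr ii (Dr ii F) z = (- (2 * lam gam z)) *: F z by rewrite normal_partZ nF scaler0.
apply: rcm_inj; rewrite rcmD rcmZ FX//.
have sc := csmx_cj Uo (sXk 1).
have K u : rcm (Dr u (Dr u F) z) = (u : C) *: ((u : C) *: mdl (X 1) z + (u : C)^*%C *: mcj (mdlb (X 1) z)) +
    (u : C)^*%C *: ((u : C) *: mdlb (X 1) z + (u : C)^*%C *: mcj (mdl (X 1) z)).
  have s1 := csmxZ Uo (csm_cst U (u : C)) (sXk 1); have s2 := csmxZ Uo (csm_cst U (u : C)^*%C) sc.
  rewrite (rcm_dird u Uo (smx_dird u Uo F_smx) Uz) (mdl_ext Uo (fun w Uw => rcm_DF_ u Uw) Uz).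
  rewrite (mdlb_ext Uo (fun w Uw => rcm_DF_ u Uw) Uz) (mdlD s1 s2 Uz) (mdlbD s1 s2 Uz).
  rewrite (mdlZ Uo (csm_cst _ _) (sXk 1) Uz) (mdlbZ Uo (csm_cst _ _) (sXk 1) Uz).
  rewrite (mdlZ Uo (csm_cst _ _) sc Uz) (mdlbZ Uo (csm_cst _ _) sc Uz) !dl_cst !dlb_cst !scale0r !add0r.
  by rewrite (mdl_cj (sXk 1) Uz) (mdlb_cj (sXk 1) Uz).
rewrite !K iiE -[(iunit : C)]/('i%C : C) conji rmorph1 dbXk// /pbk /qbk /= scale0r add0r mcjZ.
have -> : mcj (X 0 z) = X 0 z by rewrite -FX// mcj_rcm.
have -> : (- (Lc z / 2))^*%C = - (Lc z / 2) by rewrite rmorphN rmorphM; congr (- (_ * _)); [exact: Lcj|exact: conj2V].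
have -> : (- (2 * lam gam z))%:C%C = - (2 * Lc z) :> C.
  have e2 : (2%:R : R)%:C%C = 2%:R :> C by rewrite rmorph_nat.
  by rewrite rmorphN rmorphM; congr (- (_ * _)).
move: (mdl _ z) (mcj _) (X 0 z) (Lc z) (ci2 (R := R)) => p q r l; move: ('i%C : C) => t et.
by apply/rowP => j; rewrite !mxE; move: (p 0 j) (q 0 j) (r 0 j) => p1 q1 r1; field: et.
Qed.

(** After commuting derivatives, d/dzbar d/dz f_1 is a combination of f_0 and f_1, and d/dzbar f_1
    is a multiple of f_0; all products that arise vanish by the frame table. *)
Lemma dlb_Cq z : U z -> dlb Cq z = 0.
Proof.
move=> Uz; have sg1 := csm_g1 Uo jg; have sd := csmx_mdl Uo sg1; have sJ := csm_J J Uo sg1.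
have [[t1 t2 t3 t4] [t5 t6]] := frame_table Uo jg Uz.
rewrite (dlbM Uo (csm_cst U 2) (csm_cdot Uo sd sJ) Uz) dlb_cst mul0r add0r (dlb_cdot Uo sd sJ Uz).
have -> : mdlb (mdl g1) z = - (dl Lc z / 2) *: g0 z - (Lc z / 2) *: g1 z.
  rewrite -(mdl_mdlb Uo sg1 Uz) (mdl_ext Uo (fun w Uw => mdlb_g1 Uo jg Uw) Uz).
  rewrite (mdlZ Uo csm_L2 (csm_g0 Uo jg) Uz) -/(g1 z) scaleNr; congr (_ *: _ + _).
  have sL := csm_Lc Uo jg; have sL2 := csmM Uo sL (csm_cst U 2^-1).
  have -> : dl (fun w => - (Lc w / 2)) z = - dl (fun w => Lc w / 2) z.
    have e w : U w -> - (Lc w / 2) = -1 * (Lc w / 2) by rewrite mulN1r.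
    by rewrite (dl_ext Uo e Uz) (dlM Uo (csm_cst U (-1)) sL2 Uz) dl_cst mul0r add0r mulN1r.
  by rewrite (dlM Uo sL (csm_cst U _) Uz) dl_cst mulr0 addr0.
rewrite (mdlbJ J Uo sg1 Uz) (mdlb_g1 Uo jg Uz) (mdl_g1 Uo jg Uz) -!scalemxAl.
rewrite !(cdotDl, cdotNl, cdotZl, cdotZr) (cdot_vJ jg) (cdotJJ jg) t5.
have -> : cdot (g0 z) (g1 z *m JC) = 0 by rewrite cdotC (cdotJ jg) t5 oppr0.
have -> : cdot (g1b z) (g0 z) = 0 by rewrite -[g0 z]mcj_rcm cdot_cj cdotC t2 rmorph0.
by rewrite !mulr0 subr0 addr0 mulr0 add0r mulr0.
Qed.

(** One period contributes q_0 q_1 q_2, which is the product of 1, C/L and -L/2; the q_0 missing at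
    the start is 1. *)
Lemma Qs3 l z : (0 < l)%N -> U z -> Qs qk (3 * l) z = (- (Cq z / 2)) ^+ l.
Proof.
move=> l0 Uz; have l1 := Lc0 jg Uz.
have K n : \prod_(0 <= i < 3 * n) qk i z = (- (Cq z / 2)) ^+ n.
  elim: n => [|n IH]; first by rewrite muln0 big_geq.
  rewrite mulnS addnC !addnS addn0 !big_nat_recr//= IH exprSr -!mulrA; congr (_ * _).
  rewrite /qk; have -> : (3 * n %% 3 == 0)%N by lia.
  have -> : ((3 * n).+1 %% 3 == 0)%N = false by lia.
  have -> : ((3 * n).+1 %% 3 == 1)%N by lia.
  have -> : ((3 * n).+2 %% 3 == 0)%N = false by lia.
  have -> : ((3 * n).+2 %% 3 == 1)%N = false by lia.
  rewrite (mulrA 2) -/(Cq z) /cc; move: (Cq z) (Lc z) l1 => c l' l1'; by field.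
rewrite -K [RHS]big_ltn ?muln_gt0//.
by rewrite {2}/qk /= mul1r.
Qed.

Lemma dXk_qn z k : U z -> Cq z != 0 -> qk k z != 0.
Proof.
move=> Uz c0; have l0 := Lc0 jg Uz; rewrite /qk; case: ifP => _; first exact: oner_neq0.
by case: ifP => _; rewrite ?oppr_eq0 mulf_neq0 ?invr_eq0 ?two_C.
Qed.

(* Multiplying X_k by 1, i or -i according to k modulo 3 preserves the Gram matrix but changes the sign of the square of the residual of X_s, unless 3 divides s. *)
Lemma cdot_resid z w s : U z -> U w ->
  cdot (resid X z s) (resid X z s) = sg s z ^+ 2 / sg s w ^+ 2 * cdot (resid X w s) (resid X w s) /\
  ((s %% 3 != 0)%N -> cdot (resid X z s) (resid X z s) = 0).
Proof.
have sg0 k v : U v -> sg k v != 0 by move=> /(sg_gt0 jg k)[r r0 ->]; rewrite fmorph_eq0 gt_eqF.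
have sgc k v : (sg k v)^*%C = sg k v by rewrite /sg; case: ifP => _; [rewrite rmorph1|exact: conjc_real].
move=> Uz Uw; split.
  apply: (@gram_scale _ _ s (X^~ z) (X^~ w) (sg^~ z) (sg^~ w)) => [i|i|i|i|i k|i k].
  - exact: sg0.
  - exact: sg0.
  - exact: sgc.
  - exact: sgc.
  - have [kap _ h] := gram_XX Uo jg a rZ BB i k; exists kap; split; exact: h.
  - have [kap _ h] := gram_XXb Uo jg a rZ BB i k; exists kap; split; exact: h.
(* The product of the two phases is 1 on paired classes, and so is io k times conj(io l) when k = l
   mod 3. *)
move=> s3; pose io k : C := if (k %% 3 == 0)%N then 1 else if (k %% 3 == 1)%N then 'i%C else - 'i%C.
have io0 k : io k != 0.
  by rewrite /io; do 2?case: ifP => _; rewrite ?oppr_eq0 ?oner_neq0//; apply/eqP => /(congr1 (fun x => x * x)); rewrite ci2 mul0r => /eqP; rewrite oppr_eq0 oner_eq0.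
have ioc k : (io k)^*%C = if (k %% 3 == 0)%N then 1 else if (k %% 3 == 1)%N then - 'i%C else 'i%C.
  rewrite /io; case: ifP => _; first exact: rmorph1.
  by case: ifP => _; first exact: conji; rewrite rmorphN -[RHS]opprK; congr (- _); exact: conji.
have {io0} : cdot (resid X z s) (resid X z s) = io s ^+ 2 * cdot (resid X z s) (resid X z s).
  apply: (@gram_twist _ _ s (X^~ z) io io0) => i k.
    have [kap hk h] := gram_XX Uo jg a rZ BB i k; rewrite cdotZl cdotZr (h z Uz).
    case/orP: hk => [|/eqP->]; last by rewrite !mul0r !mulr0.
    rewrite /pairing /io; case: (i %% 3)%N (ltn_pmod i (isT : 0 < 3)%N) => [|[|[|//]]] _;
    case: (k %% 3)%N (ltn_pmod k (isT : 0 < 3)%N) => [|[|[|//]]] _ //= _; have e := ci2 (R := R); ring: e.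
  have [kap hk h] := gram_XXb Uo jg a rZ BB i k; rewrite mcjZ cdotZl cdotZr (h z Uz) ioc.
  case/orP: hk => [|/eqP->]; last by rewrite !mul0r !mulr0.
  rewrite /io; case: (i %% 3)%N (ltn_pmod i (isT : 0 < 3)%N) => [|[|[|//]]] _;
  case: (k %% 3)%N (ltn_pmod k (isT : 0 < 3)%N) => [|[|[|//]]] _ //= _; have e := ci2 (R := R); ring: e.
(* For [s] not divisible by 3 the square of the residual now equals its own opposite. *)
have -> : io s ^+ 2 = -1.
  by rewrite /io (negPf s3); case: ifP => _; rewrite ?sqrrN expr2 ci2.
move: (cdot _ _) => x hx; have : 2 * x = 0 by rewrite mulr_natl mulr2n {1}hx mulN1r addNr.
by move=> /eqP; rewrite mulf_eq0 (negPf (two_C (R := R))) /= => /eqP.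
Qed.

Lemma hopf_regular l z : (0 < l)%N -> U z -> Cq z != 0 ->
  hopf F l z = Qs qk l.+1 z ^+ 2 * cdot (resid X z l.+1) (resid X z l.+1).
Proof.
move=> l0 Uz c0; apply: (hopfE Uo F_conf FX sXk spk sqk spbk sqbk dX0 dXk dbX0 dbXk Uz l0).
by move=> i _; exact: dXk_qn.
Qed.

(** No q_i has to be non-zero for Phi_1, so zeros of the cubic form are covered; the residual of X_2
    is isotropic. *)
Lemma hopf1 z : U z -> hopf F 1 z = 0.
Proof.
move=> Uz; have h := cdot_resid 2 Uz Uz.
rewrite (hopfE Uo F_conf FX sXk spk sqk spbk sqbk dX0 dXk dbX0 dbXk Uz (erefl : 0 < 1)%N).
  by rewrite h.2// mulr0.
by move=> i /andP[i0 i1]; move: i0; rewrite ltnNge i1.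
Qed.

Lemma derivable_near (f h : E -> E) z : derivable h z 1 -> (\forall w \near z, f w = h w) -> derivable f z 1.
Proof.
move=> dh fh; apply: near_eq_derivable dh.
by apply: filterS fh => w ->.
Qed.

Lemma derivable_0 (f : E -> E) z : (\forall w \near z, f w = 0) -> derivable f z 1.
Proof.
by apply: derivable_near; apply: (dlb0_derivable openT (csm_cst setT 0)) => //; exact: dlb_cst.
Qed.

Lemma csm_X (f : E -> C) n : csm U f -> csm U (fun w => f w ^+ n).
Proof.
move=> sf; elim: n => [|n IH]; first exact: csm_cst.
by apply: (csm_ext Uo _ (csmM Uo sf IH)) => w _; rewrite exprS.
Qed.

Lemma dlb_X (f : E -> C) n z : csm U f -> U z -> dlb f z = 0 -> dlb (fun w => f w ^+ n) z = 0.
Proof.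
move=> sf Uz f0; elim: n => [|n IH]; first exact: dlb_cst.
rewrite (dlb_ext Uo (fun w _ => exprS (f w) n) Uz) (dlbM Uo sf (csm_X n sf) Uz).
by rewrite f0 IH mul0r mulr0 addr0.
Qed.

Lemma near_Cq z : U z -> Cq z != 0 -> \forall w \near z, Cq w != 0.
Proof.
move=> Uz c0; have [s1 s2] := csm_Cq Uo jg.
have c1 := sm_cont s1 Uz; have c2 := sm_cont s2 Uz.
have K (f : E -> R) : {for z, continuous f} -> f z != 0 -> \forall w \near z, f w != 0.
  by move=> cf f0; apply: (cf [set x | x != 0]); exact: open_nbhs_nbhs (conj (@open_neq _ _) f0).
have [r0|r0] := eqVneq (fre Cq z) 0; last first.
  by apply: filterS (K _ c1 r0) => w; apply: contra_neq => h; rewrite /fre h.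
have i0 : fim Cq z != 0 by apply: contra_neq c0; move: r0; rewrite /fre /fim; case: (Cq z) => p q /= -> ->.
by apply: filterS (K _ c2 i0) => w; apply: contra_neq => h; rewrite /fim h.
Qed.

(** Near a point with C non-zero, Phi_l vanishes unless l + 1 = 3 n, and then it is (C/2)^(2 n)
    times a constant, as the scaling [sg] is 1 at indices divisible by 3. *)
Lemma hopf_derivable_regular l z : (0 < l)%N -> U z -> Cq z != 0 -> derivable (hopf F l) z 1.
Proof.
move=> l0 Uz c0; have nU : \forall w \near z, U w by exact: open_nbhs_nbhs.
have nC := near_Cq Uz c0.
have [h3|h3] := boolP (l.+1 %% 3 == 0)%N; last first.
  apply: derivable_0; apply: filterS2 nU nC => w Uw cw.
  by rewrite hopf_regular// (cdot_resid _ Uw Uw).2// mulr0.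
pose n := (l.+1 %/ 3)%N; have ln : l.+1 = (3 * n)%N by rewrite /n; lia.
have n0 : (0 < n)%N by rewrite /n; lia.
have [K KE] : exists K, K = cdot (resid X z l.+1) (resid X z l.+1) by eexists.
have s2 := csmN Uo (csmM Uo (csm_Cq Uo jg) (csm_cst U 2^-1)).
have sn := csm_X n s2; have sn2 := csmM Uo sn sn; have sK := csmM Uo sn2 (csm_cst U K).
apply: (@derivable_near _ (fun w => (- (Cq w / 2)) ^+ n * (- (Cq w / 2)) ^+ n * K)).
  apply: (dlb0_derivable Uo sK Uz).
  have e : dlb (fun w => - (Cq w * 2^-1)) z = 0.
    rewrite (dlb_ext Uo (fun w _ => esym (mulN1r _)) Uz).
    rewrite (dlbM Uo (csm_cst _ _) (csmM Uo (csm_Cq Uo jg) (csm_cst U 2^-1)) Uz).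
    by rewrite (dlbM Uo (csm_Cq Uo jg) (csm_cst _ _) Uz) dlb_Cq// !dlb_cst !(mul0r, mulr0) !addr0 mulr0 ?addr0.
  by rewrite (dlbM Uo sn2 (csm_cst U K) Uz) (dlbM Uo sn sn Uz) dlb_cst (dlb_X n s2 Uz e) !(mul0r, mulr0) !addr0 mul0r.
apply: filterS2 nU nC => w Uw cw.
apply: (etrans (hopf_regular l0 Uw cw)); have [rE _] := cdot_resid l.+1 Uw Uz.
have sg1 v : sg l.+1 v = 1 by rewrite /sg h3.
have alg (p p' q q' t t' k : C) : p = q -> p' = t ^+ 2 / t' ^+ 2 * q' -> k = q' -> t = 1 -> t' = 1 -> p ^+ 2 * p' = q * q * k.
  by move=> -> -> -> -> ->; rewrite expr1n divr1 mul1r expr2.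
apply: (alg _ _ _ _ _ _ _ _ rE KE (sg1 w) (sg1 z)).
by rewrite ln; exact: Qs3.
Qed.

Lemma nabla2 u v z : U z -> exists2 L, SP U X 2 L &
  forall w, U w -> rcm (nabla_alpha F [:: u; v] w) =
    ((u : C) * (v : C) * cc gam J w) *: X 2 w + mcj (((u : C) * (v : C) * cc gam J w) *: X 2 w) + L w.
Proof.
move=> Uz; have [L sL hL] := nabla_ladder Uo F_conf FX sXk spk sqk spbk sqbk dX0 dXk dbX0 dbXk (isT : [:: u; v] != [::]).
exists L => // w Uw; rewrite hL// /Pu /= !big_cons big_nil mulr1.
by rewrite /Qs big_nat1 /qk.
Qed.

(** Without its leading term the second fundamental form lies in the span of the frame, to which it
    is also normal. *)
Lemma nabla2_0 u v z : U z -> Cq z = 0 -> nabla_alpha F [:: u; v] z = 0.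
Proof.
move=> Uz c0; have [L sL hL] := nabla2 u v Uz.
have h : (nabla_alpha F [:: u; v] z <= frame F z)%MS.
  rewrite (frame_T Uo F_conf FX dX0 dbX0 Uz) cmem_rcm (hL z Uz).
  rewrite /cc c0 mul0r mulr0 scale0r mcj0 !add0r; exact: SP_mem sL Uz.
have h2 := nabla_normal Uo F_conf Uz u v [::].
have h3 : perp (frame F z) (nabla_alpha F [:: u; v] z) = nabla_alpha F [:: u; v] z.
  by apply: perp_uniq h2; rewrite subrr sub0mx.
by rewrite -h3; apply: perp_uniq; rewrite ?subr0 ?mul0mx.
Qed.

Lemma mcj_X2 z : U z -> mcj (X 2 z) = \sum_j (cf a eps j 2)^*%C *: (g1 z *m JC *m Wj Z B j z).
Proof.
move=> Uz; rewrite /XX mcj_sum; apply: eq_bigr => j _; rewrite mcjZ mcjM mcj_W; congr (_ *: (_ *m _)).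
by rewrite /= mcj_J mcjK.
Qed.

Lemma mcj_X1 z : U z -> mcj (X 1 z) = \sum_j cf a eps j 1 *: (g1b z *m Wj Z B j z).
Proof.
move=> Uz; rewrite /XX mcj_sum; apply: eq_bigr => j _; rewrite mcjZ mcjM mcj_W; congr (_ *: _).
by rewrite /cf expr0 mulr1 [LHS]conjc_real.
Qed.

Lemma X2_orth z : U z -> [/\ cdot (X 2 z) (X 0 z) = 0, cdot (X 2 z) (X 1 z) = 0, cdot (X 2 z) (mcj (X 1 z)) = 0 &
  cdot (X 2 z) (mcj (X 2 z)) = Lc z / 2].
Proof.
move=> Uz; have [[t1 t2 t3 t4] [t5 t6]] := frame_table Uo jg Uz.
have t7 : cdot (g1b z *m JC) (g1b z) = 0 by rewrite cdotC (cdot_vJ jg).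
split; rewrite ?mcj_X1 ?mcj_X2// (cdot_sumW rZ BB _ _ _ _ Uz) [fr gam J 2 z]/=.
- have -> : cdot (g1b z *m JC) (fr gam J 0 z) = - (cdot (g1 z) (g0 z *m JC))^*%C.
    by rewrite (cdotJ jg) -cdot_cj mcj_J mcj_rcm.
  by rewrite t5 rmorph0 oppr0 mulr0.
- by rewrite cdotC t6 mulr0.
- by rewrite t7 mulr0.
rewrite (cdotJJ jg) (cdotC (g1b z)) t4 -[RHS]mul1r; congr (_ * _).
rewrite -[RHS](rmorph1 (real_complex R)) -a1 rmorph_sum; apply: eq_bigr => j _.
rewrite /cf expr1 rmorphM mulrACA eps1 mulr1 expr2 rmorphM; congr (_ * _); exact: conjc_real.
Qed.

(** If C were non-zero, X_2 would lie in the complexified span of the frame; but it is orthogonal to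
    that span and has hermitian square L/2. *)
Lemma osc1_0 z : U z -> osc F 1 z = 0 -> Cq z = 0.
Proof.
move=> Uz h; have [//|c0] := eqVneq (Cq z) 0.
have q1 : qnz qk z 1 by move=> i _; exact: dXk_qn.
have := osc_T Uo F_conf FX sXk spk sqk spbk sqbk dX0 dXk dbX0 dbXk Uz q1; rewrite h => hT.
have x2 : cmem (TT 2 (X^~ z)) (X 2 z).
  apply: (@cmem_sub _ _ (TT 3 (X^~ z))); last exact: (@TT_x _ _ 3 (X^~ z) 2).
  have -> : (TT 3 (X^~ z) <= TT 2 (X^~ z))%MS = (TT 3 (X^~ z) <= frame F z)%MS by rewrite (frame_T Uo F_conf FX dX0 dbX0 Uz).
  by rewrite -hT addsmx0.
have [p0 p1 p1b p2] := X2_orth Uz.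
have := cdot_mem (A := TT 2 (X^~ z)) (v := X 2 z) (w := mcj (X 2 z)).
rewrite p2 => k; have l0 := Lc0 jg Uz; have : Lc z / 2 = 0.
  apply: k; last exact: cmem_cj.
  apply: orth_TT => -[|[|k2]] h2; [split; [exact: p0|rewrite -(FX Uz) mcj_rcm (FX Uz); exact: p0]|split; [exact: p1|exact: p1b]|].
  by [].
by move/eqP; rewrite mulf_eq0 invr_eq0 (negPf (two_C (R := R))) (negPf l0).
Qed.

Lemma perp_0 k (A : 'M[R]_(k, N)) : perp A 0 = 0.
Proof. by rewrite perpE mul0mx. Qed.

Lemma osc_Cq z : U z -> (osc F 1 z = 0 <-> Cq z = 0).
Proof.
move=> Uz; split; first exact: osc1_0.
move=> c0 /=; rewrite adds0mx_id; apply/eqP; rewrite -submx0; apply/sumsmx_subP => t _.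
case: t => -[|u [|v [|]]]//= _; rewrite -[perp _ _]/(perp _ (nabla_alpha F [:: coord_field u; coord_field v] z)).
by rewrite nabla2_0// perp_0 genmx0 sub0mx.
Qed.

Lemma nabla_Cq0 W us : open W -> W `<=` U -> (forall w, W w -> Cq w = 0) -> (1 < size us)%N ->
  forall w, W w -> nabla_alpha F us w = 0.
Proof.
move=> Wo WU hW; case: us => [//|u [//|v us]] _.
elim: us u v => [|x us IH] u v w Ww; first by apply: nabla2_0; [exact: WU|exact: hW].
rewrite nablaS; have -> : Dr u (nabla_alpha F [:: v, x & us]) w = 0.
  by rewrite -[RHS](dird_mx_cst 0 u w); apply: (dird_mx_ext u Wo _ Ww) => w' Ww'; exact: IH.
by have := normal_partZ F w 0 0; rewrite !scale0r.
Qed.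

Lemma hopf_Cq0 s z : (0 < s)%N -> U z -> (\forall w \near z, Cq w = 0) -> \forall w \near z, hopf F s w = 0.
Proof.
move=> s0 Uz h; have nU : \forall w \near z, U w by exact: open_nbhs_nbhs.
have [W [Wo Wz] hW] : exists2 W, open W /\ W z & forall w, W w -> U w /\ Cq w = 0.
  exact: near_open_ex (filterI nU h).
have hW1 : W `<=` U by move=> w /hW[].
have hW2 w : W w -> Cq w = 0 by move=> /hW[].
suff : forall w, W w -> hopf F s w = 0 by move=> k; apply: filterS k _; exact: open_nbhs_nbhs.
move=> w Ww; rewrite /hopf big1// => k _; rewrite /alpha_del big1 ?mxE ?expr0n// => t _.
rewrite /higher_alpha (nabla_Cq0 Wo hW1 hW2)// ?size_map ?size_tuple//.
by rewrite perp_0 -/(rcm _) rcm0 scaler0.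
Qed.

(* At a zero of [Cq] the constancy of the rank of the first normal space forces [Cq] to vanish nearby. *)
Lemma hopf_derivable s z : (0 < s)%N -> U z -> regular_upto F s z -> derivable (hopf F s) z 1.
Proof.
move=> s0 Uz hr; have [c0|c0] := eqVneq (Cq z) 0; last exact: hopf_derivable_regular.
have nU : \forall w \near z, U w by exact: open_nbhs_nbhs.
case: s s0 hr => // -[|s] _ hr; first by apply: derivable_0; apply: filterS nU => w /hopf1.
apply: derivable_0; apply: hopf_Cq0 => //; apply: filterS2 nU hr => w Uw hw.
apply/(osc_Cq Uw)/eqP; rewrite -mxrank_eq0 (hw 1%N)// mxrank_eq0; by apply/eqP/(osc_Cq Uz).
Qed.

Lemma fr6 i r z : fr gam J (6 * i + r) z = (-1) ^+ i *: fr gam J r z.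
Proof.
elim: i => [|i IH]; first by rewrite muln0 scale1r.
by rewrite mulnS -addnA /= IH -!scalemxAl (mulJJ jg) exprS mulN1r scalerN scaleNr.
Qed.

Hypotheses (a0 : forall j, a j != 0) (eps2 : injective (fun j => (eps j : C) ^+ 2)).
Hypothesis BT : \sum_j (B j)^T *m B j = 1%:M.

(** Near [z] all q_k are non-zero, so repeated differentiation makes [v] orthogonal to every X_k.
    The frame repeats up to sign after six steps while the power of eps_j grows by 2: a Vandermonde
    system that separates the blocks. *)
Lemma F_substantial z (v : 'rV[R]_N) : U z -> Cq z != 0 -> (forall w, U w -> dt (F w) v = 0) -> v = 0.
Proof.
move=> Uz c0 hv; have nU : \forall w \near z, U w by exact: open_nbhs_nbhs.
have [W [Wo Wz] hW] : exists2 W, open W /\ W z & forall w, W w -> U w /\ Cq w != 0.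
  exact: near_open_ex (filterI nU (near_Cq Uz c0)).
have Xv k w : W w -> cdot (X k w) (rcm v) = 0.
  elim: k w => [|k IH] w Ww; have [Uw cw] := hW w Ww; first by rewrite -FX// cdot_rcm hv.
  have := dl_cdot Uo (sXk k) (csmx_cst (rcm v) U) Uw.
  rewrite (dl_ext Wo IH Ww) dl_cst mdl_cst cdot0r addr0 dXk// cdotDl !cdotZl IH// mulr0 add0r => /esym/eqP.
  by rewrite mulf_eq0 (negPf (dXk_qn k Uw cw)) /= => /eqP.
pose y j := rcm v *m (Wj Z B j z)^T.
have fy r j : cdot (y j) (fr gam J r z) = 0.
  have h i : \sum_j (cf a eps j r * cdot (y j) (fr gam J r z)) * ((eps j : C) ^+ 2) ^+ i = 0.
    have nr : nu (6 * i + r) = (2 * i + nu r)%N by rewrite /nu; lia.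
    transitivity ((-1) ^+ i * cdot (X (6 * i + r) z) (rcm v)); last by rewrite Xv// mulr0.
    rewrite /XX cdot_suml mulr_sumr; apply: eq_bigr => k _.
    rewrite fr6 cdotZl -scalemxAl cdotZl cdotMl (cdotC (fr gam J r z)) /cf nr exprD exprM.
    rewrite -[cdot (rcm v *m _) _]/(cdot (y k) (fr gam J r z)).
    move: (cdot _ _) (a k)%:C%C (_ ^+ i) (_ ^+ nu r) => t1 t2 t3 t4.
    have := sqrr_sign C i; move: ((-1) ^+ i) => sn e; ring: e.
  have := vandermonde eps2 h j => /eqP; rewrite !mulf_eq0 => /orP[/orP[|]|/eqP//].
    by rewrite fmorph_eq0 (negPf (a0 j)).
  rewrite expf_eq0 => /andP[_ /eqP e0].
  by have := eps1 j; rewrite e0 mul0r => /eqP; rewrite eq_sym oner_eq0.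
have y0 j : y j = 0.
  apply: (six_basis Uo jg Uz); [exact: (fy 0%N j)|exact: (fy 1%N j)| |exact: (fy 3%N j)|exact: (fy 4%N j)|exact: (fy 2%N j)].
  by have := fy 5%N j; rewrite /= (mulJJ jg) cdotNr => /eqP; rewrite oppr_eq0 => /eqP.
have vB j : v *m (B j)^T = 0.
  have := y0 j; rewrite /y /Wj rcm_tr -rcmM trmx_mul mulmxA => h.
  have {}h : v *m (B j)^T *m (Z j z)^T = 0 by apply: rcm_inj; rewrite h rcm0.
  have [_ oZ _] := rZ j; have := congr1 (mulmx^~ (Z j z)) h.
  have zz : (Z j z)^T *m Z j z = 1%:M by exact/mulmx1C/oZ.
  by rewrite -mulmxA zz mulmx1 mul0mx.
by rewrite -[v]mulmx1 -BT mulmx_sumr big1// => j _; rewrite mulmxA vB mul0mx.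
Qed.

End Exceptional.

(** * Finite sets as real analytic subvarieties *)

Section AnalyticStrict.
Context {R : realType} {m : nat}.
Implicit Types (F : 'rV[R]_m -> R) (x y : 'rV[R]_m).

(** The invariant [K] is stable under products, degrees adding. Multiplying through by [d] avoids
    the exponent degree minus 1. *)
Lemma monomial_diff (al : 'I_m -> nat) y y' (d e : R) : 0 <= d -> 0 <= e ->
  (forall i, `|y 0 i| <= d) -> (forall i, `|y' 0 i| <= d) -> (forall i, `|y 0 i - y' 0 i| <= e) ->
  d * `|\prod_i y 0 i ^+ al i - \prod_i y' 0 i ^+ al i| <= (\sum_i al i)%:R * d ^+ (\sum_i al i) * e.
Proof.
move=> d0 e0 yd y'd ye.
pose K (p q : R) (n : nat) := [/\ `|p| <= d ^+ n, `|q| <= d ^+ n & d * `|p - q| <= n%:R * d ^+ n * e].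
have KM p q n p' q' n' : K p q n -> K p' q' n' -> K (p * p') (q * q') (n + n')%N.
  move=> [h1 h2 h3] [k1 k2 k3]; split; rewrite ?normrM ?exprD.
  - by rewrite ler_pM.
  - by rewrite ler_pM.
  have -> : p * p' - q * q' = p * (p' - q') + (p - q) * q' by ring.
  apply: (@le_trans _ _ (d * (`|p| * `|p' - q'|) + d * (`|p - q| * `|q'|))).
    by rewrite -mulrDr ler_wpM2l// -!normrM ler_normD.
  have -> : (n + n')%:R * (d ^+ n * d ^+ n') * e = d ^+ n * (n'%:R * d ^+ n' * e) + (n%:R * d ^+ n * e) * d ^+ n'.
    by rewrite natrD; ring.
  apply: lerD; first by rewrite mulrCA ler_pM// mulr_ge0.
  by rewrite mulrA ler_pM// mulr_ge0.
have K0 : K 1 1 0%N by split; rewrite ?normr1 ?subrr ?normr0 ?mulr0 ?mul0r.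
have KX p q n : K p q 1%N -> K (p ^+ n) (q ^+ n) n.
  move=> h; elim: n => [|n IH]; first exact: K0.
  by rewrite !exprS -add1n; exact: KM.
suff [_ _ ] : K (\prod_i y 0 i ^+ al i) (\prod_i y' 0 i ^+ al i) (\sum_i al i)%N by [].
have K1 i : K (y 0 i) (y' 0 i) 1%N by split; rewrite ?expr1// mul1r ler_wpM2l.
by apply: (big_rec3 K) => // i n p q _ h; apply: KM => //; exact: KX.
Qed.

Lemma monomial1 (al : 'I_m -> nat) y : (\sum_i al i = 1)%N -> \prod_i y 0 i ^+ al i = \sum_i y 0 i * (al i)%:R.
Proof.
move=> h; have [i0 hi0] : exists i0, al i0 != 0%N.
  apply: contrapT => k; move: h; rewrite big1// => i _; apply/eqP; apply: contrapT => hi.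
  by apply: k; exists i; apply/negP.
move: h; rewrite (bigD1 i0)//= => h.
have aux (p q : nat) : (p + q = 1 -> p != 0 -> p = 1 /\ q = 0)%N by move=> ? /eqP; lia.
have [ai0 hs] := aux _ _ h hi0.
have a0 i : i != i0 -> al i = 0%N.
  by move=> ii; have /eqP := hs; rewrite sum_nat_eq0 => /forallP/(_ i); rewrite ii => /eqP.
rewrite (bigD1 i0)//= [X in _ * X]big1 => [|i /a0->]; last by rewrite expr0.
rewrite [RHS](bigD1 i0)//= [X in _ = _ + X]big1 => [|i /a0->]; last by rewrite mulr0.
by rewrite ai0 expr1 !mulr1 addr0.
Qed.

Definition lin_coef (c : {ffun 'I_m -> nat} -> R) i : R :=
  \sum_(al : {ffun 'I_m -> 'I_2} | (\sum_i al i)%N == 1%N) c [ffun i => al i : nat] * (al i)%:R.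

Lemma power_term1 c y : power_term c y 1 = \sum_i y 0 i * lin_coef c i.
Proof.
rewrite /power_term /lin_coef; under [RHS]eq_bigr do rewrite mulr_sumr.
rewrite exchange_big /=; apply: eq_bigr => al /eqP h.
rewrite (monomial1 y (al := fun i => al i : nat))// mulr_sumr.
by apply: eq_bigr => i _; rewrite mulrCA.
Qed.

Lemma power_term_diff c y y' (d e r : R) N : 0 < d -> 0 <= e -> 0 < r ->
  (forall i, `|y 0 i| <= d) -> (forall i, `|y' 0 i| <= d) -> (forall i, `|y 0 i - y' 0 i| <= e) ->
  d * `|power_term c y N - power_term c y' N| <=
  N%:R * (d / r) ^+ N * e * power_term (fun al => `|c al|) (const_mx r) N.
Proof.
move=> d0 e0 r0 yd y'd ye; rewrite /power_term -sumrB.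
apply: (@le_trans _ _ (d * \sum_(al : {ffun 'I_m -> 'I_N.+1} | (\sum_i al i)%N == N)
    `|c [ffun i => al i : nat]| * `|\prod_i y 0 i ^+ al i - \prod_i y' 0 i ^+ al i|)).
  rewrite (ler_pM2l d0); apply: (le_trans (ler_norm_sum _ _ _)).
  by apply: ler_sum => al _; rewrite -mulrBr normrM.
rewrite mulr_sumr mulr_sumr; apply: ler_sum => al /eqP h.
have -> : \prod_i (const_mx r : 'rV[R]_m) 0 i ^+ al i = r ^+ N.
  under eq_bigr do rewrite mxE; by rewrite prodrXr h.
have := @monomial_diff (fun i => al i : nat) y y' d e (ltW d0) e0 yd y'd ye; rewrite h => k.
rewrite mulrCA.
have -> : N%:R * (d / r) ^+ N * e * (`|c [ffun i => al i : nat]| * r ^+ N) =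
  `|c [ffun i => al i : nat]| * (N%:R * d ^+ N * e).
  by rewrite expr_div_n; field; rewrite expf_neq0 ?gt_eqF.
by rewrite ler_wpM2l.
Qed.

(** The sequence (N + 2) q^N starts at 2 and does not increase, because (N + 3) q <= N + 2. *)
Lemma nat_pow4 (N : nat) (q : R) : (1 < N)%N -> 0 <= q <= 1 / 4 -> N%:R * q ^+ N <= 2 * q ^+ 2.
Proof.
case: N => [//|[//|N]] _ /andP[q0 q4].
have h : N.+2%:R * q ^+ N <= 2.
  elim: N => [|N IH]; first by rewrite expr0 mulr1.
  have qN : 0 <= q ^+ N by exact: exprn_ge0.
  apply: le_trans IH; rewrite exprS mulrCA mulrA.
  have : N.+3%:R * q <= N.+2%:R.
    have -> : N.+3%:R = N.+2%:R + 1 :> R by rewrite -[N.+3]addn1 natrD.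
    have : 2 <= N.+2%:R :> R by rewrite ler_nat.
    move: (N.+2%:R) => n h; nra.
  by move=> h; rewrite (mulrC q) ler_wpM2r.
rewrite -[N.+2]addn2 exprD mulrA ler_wpM2r ?exprn_ge0// addn2; exact: h.
Qed.

(** Strict differentiability: the increment between two points close to [x] differs from its linear
    part by at most their distance times the distance to [x], up to a constant. A contraction
    argument needs this form. *)
Lemma analytic_strict F x : real_analytic_at F x -> exists (l : 'I_m -> R) (C r : R), [/\ 0 <= C, 0 < r &
  forall (d e : R) y y', 0 < d < r -> 0 <= e ->
   (forall i, `|y 0 i| <= d) -> (forall i, `|y' 0 i| <= d) -> (forall i, `|y 0 i - y' 0 i| <= e) ->
   `|F (x + y) - F (x + y') - \sum_i (y 0 i - y' 0 i) * l i| <= C * d * e].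
Proof.
move=> [c [r r0 h]].
(* At half the radius the series of absolute values converges; d < r2 / 4 makes the ratio d / r2 at
   most 1/4, as [nat_pow4] asks. *)
pose r2 := r / 2; have r20 : 0 < r2 by rewrite divr_gt0.
pose p N := power_term (fun al => `|c al|) (const_mx r2) N.
have p0 N : 0 <= p N.
  apply: sumr_ge0 => al _; rewrite mulr_ge0// prodr_ge0// => i _; rewrite mxE exprn_ge0//; exact: ltW.
have pc : cvgn (series p).
  have [|k _] := h (const_mx r2); first by move=> i; rewrite mxE gtr0_norm// /r2; lra.
  have e : map_mx Num.norm (const_mx r2) = const_mx r2 :> 'rV[R]_m.
    by apply/matrixP => i j; rewrite !mxE gtr0_norm.
  by rewrite e in k.
pose M := limn (series p).
have pM n : series p n <= M.
  apply: nondecreasing_cvgn_le => //; apply/nondecreasing_seqP => k.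
  by rewrite /series /= big_nat_recr//= lerDl.
exists (lin_coef c), (2 * M / r2 ^+ 2), (r2 / 4).
have M0 : 0 <= M by apply: le_trans (pM 0%N); rewrite /series /= big_geq.
split; [by rewrite divr_ge0 ?mulr_ge0 ?exprn_ge0// ltW|by rewrite divr_gt0|].
move=> d e y y' /andP[d0 dr] e0 yd y'd ye.
have dr' : d < r by rewrite /r2 in dr; lra.
have [|_ c1] := h y; first by move=> i; exact: le_lt_trans (yd i) dr'.
have [|_ c2] := h y'; first by move=> i; exact: le_lt_trans (y'd i) dr'.
set L := \sum_i _.
have c3 : (fun n => `|series (power_term c y) n - series (power_term c y') n - L|) @ \oo -->
    `|F (x + y) - F (x + y') - L|.
  by apply: cvg_norm; apply: cvgB; [exact: cvgB|exact: cvg_cst].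
rewrite -(cvg_lim _ c3)//; apply: limr_le; first by apply/cvg_ex; eexists; exact: c3.
exists 2%N => // n /= n2.
have q4 : 0 <= d / r2 <= 1 / 4.
  apply/andP; split; first exact: divr_ge0 (ltW d0) (ltW r20).
  by rewrite ler_pdivrMr//; lra.
have -> : series (power_term c y) n - series (power_term c y') n - L =
    \sum_(2 <= N < n) (power_term c y N - power_term c y' N).
  have S (f : nat -> R) : series f n = f 0%N + f 1%N + \sum_(2 <= k < n) f k.
    by rewrite /series /= (big_cat_nat (n := 2))//= big_nat_recr//= big_nat1.
  rewrite !S sumrB.
  have : power_term c y 0 - power_term c y' 0 = 0.
    apply/eqP; rewrite -normr_eq0; have := power_term_diff c 0 d0 e0 r20 yd y'd ye.
    by rewrite !mul0r pmulr_rle0// => k; apply/eqP/le_anti; rewrite k normr_ge0.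
  have : power_term c y 1 - power_term c y' 1 = L.
    by rewrite !power_term1 -sumrB; apply: eq_bigr => i _; rewrite mulrBl.
  by move: (power_term c y 0) (power_term c y' 0) (power_term c y 1) (power_term c y' 1) => p1 p2 p3 p4 e1 e2; lra.
rewrite -(ler_pM2l d0).
apply: (@le_trans _ _ (\sum_(2 <= N < n) 2 * (d / r2) ^+ 2 * e * p N)).
  apply: (@le_trans _ _ (\sum_(2 <= N < n) d * `|power_term c y N - power_term c y' N|)).
    by rewrite -mulr_sumr (ler_pM2l d0) ler_norm_sum.
  rewrite big_nat_cond [leRHS]big_nat_cond; apply: ler_sum => N /andP[/andP[N2 _] _].
  apply: le_trans (power_term_diff c N d0 e0 r20 yd y'd ye) _.
  by rewrite ler_wpM2r// ler_wpM2r// nat_pow4.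
rewrite -mulr_sumr.
have s1 : \sum_(2 <= N < n) p N <= M.
  apply: le_trans (pM n); rewrite /series /= [leRHS](big_cat_nat (n := 2))//= lerDr; apply: sumr_ge0 => *; exact: p0.
have -> : d * (2 * M / r2 ^+ 2 * d * e) = (2 * (d / r2) ^+ 2 * e) * M.
  by field; rewrite gt_eqF.
by apply: ler_wpM2l s1; rewrite mulr_ge0// mulr_ge0// sqr_ge0.
Qed.

End AnalyticStrict.

Section SingletonDimension.
Context {R : realType}.

Lemma rv_normP {k} (u : 'rV[R]_k) (r : R) : 0 <= r -> (`|u| <= r) <-> (forall i, `|u 0 i| <= r).
Proof.
move=> r0; split=> [h i|h].
  apply: le_trans h; rewrite [leRHS]mx_normrE; exact: (le_bigmax _ (fun ij => `|u ij.1 ij.2|) (0, i)).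
by rewrite [leLHS]mx_normrE; apply: bigmax_le => // -[i j] _ /=; rewrite ord1.
Qed.

(** By compactness |u - T u| has a minimum on the ball; applying [T] to a minimiser at least halves
    it, so it is 0. *)
Lemma fixed_point {k} (T : 'rV[R]_k -> 'rV[R]_k) (r : R) : 0 < r ->
  (forall u, `|u| <= r -> `|T u| <= r) ->
  (forall u v, `|u| <= r -> `|v| <= r -> `|T u - T v| <= `|u - v| / 2) ->
  exists2 u, `|u| <= r & T u = u.
Proof.
move=> r0 hT hc; pose A := [set u : 'rV[R]_k | `|u| <= r].
have Ac : compact A.
  apply: bounded_closed_compact.
    by exists r; split; [exact: num_real|move=> M rM u /= h; exact: le_trans h (ltW rM)].
  have -> : A = closed_ball_ (fun x => `|x|) 0 r by apply/seteqP; split=> u /=; rewrite /closed_ball_ /= sub0r normrN.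
  exact: closed_closed_ball_.
have A0 : A !=set0 by exists 0; rewrite /A /= normr0 ltW.
have fc : {within A, continuous (fun u => `|u - T u|)}.
  apply/subspace_continuousP => u Au; apply/cvgrPdist_lt => e e0.
  rewrite near_withinE; near=> v => Av.
  have uv : `|u - v| < e / 2 by near: v; apply: cvgr_dist_lt; [exact: cvg_id|rewrite divr_gt0].
  apply: le_lt_trans (ler_dist_dist (u - T u) (v - T v)) _.
  have -> : u - T u - (v - T v) = (u - v) - (T u - T v) by apply/rowP => j; rewrite !mxE; ring.
  apply: le_lt_trans (ler_normB _ _) _; have := hc u v Au Av; lra.
have [c cA hmin] := compact_EVT_min A0 Ac fc.
exists c; first by rewrite inE in cA.
rewrite inE in cA; have := hmin (T c); rewrite inE => /(_ (hT c cA)) h.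
have := hc c (T c) cA (hT c cA) => h2.
have : `|c - T c| <= 0 by lra.
by rewrite normr_le0 subr_eq0 => /eqP.
Unshelve. all: by end_near. Qed.

(* If [k < m], choose [v] in the kernel of the differential; for small [t != 0] a contraction produces a zero [x + t v + u B^T], distinct from [x]. *)
Lemma manifold_singleton {m} (x : 'rV[R]_m) e : manifold_point e [set x] x -> e = 0%N.
Proof.
move=> [_ [k [W [F [ek Wx [Wo Fa SW] Jk]]]]]; apply/eqP; apply: contraT => e0.
set J := Defs.jacobian F x in Jk.
have FJ l i : derive1 (fun t : R => F l (x + t *: delta_mx 0 i)) 0 = J l i by rewrite mxE.
have Fx l : F l x = 0.
  by have : ([set x] `&` W) x by []; rewrite SW => -[_ h].
have [l0 hl] := choice (fun l => analytic_strict (Fa l x Wx)).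
have [Cl hC] := choice hl; have [rl hr] := choice hC.
(* The estimate between [x] and points on a coordinate line identifies the linear coefficients with
   partial derivatives. *)
have lJ l i : l0 l i = J l i.
  have [C0 r0 h] := hr l; rewrite -FJ; apply/esym; rewrite /derive1; apply: cvg_lim => //.
  apply/cvgrPdist_le => et et0; have Cp : 0 < Cl l + 1 by rewrite ltr_wpDl.
  near=> t; rewrite /= addr0 scale0r addr0.
  have t0 : t != 0 by near: t; exact: nbhs_dnbhs_neq.
  have ta : 0 < `|t| by rewrite normr_gt0.
  have tr : 0 < `|t| < rl l by rewrite ta /=; near: t; exact: dnbhs0_lt.
  have td j : `|(t *: delta_mx 0 i : 'rV[R]_m) 0 j| <= `|t|.
    by rewrite !mxE eqxx /=; case: (j == i); rewrite ?mulr1 ?mulr0 ?normr0.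
  have := h `|t| `|t| (t *: delta_mx 0 i) 0 tr (ltW ta) td.
  have h0 j : `|(0 : 'rV[R]_m) 0 j| <= `|t| by rewrite mxE normr0.
  have td' j : `|(t *: delta_mx 0 i : 'rV[R]_m) 0 j - (0 : 'rV[R]_m) 0 j| <= `|t| by rewrite [X in _ - X]mxE subr0.
  move=> /(_ h0 td'); rewrite addr0 (bigD1 i)//= big1 => [|j ji]; last first.
    by rewrite !mxE eqxx /= (negPf ji) mulr0 subr0 mul0r.
  rewrite !mxE !eqxx /= mulr1 subr0 addr0 => kk.
  have -> : l0 l i - t^-1 *: (F l (x + t *: delta_mx 0 i) - F l x) =
     - t^-1 * (F l (x + t *: delta_mx 0 i) - F l x - t * l0 l i).
    by rewrite /GRing.scale /=; field.
  rewrite normrM normrN normfV -ler_pdivlMl ?invr_gt0// invrK mulrC.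
  rewrite (mulrC (l0 l i)); apply: le_trans kk _; rewrite [leRHS]mulrC; apply: (ler_wpM2r (ltW ta)).
  apply: (@le_trans _ _ ((Cl l + 1) * `|t|)); first by rewrite ler_wpM2r ?(ltW ta)// lerDl.
  rewrite mulrC -ler_pdivlMr//; near: t; exact: dnbhs0_le (divr_gt0 et0 Cp).
pose C := 1 + \sum_l Cl l; have C1 l : Cl l <= C.
  rewrite /C (bigD1 l)//= addrCA lerDl addr_ge0// sumr_ge0// => i _; by have [] := hr i.
have [r r0 hrr] : exists2 r : R, 0 < r & forall l, r <= rl l.
  exists (\big[Num.min/1]_l rl l); last by move=> l; exact: bigmin_le.
  by apply: (big_ind (fun p : R => 0 < p)) => // [p q p0 q0|l _]; [rewrite lt_min p0 q0|have [] := hr l].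
have strict d et (y y' : 'rV[R]_m) : 0 < d < r -> 0 <= et ->
   (forall i, `|y 0 i| <= d) -> (forall i, `|y' 0 i| <= d) -> (forall i, `|y 0 i - y' 0 i| <= et) ->
   forall l, `|F l (x + y) - F l (x + y') - ((y - y') *m J^T) 0 l| <= C * d * et.
  move=> /andP[d0 dr] et0 yd y'd ye l; have [C0 r0' h] := hr l.
  have := h d et y y'; rewrite d0 (lt_le_trans dr (hrr l)) => /(_ isT et0 yd y'd ye) k1.
  have -> : ((y - y') *m J^T) 0 l = \sum_i (y 0 i - y' 0 i) * l0 l i.
    by rewrite mxE; apply: eq_bigr => i _; rewrite lJ [J^T _ _]mxE; congr (_ * _); rewrite !mxE.
  apply: le_trans k1 _; rewrite ler_wpM2r// ler_wpM2r//; exact: ltW.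
have kJ : row_free J by rewrite /row_free Jk.
(* As [J *m B = 1], moving by u B^T changes the linear part of [F] by [u]. *)
have [B JB] := row_freeP kJ.
have [v vJ v0] : exists2 v : 'rV[R]_m, v *m J^T = 0 & v != 0.
  have /rowV0Pn[v] : kermx J^T != 0.
    by rewrite -mxrank_eq0 mxrank_ker mxrank_tr Jk -ek addnK.
  by move=> /sub_kermxP h v0; exists v.
have [V V0 hV] : exists2 V : R, 0 < V & forall i, `|v 0 i| <= V.
  exists (1 + `|v|) => [|i]; first by rewrite ltr_wpDr.
  by have := (rv_normP v (normr_ge0 v)).1 (lexx _) i; lra.
have [K K1 hK] : exists2 K : R, 1 <= K & forall (u : 'rV[R]_k) i, `|(u *m B^T) 0 i| <= K * `|u|.
  exists (1 + \sum_i \sum_l `|B i l|) => [|u i].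
    by rewrite lerDl sumr_ge0// => i _; rewrite sumr_ge0.
  rewrite mxE; apply: le_trans (ler_norm_sum _ _ _) _.
  apply: (@le_trans _ _ (\sum_l `|B i l| * `|u|)).
    apply: ler_sum => l _; rewrite mxE normrM mulrC ler_wpM2l//.
    exact: (rv_normP u (normr_ge0 u)).1.
  rewrite -mulr_suml ler_wpM2r// (bigD1 i)//= addrCA lerDl addr_ge0// sumr_ge0// => j _.
  by rewrite sumr_ge0.
have [w w0 hW] : exists2 w : R, 0 < w & forall y : 'rV[R]_m, (forall i, `|y 0 i| <= w) -> W (x + y).
  have /nbhs_ballP[w /= w0 h] := open_nbhs_nbhs (conj Wo Wx).
  exists (w / 2) => [|y hy]; first by rewrite divr_gt0.
  apply: h; rewrite -ball_normE /ball_ /= opprD addrA subrr sub0r normrN.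
  have w2 : 0 <= w / 2 by rewrite divr_ge0// ltW.
  by apply: le_lt_trans ((rv_normP y w2).2 hy) _; lra.
(* For |u| <= s the points x + y u stay in the range of the estimates and in [W], and the
   contraction constant C K (K + 1) s is at most 1/2. *)
pose s := Num.min (Num.min (r / 2) w) (1 / (2 * (C * K))) / (K + 1).
have K0 : 0 < K + 1 by lra.
have C0 : 0 < C by rewrite /C ltr_wpDr// sumr_ge0// => l _; have [] := hr l.
have CK : 0 < C * K by rewrite mulr_gt0//; lra.
have m0 : 0 < Num.min (Num.min (r / 2) w) (1 / (2 * (C * K))).
  by rewrite !lt_min w0 !divr_gt0// mulr_gt0.
have s0 : 0 < s by rewrite divr_gt0.
have sK : (K + 1) * s = Num.min (Num.min (r / 2) w) (1 / (2 * (C * K))) by rewrite /s; field; rewrite gt_eqF.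
have d0 : 0 < (K + 1) * s by rewrite mulr_gt0.
have [d1 d2 d3] : [/\ (K + 1) * s <= r / 2, (K + 1) * s <= w & (C * K) * ((K + 1) * s) <= 1 / 2].
  split; rewrite ?sK ?ge_min ?lexx ?orbT//.
  have : Num.min (Num.min (r / 2) w) (1 / (2 * (C * K))) <= 1 / (2 * (C * K)) by rewrite ge_min lexx orbT.
  rewrite -(ler_pM2l CK) => h; apply: le_trans h _.
  by have -> : (C * K) * (1 / (2 * (C * K))) = 1 / 2 by field; rewrite !gt_eqF//; lra.
have dr : 0 < (K + 1) * s < r by rewrite d0 /=; lra.
have d4 : C * ((K + 1) * s) <= 1 / 2.
  by apply: le_trans d3; rewrite ler_wpM2r ?ler_peMr// ltW.
pose t := s / V; have t0 : t != 0 by rewrite gt_eqF// divr_gt0.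
pose y u : 'rV[R]_m := t *: v + u *m B^T.
have tv i : `|(t *: v) 0 i| <= s.
  rewrite mxE normrM gtr0_norm ?divr_gt0// /t -mulrA ler_piMr ?(ltW s0)//.
  by rewrite mulrC ler_pdivrMr// mul1r.
have yb u : `|u| <= s -> forall i, `|y u 0 i| <= (K + 1) * s.
  move=> us i; rewrite /y mxE; apply: le_trans (ler_normD _ _) _.
  have h1 := tv i; have h2 := hK u i; have : K * `|u| <= K * s by rewrite ler_wpM2l//; lra.
  by lra.
(* Fixed points of [T] are the zeros of u -> F (x + y u), whose linear part in [u] is the
   identity. *)
pose T (u : 'rV[R]_k) : 'rV[R]_k := u - \row_l F l (x + y u).
have BJ : B^T *m J^T = 1%:M by rewrite -trmx_mul JB trmx1.
have Tc (u1 u2 : 'rV[R]_k) : `|u1| <= s -> `|u2| <= s -> `|T u1 - T u2| <= `|u1 - u2| / 2.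
  move=> h1 h2; have n0 := normr_ge0 (u1 - u2); apply/(rv_normP _ _) => [|l]; first by rewrite divr_ge0.
  have K0' : 0 <= K * `|u1 - u2| by rewrite mulr_ge0//; lra.
  have yy i : `|y u1 0 i - y u2 0 i| <= K * `|u1 - u2|.
    have -> : y u1 0 i - y u2 0 i = ((u1 - u2) *m B^T) 0 i by rewrite /y mulmxBl !mxE; ring.
    exact: hK.
  have := strict _ _ (y u1) (y u2) dr K0' (yb u1 h1) (yb u2 h2) yy l.
  have -> : (y u1 - y u2) *m J^T = u1 - u2.
    by rewrite /y opprD addrACA subrr add0r -mulmxBl -mulmxA BJ mulmx1.
  have -> : (T u1 - T u2) 0 l = - (F l (x + y u1) - F l (x + y u2) - (u1 - u2) 0 l) by rewrite /T !mxE; ring.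
  rewrite normrN => h; apply: le_trans h _.
  have -> : C * ((K + 1) * s) * (K * `|u1 - u2|) = (C * K * ((K + 1) * s)) * `|u1 - u2| by ring.
  by rewrite [leRHS]mulrC ler_wpM2r// -[leRHS]mul1r.
have z0 : `|(0 : 'rV[R]_k)| <= s by rewrite normr0 ltW.
have T0 : `|T 0| <= s / 2.
  apply/(rv_normP _ _) => [|l]; first by rewrite divr_ge0// ltW.
  have y0 : y 0 = t *: v by rewrite /y mul0mx addr0.
  have k1 i : `|(t *: v) 0 i| <= (K + 1) * s by rewrite -y0; exact: yb.
  have k2 (i : 'I_m) : `|(0 : 'rV[R]_m) 0 i| <= (K + 1) * s by rewrite mxE normr0 ltW.
  have k3 i : `|(t *: v) 0 i - (0 : 'rV[R]_m) 0 i| <= s by rewrite [X in _ - X]mxE subr0.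
  have := strict _ _ (t *: v) 0 dr (ltW s0) k1 k2 k3 l.
  rewrite addr0 Fx !subr0 -scalemxAl vJ scaler0 mxE subr0 => h.
  rewrite /T !mxE y0 sub0r normrN; apply: le_trans h _.
  have -> : s / 2 = 1 / 2 * s by rewrite mul1r mulrC.
  by apply: (ler_wpM2r (ltW s0)).
have [u us Tu] : exists2 u, `|u| <= s & T u = u.
  apply: (fixed_point s0 _ Tc) => u us.
  have := Tc u 0 us z0; rewrite subr0 => h.
  have := ler_normD (T u - T 0) (T 0); rewrite subrK => h2; lra.
have Fu l : F l (x + y u) = 0.
  by have := congr1 (fun w : 'rV[R]_k => w 0 l) Tu; rewrite /T !mxE; lra.
have Wu : W (x + y u) by apply: hW => i; exact: le_trans (yb u us i) d2.
have : ([set x] `&` W) (x + y u) by rewrite SW; split.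
move=> [/= xe _]; have yu0 : y u = 0 by apply: (addrI x); rewrite addr0.
have u0 : u = 0.
  have := congr1 (mulmx^~ J^T) yu0; rewrite /y mulmxDl -scalemxAl vJ scaler0 add0r -mulmxA BJ mulmx1.
  by rewrite mul0mx.
by move/eqP: yu0; rewrite /y u0 mul0mx addr0 scaler_eq0 (negPf t0) (negPf v0).
Unshelve. all: by end_near. Qed.

End SingletonDimension.

Section FiniteSubvariety.
Context {R : realType} {m : nat}.
Implicit Types (x : 'rV[R]_m).

Lemma coord_analytic (i : 'I_m) (b : R) x : real_analytic_at (fun y : 'rV[R]_m => y 0 i - b) x.
Proof.
pose c (al : {ffun 'I_m -> nat}) : R :=
  if (\sum_j al j == 0)%N then x 0 i - b else if (\sum_j al j == 1)%N then (al i)%:R else 0.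
have cE N (al : {ffun 'I_m -> 'I_N.+1}) : (\sum_j [ffun j => al j : nat] j = \sum_j al j)%N.
  by apply: eq_bigr => j _; rewrite ffunE.
have c2 (h : R -> R) y N : h 0 = 0 -> (1 < N)%N -> power_term (fun al => h (c al)) y N = 0.
  move=> h0 N1; rewrite /power_term big1// => al /eqP e; rewrite /c cE e.
  by case: N N1 al e => [//|[//|N]] _ al e; rewrite h0 mul0r.
have conv (h : R -> R) y : h 0 = 0 ->
    series (power_term (fun al => h (c al)) y) @ \oo --> power_term (fun al => h (c al)) y 0 + power_term (fun al => h (c al)) y 1.
  move=> h0; apply: cvg_near_cst; exists 2%N => // n /= n2.
  rewrite /series /= (big_cat_nat (n := 2))//= big_nat_recr//= big_nat1 big_nat_cond big1 ?addr0// => N /andP[/andP[N2 _] _].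
  exact: c2.
exists c, 1 => // y _; split.
  by apply/cvg_ex; eexists; apply: (conv Num.norm); rewrite normr0.
have := conv id y erefl.
have -> : power_term (fun al => id (c al)) y 0 + power_term (fun al => id (c al)) y 1 = (x + y) 0 i - b; last by [].
have -> : power_term (fun al => id (c al)) y 0 = x 0 i - b.
  rewrite /power_term (bigD1 [ffun => ord0])/=; last by apply/eqP; rewrite big1// => j _; rewrite ffunE.
  have s0 : (\sum_j ([ffun=> ord0] : {ffun 'I_m -> 'I_1}) j = 0)%N by rewrite big1// => j _; rewrite ffunE.
  have -> : c [ffun i0 => ([ffun=> ord0] : {ffun 'I_m -> 'I_1}) i0 : nat] = x 0 i - b by rewrite /c cE s0.
  rewrite big1 ?mulr1 => [|j _]; last by rewrite ffunE expr0.
  rewrite big1 ?addr0// => al /andP[_ /eqP]; case.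
  by apply/ffunP => j; rewrite ffunE; apply/val_inj => /=; case: (al j) => -[].
rewrite power_term1 (bigD1 i)//= big1 => [|j ji].
  have -> : lin_coef c i = 1.
    rewrite /lin_coef (bigD1 [ffun j => inord (j == i)])/=; last first.
      by rewrite (bigD1 i)//= big1 ?addn0 => [|j ji]; rewrite ffunE ?eqxx ?(negPf ji) inordK.
    rewrite big1 ?addr0 => [|al /andP[/eqP h1 h2]].
      rewrite /c cE (bigD1 i)//= big1 ?addn0 => [|j ji]; rewrite ffunE ?eqxx ?(negPf ji) ?inordK//=.
      by rewrite !ffunE eqxx inordK// mulr1.
    have [->|ai] := eqVneq (al i : nat) 0%N; first by rewrite mulr0.
    exfalso; move/negP: h2; apply; apply/eqP/ffunP => j; rewrite ffunE; apply/val_inj; rewrite /= inordK; last by case: (j == i).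
    have aux (p q r : nat) : (p + q = 1 -> p != 0 -> p = 1 /\ q = 0)%N by move=> ? /eqP; lia.
    move: h1; rewrite (bigD1 i)//= => h1; have [a1 /eqP a0] := aux _ _ 0%N h1 ai.
    have [->|ji] := eqVneq j i; first by rewrite a1.
    by move: a0; rewrite sum_nat_eq0 => /forallP/(_ j); rewrite ji => /eqP.
  by rewrite !mxE; ring.
rewrite /lin_coef big1 ?mulr0// => al /eqP h; rewrite /c cE h /= ffunE.
have aux (p q r : nat) : (p + (q + r) = 1 -> p * q = 0)%N by nia.
rewrite -natrM; apply/eqP; rewrite pnatr_eq0; apply/eqP; move: h; rewrite (bigD1 i)//= (bigD1 j)//=; exact: aux.
Qed.

(** Cut out by the m coordinate equations, whose Jacobian is the identity; [manifold_singleton]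
    excludes larger dimensions. *)
Lemma singleton_subvariety x : analytic_subvariety 0 [set x].
Proof.
pose F (l : 'I_m) (y : 'rV[R]_m) := y 0 l - x 0 l.
have ae : analytic_equations [set x] setT F.
  split=> [|l y _|]; [exact: openT|exact: coord_analytic|].
  apply/seteqP; split=> y /=; first by move=> [-> _]; split=> // l; rewrite /F subrr.
  by move=> [_ h]; split=> //; apply/rowP => l; have /eqP := h l; rewrite subr_eq0 => /eqP.
split; first by move=> y _; exists setT, m, F.
  exists x; split=> //; exists m, setT, F; split=> //.
  have -> : Defs.jacobian F x = 1%:M; last by rewrite mxrank1.
  apply/matrixP => l i; rewrite !mxE /F derive1E.
  have -> : (fun t : R => (x + t *: delta_mx 0 i) 0 l - x 0 l) = (fun t => t * (l == i)%:R).
    by apply/funext => t; rewrite !mxE eqxx /=; ring.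
  by rewrite (_ : (fun t : R => t * _) = (fun t => (l == i)%:R *: t)) ?deriveZ//= ?derive_id /GRing.scale/= ?mulr1//; apply/funext => t; rewrite mulrC.
by move=> e y h; have [/= yx _] := h; rewrite yx in h; rewrite (manifold_singleton h).
Qed.

Lemma finite_locally_union (A S : set 'rV[R]_m) : (0 < m)%N -> finite_set S -> locally_union_of_subvarieties A S.
Proof.
move=> m0 /finite_seqP[s sS] x _.
(* A finite set is its own stratum of dimension 0; the other strata are empty. *)
exists setT, (fun d : 'I_m => if (d : nat) == 0%N then S else set0); split.
- by split; [exact: openT|].
- move=> d; case: eqP => [->|_]; last first.
    exists 0%N, (fun _ => set0); split=> [|[]//|]; first by move=> [].
    by apply/seteqP; split=> // y [[]].
  (* [undup] makes the listed points distinct, hence the singletons disjoint. *)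
  exists (size (undup s)), (fun l => [set nth 0 (undup s) l]); split.
  + move=> i j _ _ [y [/= -> ]] /eqP; rewrite nth_uniq ?undup_uniq// => /eqP e; exact: val_inj.
  + by move=> l; exact: singleton_subvariety.
  rewrite sS; apply/seteqP; split=> y /=.
    rewrite -mem_undup => /[dup] ys; rewrite -index_mem => h.
    by exists (Ordinal h) => //=; rewrite nth_index.
  by move=> [l _ /= ->]; rewrite -mem_undup mem_nth.
rewrite setIT; apply/seteqP; split=> y; first by move=> Sy; exists (Ordinal m0).
by move=> [d _]; case: eqP.
Qed.

(** [Gamma] is convex, being cut out by linear inequalities, and coordinates in [0, pi) bound the
    parameter on the line by pi. *)
Lemma Gamma_segment (theta : 'rV[R]_m) i : Gamma R m theta ->
  coordinate_segment theta i (coordinate_line theta i `&` Gamma R m).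
Proof.
move=> [t1 t2]; exists [set t | Gamma R m (theta + t *: delta_mx 0 i)]; split.
- move=> a b [a1 a2] [b1 b2] c /andP[ac cb].
  have E j t : (theta + t *: delta_mx 0 i) 0 j = theta 0 j + t * (j == i)%:R by rewrite !mxE eqxx.
  split=> [j|j k jk].
    have := a1 j; have := b1 j; rewrite !E; case: (j == i); rewrite ?mulr1 ?mulr0//.
    by move=> /andP[b3 b4] /andP[a3 a4]; apply/andP; split; lra.
  have := a2 j k jk; have := b2 j k jk; rewrite !E; case: (j == i); case: (k == i); rewrite ?mulr1 ?mulr0//; lra.
- exists pi => t [h _]; have /andP[h1 h2] := h i; have /andP[h3 h4] := t1 i.
  move: h1 h2; rewrite !mxE !eqxx mulr1 => h1 h2; rewrite ler_norml; apply/andP; split; lra.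
apply/seteqP; split=> y /=; first by move=> [[t _ <-] h]; exists t.
by move=> [t h <-]; split=> //; exists t.
Qed.

End FiniteSubvariety.

(** * The moduli space *)

Section Localization.
Context {R : realType}.
Local Notation E := (Cplx R).
Local Notation C := (R[i]).
Implicit Types (U W : set E).

Lemma Ck_local k U (f : E -> R) : (forall z, U z -> exists2 W, W z & Ck k W f) -> Ck k U f.
Proof.
elim: k f => [|k IH] f h; split=> //.
- by move=> z /h[W Wz /Ck_cont]; apply.
- by move=> z /h[W Wz /Ck_cont]; apply.
split=> [u z /h[W Wz hW]|u]; first exact: Ck_drv hW Wz.
by apply: IH => z /h[W Wz /= [_ [_ hW]]]; exists W => //; exact: hW.
Qed.

Lemma smx_local {p q} U (F : E -> 'M[R]_(p, q)) : (forall z, U z -> exists2 W, W z & smx W F) -> smx U F.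
Proof.
by move=> h i j k; apply: Ck_local => z /h[W Wz hW]; exists W => //; exact: hW.
Qed.

Lemma conf_local {N} U (F : E -> 'rV[R]_N) : (forall z, U z -> exists2 W, W z & conf W F) -> conf U F.
Proof.
move=> h; split=> [|z /h[W Wz [_ cF]]]; last exact: cF.
by apply: smx_local => z /h[W Wz [sF _]]; exists W.
Qed.

Lemma conf_sub {N} U W (F : E -> 'rV[R]_N) : W `<=` U -> conf U F -> conf W F.
Proof. by move=> WU [sF cF]; split=> [|z /WU]; [exact: smx_sub sF|exact: cF]. Qed.

Lemma conf_ext {N} U (F G : E -> 'rV[R]_N) : open U -> (forall z, U z -> F z = G z) -> conf U F -> conf U G.
Proof.
move=> Uo FG [sF cF]; split=> [|z Uz]; first exact: smx_ext FG sF.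
have e u := dird_mx_ext u Uo FG Uz.
by have := cF z Uz; rewrite FG// !e.
Qed.

Lemma al_ext {N} U (F G : E -> 'rV[R]_N) u v z : open U -> (forall z, U z -> F z = G z) -> U z ->
  al F u v z = al G u v z.
Proof.
move=> Uo FG Uz; have e w z' (Uz' : U z') := dird_mx_ext w Uo FG Uz'.
rewrite !alphaE (dird_mx_ext u Uo (e v) Uz).
rewrite np.unlock /normal_part /frame -!DrfE -!iiE.
by rewrite !e// FG.
Qed.

Lemma sff_ext {N} U (F G : E -> 'rV[R]_N) v z : open U -> (forall z, U z -> F z = G z) -> U z ->
  sff F v z = sff G v z.
Proof.
move=> Uo FG Uz; have e w := dird_mx_ext w Uo FG Uz.
by rewrite /sff /lam !e !(al_ext _ _ Uo FG Uz).
Qed.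

Lemma rot_ext {N} U (F G : E -> 'rV[R]_N) e Z : open U -> (forall z, U z -> F z = G z) -> rot U F e Z -> rot U G e Z.
Proof.
by move=> Uo FG [h1 h2 h3]; split=> // z v Uz; rewrite -(sff_ext _ Uo FG Uz) h3.
Qed.

Lemma jcurve_sub {N} U W (F : E -> 'rV[R]_N) J : W `<=` U -> jcurve U F J -> jcurve W F J.
Proof. by move=> WU [h1 h2 h3 h4]; split=> //; [exact: conf_sub h1|move=> z /WU; exact: h4]. Qed.

Lemma sff_smx {N} U (F : E -> 'rV[R]_N) v : open U -> conf U F -> smx U (sff F v).
Proof.
move=> Uo cF; have sF := cF.1.
have sa u : smx U (al F v u).
  have s1 := smxM Uo (smx_dird v Uo (smx_dird u Uo sF)) (nproj_smx Uo cF).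
  by apply: (smx_ext Uo _ s1) => w Uw; rewrite (mul_nproj _ Uo cF Uw) alphaE.
have K u : smx U (fun w => (Dr u F w)^T *m al F v u w - (al F v u w)^T *m Dr u F w).
  have sD := smx_dird u Uo sF.
  exact: smxB Uo (smxM Uo (smx_tr Uo sD) (sa u)) (smxM Uo (smx_tr Uo (sa u)) sD).
exact: smxZ Uo (lamV_smx Uo cF) (smxD Uo (K 1) (K ii)).
Qed.

Lemma expi_norm (t : R) : (expi t : C) * (expi t : C)^*%C = 1.
Proof. by apply: Cext; rewrite /expi /=; have := cos2Dsin2 t; rewrite !expr2 => h; lra. Qed.

(** Equal squares leave exp(i s) = exp(i t) or its opposite. In the second case the two sines,
    non-negative on [0, pi), are opposite, so both angles are 0. *)
Lemma expi_sq_inj (s t : R) : 0 <= s < pi -> 0 <= t < pi -> (expi s : C) ^+ 2 = (expi t : C) ^+ 2 -> s = t.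
Proof.
have Hn (x : R) : 0 <= x < pi -> 0 <= sin x by move=> /andP[h1 h2]; apply: sin_ge0_pi; rewrite h1 ltW.
have Hz (x : R) : 0 <= x < pi -> sin x = 0 -> x = 0.
  move=> /andP[h1 h2] sx; apply: contrapT => x0.
  have : 0 < sin x by apply: sin_gt0_pi; apply/andP; split; [rewrite lt_def h1 andbT; exact/eqP|exact: h2].
  by rewrite sx ltxx.
move=> hs ht /eqP; rewrite eqf_sqr => /orP[] /eqP[cE sE].
  have hI (x : R) : 0 <= x < pi -> x \in `[0, pi] by move=> /andP[h1 h2]; rewrite in_itv /= h1 ltW.
  by apply: cos_inj => //; exact: hI.
have s0 := Hn s hs; have t0 := Hn t ht.
have e1 : sin s = 0 by lra.
have e2 : sin t = 0 by lra.
by rewrite (Hz s hs e1) (Hz t ht e2).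
Qed.

End Localization.

Section Blocks.
Context {R : realType} (n m : nat) (nm : n.+1 = (6 * m)%N).

Lemma block_orth (i j : 'I_m) : block_incl R n i *m (block_incl R n j)^T = if i == j then 1%:M else 0.
Proof.
have hb (l : 'I_m) (k : 'I_6) : (6 * l + k < n.+1)%N.
  by rewrite nm; have := ltn_ord l; have := ltn_ord k; lia.
apply/matrixP => k l; rewrite mxE (bigD1 (Ordinal (hb i k)))//= !mxE eqxx mul1r big1 ?addr0 => [|c ck].
  have [<-|ij] := eqVneq i j; rewrite mxE; first by congr (_%:R); rewrite eqn_add2l.
  have ij' : (i : nat) <> j by move=> /val_inj/eqP; rewrite (negPf ij).
  by case: eqP => //= h; case: ij'; have := ltn_ord k; have := ltn_ord l; lia.
rewrite !mxE; case: eqP => [ce|]; last by rewrite mul0r.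
by case/eqP: ck; apply: val_inj.
Qed.

Lemma block_sum : \sum_(j < m) (block_incl R n j)^T *m block_incl R n j = 1%:M.
Proof.
apply/matrixP => a b; rewrite summxE [RHS]mxE.
have hj : (a %/ 6 < m)%N by rewrite ltn_divLR// mulnC -nm.
have hk : (a %% 6 < 6)%N by rewrite ltn_mod.
rewrite (bigD1 (Ordinal hj))//= [X in _ + X]big1 ?addr0 => [|j jj]; last first.
  rewrite mxE big1// => k _; rewrite !mxE; case: eqP => [ae|]; last by rewrite mul0r.
  by case/eqP: jj; apply: val_inj => /=; rewrite ae; have := ltn_ord k; lia.
rewrite mxE (bigD1 (Ordinal hk))//= [X in _ + X]big1 ?addr0 => [|k kk]; last first.
  rewrite !mxE; case: eqP => [ae|]; last by rewrite mul0r.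
  by case/eqP: kk; apply: val_inj => /=; rewrite /= in ae; lia.
rewrite !mxE /=; have <- : (a = 6 * (a %/ 6) + a %% 6 :> nat)%N by lia.
by rewrite eqxx mul1r eq_sym.
Qed.

End Blocks.

Section AlphaTrace.
Context {R : realType} {N : nat}.
Local Notation E := (Cplx R).
Local Notation C := (R[i]).

(** Multiplying both directions by [k] scales the trace by |k|^2; this carries minimality through a
    change of chart. *)
Lemma al_trace2 U (F : E -> 'rV[R]_N) (k : E) z : open U -> conf U F -> U z ->
  al F 1 1 z + al F ii ii z = 0 ->
  al F ((1 : C) * k) ((1 : C) * k) z + al F ((ii : C) * k) ((ii : C) * k) z = 0.
Proof.
move=> Uo cF Uz h; have {}h : al F ii ii z = - al F 1 1 z by apply/eqP; rewrite -addr_eq0 addrC h.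
have q u v : al F u v z = complex.Re u *: (complex.Re v *: al F 1 1 z + complex.Im v *: al F 1 ii z) +
    complex.Im u *: (complex.Re v *: al F 1 ii z - complex.Im v *: al F 1 1 z).
  rewrite (alpha_linl u v Uo cF Uz) !(alphaC _ v Uo cF Uz) (alpha_linl v 1 Uo cF Uz) (alpha_linl v ii Uo cF Uz).
  by rewrite h (alphaC ii 1 Uo cF Uz) scalerN.
rewrite (q (1 * k) (1 * k)) (q (ii * k) (ii * k)) iiE /iunit {q h}; case: k => x y /=; move: (al F 1 1 z) (al F 1 ii z) => A B.
by apply/rowP => j; rewrite !mxE; ring.
Qed.

End AlphaTrace.

Section Moduli.
Context {R : realType} {M Mt : topologicalType}.
Local Notation E := (Cplx R).
Local Notation C := (R[i]).
Variables (X : riemann_surface R M) (Xt : riemann_surface R Mt) (P : Mt -> M) (g : M -> 'rV[R]_6).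

Lemma jcurve_charts : pseudoholomorphic_S5 X g -> exists J, forall c, atlas X c -> jcurve (cimg c) (loc g c) J.
Proof.
move=> [cg [A AA [gA1 _ _ ph]]].
have [e ee [eA AA']] := unit_kernel AA; have [K hK] := cr_mx e.
exists (A *m K *m A^T) => c Xc.
have g1 p : dot (g p) (g p) = 1 by have := gA1 p; rewrite -!dtdot dotMl -mulmxA AA mulmx1.
have cc : conf (cimg c) (loc g c) by exact: (conformal_conf X g1).1 cg c Xc.
apply: (pholo_jcurve (imgo Xc) cc AA ee eA AA' hK) => z u cz.
have D v : Dr v (fun w => loc g c w *m A) z = Dr v (loc g c) z *m A.
  by rewrite (dird_mxM v (imgo Xc) cc.1 (smx_cst A _) cz) dird_mx_cst mulmx0 addr0.
by rewrite -!D iiE !DrE; exact: ph.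
Qed.

Variables (n m : nat).
Hypotheses (hP : universal_cover Xt X P) (nm : n.+1 = (6 * m)%N).
Variable J : 'M[R]_6.
Hypothesis hJ : forall c, atlas X c -> jcurve (cimg c) (loc g c) J.
Local Notation gt := (g \o P).
Local Notation B j := (block_incl R n j).

Let cg c : atlas X c -> conf (cimg c) (loc g c). Proof. by move=> /hJ[]. Qed.

Variable F0 : M -> 'rV[R]_n.+1.
Hypothesis cF0 : forall c, atlas X c -> conf (cimg c) (loc F0 c).
Hypothesis sF0 : forall c, atlas Xt c -> smx (cimg c) (loc (F0 \o P) c).
Hypothesis nF0 : forall c z, atlas Xt c -> cimg c z -> Dr 1 (loc (F0 \o P) c) z != 0.

Lemma proj_loc c z : atlas Xt c -> cimg c z -> exists d W phi (k : E -> C),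
  [/\ atlas X d, [/\ open W, W z & W `<=` cimg c], hol W phi k, (forall w, W w -> cimg d (phi w)) &
   forall w, W w -> (loc g d \o phi) w = loc gt c w].
Proof.
move=> Xc cz; have [d Xd dz] := atlas_cover X (P (cinv c z)).
have [W [phi [k [Wo Wz WU hphi [phE hW]]]]] := proj_chart hP cF0 sF0 nF0 Xc Xd cz dz.
exists d, W, phi, k; split=> // w Ww; first by have [] := hW w Ww.
by rewrite /loc /=; have [_ _ ->] := hW w Ww.
Qed.

Lemma gt_conf c : atlas Xt c -> conf (cimg c) (loc gt c).
Proof.
move=> Xc; apply: conf_local => z cz; have [d [W [phi [k [Xd [Wo Wz WU] hphi dW hW]]]]] := proj_loc Xc cz.
by exists W => //; exact: conf_ext Wo hW (conf_hol (imgo Xd) Wo hphi dW (cg Xd)).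
Qed.

Lemma g_minimal c z : atlas X c -> cimg c z -> al (loc g c) 1 1 z + al (loc g c) ii ii z = 0.
Proof. by move=> Xc cz; rewrite (minimal_alpha (imgo Xc) (hJ Xc) cz) addrN. Qed.

Lemma gt_minimal c z : atlas Xt c -> cimg c z -> al (loc gt c) 1 1 z + al (loc gt c) ii ii z = 0.
Proof.
move=> Xc cz; have [d [W [phi [k [Xd [Wo Wz WU] hphi dW hW]]]]] := proj_loc Xc cz.
rewrite -!(al_ext _ _ Wo hW Wz) !(al_hol (imgo Xd) Wo hphi dW (cg Xd) _ _ Wz).
exact: (al_trace2 (k z) (imgo Xd) (cg Xd) (dW z Wz) (g_minimal Xd (dW z Wz))).
Qed.

Definition factors {V} (h : Mt -> V) := forall p q, P p = P q -> h p = h q.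

Section FromFactors.
Variables (a th : 'rV[R]_m) (h : 'I_m -> Mt -> 'rV[R]_6).
Hypotheses (ha : S_star R m a) (hth : Gamma R m th).
Hypotheses (has : forall j, associated Xt gt (th 0 j) (h j)) (hf : forall j, factors (h j)).

Lemma weighted_factors : factors (weighted_sum n a h).
Proof. by move=> p q pq; apply: eq_bigr => j _; rewrite (hf j pq). Qed.

(** Upstairs each h_j is the lift of [g] times a rotation, and [lift_chart] pulls these rotations
    back by a local section. *)
Lemma local_form (F : M -> 'rV[R]_n.+1) c z : (forall q, F (P q) = weighted_sum n a h q) -> atlas X c -> cimg c z ->
  exists W (Z : 'I_m -> E -> 'M[R]_6), [/\ open W, W z, W `<=` cimg c,
   (forall j, rot W (loc g c) (expi (th 0 j) - 1) (Z j)) &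
   forall w, W w -> loc F c w = \sum_j a 0 j *: (loc g c w *m Z j w *m B j)].
Proof.
move=> FP Xc cz; have [c' [W [psi [k [Xc' [Wo Wz WU] hpsi hW]]]]] := lift_chart hP cF0 sF0 nF0 Xc cz.
have /choice[Z hZ] : forall j, exists Z, grot Xt gt (expi (th 0 j) - 1) Z /\ forall p, h j p = gt p *m Z p.
  by move=> j; have [Z] := associated_grot gt_conf (has j); exists Z.
exists W, (fun j w => Z j (cinv c' (psi w))); split=> // [j|w Ww].
  have r := rot_hol (imgo Xc') Wo hpsi (fun w Ww => (hW w Ww).1) (gt_conf Xc') ((hZ j).1 c' Xc').
  by apply: rot_ext Wo _ r => w Ww; rewrite /loc /= (hW w Ww).2.
rewrite /loc /= -(hW w Ww).2 FP; apply: eq_bigr => j _.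
by rewrite (hZ j).2.
Qed.

Let a1 : \sum_(j < m) a 0 j ^+ 2 = 1. Proof. by case: ha. Qed.
Let a0 (j : 'I_m) : a 0 j != 0.
Proof. by have [_ /prodf_neq0] := ha; apply. Qed.

Lemma expi_inj : injective (fun j : 'I_m => (expi (th 0 j) : C) ^+ 2).
Proof.
move=> i j /expi_sq_inj; have [t1 t2] := hth => /(_ (t1 i) (t1 j)) e.
by case: (ltngtP i j) => [/t2|/t2|/val_inj//]; rewrite e ltxx.
Qed.

(** [F] is read off an arbitrary section of [P], on which it does not depend since the sum factors.
    Its regularity and the Hopf condition are local and come from [local_form]. *)
Lemma moduli_intro : (forall v, (forall q, dot (weighted_sum n a h q) v = 0) -> v = 0) ->
  exceptional_moduli Xt X P g n m (a, th).
Proof.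
move=> hs; split=> //; exists h; split=> //.
have [_ [_ Ps _] _] := hP; have /choice[sec hsec] := Ps.
pose F p := weighted_sum n a h (sec p).
have FP q : F (P q) = weighted_sum n a h q by apply: weighted_factors; rewrite hsec.
have lf c z Xc cz := @local_form F c z FP Xc cz.
have eq1 (j : 'I_m) := expi_norm (th 0 j).
exists (congruence_class F), F; split; last by apply/funext => q; rewrite /= FP.
  exists F; [split|reflexivity].
  - by move=> v hv; apply: hs => q; rewrite -FP.
  - split.
      apply/minimalP; split=> [c Xc|c z Xc cz].
        apply: conf_local => z cz; have [W [Z [Wo Wz WU rZ FE]]] := lf c z Xc cz.
        by exists W => //; exact: (F_conf Wo (jcurve_sub WU (hJ Xc)) rZ (block_orth nm) a1 FE).
      have [W [Z [Wo Wz WU rZ FE]]] := lf c z Xc cz.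
      exact: (F_minimal Wo (jcurve_sub WU (hJ Xc)) rZ eq1 (block_orth nm) a1 FE Wz).
    move=> s c z /andP[s0 _] Xc cz hr; have [W [Z [Wo Wz WU rZ FE]]] := lf c z Xc cz.
    exact: (hopf_derivable Wo (jcurve_sub WU (hJ Xc)) rZ eq1 (block_orth nm) a1 FE s0 Wz hr).
  - move=> c z u v Xc cz; have [W [Z [Wo Wz WU rZ FE]]] := lf c z Xc cz.
    by rewrite -!dtdot -!DrE; exact: (F_met Wo (jcurve_sub WU (hJ Xc)) rZ (block_orth nm) a1 FE u v Wz).
by exists 1%:M; rewrite ?trmx1 ?mulmx1// => p; rewrite mulmx1.
Qed.

Lemma substantial_Cq c z : atlas X c -> cimg c z -> Cq (loc g c) J z != 0 ->
  forall v, (forall q, dot (weighted_sum n a h q) v = 0) -> v = 0.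
Proof.
move=> Xc cz c0 v hv; have [_ [_ Ps _] _] := hP; have /choice[sec hsec] := Ps.
pose F p := weighted_sum n a h (sec p).
have FP q : F (P q) = weighted_sum n a h q by apply: weighted_factors; rewrite hsec.
have [W [Z [Wo Wz WU rZ FE]]] := @local_form F c z FP Xc cz.
apply: (F_substantial Wo (jcurve_sub WU (hJ Xc)) rZ (fun j => expi_norm (th 0 j)) FE a0 expi_inj (block_sum nm) Wz c0).
by move=> w Ww; rewrite dtdot; exact: hv.
Qed.

End FromFactors.

(* Some member of the associated family with angle [t] descends to the surface [M]. *)
Definition realizable t := exists2 h : Mt -> 'rV[R]_6, associated Xt gt t h & factors h.

Lemma orth_entry {q} (A : 'M[R]_q) i j : A *m A^T = 1%:M -> `|A i j| <= 1.
Proof.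
move=> hA; have : (A *m A^T) i i = 1 by rewrite hA mxE eqxx.
rewrite mxE (bigD1 j)//= mxE -expr2 => h.
have s0 : 0 <= \sum_(k | k != j) A i k * A^T k i by apply: sumr_ge0 => k _; rewrite mxE -expr2 sqr_ge0.
have : A i j ^+ 2 <= 1 by lra.
by rewrite ler_norml; move: (A i j) => x hx; apply/andP; split; nra.
Qed.

Lemma sff_expi {N} U (F : E -> 'rV[R]_N) x u z : open U -> conf U F -> U z ->
  sff F ((expi x - 1) * u) z = fcos x *: sff F u z + sin x *: sff F (ii * u) z.
Proof.
move=> Uo cF Uz; rewrite (sff_lin (_ * u) Uo cF Uz) (sff_lin u Uo cF Uz) (sff_lin (ii * u) Uo cF Uz).
move: (sff F 1 z) (sff F ii z) => S1 S2; rewrite iiE /iunit /expi /fcos; case: u => p q /=.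
by apply/matrixP => k l; rewrite !mxE; ring.
Qed.

Lemma grot_orth e Z p : grot Xt gt e Z -> Z p *m (Z p)^T = 1%:M.
Proof.
by move=> hZ; move: p; apply: (chart_cover (X := Xt)) => c z Xc cz; have [_ h _] := hZ c Xc; exact: h.
Qed.

(* The solutions at the nodes are normalised to be 1 at [q0], so that the Newton series of the normalised solutions can be formed; a condition [h p = h q] holding at all nodes passes to the sum. *)
Lemma newton_good (q0 : Mt) (t : nat -> R) th : injective t -> (forall k, 0 <= t k <= 4) ->
  (forall k, realizable (t k)) -> 0 <= th <= 4 -> realizable th.
Proof.
(* Away from the nodes all differences th - t k are non-zero, as the Newton quotients at [th]
   require. *)
move=> tI t4 gd th4; have [[k ->]|nk] := pselect (exists k, th = t k); first exact: gd.
have tht k : th != t k by apply/eqP => e; apply: nk; exists k.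
have /choice[Z hZ] : forall k, exists Z, grot Xt gt (expi (t k) - 1) Z /\ factors (fun p => gt p *m Z p).
  move=> k; have [h ah fh] := gd k; have [Z gZ hE] := associated_grot gt_conf ah.
  by exists Z; split=> // p q pq; rewrite -!hE; exact: fh.
pose Zf k p : 'M[R]_6 := Z k p *m (Z k q0)^T.
have Zo k p : Z k p *m (Z k p)^T = 1%:M := grot_orth p (hZ k).1.
have gZ k : grot Xt gt (expi (t k) - 1) (Zf k).
  by apply: grot_mulr (hZ k).1; rewrite trmxK; exact: mulmx1C.
pose Bs (c : chart R Mt) (u z : E) := sff (loc gt c) u z.
have HBs c u : atlas Xt c -> smx (cimg c) (Bs c u) by move=> Xc; exact: sff_smx (imgo Xc) (gt_conf Xc).
have HBl c u z : atlas Xt c -> cimg c z -> Bs c u z = complex.Re u *: Bs c 1 z + complex.Im u *: Bs c ii z.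
  by move=> Xc cz; exact: sff_lin (imgo Xc) (gt_conf Xc) cz.
have Zs k c : atlas Xt c -> smx (cimg c) (Zf k \o cinv c) by move=> Xc; have [] := gZ k c Xc.
have Z1 k p i j : `|Zf k p i j| <= 1 by apply: orth_entry; exact: grot_orth (gZ k).
have Z0 k : Zf k q0 = 1%:M by exact: Zo.
have Zd k c u z : atlas Xt c -> cimg c z -> Dr u (Zf k \o cinv c) z = Bth Bs c u z (t k) *m Zf k (cinv c z).
  move=> Xc cz; have [_ _ dZ] := gZ k c Xc; rewrite [LHS](dZ z u cz); congr (_ *m _).
  exact: sff_expi (imgo Xc) (gt_conf Xc) cz.
have [L LE] : exists L, L = Zl t Zf th by eexists.
have L_s c : atlas Xt c -> smx (cimg c) (loc L c).
  by rewrite LE => Xc; exact: (Zl_smx HBs HBl tI t4 Zs Z1 Z0 Zd th4 tht Xc).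
have L_D c u z : atlas Xt c -> cimg c z -> Dr u (loc L c) z = sff (loc gt c) ((expi th - 1) * u) z *m loc L c z.
  move=> Xc cz; rewrite (sff_expi th u (imgo Xc) (gt_conf Xc) cz) LE.
  exact: (Zl_Dr HBs HBl tI t4 Zs Z1 Z0 Zd th4 tht u Xc cz).
have L_0 : L q0 = 1%:M by rewrite LE; exact: (Zl_q0 HBs HBl tI t4 Zs Z1 Z0 Zd th4).
(* The Newton sum is not orthogonal term by term. But L^T L has zero derivative, as [sff] is skew,
   and equals 1 at [q0]. *)
have Lo p : L p *m (L p)^T = 1%:M.
  apply: mulmx1C; have : (L p)^T *m L p = (L q0)^T *m L q0; last by rewrite L_0 trmx1 mulmx1.
  apply: (const_connected (X := Xt) (G := fun p => (L p)^T *m L p)) => [c Xc|c z u Xc cz].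
    exact: smxM (imgo Xc) (smx_tr (imgo Xc) (L_s c Xc)) (L_s c Xc).
  rewrite (dird_mxM u (imgo Xc) (smx_tr (imgo Xc) (L_s c Xc)) (L_s c Xc) cz) (dird_mx_tr u (imgo Xc) (L_s c Xc) cz).
  rewrite (L_D c u z Xc cz) trmx_mul sff_skew mulmxN mulNmx !mulmxA; exact: addNr.
have gL : grot Xt gt (expi th - 1) L.
  move=> c Xc; split; [exact: L_s|by move=> z cz; exact: Lo|by move=> z v cz; exact: L_D].
exists (fun p => gt p *m L p); first exact: (grot_associated gt_conf gt_minimal gL).
move=> p q pq; rewrite LE; apply: (Zl_factor HBs HBl tI t4 Zs Z1 Z0 Zd th4) => k.
by rewrite /Zf !mulmxA; congr (_ *m _); exact: (hZ k).2.
Qed.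

(** An infinite set contains an injective sequence of nodes, and pi < 4 places all angles in the
    interval of the Newton estimates. *)
Lemma good_all (q0 : Mt) t : infinite_set [set x | 0 <= x < pi /\ realizable x] -> 0 <= t < pi -> realizable t.
Proof.
move=> /infiniteP/pcard_leP/unsquash f ht.
have p4 : (pi : R) < 4 by have := @pihalf_lt2 R; lra.
have c4 (x : R) : 0 <= x < pi -> 0 <= x <= 4 by move=> /andP[-> /= h]; lra.
have fS k : [set x | 0 <= x < pi /\ realizable x] (f k) by exact: (@funS _ _ _ _ f k I).
apply: (@newton_good q0 f t).
- by move=> k l; apply: (@inj _ _ _ f); rewrite inE.
- by move=> k; apply: c4; have [] := fS k.
- by move=> k; have [] := fS k.
exact: c4.
Qed.

Lemma al0 c u v z : atlas X c -> cimg c z -> Cq (loc g c) J z = 0 -> al (loc g c) u v z = 0.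
Proof.
move=> Xc cz c0; have Uo := imgo Xc.
have := alpha_zz Uo (hJ Xc) cz; rewrite /cc c0 mul0r scale0r scaler0 => h.
have [a1 a2] : al (loc g c) 1 1 z = 0 /\ al (loc g c) 1 ii z = 0.
  move: h; move: (al _ 1 1 z) (al _ 1 ii z) => p q h; split; apply/rowP => j.
    by have := congr1 (fun x : 'rV[C]_6 => complex.Re (x 0 j)) h; rewrite !mxE /=; lra.
  by have := congr1 (fun x : 'rV[C]_6 => complex.Im (x 0 j)) h; rewrite !mxE /=; lra.
have a3 := g_minimal Xc cz; rewrite a1 add0r in a3.
rewrite (alpha_linl u v Uo (cg Xc) cz) !(alphaC _ v Uo (cg Xc) cz).
rewrite (alpha_linl v 1 Uo (cg Xc) cz) (alpha_linl v ii Uo (cg Xc) cz).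
by rewrite (alphaC ii 1 Uo (cg Xc) cz) a1 a2 a3 !(scaler0, addr0).
Qed.

(* Without cubic form the second fundamental form vanishes, hence the associated family is constant. *)
Lemma flat_associated s t h : (forall c z, atlas X c -> cimg c z -> Cq (loc g c) J z = 0) ->
  associated Xt gt s h -> associated Xt gt t h.
Proof.
move=> h0 ah; have [Z gZ hE] := associated_grot gt_conf ah.
have s0 c v z : atlas Xt c -> cimg c z -> sff (loc gt c) v z = 0.
  move=> Xc cz; have [d [W [phi [k [Xd [Wo Wz WU] hphi dW hW]]]]] := proj_loc Xc cz.
  have a0 u w : al (loc gt c) u w z = 0.
    rewrite -(al_ext _ _ Wo hW Wz) (al_hol (imgo Xd) Wo hphi dW (cg Xd) _ _ Wz) al0//; [exact: dW|].
    by apply: h0 => //; exact: dW.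
  by rewrite /sff !a0 /skew2 !(mulmx0, trmx0, mul0mx, subr0, addr0, scaler0).
have -> : h = (fun p => gt p *m Z p) by apply/funext.
apply: (grot_associated gt_conf gt_minimal) => c Xc; have [k1 k2 k3] := gZ c Xc; split=> // z v cz.
by rewrite k3// !s0.
Qed.

End Moduli.

Section Final.
Context {R : realType} {M Mt : topologicalType}.
Local Notation E := (Cplx R).
Local Notation C := (R[i]).
Variables (X : riemann_surface R M) (Xt : riemann_surface R Mt) (P : Mt -> M) (g : M -> 'rV[R]_6) (n m : nat).
Hypotheses (hP : universal_cover Xt X P) (nm : n.+1 = (6 * m)%N) (m0 : (0 < m)%N).
Local Notation B j := (block_incl R n j).
Local Notation gt := (g \o P).

Lemma weighted_block {T} (a : 'rV[R]_m) (h : 'I_m -> T -> 'rV[R]_6) q (i : 'I_m) :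
  weighted_sum n a h q *m (B i)^T = a 0 i *: h i q.
Proof.
rewrite /weighted_sum mulmx_suml (bigD1 i)//= big1 ?addr0 => [|j ji].
  by rewrite -scalemxAl -mulmxA (block_orth nm) eqxx mulmx1.
by rewrite -scalemxAl -mulmxA (block_orth nm) (negPf ji) mulmx0 scaler0.
Qed.

(** Besides unpacking, this supplies the auxiliary immersion [F0] of the chart arguments: conformal
    as a congruent copy of a minimal surface, with a lift that is smooth as a combination of the h_j
    and immersed because one block of it is a non-zero multiple of some h_j. Projection to the
    blocks also shows that every h_j factors. *)
Lemma moduli_data a th : exceptional_moduli Xt X P g n m (a, th) -> exists h (F0 : M -> 'rV[R]_n.+1),
  [/\ S_star R m a /\ Gamma R m th, forall j, associated Xt gt (th 0 j) (h j), forall j, factors P (h j),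
      (forall v, (forall q, dot (weighted_sum n a h q) v = 0) -> v = 0) &
      [/\ forall c, atlas X c -> conf (cimg c) (loc F0 c),
          forall c, atlas Xt c -> smx (cimg c) (loc (F0 \o P) c) &
          forall c z, atlas Xt c -> cimg c z -> Dr 1 (loc (F0 \o P) c) z != 0]].
Proof.
move=> [/= ha hth [h [ah [cl [F0 [[f [sf [mf _] _] <-] [Bo BoB F0E] hF]]]]]].
have a_0 j : a 0 j != 0 by have [_ /prodf_neq0] := ha; apply.
have [_ [_ Ps _] _] := hP.
have FP q : F0 (P q) = weighted_sum n a h q by rewrite hF.
have [cf _] := (minimalP X f).1 mf.
have ch j c : atlas Xt c -> conf (cimg c) (loc (h j) c).
  by have [/minimalP[k _] _ _] := ah j; exact: k.
have sw c : atlas Xt c -> smx (cimg c) (loc (F0 \o P) c).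
  move=> Xc; have Uo := imgo Xc.
  have s1 : smx (cimg c) (fun w => \sum_j a 0 j *: (loc (h j) c w *m B j)).
    apply: smx_sum => // j _; apply: (smxZ Uo (sm_cst _ (a 0 j))).
    exact: smxM Uo (ch j c Xc).1 (smx_cst _ _).
  by apply: (smx_ext Uo _ s1) => w _; rewrite /loc /= FP.
exists h, F0; split=> // [j p q pq|v hv|].
- have := congr1 (mulmx^~ (B j)^T) (FP p); rewrite pq FP !weighted_block => e.
  by apply: (scalerI (a_0 j)).
- have vB : v *m Bo^T = 0.
    apply: sf => p; have [q <-] := Ps p; rewrite -(hv q) -FP F0E -!dtdot dotMl; reflexivity.
  by have := congr1 (mulmx^~ Bo) vB; rewrite -mulmxA (mulmx1C BoB) mulmx1 mul0mx.
split=> // [c Xc|c z Xc cz].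
  have Uo := imgo Xc; have [s1 c1] := cf c Xc.
  have FE w : cimg c w -> loc f c w *m Bo = loc F0 c w by move=> _; rewrite /loc /= F0E.
  apply: (conf_ext Uo FE); split; first exact: smxM Uo s1 (smx_cst _ _).
  move=> z cz; have D u : Dr u (fun w => loc f c w *m Bo) z = Dr u (loc f c) z *m Bo.
    by rewrite (dird_mxM u Uo s1 (smx_cst Bo _) cz) dird_mx_cst mulmx0 addr0.
  by rewrite !D !(dt_isom _ _ BoB); exact: c1.
have Uo := imgo Xc; have [j0 _] : exists j0 : 'I_m, true by exists (Ordinal m0).
have [sh /(_ z cz)[_ l0 _ _]] := ch j0 c Xc.
apply/eqP => D0; have : Dr 1 (fun w => loc (F0 \o P) c w *m (B j0)^T) z = 0.
  by rewrite (dird_mxM 1 Uo (sw c Xc) (smx_cst _ _) cz) D0 mul0mx dird_mx_cst mulmx0 addr0.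
have FE w : cimg c w -> loc (F0 \o P) c w *m (B j0)^T = a 0 j0 *: loc (h j0) c w.
  by move=> _; rewrite /loc /= FP weighted_block.
rewrite (dird_mx_ext 1 Uo FE cz) (dird_mxZ 1 Uo (sm_cst _ _) sh cz) dird_cst scale0r add0r => /eqP.
rewrite scaler_eq0 (negPf (a_0 j0)) /= => /eqP D1.
by rewrite D1 dot0l ltxx in l0.
Qed.

Lemma finite_rows (S : set R) : finite_set S -> finite_set [set th : 'rV[R]_m | forall j, S (th 0 j)].
Proof.
move=> /finite_seqP[s sS]; pose f (u : {ffun 'I_m -> 'I_(size s)}) : 'rV[R]_m := \row_j nth 0 s (u j).
apply: (@sub_finite_set _ _ (f @` setT)); last by apply: finite_image; exact: finite_finset.
move=> th hth; have hs (j : 'I_m) : (index (th 0%R j) s < size s)%N by rewrite index_mem; have := hth j; rewrite sS.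
exists [ffun j => Ordinal (hs j)] => //; apply/rowP => j; rewrite !mxE ffunE /= nth_index//.
by rewrite -index_mem.
Qed.

(** A non-empty moduli space provides [F0]. With a non-zero cubic form somewhere, the alternative
    for [Gamma0] is that of the realizable angles in [0, pi): finitely many, or all of them by
    [good_all]. *)
Lemma moduli_split J : (forall c, atlas X c -> jcurve (cimg c) (loc g c) J) -> exists Gamma0 : set 'rV[R]_m,
  [/\ Gamma0 `<=` Gamma R m, exceptional_moduli Xt X P g n m = S_star R m `*` Gamma0 &
      Gamma0 = Gamma R m \/ finite_set Gamma0].
Proof.
move=> hJ; have [[[a0 th0] hmod]|nomod] := pselect (exists x, exceptional_moduli Xt X P g n m x); last first.
  (* An empty moduli space is the product with the empty set. *)
  exists set0; split; [by []| |by right].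
  rewrite setX0; apply/seteqP; split=> // x hx; apply: nomod; by exists x.
have [h0 [F0 [[ha0 hth0] ah0 fh0 sh0 [cF sF nF]]]] := moduli_data hmod.
have [[c [z [Xc cz c0]]]|flat] := pselect (exists c z, [/\ atlas X c, cimg c z & Cq (loc g c) J z != 0]).
  exists (Gamma R m `&` [set th | forall j, realizable Xt P g (th 0 j)]); split.
  - by move=> th [].
  - apply/seteqP; split=> -[a th].
      by move=> /moduli_data[h [F1 [[ha hth] ah fh _ _]]]; split=> //; split=> // j; exists (h j).
    move=> [/= ha [hth hg]].
    have /choice[h hh] : forall j, exists h, associated Xt gt (th 0 j) h /\ factors P h.
      by move=> j; have [h k1 k2] := hg j; exists h.
    have ah j := (hh j).1; have fh j := (hh j).2.
    apply: (moduli_intro hP nm hJ cF sF nF ha hth ah fh).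
    exact: (substantial_Cq hP nm hJ cF sF nF ha hth ah fh Xc cz c0).
  have [_ [_ Ps _] _] := hP; have [q0 _] := Ps (cinv c z).
  have [inf|fin] := pselect (infinite_set [set x | 0 <= x < pi /\ realizable Xt P g x]).
    left; apply/seteqP; split=> [th []//|th hth]; split=> // j.
    by apply: (good_all hP hJ cF sF nF q0 inf); have [k _] := hth; exact: k.
  right; move/contrapT: fin => fin; apply: sub_finite_set (finite_rows fin) => th [[k _] hg] j.
  by split; [exact: k|exact: hg].
exists (Gamma R m); split; [by []| |by left].
apply/seteqP; split=> -[a th]; first by move=> [].
move=> [/= ha hth].
have Cq0 c z : atlas X c -> cimg c z -> Cq (loc g c) J z = 0.
  by move=> Xc cz; apply/eqP; apply: contrapT => /negP h; apply: flat; exists c, z.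
have ah j : associated Xt gt (th 0 j) (h0 j) := flat_associated hP hJ cF sF nF (th 0 j) Cq0 (ah0 j).
apply: (moduli_intro hP nm hJ cF sF nF ha hth ah fh0) => v hv.
have a_0 j : a 0 j != 0 by have [_ /prodf_neq0] := ha; apply.
have a0_0 j : a0 0 j != 0 by have [_ /prodf_neq0] := ha0; apply.
(* Without cubic form the one family [h0] serves all angles and only the weights change: rescaling
   the blocks of [v] turns orthogonality to the sum with weights [a] into orthogonality to the
   substantial sum with weights [a0]. *)
pose v' := \sum_j (a 0 j / a0 0 j) *: (v *m (B j)^T *m B j).
have ws b q w : dot (weighted_sum n b h0 q) w = \sum_j b 0 j * dt (h0 j q) (w *m (B j)^T).
  by rewrite -dtdot dot_suml; apply: eq_bigr => j _; rewrite dotZl dotMl.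
have v'B (j : 'I_m) : v' *m (B j)^T = (a 0 j / a0 0 j) *: (v *m (B j)^T).
  rewrite mulmx_suml (bigD1 j)//= big1 ?addr0 => [|k kj].
    by rewrite -scalemxAl -mulmxA (block_orth nm) eqxx mulmx1.
  by rewrite -scalemxAl -mulmxA (block_orth nm) (negPf kj) mulmx0 scaler0.
have v'0 : v' = 0.
  apply: sh0 => q; rewrite -(hv q) !ws; apply: eq_bigr => j _.
  by rewrite v'B dotZr mulrA mulrCA divff ?mulr1// a0_0.
rewrite -[v]mulmx1 -(block_sum nm) mulmx_sumr big1// => j _.
have := v'B j; rewrite v'0 mul0mx => /esym/eqP; rewrite scaler_eq0 mulf_eq0 invr_eq0.
by rewrite (negPf (a_0 j)) (negPf (a0_0 j)) /= => /eqP vB; rewrite mulmxA vB mul0mx.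
Qed.

End Final.

Theorem theorem10 (R : realType) (M Mt : topologicalType)
    (X : riemann_surface R M) (Xt : riemann_surface R Mt) (P : Mt -> M)
    (g : M -> 'rV[R]_6) (n m : nat)
    (hP : universal_cover Xt X P)
    (hg : pseudoholomorphic_S5 X g)
    (hflat : nonflat X g)
    (hodd : odd n)
    (hmod : (n = 5 %[mod 6])%N)
    (hm : m = (n.+1 %/ 6)%N) :
  exists Gamma0 : set 'rV[R]_m,
    [/\ Gamma0 `<=` Gamma R m,
        exceptional_moduli Xt X P g n m = S_star R m `*` Gamma0,
        (Gamma0 <> Gamma R m ->
           locally_union_of_subvarieties (Gamma R m) Gamma0) &
        forall (theta : 'rV[R]_m) (i : 'I_m), Gamma0 theta ->
          finite_set (coordinate_line theta i `&` Gamma0) \/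
          coordinate_segment theta i (coordinate_line theta i `&` Gamma0)].
Proof.
have nm : n.+1 = (6 * m)%N by lia.
have m0 : (0 < m)%N by lia.
have [J hJ] := jcurve_charts hg.
have [G0 [G0s G0E G0c]] := moduli_split hP nm m0 hJ.
exists G0; split=> // [nG|theta i Gt]; case: G0c => [e|fin].
- by case: nG.
- exact: finite_locally_union.
- by right; rewrite e in Gt *; exact: Gamma_segment.
by left; apply: sub_finite_set fin => x [].
Qed.
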